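(* Let $S$ be a finite set, $r:S\times S\to[0,\infty)$ transition rates of an irreducible continuous-time random walk on $S$ with $r(x,x)=0$, reversible with respect to a probability measure $m$. Decompose $S_\star$ into the classes $S_1^{(2)},\dots,S_{\kappa_\star}^{(2)}$ described in the context, assume $\kappa_\star\ge2$, and write $S\setminus S_\star=\{y_1,\dots,y_{\kappa_0}\}$. Let $(d_N)$ be positive reals with $d_N\to0$, $d_N\log N\to0$, decaying subexponentially ($d_Ne^{\epsilon N}\to\infty$ for every $\epsilon>0$), and with $\lim_{N\to\infty}d_NN^2(\log N)^2=0$. Let $\theta_{N,2}=N/d_N^2$. Then: (1) For each $1\le i\le\kappa_\star$, $$\lim_{N\to\infty}\inf_{\eta,\zeta\in\mathcal{E}_N(S_i^{(2)})}\mathbb{P}_\eta\left[\tau_{\{\zeta\}}<\tau_{\mathcal{E}_N(S_\star\setminus S_i^{(2)})}\right]=1,$$ where the infimum is over distinct $\eta,\zeta$. (2) Fix $i_0\in\{1,\dots,\kappa_\star\}$. For the inclusion process started at any configuration in $\mathcal{E}_N(S_{i_0}^{(2)})$, the law of $\{Y_N(\theta_{N,2}t)\}_{t\ge0}$ converges, with respect to the Skorokhod topology on $D([0,\infty);\{1,\dots,\kappa_\star\})$, to the law of the Markov process $X_{\mathrm{second}}$ on $\{1,\dots,\kappa_\star\}$ started at $i_0$ with generator $$(\mathscr{L}_2f)(i)=\sum_{j\ne i}\frac{1}{|S_i^{(2)}|\mathfrak{R}_{i,j}}\{f(j)-f(i)\}.$$ (3) Let $S_\star=S_1^{(3)}\cup\dots\cup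 S_{\gamma_\star}^{(3)}$ be the partition obtained as follows: the irreducible (communicating) classes of $X_{\mathrm{second}}$ partition $\{1,\dots,\kappa_\star\}$, and each $S_k^{(3)}$ is the union of the $S_i^{(2)}$ over $i$ in one such class; for each $i$ let $\hat i$ be the unique index with $S_i^{(2)}\subseteq S_{\hat i}^{(3)}$. Then for all $t>0$, $$\lim_{N\to\infty}\sup_{1\le i\le\kappa_\star,\,1\le n\le\mathfrak{n}(i)}\mathbb{E}_{\xi_N^{x_{i,n}}}\left[\int_0^t\mathbf{1}\{\eta_N(\theta_{N,2}s)\notin\mathcal{E}_N(S_{\hat i}^{(3)})\}ds\right]=0.$$
   Context: $M_\star=\max_xm(x)$, $S_\star=\{x:m(x)=M_\star\}$, $m_\star(x)=m(x)/M_\star$. The sets $S_1^{(2)},\dots,S_{\kappa_\star}^{(2)}$ are the partition of $S_\star$ into irreducible components of the random walk with rates $r$ restricted to $S_\star$: the rates $r$ restricted to each $S_i^{(2)}$ are irreducible and $r(x,x')=0$ whenever $x,x'$ lie in different classes. Write $S_i^{(2)}=\{x_{i,1},\dots,x_{i,\mathfrak{n}(i)}\}$. For $i,j$, $$\mathfrak{R}_{i,j}=\int_0^1\frac{dt}{\sum_{n=1}^{\mathfrak{n}(i)}\sum_{m=1}^{\mathfrak{n}(j)}\sum_{p=1}^{\kappa_0}\frac{1}{(1-m_\star(y_p))\left(\frac{1-t}{r(x_{i,n},y_p)}+\frac{t}{r(x_{j,m},y_p)}\right)}},$$ where a summand is taken to be $0$ if $r(x_{i,n},y_p)r(x_{j,m},y_p)=0$;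 $\mathfrak{R}_{i,j}=\infty$ if all summands vanish, and $1/\infty=0$. $\mathcal{H}_N=\{\eta\in\mathbb{N}^S:\sum_x\eta_x=N\}$; the inclusion process $\eta_N(\cdot)$ is the Markov chain on $\mathcal{H}_N$ with generator $(\mathcal{L}_Nf)(\eta)=\sum_{x,y}\eta_x(d_N+\eta_y)r(x,y)\{f(\sigma^{x,y}\eta)-f(\eta)\}$, $\sigma^{x,y}\eta$ moving one particle from $x$ to $y$ if $\eta_x\ge1$ (else $\sigma^{x,y}\eta=\eta$). $\mathbb{P}_\eta,\mathbb{E}_\eta$: law/expectation started at $\eta$; $\tau_{\mathcal{A}}$: hitting time of $\mathcal{A}$. $\xi_N^x$: all particles at $x$; $\mathcal{E}_N(A)=\{\xi_N^x:x\in A\}$, $\mathcal{E}_N^\star=\mathcal{E}_N(S_\star)$. Trace process on nonempty $\mathcal{G}$: $\eta_N^{\mathcal{G}}(t)=\eta_N(S^{\mathcal{G}}(t))$ with $T^{\mathcal{G}}(t)=\int_0^t\mathbf{1}\{\eta_N(s)\in\mathcal{G}\}ds$, $S^{\mathcal{G}}(t)=\sup\{s\ge0:T^{\mathcal{G}}(s)\le t\}$. $\eta_N^\star$ is the trace process on $\mathcal{E}_N^\star$, and $Y_N(t)=i$ if $\eta_N^\star(t)\in\mathcal{E}_N(S_i^{(2)})$. *)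

(* Defs.v *)
From HB Require Import structures.
From mathcomp Require Import all_boot all_order all_algebra.
From mathcomp Require Import all_classical all_reals all_analysis.
Set Implicit Arguments. Unset Strict Implicit. Unset Printing Implicit Defensive.
Import Order.TTheory GRing.Theory Num.Theory.
Local Open Scope classical_set_scope.
Local Open Scope ring_scope.

Section Defs.
Variable R : realType.

Section CTMC.
Variable E : finType.
Variable Q : E -> E -> R.  (* jump rates (off-diagonal entries used) *)

Definition gen (x y : E) : R :=
  if x == y then - (\sum_(z | z != x) Q x z) else Q x y.

Fixpoint genpow (k : nat) (x y : E) : R :=
  match k with
  | 0%N => (x == y)%:R
  | k.+1 => \sum_z gen x z * genpow k z y
  end.

Definition trans (t : R) (x y : E) : R :=
  limn (fun n => \sum_(k < n) t ^+ k / (k`!)%:R * genpow k x y).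

Fixpoint fdd_prod (t : R) (x : E) (l : seq (R * E)) : R :=
  match l with
  | [::] => 1
  | (t', x') :: l' => trans (t' - t) x x' * fdd_prod t' x' l'
  end.

Definition cadlag (f : R -> E) : Prop :=
  forall t, 0 <= t ->
    (exists e, 0 < e /\ forall s, t <= s < t + e -> f s = f t) /\
    (0 < t -> exists e l, 0 < e /\ forall s, t - e < s < t -> f s = l).

Definition is_ctmc d (T : measurableType d) (P : probability T R)
    (x0 : E) (X : R -> T -> E) : Prop :=
  [/\ (forall w, cadlag (X^~ w)),
      (forall t x, measurable [set w | X t w = x]) &
      (forall (ts : seq R) (xs : seq E), size ts = size xs ->
         sorted <=%R (0 :: ts) ->
         P [set w | forall i, (i < size ts)%N -> X (nth 0 ts i) w = nth x0 xs i]
           = (fdd_prod 0 x0 (zip ts xs))%:E)].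

Definition hit T (X : R -> T -> E) (A : {set E}) (w : T) : \bar R :=
  ereal_inf [set t%:E | t in [set t | 0 <= t /\ X t w \in A]].

Definition occ T (X : R -> T -> E) (G : {set E}) (w : T) (t : R) : R :=
  fine (\int[lebesgue_measure]_(s in `[0%R, t]) ((X s w \in G)%:R : R)%:E)%E.

Definition trtime T (X : R -> T -> E) (G : {set E}) (w : T) (t : R) : R :=
  fine (ereal_sup [set s%:E | s in [set s | 0 <= s /\ occ X G w s <= t]]).

Definition trace T (X : R -> T -> E) (G : {set E}) (t : R) (w : T) : E :=
  X (trtime X G w t) w.
End CTMC.

Section Skorokhod.
Variable E : finType.

Definition time_change (l : R -> R) : Prop :=
  [/\ l 0 = 0, (forall s t, 0 <= s -> s < t -> l s < l t),
      (forall t, 0 <= t -> 0 <= l t) & (forall u, 0 <= u -> exists2 t, 0 <= t & l t = u)].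

(* convergence in the Skorokhod topology (Ethier-Kurtz, Prop. 3.5.3),
   with the discrete metric on E *)
Definition sk_conv (xs : nat -> R -> E) (x : R -> E) : Prop :=
  exists lam : nat -> R -> R, (forall n, time_change (lam n)) /\
    forall T, 0 < T ->
      (forall eps, 0 < eps ->
         \forall n \near \oo, forall t, 0 <= t <= T -> `|lam n t - t| < eps) /\
      (\forall n \near \oo, forall t, 0 <= t <= T -> xs n t = x (lam n t)).

Definition sk_bounded_continuous (F : (R -> E) -> R) : Prop :=
  (exists M, forall f, cadlag f -> `|F f| <= M) /\
  (forall xs x, (forall n, cadlag (xs n)) -> cadlag x -> sk_conv xs x ->
     (fun n => F (xs n)) @ \oo --> (F x : R^o)).

Definition sk_law_conv d (T : measurableType d) (Pn : nat -> probability T R)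
    (Xn : nat -> R -> T -> E)
    d' (T' : measurableType d') (P : probability T' R) (X : R -> T' -> E) : Prop :=
  forall F : (R -> E) -> R, sk_bounded_continuous F ->
    (forall n, measurable_fun setT (fun w => F (Xn n ^~ w))) ->
    measurable_fun setT (fun w => F (X ^~ w)) ->
    (fun n => \int[Pn n]_w (F (Xn n ^~ w))%:E)%E @ \oo --> (\int[P]_w (F (X ^~ w))%:E)%E.
End Skorokhod.

Section Setting.
Variable S : finType.
Variables (r : S -> S -> R) (m : S -> R).

Definition Mstar : R := \big[Num.max/0]_x m x.
Definition Sstar : {set S} := [set x | m x == Mstar].
Definition mstar (x : S) : R := m x / Mstar.

Definition rstar : rel S := [rel x y | [&& x \in Sstar, y \in Sstar & 0 < r x y]].
Definition rclass (x : S) : {set S} := [set y in Sstar | connect rstar x y].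
Definition classes : {set {set S}} := [set rclass x | x in Sstar].
Definition cls : finType := {C : {set S} | C \in classes}.

Definition all_vanish (A B : {set S}) : bool :=
  [forall x in A, forall x' in B, forall y in ~: Sstar, r x y * r x' y == 0].

Definition Rsummand (t : R) (x x' y : S) : R :=
  if r x y * r x' y == 0 then 0
  else 1 / ((1 - mstar y) * ((1 - t) / r x y + t / r x' y)).

Definition Rint (A B : {set S}) : R :=
  fine (\int[lebesgue_measure]_(t in `[0%R, 1%R]) 
          (1 / (\sum_(x in A) \sum_(x' in B) \sum_(y in ~: Sstar) Rsummand t x x' y))%:E)%E.

Definition Rres (A B : {set S}) : \bar R :=
  if all_vanish A B then +oo%E else (Rint A B)%:E.

Definition rate2 (C D : cls) : R :=
  if C == D then 0 else
  match Rres (val C) (val D) with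
  | x%:E => (#|val C|%:R * x)^-1
  | _ => 0
  end.

Definition rel2 : rel cls := [rel C D | 0 < rate2 C D].
Definition S3 (C : cls) : {set S} :=
  \bigcup_(D : cls | connect rel2 C D && connect rel2 D C) val D.
Definition S3of (x : S) : {set S} := \bigcup_(C : cls | x \in val C) S3 C.

Definition Hn (N : nat) : finType :=
  {eta : {ffun S -> 'I_N.+1} | \sum_x (val (eta x)) == N}.

Definition cfg N (eta : Hn N) (x : S) : nat := val (val eta x).

Definition xi_fun (N : nat) (x : S) : {ffun S -> 'I_N.+1} :=
  [ffun y => if y == x then ord_max else ord0].

Lemma xi_proof N x : \sum_y (val (xi_fun N x y)) == N.
Proof.
rewrite (bigD1 x) //= ffunE eqxx /=.
rewrite big1 => [|y /negbTE yx]; first by apply/eqP; exact: addn0.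
by rewrite ffunE yx.
Qed.

Definition xi N (x : S) : Hn N := exist _ (xi_fun N x) (xi_proof N x).

Definition EN N (A : {set S}) : {set Hn N} := [set xi N x | x in A].

Definition moved N (x y : S) (eta zeta : Hn N) : bool :=
  [&& (0 < cfg eta x)%N, cfg zeta x == (cfg eta x).-1, cfg zeta y == (cfg eta y).+1
    & [forall z, (z != x) && (z != y) ==> (cfg zeta z == cfg eta z)]].

Definition Qinc N (dN : R) (eta zeta : Hn N) : R :=
  \sum_x \sum_y (if moved x y eta zeta then
                   (cfg eta x)%:R * (dN + (cfg eta y)%:R) * r x y else 0).

(* Y_N(t) : the class S_i^(2) containing the site of eta_N^star(t)
   (dflt is only used off E_N^star, which has probability 0) *)
Definition Yval N (dflt : cls) (eta : Hn N) : cls :=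
  odflt dflt [pick C : cls | eta \in EN N (val C)].

Definition Ytr N (dflt : cls) T (X : R -> T -> Hn N) (t : R) (w : T) : cls :=
  Yval dflt (trace X (EN N Sstar) t w).
End Setting.
End Defs.

(* Main.v *)
(** The generator of the sped-up process is compared with [rate2] through its Dirichlet form.
    For each class [C] the equilibrium potential of the two-class profile problem, extended to
    configurations carried by three sites, is a test function [V] whose Dirichlet form against any
    function [w] of bounded Dirichlet energy is, up to a small error, that of the limiting chain
    evaluated at the condensates: the edges between two classes act as resistors in series, and
    summation by parts along the line of configurations produces the integral [Rint].
    An [L2(mu)] energy estimate upgrades this to convergence of the transition functions, uniformly
    on bounded time intervals, and the same test functions bound the probability of leaving a class
    before visiting one of its sites.  Convergence of the transition functions yields the
    finite-dimensional laws and a bound on two jumps within one cell of a fine grid.  Off a small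
    event, the trace process then follows the skeleton of its values on the grid, and the oscillation
    of a Skorokhod-continuous functional over all paths following a given skeleton tends to 0. *)
Require Import Defs.
From HB Require Import structures.
From mathcomp Require Import all_boot all_order all_algebra.
From mathcomp Require Import all_classical all_reals all_analysis.
From mathcomp Require Import measurable_realfun ring lra zify.
Set Implicit Arguments. Unset Strict Implicit. Unset Printing Implicit Defensive.
Import Order.TTheory GRing.Theory Num.Theory numFieldNormedType.Exports.
Local Open Scope classical_set_scope.
Local Open Scope ring_scope.

(** The hypotheses on [d] are dictated by the weights. As [wgt d k] is about [d / k], an edge
    joining [Sstar] to its complement has, on the accelerated time scale, conductance of order
    [N ^ 2 / d], and every further occupied site costs a factor [d * log N]. One further site
    carries the limit; two of them cost [d * N ^ 2 * (log N) ^ 2], which is assumed to vanish. A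
    crossing passes through one site outside [Sstar], from which the particle may turn back. The
    test function counts such a particle by its return probability, and this is what makes the
    currents through the two halves of the crossing equal. The energy of [w] along the evolution is
    not known in advance, so errors are only claimed relative to its square root, a quantity that
    the dissipation can absorb. The resulting mean square bound becomes pointwise because every
    condensate on [Sstar] keeps a mass close to [1 / #|Sstar|]. The trace is built path by path from
    a random clock. Events about it are therefore never measured directly but covered by events on
    finite grids. *)

Lemma le_of_eq disp (T : porderType disp) (x y : T) : x = y -> (x <= y)%O.
Proof. by move->. Qed.

(** * Derivatives of finite sums and growth bounds *)

Section FiniteSums.
Variable R : realType.

Lemma is_derive_bigsum (I : Type) (s : seq I) (Pr : pred I) (f : I -> R -> R) (df : I -> R) (t : R) :
  (forall i, is_derive t (1 : R) (f i) (df i)) ->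
  is_derive t (1 : R) (fun u => \sum_(i <- s | Pr i) f i u) (\sum_(i <- s | Pr i) df i).
Proof.
move=> h; elim: s => [|i s IH].
  have -> : (fun u : R => \sum_(i <- [::] | Pr i) f i u) = cst 0.
    by apply/funext => u; rewrite big_nil.
  by rewrite big_nil; exact: is_derive_cst.
case Pi : (Pr i).
  have -> : (fun u : R => \sum_(j <- i :: s | Pr j) f j u) =
            (f i) + (fun u => \sum_(j <- s | Pr j) f j u).
    by apply/funext => u; rewrite big_cons Pi.
  by rewrite big_cons Pi; apply: is_deriveD.
have -> : (fun u : R => \sum_(j <- i :: s | Pr j) f j u) =
          (fun u => \sum_(j <- s | Pr j) f j u).
  by apply/funext => u; rewrite big_cons Pi.
by rewrite big_cons Pi.
Qed.

Lemma derive0_const (f : R -> R) :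
  (forall t, is_derive t (1 : R) f 0) -> forall s t, f s = f t.
Proof.
move=> h.
have aux (s t : R) : s < t -> f s = f t.
  move=> st; have cf : {within `[s, t], continuous f}.
    apply: derivable_within_continuous => x _; exact: @ex_derive _ _ _ _ _ _ _ (h x).
  have [c _] := MVT st (fun x _ => h x) cf.
  by rewrite mul0r => /eqP; rewrite subr_eq0 => /eqP.
move=> s t; case: (ltgtP s t) => [/aux//|/aux//|->//].
Qed.

Lemma derive_le_growth (f df : R -> R) (c T : R) :
  (forall t, is_derive t (1 : R) f (df t)) ->
  (forall t, 0 <= t <= T -> df t <= c) -> forall t, 0 <= t <= T -> f t <= f 0 + c * t.
Proof.
move=> h hc t /andP[]; rewrite le_eqVlt => /predU1P[<- _|t0 tT]; first by rewrite mulr0 addr0.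
have cf : {within `[0, t], continuous f}.
  apply: derivable_within_continuous => x _; exact: @ex_derive _ _ _ _ _ _ _ (h x).
have [x] := MVT t0 (fun x _ => h x) cf.
rewrite in_itv /= subr0 => /andP[x0 xt] e.
have : df x <= c by apply: hc; rewrite (ltW x0) (le_trans (ltW xt) tT).
by move=> hx; rewrite -lerBlDl e ler_pM2r.
Qed.
End FiniteSums.
(** * Semigroups of finite chains *)

Section Semigroup.
Variables (R : realType) (E : finType) (Q : E -> E -> R).
Local Notation gen := (gen Q).
Local Notation genpow := (genpow Q).
Local Notation trans := (trans Q).

Lemma gen_rowsum x : \sum_y gen x y = 0.
Proof.
rewrite (bigD1 x) //= /Defs.gen eqxx addrC.
rewrite (eq_bigr (fun z => Q x z)) ?subrr // => z zx.
by rewrite eq_sym (negbTE zx).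
Qed.

Lemma gen_apply (f : E -> R) x :
  \sum_y gen x y * f y = \sum_y Q x y * (f y - f x).
Proof.
rewrite (bigD1 x) //= [in RHS](bigD1 x) //= subrr mulr0 add0r {1}/Defs.gen eqxx.
rewrite mulNr mulr_suml addrC -sumrB; apply: eq_bigr => z zx.
by rewrite /Defs.gen eq_sym (negbTE zx) mulrBr.
Qed.

Lemma genpowSr k x y : genpow k.+1 x y = \sum_z genpow k x z * gen z y.
Proof.
elim: k x y => [|k IH] x y.
  rewrite /=; rewrite (bigD1 y) //= eqxx mulr1 big1 ?addr0; last first.
    by move=> z /negbTE zy; rewrite zy mulr0.
  rewrite (bigD1 x) //= eqxx mul1r big1 ?addr0 // => z zx.
  by rewrite eq_sym (negbTE zx) mul0r.
have -> : genpow k.+2 x y = \sum_z gen x z * genpow k.+1 z y by [].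
under eq_bigr => z _ do rewrite IH mulr_sumr.
rewrite exchange_big /=; apply: eq_bigr => z _.
by rewrite mulr_suml; apply: eq_bigr => u _; rewrite mulrA.
Qed.

Definition genbound : R := 1 + \sum_x \sum_y `|gen x y|.

Lemma genbound_ge1 : 1 <= genbound.
Proof. by rewrite lerDl sumr_ge0 // => x _; rewrite sumr_ge0. Qed.

Lemma genpow_bound k x y : `|genpow k x y| <= genbound ^+ k.
Proof.
elim: k x y => [|k IH] x y /=.
  by rewrite expr0; case: eqP; rewrite ?normr1 ?normr0.
apply: le_trans (ler_norm_sum _ _ _) _.
rewrite exprS; apply: (@le_trans _ _ ((\sum_z `|gen x z|) * genbound ^+ k)).
  by rewrite mulr_suml; apply: ler_sum => z _; rewrite normrM ler_wpM2l.
apply: ler_wpM2r; first by rewrite exprn_ge0 // (le_trans _ genbound_ge1).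
rewrite /genbound [X in _ <= 1 + X](bigD1 x) //= addrCA lerDl addr_ge0 // sumr_ge0 // => z _.
by rewrite sumr_ge0.
Qed.

(** Coefficients of an exponential series in which the powers of the generator are replaced by a
    sequence [a]. Differentiation in time becomes the shift of [a], and a geometric bound on [a]
    gives convergence everywhere. *)
Let coef (a : nat -> R) : R^nat := fun k => a k / k`!%:R.

Lemma cvg_coef_pseries (a : nat -> R) (A B t : R) : 0 <= A -> 0 <= B ->
  (forall k, `|a k| <= A * B ^+ k) -> cvgn (pseries (coef a) t).
Proof.
move=> A0 B0 aB; apply: normed_cvg.
apply: (@series_le_cvg _ _ (fun k => A * exp_coeff (B * `|t|) k)) => [k|k|k|].
- exact: normr_ge0.
- by rewrite mulr_ge0 // exp_coeff_ge0 // mulr_ge0.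
- rewrite /coef /exp_coeff /= normrM normrM normrX exprMn normfV.
  rewrite [in leRHS]mulrAC !mulrA (ger0_norm (ler0n _ _)).
  rewrite ![_ / _ * _]mulrAC ler_wpM2r //.
  by rewrite ler_wpM2r ?exprn_ge0 // aB.
- idtac; have -> : (fun k => A * exp_coeff (B * `|t|) k) = A *: exp_coeff (B * `|t|) by [].
  apply: is_cvg_seriesZ; exact: is_cvg_series_exp_coeff.
Qed.

Lemma pseries_diffs_coef (a : nat -> R) : pseries_diffs (coef a) = coef (fun k => a k.+1).
Proof.
apply/funext => k; rewrite /pseries_diffs /coef factS natrM invfM.
by rewrite mulrCA mulVKf // pnatr_eq0.
Qed.

Lemma is_derive_coef (a : nat -> R) (A B t : R) : 0 <= A -> 0 <= B ->
  (forall k, `|a k| <= A * B ^+ k) ->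
  is_derive t (1 : R) (fun u => limn (pseries (coef a) u))
    (limn (pseries (coef (fun k => a k.+1)) t)).
Proof.
move=> A0 B0 aB; rewrite -pseries_diffs_coef.
have aS (b : nat -> R) A' : 0 <= A' -> (forall k, `|b k| <= A' * B ^+ k) ->
    forall k, `|b k.+1| <= A' * B * B ^+ k.
  by move=> _ h k; rewrite -mulrA -exprS.
apply: (@pseries_snd_diffs R _ (`|t| + 1)).
- exact: cvg_coef_pseries aB.
- rewrite pseries_diffs_coef; apply: (@cvg_coef_pseries _ (A * B) B) => //.
  exact: mulr_ge0.
  exact: aS.
- rewrite !pseries_diffs_coef; apply: (@cvg_coef_pseries _ (A * B * B) B) => //.
  by rewrite !mulr_ge0.
  by apply: (aS (fun k => a k.+1)); [exact: mulr_ge0|exact: aS].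
- by rewrite [ltRHS]ger0_norm ?addr_ge0 // ltrDl.
Qed.

Let transE t x y : trans t x y = limn (pseries (coef (fun k => genpow k x y)) t).
Proof.
rewrite /Defs.trans; congr (lim (_ @ \oo)); apply/funext => n.
rewrite /pseries /series /= big_mkord; apply: eq_bigr => k _.
by rewrite /coef mulrC mulrA mulrAC.
Qed.

Let genpow_bound1 x y k : `|genpow k x y| <= 1 * genbound ^+ k.
Proof. by rewrite mul1r genpow_bound. Qed.

Let genbound0 : 0 <= genbound.
Proof. exact: le_trans genbound_ge1. Qed.

Let cvg_transP x y t : pseries (coef (fun k => genpow k x y)) t @ \oo --> trans t x y.
Proof. rewrite transE; exact: (@cvg_coef_pseries _ 1 genbound). Qed.

Lemma cvg_bigsum (I : finType) (f : I -> R^nat) (l : I -> R) :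
  (forall i, f i @ \oo --> l i) -> (fun n => \sum_i f i n) @ \oo --> \sum_i l i.
Proof.
move=> h; elim: (index_enum I) => [|i s IH].
  by rewrite big_nil; under eq_fun do rewrite big_nil; exact: cvg_cst.
by rewrite big_cons; under eq_fun do rewrite big_cons; exact: cvgD.
Qed.

Lemma is_derive_trans t x y :
  is_derive t (1 : R) (fun u => trans u x y) (\sum_z gen x z * trans t z y).
Proof.
have -> : (fun u => trans u x y) = (fun u => limn (pseries (coef (fun k => genpow k x y)) u)).
  by apply/funext => u; exact: transE.
apply: is_derive_eq; first exact: (@is_derive_coef _ 1 genbound).
apply/cvg_lim => //.
have h : (fun n => \sum_z gen x z * pseries (coef (fun k => genpow k z y)) t n) @ \oo -->
   \sum_z gen x z * trans t z y.
  by apply: cvg_bigsum => z; apply: cvgM; [exact: cvg_cst|exact: cvg_transP].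
apply: cvg_trans h; apply: near_eq_cvg; near=> n.
under eq_bigr do rewrite mulr_sumr.
rewrite exchange_big /=; apply: eq_bigr => k _.
rewrite /coef /= mulr_suml mulr_suml; apply: eq_bigr => z _; by rewrite !mulrA.
Unshelve. all: by end_near. Qed.

(** Left and right recursions define the same powers of the generator ([genpowSr]), so the partial
    sums on the two sides agree term by term. *)
Lemma trans_comm t x y :
  \sum_z gen x z * trans t z y = \sum_z trans t x z * gen z y.
Proof.
have h1 : (fun n => \sum_z gen x z * pseries (coef (fun k => genpow k z y)) t n) @ \oo -->
   \sum_z gen x z * trans t z y.
  by apply: cvg_bigsum => z; apply: cvgM; [exact: cvg_cst|exact: cvg_transP].
have h2 : (fun n => \sum_z pseries (coef (fun k => genpow k x z)) t n * gen z y) @ \oo -->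
   \sum_z trans t x z * gen z y.
  by apply: cvg_bigsum => z; apply: cvgM; [exact: cvg_transP|exact: cvg_cst].
apply: (cvg_unique _ h1) => //.
apply: cvg_trans h2; apply: near_eq_cvg; near=> n.
under eq_bigr do rewrite mulr_suml.
rewrite exchange_big /=.
under [RHS]eq_bigr do rewrite mulr_sumr.
rewrite [RHS]exchange_big /=; apply: eq_bigr => k _.
have := genpowSr k x y; rewrite /coef /= => e.
rewrite -[LHS]mulr1 -[RHS]mulr1.
transitivity ((\sum_z genpow k x z * gen z y) * (t ^+ k / k`!%:R)).
  rewrite mulr1 mulr_suml; by apply: eq_bigr => z _; ring.
by rewrite -e mulr1 mulr_suml; apply: eq_bigr => z _; ring.
Unshelve. all: by end_near. Qed.

Lemma trans0 x y : trans 0 x y = (x == y)%:R.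
Proof.
apply: cvg_lim => //; rewrite -(cvg_shiftS _).
apply: cvg_near_cst; near=> n; rewrite [LHS]big_ord_recl /= expr0 fact0 divr1 mul1r.
by rewrite big1 ?addr0 // => i _; rewrite exprS mul0r mul0r mul0r.
Unshelve. all: by end_near. Qed.

Definition semig (t : R) (f : E -> R) (x : E) : R := \sum_y trans t x y * f y.

Lemma is_derive_semig t f x :
  is_derive t (1 : R) (fun u => semig u f x) (\sum_z gen x z * semig t f z).
Proof.
apply: is_derive_eq; first apply: is_derive_bigsum => y.
  have h := is_derive_trans t x y.
  exact: is_deriveM.
rewrite /=; under eq_bigr do rewrite scaler0 add0r.
under [RHS]eq_bigr do rewrite mulr_sumr.
rewrite [RHS]exchange_big /=; apply: eq_bigr => y _.
rewrite /GRing.scale /= mulr_sumr; apply: eq_bigr => z _.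
by rewrite mulrC mulrA.
Qed.

Lemma semig0 f x : semig 0 f x = f x.
Proof.
rewrite /semig (bigD1 x) //= trans0 eqxx mul1r big1 ?addr0 // => y yx.
by rewrite trans0 eq_sym (negbTE yx) mul0r.
Qed.

Lemma semigD (s t : R) f x : semig (s + t) f x = semig s (semig t f) x.
Proof.
(* Interpolation between the two sides: [psi (s + t)] and [psi t] are the two expressions, and the
   derivative vanishes because [trans] commutes with the generator. *)
pose psi u := \sum_z trans (s + t - u) x z * semig u f z.
have dpsi u : is_derive u (1 : R) psi 0.
  apply: is_derive_eq.
    apply: is_derive_bigsum => z.
    have h1 : is_derive u (1:R) (fun v => trans (s + t - v) x z)
       (- (\sum_w gen x w * trans (s + t - u) w z)).
      have hc : is_derive u (1 : R) (fun v : R => s + t - v) (-1).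
        have hid := @is_derive_id R R u 1.
        have hcst := @is_derive_cst R R R (s + t) u 1.
        have := @is_deriveB R R R (cst (s + t)) id u 1 _ _ hcst hid.
        by rewrite sub0r.
      have := @is_derive1_comp R (fun v => trans v x z) (fun v => s + t - v) u _ _
        (is_derive_trans _ _ _) hc.
      by rewrite mulrN1.
    have h2 := is_derive_semig u f z.
    exact: is_deriveM.
  rewrite /= big_split /= /GRing.scale /=.
  under [X in X + _]eq_bigr do rewrite mulr_sumr.
  rewrite [X in X + _]exchange_big /=.
  rewrite [X in _ + X](_ : _ = - \sum_w (\sum_z gen x z * trans (s + t - u) z w) * semig u f w).
    under [X in _ - X]eq_bigr do rewrite trans_comm mulr_suml.
    by apply/eqP; rewrite subr_eq0; apply/eqP; apply: eq_bigr => z _; apply: eq_bigr => w _; rewrite mulrA.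
  by rewrite -sumrN; apply: eq_bigr => w _; rewrite mulrN mulrC.
have := derive0_const dpsi (s + t) t.
rewrite /psi subrr addrK => e; rewrite -[RHS]e.
rewrite (bigD1 x) //= trans0 eqxx mul1r big1 ?addr0 // => y yx.
by rewrite trans0 eq_sym (negbTE yx) mul0r.
Qed.

Lemma semig_ind t y x : semig t (fun z => (z == y)%:R) x = trans t x y.
Proof.
rewrite /semig (bigD1 y) //= eqxx mulr1 big1 ?addr0 // => z /negbTE zy.
by rewrite zy mulr0.
Qed.

Lemma trans_sum1 t x : \sum_y trans t x y = 1.
Proof.
pose psi u := \sum_y trans u x y.
have dpsi u : is_derive u (1 : R) psi 0.
  apply: is_derive_eq; first by apply: is_derive_bigsum => z; exact: is_derive_trans.
  under eq_bigr do rewrite trans_comm.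
  by rewrite exchange_big /= big1 // => z _; rewrite -mulr_sumr gen_rowsum mulr0.
rewrite -/(psi t) (derive0_const dpsi t 0) /psi (bigD1 x) //= trans0 eqxx big1 ?addr0 // => y yx.
by rewrite trans0 eq_sym (negbTE yx).
Qed.

Lemma trans_stationary (mu : E -> R) t y :
  (forall z, \sum_x mu x * gen x z = 0) -> \sum_x mu x * trans t x y = mu y.
Proof.
move=> st; pose psi u := \sum_x mu x * trans u x y.
have dpsi u : is_derive u (1 : R) psi 0.
  apply: is_derive_eq.
    apply: is_derive_bigsum => x.
    have h := is_derive_trans u x y.
    have hc := is_derive_cst (mu x) u (1 : R).
    exact: is_deriveM.
  rewrite /= /GRing.scale /=.
  under eq_bigr do rewrite mulr0 addr0 mulr_sumr.
  rewrite exchange_big /= big1 // => z _.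
  by under eq_bigr do rewrite mulrA; rewrite -mulr_suml st mul0r.
rewrite -/(psi t) (derive0_const dpsi t 0) /psi (bigD1 y) //= trans0 eqxx mulr1 big1 ?addr0 // => x xy.
by rewrite trans0 (negbTE xy) mulr0.
Qed.

(** Carried as a hypothesis instead of being derived from the signs of the rates: for the inclusion
    process it is read off the marginals of a realization, and for the limit chain it is inherited
    through the convergence of kernels. *)
Definition nonneg_kernel := forall t x y, 0 <= t -> 0 <= trans t x y.

Lemma semig_le (t : R) f g x : nonneg_kernel -> 0 <= t -> (forall y, f y <= g y) ->
  semig t f x <= semig t g x.
Proof. by move=> pos t0 fg; apply: ler_sum => y _; rewrite ler_wpM2l // pos. Qed.

Lemma semig_cst t c x : semig t (fun _ => c) x = c.
Proof. by rewrite /semig -mulr_suml trans_sum1 mul1r. Qed.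

Lemma semig_bound (pos : nonneg_kernel) (f : E -> R) (K t : R) x :
  (forall x, `|f x| <= K) -> 0 <= t -> `|semig t f x| <= K.
Proof.
move=> fK t0; rewrite ler_norml; apply/andP; split.
  by rewrite -(semig_cst t (- K) x); apply: semig_le => // y; have := fK y; rewrite ler_norml => /andP[].
by rewrite -(semig_cst t K x); apply: semig_le => // y; have := fK y; rewrite ler_norml => /andP[].
Qed.

Lemma gen_sum_bound (f : E -> R) K x : 0 <= K -> (forall x, `|f x| <= K) ->
  `|\sum_z gen x z * f z| <= genbound * K.
Proof.
move=> K0 fK; apply: le_trans (ler_norm_sum _ _ _) _.
apply: (@le_trans _ _ ((\sum_z `|gen x z|) * K)).
  by rewrite mulr_suml; apply: ler_sum => z _; rewrite normrM ler_wpM2l.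
apply: ler_wpM2r => //.
rewrite /genbound [X in _ <= 1 + X](bigD1 x) //= addrCA lerDl addr_ge0 // sumr_ge0 // => z _.
by rewrite sumr_ge0.
Qed.

(** The second time derivative is at most [genbound ^+ 2 * K], so two growth bounds give the upper
    half; the lower half is the upper half for the opposite function. *)
Lemma semig_taylor (pos : nonneg_kernel) (f : E -> R) (K t : R) x :
  0 <= K -> (forall x, `|f x| <= K) -> 0 <= t ->
  `|semig t f x - f x - t * \sum_z gen x z * f z| <= genbound ^+ 2 * K * t ^+ 2.
Proof.
have one (g : E -> R) : 0 <= K -> (forall x, `|g x| <= K) -> 0 <= t ->
    semig t g x - g x - t * (\sum_z gen x z * g z) <= genbound ^+ 2 * K * t ^+ 2.
  move=> K0 gK t0; pose C := genbound ^+ 2 * K.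
  have C0 : 0 <= C by rewrite mulr_ge0 // exprn_ge0.
  pose d1 u := \sum_z gen x z * semig u g z.
  have dd1 u : is_derive u (1 : R) d1 (\sum_z gen x z * \sum_w gen z w * semig u g w).
    apply: is_derive_eq.
      apply: is_derive_bigsum => z.
      have h := is_derive_semig u g z.
      have hc := is_derive_cst (gen x z) u (1 : R).
      exact: is_deriveM.
    by rewrite /= /GRing.scale /=; apply: eq_bigr => z _; rewrite mulr0 addr0.
  have b1 u : 0 <= u <= t -> d1 u <= d1 0 + C * u.
    apply: (derive_le_growth dd1) => v /andP[v0 _].
    apply: le_trans (ler_norm _) _; rewrite /C expr2 -mulrA.
    apply: gen_sum_bound => [|z]; first by rewrite mulr_ge0.
    apply: gen_sum_bound => // w; exact: semig_bound.
  have h := @derive_le_growth R (fun u => semig u g x) d1 (d1 0 + C * t) t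
    (fun u => is_derive_semig u g x).
  have : forall u, 0 <= u <= t -> d1 u <= d1 0 + C * t.
    move=> u ut; apply: le_trans (b1 u ut) _; rewrite lerD2l ler_wpM2l //.
    by case/andP: ut.
  move=> /h /(_ t); rewrite t0 lexx => /(_ isT); rewrite semig0.
  rewrite (_ : d1 0 = \sum_z gen x z * g z); last first.
    by apply: eq_bigr => z _; rewrite semig0.
  rewrite /C; set S := \sum_z _; nra.
move=> K0 fK t0; rewrite ler_norml; apply/andP; split; last exact: one.
have fKN y : `|- f y| <= K by rewrite normrN.
have := one (fun z => - f z) K0 fKN t0.
rewrite /semig; under eq_bigr do rewrite mulrN.
under [X in _ - _ * X <= _]eq_bigr do rewrite mulrN.
by rewrite !sumrN; set S := \sum_z _; set S' := \sum_z _; nra.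
Qed.
End Semigroup.
(** * Configurations and the reversible measure *)

Section Config.
Variables (R : realType) (S : finType).
Local Notation Hn := (Hn S).

Lemma cfg_inj n (e e' : Hn n) : (forall x, cfg e x = cfg e' x) -> e = e'.
Proof. by move=> h; apply/val_inj/ffunP => x; apply/val_inj; exact: h. Qed.

Lemma cfg_sum n (e : Hn n) : (\sum_x cfg e x = n)%N.
Proof. exact/eqP/(valP e). Qed.

Lemma cfg_le n (e : Hn n) x : (cfg e x <= n)%N.
Proof. by rewrite -ltnS /cfg ltn_ord. Qed.

(** A total constructor: when the values of [f] do not add up to [n] it returns the condensate at
    [x0], so every use comes with a proof of the sum. *)
Definition mkc (x0 : S) n (f : S -> nat) : Hn n :=
  insubd (xi n x0) [ffun x => inord (f x)].

Lemma cfg_mkc x0 n f x : (\sum_x f x = n)%N -> cfg (mkc x0 n f) x = f x.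
Proof.
move=> e; have fn z : (f z <= n)%N by rewrite -e (bigD1 z) //= leq_addr.
rewrite /cfg /mkc /insubd insubT /=.
  by apply/eqP; rewrite -[RHS]e; apply: eq_bigr => z _; rewrite ffunE inordK // ltnS.
by move=> p; rewrite ffunE inordK // ltnS.
Qed.

Lemma cfg_xi n (x z : S) : cfg (xi n x) z = (if z == x then n else 0)%N.
Proof. by rewrite /cfg /= ffunE; case: eqP. Qed.

Definition addp n (zeta : Hn n) x : Hn n.+1 :=
  mkc x n.+1 (fun z => cfg zeta z + (z == x))%N.

Definition subp n (eta : Hn n.+1) x : Hn n :=
  mkc x n (fun z => cfg eta z - (z == x))%N.

Lemma sum_ind x : (\sum_(z : S) (z == x) = 1)%N.
Proof.
by rewrite (bigD1 x) //= eqxx big1 // => z /negbTE ->.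
Qed.

Lemma cfg_addp n (zeta : Hn n) x z : cfg (addp zeta x) z = (cfg zeta z + (z == x))%N.
Proof.
by rewrite /addp cfg_mkc // big_split /= cfg_sum sum_ind addn1.
Qed.

Lemma cfg_subp n (eta : Hn n.+1) x z : (0 < cfg eta x)%N ->
  cfg (subp eta x) z = (cfg eta z - (z == x))%N.
Proof.
move=> ex; rewrite /subp cfg_mkc //.
rewrite sumnB; first by rewrite cfg_sum sum_ind subn1.
by move=> u _; case: eqP => // ->.
Qed.

Lemma addp_subp n (eta : Hn n.+1) x : (0 < cfg eta x)%N -> addp (subp eta x) x = eta.
Proof.
move=> ex; apply: cfg_inj => z; rewrite cfg_addp cfg_subp //.
by case: eqP => [->|_]; rewrite ?subnK ?subn0 ?addn0.
Qed.

Lemma addp_inj n x : injective (fun zeta : Hn n => addp zeta x).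
Proof.
move=> a b e; apply: cfg_inj => z.
by have := congr1 (fun e => cfg e z) e; rewrite !cfg_addp => /addIn.
Qed.

Lemma movedP n x y (eta eta' : Hn n.+1) : x != y ->
  reflect (exists zeta, eta = addp zeta x /\ eta' = addp zeta y) (moved x y eta eta').
Proof.
move=> xy; apply: (iffP and4P) => [[ex /eqP e1 /eqP e2 /forallP e3]|[zeta [-> ->]]].
  exists (subp eta x); split; first by rewrite addp_subp.
  apply: cfg_inj => z; rewrite cfg_addp cfg_subp //.
  case: (eqVneq z x) => [->|zx].
    by rewrite (negbTE xy) addn0 subn1.
  case: (eqVneq z y) => [->|zy]; first by rewrite subn0 addn1.
  have := e3 z; rewrite zx zy /= => /eqP ->; by rewrite subn0 addn0.
split; rewrite ?cfg_addp ?eqxx ?addn1 //=.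
- by rewrite (negbTE xy) addn0.
- by rewrite (eq_sym y) (negbTE xy) addn0.
- by apply/forallP => z; rewrite !cfg_addp; apply/implyP => /andP[/negbTE -> /negbTE ->].
Qed.

(** A jump is determined by its two sites and by the configuration [zeta] of the other particles.
    Before the jump the site [x] holds one particle more than in [zeta] and the site [y] exactly as
    many, whence the shape of the rate. *)
Lemma sum_Qinc n (r : S -> S -> R) (d : R) (F : Hn n.+1 -> Hn n.+1 -> R) :
  (forall x, r x x = 0) ->
  \sum_eta \sum_eta' Qinc r d eta eta' * F eta eta' =
  \sum_(zeta : Hn n) \sum_x \sum_y
    (cfg zeta x).+1%:R * (d + (cfg zeta y)%:R) * r x y * F (addp zeta x) (addp zeta y).
Proof.
move=> rxx.
transitivity (\sum_eta \sum_eta' \sum_x \sum_y \sum_(zeta : Hn n)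
   (if (eta == addp zeta x) && (eta' == addp zeta y) then
    (cfg zeta x).+1%:R * (d + (cfg zeta y)%:R) * r x y * F eta eta' else 0)).
  apply: eq_bigr => e _; apply: eq_bigr => e' _.
  rewrite /Qinc mulr_suml; apply: eq_bigr => x _.
  rewrite mulr_suml; apply: eq_bigr => y _.
  case: (eqVneq x y) => [<-|xy].
    rewrite rxx mulr0 if_same mul0r big1 // => zeta _.
    by rewrite mulr0 mul0r if_same.
  case: (movedP e e' xy) => [[zeta [-> ->]]|nm].
    rewrite (bigD1 zeta) //= !eqxx /= big1 ?addr0; last first.
      move=> z zz; case: eqP => //= h.
      by have := addp_inj h => /eqP; rewrite eq_sym (negbTE zz).
    by rewrite !cfg_addp eqxx addn1 eq_sym (negbTE xy) addn0.
  rewrite mul0r big1 // => zeta _; case: andP => // -[/eqP e1 /eqP e2].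
  by case: nm; exists zeta.
under eq_bigr => e _.
  rewrite exchange_big /=.
  under eq_bigr => x _.
    rewrite exchange_big /=.
    under eq_bigr => y _ do rewrite exchange_big /=.
    over.
  over.
rewrite exchange_big /=.
under eq_bigr => x _.
  rewrite exchange_big /=.
  under eq_bigr => y _ do rewrite exchange_big /=.
  rewrite exchange_big /=.
  over.
rewrite exchange_big /=; apply: eq_bigr => zeta _; apply: eq_bigr => x _; apply: eq_bigr => y _.
rewrite (bigD1 (addp zeta x)) //= [X in _ + X]big1 ?addr0; last first.
  by move=> e /negbTE ee; rewrite big1 // => e' _; rewrite ee.
rewrite (bigD1 (addp zeta y)) //= [X in _ + X]big1 ?addr0 ?eqxx //.
by move=> e /negbTE ee; rewrite ee andbF.
Qed.

Lemma sum_inj_le (I J : finType) (phi : I -> J) (F : J -> R) :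
  injective phi -> (forall j, 0 <= F j) -> \sum_i F (phi i) <= \sum_j F j.
Proof.
move=> inj F0; rewrite [leRHS](bigID (fun j => j \in [set phi i | i in [set: I]]%SET)) /=.
rewrite -[leLHS]addr0; apply: lerD; last by rewrite sumr_ge0.
apply: le_of_eq.
by rewrite (big_imset _ (in2W inj)) /=; apply: eq_bigl => i; rewrite finset.inE.
Qed.

(* The total number of particles determines the coordinate at x0. *)
Lemma sum_prod_le n (x0 : S) (a : S -> nat -> R) : (forall s i, 0 <= a s i) ->
  \sum_(zeta : Hn n) \prod_(s | s != x0) a s (cfg zeta s) <=
  \prod_(s | s != x0) \sum_(i < n.+1) a s i.
Proof.
move=> a0; pose a' s i := if s == x0 then (i == 0%N)%:R else a s i.
have a'0 s i : 0 <= a' s i by rewrite /a'; case: ifP => // _; case: eqP.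
have e1 : \prod_(s | s != x0) \sum_(i < n.+1) a s i = \prod_s \sum_(i < n.+1) a' s i.
  rewrite [RHS](bigD1 x0) //= [X in X * _](_ : _ = 1) ?mul1r; last first.
    rewrite /a' big_ord_recl eqxx /= big1 ?addr0 // => i _.
  by apply: eq_bigr => s sx; apply: eq_bigr => i _; rewrite /a' (negbTE sx).
rewrite e1 bigA_distr_bigA /=.
pose phi (zeta : Hn n) : {ffun S -> 'I_n.+1} :=
  [ffun s => if s == x0 then ord0 else val zeta s].
have phi_inj : injective phi.
  move=> z z' e; have h s : s != x0 -> cfg z s = cfg z' s.
    by move=> sx; have := congr1 (fun f : {ffun _ -> _} => val (f s)) e; rewrite !ffunE (negbTE sx).
  apply: cfg_inj => s; case: (eqVneq s x0) => [->|/h//].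
  have := cfg_sum z'; have := cfg_sum z; rewrite (bigD1 x0) //= [in X in _ -> X](bigD1 x0) //=.
  rewrite (eq_bigr _ h); set t := (\sum_(_ | _) _)%N; lia.
have F0 (f : {ffun S -> 'I_n.+1}) : 0 <= \prod_s a' s (f s) by apply: prodr_ge0.
apply: (le_trans _ (sum_inj_le phi_inj F0)).
apply: ler_sum => zeta _; rewrite [leRHS](bigD1 x0) //=.
rewrite /a' ffunE eqxx /= mul1r.
apply: le_of_eq; apply: eq_bigr => s sx.
by rewrite (negbTE sx) ffunE (negbTE sx).
Qed.

(** Coordinates on configurations carried by three sites: [j] particles at the middle site [y], [l]
    at [x], the rest at [z]. Subtraction is truncated, so only [j + l <= n] is meaningful. *)
Definition c3 (x y z : S) n (j l : nat) : Hn n :=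
  mkc x n (fun s => if s == x then l else if s == y then j else if s == z then n - j - l else 0)%N.

Definition supp3 (x y z : S) n (zeta : Hn n) : bool :=
  [forall s, (s != x) && (s != y) && (s != z) ==> (cfg zeta s == 0%N)].

Lemma sum3 (x y z : S) (f : S -> nat) : x != y -> x != z -> y != z ->
  (forall s, s != x -> s != y -> s != z -> f s = 0%N) ->
  (\sum_s f s = f x + f y + f z)%N.
Proof.
move=> xy xz yz f0; rewrite (bigD1 x) //= (bigD1 y) //= 1?eq_sym //.
rewrite (bigD1 z) /=; last by rewrite eq_sym xz eq_sym yz.
rewrite big1 ?addn0 ?addnA // => s /andP[/andP[sx sy] sz]; exact: f0.
Qed.

Section Three.
Variables (x y z : S).
Hypotheses (xy : x != y) (xz : x != z) (yz : y != z).

Lemma cfg_c3 n j l s : (j + l <= n)%N ->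
  cfg (c3 x y z n j l) s =
  (if s == x then l else if s == y then j else if s == z then n - j - l else 0)%N.
Proof.
move=> jl; rewrite /c3 cfg_mkc // (sum3 xy xz yz) ?eqxx.
  rewrite (eq_sym y x) (negbTE xy) (eq_sym z x) (negbTE xz) (eq_sym z y) (negbTE yz).
  by lia.
by move=> u /negbTE -> /negbTE -> /negbTE ->.
Qed.

Lemma supp3_sum n (zeta : Hn n) : supp3 x y z zeta ->
  (cfg zeta x + cfg zeta y + cfg zeta z = n)%N.
Proof.
move=> /forallP h; rewrite -[RHS](cfg_sum zeta) (sum3 xy xz yz) // => s sx sy sz.
by have := h s; rewrite sx sy sz => /eqP.
Qed.

Lemma supp3_c3 n j l : (j + l <= n)%N -> supp3 x y z (c3 x y z n j l).
Proof.
move=> jl; apply/forallP => s; apply/implyP => /andP[/andP[sx sy] sz].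
by rewrite cfg_c3 // (negbTE sx) (negbTE sy) (negbTE sz).
Qed.

Lemma c3_cfg n (zeta : Hn n) : supp3 x y z zeta ->
  c3 x y z n (cfg zeta y) (cfg zeta x) = zeta.
Proof.
move=> h; have e := supp3_sum h; apply: cfg_inj => s; rewrite cfg_c3; last by lia.
case: eqP => [->//|/eqP sx]; case: eqP => [->//|/eqP sy]; case: eqP => [->|/eqP sz].
  by lia.
by move/forallP: h => /(_ s); rewrite sx sy sz => /eqP.
Qed.

Lemma sum_supp3 n (h : Hn n -> R) :
  \sum_(zeta | supp3 x y z zeta) h zeta =
  \sum_(j < n.+1) \sum_(l < n.+1 | (j + l <= n)%N) h (c3 x y z n j l).
Proof.
rewrite pair_big_dep /=.
rewrite (reindex_onto (fun p : 'I_n.+1 * 'I_n.+1 => c3 x y z n p.1 p.2)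
  (fun zeta => (inord (cfg zeta y), inord (cfg zeta x)))) /=; last first.
  by move=> zeta hz; rewrite !inordK ?ltnS ?cfg_le // c3_cfg.
apply: eq_bigl => -[j l] /=; apply/andP/idP => [[h3 /eqP [e1 e2]]|jl].
  have := supp3_sum h3; have := congr1 val e1; have := congr1 val e2.
  by rewrite /= !inordK ?ltnS ?cfg_le //; lia.
split; first exact: supp3_c3.
rewrite !cfg_c3 // !eqxx (eq_sym y x) (negbTE xy) !inord_val //.
Qed.
End Three.
End Config.

(** * Weights of the reversible measure *)

Section Weights.
Variable R : realType.

(* [wgt d n] is Gamma(n + d) / (n! Gamma(d)). *)
Definition wgt (d : R) (n : nat) : R := \prod_(i < n) ((d + i%:R) / i.+1%:R).
Definition harm (n : nat) : R := \sum_(i < n) i.+1%:R^-1.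
Definition omg (d : R) (n : nat) : R := expR (d * harm n).

Variable d : R.
Hypothesis d0 : 0 < d.
Local Notation w := (wgt d).

Lemma wgt0 : w 0%N = 1. Proof. by rewrite /wgt big_ord0. Qed.

Lemma wgtS n : n.+1%:R * w n.+1 = (d + n%:R) * w n.
Proof.
rewrite /wgt big_ord_recr /= mulrC -mulrA mulfVK ?pnatr_eq0 // mulrC //.
Qed.

Lemma wgt_gt0 n : 0 < w n.
Proof. by apply: prodr_gt0 => i _; rewrite divr_gt0 // ltr_pwDl. Qed.

Lemma harm_ge0 n : 0 <= harm n.
Proof. by apply: sumr_ge0 => i _; rewrite invr_ge0. Qed.

Lemma harm_mono m n : (m <= n)%N -> harm m <= harm n.
Proof.
move=> mn; rewrite /harm -(subnKC mn) big_split_ord /= lerDl.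
by apply: sumr_ge0 => i _; rewrite invr_ge0.
Qed.

Lemma omg_ge1 n : 1 <= omg d n.
Proof. by rewrite -expR0 ler_expR mulr_ge0 ?harm_ge0 // ltW. Qed.

(** The ratio of consecutive values of [(d + n) * w n] is exactly [1 + d / (n + 1)], which is at
    most [expR (d / (n + 1))]. Together with [wgtD_ge] this pins [w n] to [d / n] up to the factor
    [omg], close to 1 when [d * log n] is small. *)
Lemma wgtD_le n : (d + n%:R) * w n <= d * omg d n.
Proof.
elim: n => [|n IH].
  by rewrite addr0 wgt0 mulr1 ler_peMr ?omg_ge1 // ltW.
have e : (d + n.+1%:R) * w n.+1 = (1 + d / n.+1%:R) * ((d + n%:R) * w n).
  rewrite -(wgtS n) mulrA; congr (_ * _).
    by rewrite mulrDl mul1r mulfVK ?pnatr_eq0 // addrC.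
rewrite e (_ : omg d n.+1 = expR (d / n.+1%:R) * omg d n); last first.
  by rewrite /omg /harm big_ord_recr /= mulrDr expRD mulrC.
have h1 : 0 <= d / n.+1%:R by rewrite divr_ge0 // ltW.
have h2 : 0 <= (d + n%:R) * w n by rewrite mulr_ge0 ?(ltW (wgt_gt0 _)) // addr_ge0 // ltW.
have h3 := expR_ge1Dx (d / n.+1%:R).
apply: (@le_trans _ _ (expR (d / n.+1%:R) * ((d + n%:R) * w n))); first by rewrite ler_wpM2r.
by rewrite [leRHS]mulrCA ler_wpM2l // expR_ge0.
Qed.

Lemma wgtD_ge n : d <= (d + n%:R) * w n.
Proof.
elim: n => [|n IH]; first by rewrite addr0 wgt0 mulr1.
apply: le_trans IH _; rewrite -wgtS ler_wpM2r ?(ltW (wgt_gt0 _)) //.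
by rewrite lerDr ltW.
Qed.

Lemma wgtS_le n : w n.+1 <= d * omg d n / n.+1%:R.
Proof. by rewrite ler_pdivlMr ?ltr0n // mulrC wgtS wgtD_le. Qed.

Lemma omg_mono m n : (m <= n)%N -> omg d m <= omg d n.
Proof. by move=> mn; rewrite ler_expR ler_pM2l // harm_mono. Qed.

Lemma sum_wgtS N : \sum_(i < N) w i.+1 <= d * omg d N * harm N.
Proof.
rewrite /harm mulr_sumr; apply: ler_sum => i _.
apply: le_trans (wgtS_le i) _; rewrite ler_wpM2r ?invr_ge0 // ler_pM2l //.
by rewrite omg_mono // ltnW.
Qed.

End Weights.

(** * Reversibility and the Dirichlet form of the inclusion process *)

Section Chain.
Variables (R : realType) (S : finType) (r : S -> S -> R) (ms : S -> R) (d : R).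
Hypothesis d0 : 0 < d.
Hypothesis r0 : forall x y, 0 <= r x y.
Hypothesis rxx : forall x, r x x = 0.
Hypothesis ms0 : forall x, 0 < ms x.
Hypothesis rev : forall x y, ms x * r x y = ms y * r y x.
Local Notation w := (wgt d).

Definition nu n (eta : Hn S n) : R := \prod_x (w (cfg eta x) * ms x ^+ cfg eta x).

Lemma nu_gt0 n (eta : Hn S n) : 0 < nu eta.
Proof. by apply: prodr_gt0 => x _; rewrite mulr_gt0 ?wgt_gt0 // exprn_gt0. Qed.

Lemma nu_addp n (zeta : Hn S n) x :
  nu (addp zeta x) * (cfg zeta x).+1%:R = ms x * (d + (cfg zeta x)%:R) * nu zeta.
Proof.
rewrite /nu (bigD1 x) //= [in RHS](bigD1 x) //= cfg_addp eqxx addn1 exprS.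
rewrite (eq_bigr (fun z => w (cfg zeta z) * ms z ^+ cfg zeta z)); last first.
  by move=> z /negbTE zx; rewrite cfg_addp zx addn0.
set P := \prod_(_ | _) _; have := wgtS d (cfg zeta x); set k := cfg zeta x => e.
transitivity ((k.+1%:R * w k.+1) * (ms x * ms x ^+ k) * P); first by ring.
by rewrite e; ring.
Qed.

Variable n : nat.
Definition Zn : R := \sum_(eta : Hn S n.+1) nu eta.
Hypothesis x0 : S.

Lemma Zn_gt0 : 0 < Zn.
Proof.
rewrite /Zn (bigD1 (xi n.+1 x0)) //= ltr_wpDr ?nu_gt0 // sumr_ge0 // => e _.
exact: ltW (nu_gt0 e).
Qed.

Definition mu (eta : Hn S n.+1) : R := nu eta / Zn.

Lemma mu_gt0 eta : 0 < mu eta.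
Proof. by rewrite divr_gt0 ?nu_gt0 ?Zn_gt0. Qed.

Lemma mu_sum1 : \sum_eta mu eta = 1.
Proof. by rewrite -mulr_suml divff // gt_eqF // Zn_gt0. Qed.

(* An edge is encoded by the configuration [zeta] of the particles that stay: it joins [zeta] plus one particle at [x]
   and [zeta] plus one particle at [y]. *)
Definition Kc (zeta : Hn S n) x y : R :=
  ms x * r x y * (d + (cfg zeta x)%:R) * (d + (cfg zeta y)%:R) * nu zeta / Zn.

Lemma Kc_sym zeta x y : Kc zeta x y = Kc zeta y x.
Proof. by rewrite /Kc rev; ring. Qed.

Lemma Kc_ge0 zeta x y : 0 <= Kc zeta x y.
Proof.
rewrite /Kc !mulr_ge0 // ?invr_ge0 ?addr_ge0 // ?ltW ?nu_gt0 ?Zn_gt0 //.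
Qed.

Lemma KcE zeta x y :
  Kc zeta x y = mu (addp zeta x) * ((cfg zeta x).+1%:R * (d + (cfg zeta y)%:R) * r x y).
Proof.
rewrite /Kc /mu; have := nu_addp zeta x; set k := cfg zeta x => e.
transitivity (ms x * (d + k%:R) * nu zeta * ((d + (cfg zeta y)%:R) * r x y) / Zn); first by ring.
by rewrite -e; ring.
Qed.

Local Notation grad f zeta x y := (f (addp zeta x) - f (addp zeta y)).

Definition Dir (f g : Hn S n.+1 -> R) : R :=
  2^-1 * \sum_(zeta : Hn S n) \sum_x \sum_y Kc zeta x y * (grad f zeta x y * grad g zeta x y).

Lemma DirC f g : Dir f g = Dir g f.
Proof.
congr (_ * _); apply: eq_bigr => z _; apply: eq_bigr => x _; apply: eq_bigr => y _.
by rewrite [X in _ * X = _]mulrC.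
Qed.

(** Integration by parts: the sum over oriented edges equals its own reversal by symmetry of [Kc],
    and the average of the two is minus the form. *)
Lemma Dir_gen f g :
  \sum_eta mu eta * f eta * (\sum_eta' gen (Qinc r d) eta eta' * g eta') = - Dir f g.
Proof.
have -> : \sum_eta mu eta * f eta * (\sum_eta' gen (Qinc r d) eta eta' * g eta') =
  \sum_eta \sum_eta' Qinc r d eta eta' * (mu eta * f eta * (g eta' - g eta)).
  apply: eq_bigr => e _; rewrite gen_apply mulr_sumr; apply: eq_bigr => e' _; ring.
rewrite sum_Qinc //.
pose A := \sum_(zeta : Hn S n) \sum_x \sum_y
   Kc zeta x y * (f (addp zeta x) * (g (addp zeta y) - g (addp zeta x))).
pose B := \sum_(zeta : Hn S n) \sum_x \sum_y
   Kc zeta x y * (f (addp zeta y) * (g (addp zeta x) - g (addp zeta y))).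
have -> : \sum_(zeta : Hn S n) \sum_x \sum_y (cfg zeta x).+1%:R * (d + (cfg zeta y)%:R) * r x y *
   (mu (addp zeta x) * f (addp zeta x) * (g (addp zeta y) - g (addp zeta x))) = A.
  by apply: eq_bigr => z _; apply: eq_bigr => x _; apply: eq_bigr => y _; rewrite KcE; ring.
have AB : A = B.
  apply: eq_bigr => z _; rewrite exchange_big /=; apply: eq_bigr => x _; apply: eq_bigr => y _.
  by rewrite Kc_sym.
have : A + B = - (2 * Dir f g).
  rewrite /Dir mulrA divff ?mul1r ?pnatr_eq0 // -big_split -sumrN /=.
  apply: eq_bigr => z _; rewrite -big_split -sumrN /=.
  apply: eq_bigr => x _; rewrite -big_split -sumrN /=.
  by apply: eq_bigr => y _; ring.
by rewrite -AB; lra.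
Qed.

(** Stationarity is the vanishing of the form against constants, tested on an indicator. *)
Lemma mu_gen eta : \sum_eta' mu eta' * gen (Qinc r d) eta' eta = 0.
Proof.
have := Dir_gen (fun _ => 1) (fun e => (e == eta)%:R).
rewrite /Dir (_ : \sum_(zeta : Hn S n) _ = 0) ?mulr0 ?oppr0; last first.
  by apply: big1 => z _; apply: big1 => x _; apply: big1 => y _; rewrite subrr mul0r mulr0.
move=> e0; rewrite -[RHS]e0; apply: eq_bigr => e _; rewrite mulr1; congr (_ * _).
by rewrite (bigD1 eta) //= eqxx mulr1 big1 ?addr0 // => e' /negbTE ->; rewrite mulr0.
Qed.

Lemma Dir_ge0 f : 0 <= Dir f f.
Proof.
rewrite mulr_ge0 ?invr_ge0 //; do 3!(apply: sumr_ge0 => ? _).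
by rewrite mulr_ge0 ?Kc_ge0 // -expr2 sqr_ge0.
Qed.

(** Every edge with [0 < r x y] has positive conductance, so a function of zero energy is unchanged
    by such a jump; irreducibility extends this to any pair of sites, and all particles can then be
    gathered on one site. *)
Lemma Dir_eq0 f : (forall x y, connect [rel a b | 0 < r a b] x y) ->
  Dir f f = 0 -> forall eta eta', f eta = f eta'.
Proof.
move=> irr h.
have step zeta x y : 0 < r x y -> f (addp zeta x) = f (addp zeta y).
  move=> rxy; have : \sum_(zeta : Hn S n) \sum_x \sum_y Kc zeta x y * (grad f zeta x y * grad f zeta x y) = 0.
    by move/eqP: h; rewrite /Dir mulf_eq0 invr_eq0 pnatr_eq0 /= => /eqP.
  have K0 z u v : 0 <= Kc z u v * (grad f z u v * grad f z u v).
    by rewrite mulr_ge0 ?Kc_ge0 // -expr2 sqr_ge0.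
  have psum0 (I : finType) (F : I -> R) : (forall i, 0 <= F i) -> \sum_i F i = 0 -> forall i, F i = 0.
    by move=> F0 e i; apply: (psumr_eq0P _ e) => // j _.
  move=> /psum0 h1; have /psum0 h2 := h1 (fun z => sumr_ge0 _ (fun u _ => sumr_ge0 _ (fun v _ => K0 z u v))) zeta.
  have /psum0 h3 := h2 (fun u => sumr_ge0 _ (fun v _ => K0 zeta u v)) x.
  have /eqP := h3 (fun v => K0 zeta x v) y.
  rewrite mulf_eq0 -expr2 sqrf_eq0 subr_eq0 => /orP[|/eqP//].
  rewrite gt_eqF // /Kc !mulr_gt0 // ?invr_gt0 ?ltr_pwDl // ?nu_gt0 ?Zn_gt0 //.
have stepc zeta x y : f (addp zeta x) = f (addp zeta y).
  have /connectP[p pp ->] := irr x y.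
  elim: p x pp => //= u p IH x /andP[xu /IH <-]; exact: step.
have toxi eta z : f eta = f (xi n.+1 z).
  (* Induction on the number of particles that are not yet at [z]. *)
  move E : (n.+1 - cfg eta z)%N => k; elim: k eta E => [|k IH] eta E.
    congr f; apply: cfg_inj => u; rewrite cfg_xi.
    have ez : cfg eta z = n.+1 by have := cfg_le eta z; lia.
    case: eqP => [->//|/eqP uz]; have := cfg_sum eta.
    by rewrite (bigD1 z) //= (bigD1 u) //= ez; lia.
  have [x xz ex] : exists2 x, x != z & (0 < cfg eta x)%N.
    apply/exists_inP; rewrite -[X in is_true X]negbK negb_exists_in; apply/negP => /forall_inP h0.
    have := cfg_sum eta; rewrite (bigD1 z) //= big1 ?addn0; first by lia.
    by move=> u uz; have := h0 u uz; rewrite lt0n negbK => /eqP.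
  rewrite -(addp_subp ex) (stepc _ x z) IH // cfg_addp eqxx cfg_subp //.
  by rewrite eq_sym (negbTE xz) subn0 addn1; lia.
by move=> eta eta'; rewrite (toxi eta x0) (toxi eta' x0).
Qed.
End Chain.

(** * Primitives of Lipschitz functions on the unit interval *)

Section Primitive.
Variable R : realType.
Local Notation mu := (@lebesgue_measure R).

(** Lipschitz rather than continuous, because the gradient of the test function needs a quadratic
    Taylor remainder for the primitive. *)
Definition lip01 (f : R -> R) : Prop :=
  exists L : R, 0 <= L /\ forall s t : R, 0 <= s <= 1 -> 0 <= t <= 1 -> `|f s - f t| <= L * `|s - t|.

Lemma lip01_sum (I : finType) (P : pred I) (f : I -> R -> R) :
  (forall i, P i -> lip01 (f i)) -> lip01 (fun t => \sum_(i | P i) f i t).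
Proof.
move=> h; elim: (index_enum I) => [|i s [L [L0 IH]]].
  by exists 0; split=> // u v _ _; rewrite !big_nil subrr normr0 mul0r.
case Pi : (P i); last by exists L; split => // u v hu hv; rewrite !big_cons Pi; exact: IH.
have [L' [L'0 hi]] := h i Pi.
exists (L' + L); split; first exact: addr_ge0.
move=> u v hu hv; rewrite !big_cons Pi opprD addrACA mulrDl.
apply: le_trans (ler_normD _ _) _; apply: lerD; [exact: hi|exact: IH].
Qed.

Lemma lip01_mulr (f : R -> R) (c : R) : lip01 f -> lip01 (fun t => f t * c).
Proof.
move=> [L [L0 h]]; exists (L * `|c|); split; first exact: mulr_ge0.
by move=> s t hs ht; rewrite -mulrBl normrM mulrAC ler_wpM2r // h.
Qed.

Lemma lip01_bound (f : R -> R) : lip01 f -> exists K : R, 0 <= K /\ forall t : R, 0 <= t <= 1 -> `|f t| <= K.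
Proof.
move=> [L [L0 h]]; exists (`|f 0| + L); split; first exact: addr_ge0.
move=> t ht; have h01 : is_true ((0 : R) <= (0 : R) <= (1 : R)) by rewrite lexx ler01.
have := h t 0 ht h01; rewrite subr0.
have -> : `|t| = t by rewrite ger0_norm //; case/andP: ht.
have := ler_normD (f 0) (f t - f 0); rewrite addrC subrK.
by case/andP: ht => t0 t1; nra.
Qed.

Lemma lip01_inv (f : R -> R) (c : R) : 0 < c -> (forall t : R, 0 <= t <= 1 -> c <= f t) -> lip01 f ->
  lip01 (fun t => (f t)^-1).
Proof.
move=> c0 fc [L [L0 h]]; exists (L / c ^+ 2); split.
  by rewrite divr_ge0 // exprn_ge0 // ltW.
move=> s t hs ht; have fs := lt_le_trans c0 (fc s hs); have ft := lt_le_trans c0 (fc t ht).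
have -> : (f s)^-1 - (f t)^-1 = (f t - f s) / (f s * f t).
  by field; rewrite !gt_eqF.
rewrite normrM normfV (gtr0_norm (mulr_gt0 fs ft)) distrC mulrAC.
apply: ler_pM => //; first by rewrite invr_ge0 ltW // mulr_gt0.
  exact: h.
rewrite lef_pV2 ?posrE ?exprn_gt0 ?mulr_gt0 // expr2.
by apply: ler_pM; rewrite ?fc // ltW.
Qed.

Lemma lip01_integrable (f : R -> R) (i : interval R) :
  [set` i] `<=` `[0, 1]%classic -> lip01 f -> mu.-integrable [set` i] (EFin \o f).
Proof.
move=> sub [L [L0 h]].
apply: (@integrableS _ _ _ mu `[0%R, 1%R]%classic) => //.
apply: continuous_compact_integrable; first exact: segment_compact.
apply/subspace_continuousP => x x01; apply/cvgrPdist_le => e e0.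
rewrite near_withinE; near=> u => u01.
have hx : 0 <= x <= 1 by move: x01; rewrite /= in_itv.
have hu : 0 <= u <= 1 by move: u01; rewrite /= in_itv.
apply: le_trans (h x u hx hu) _.
have hd : `|x - u| <= e / (L + 1).
  near: u; apply: cvgr_dist_le; first exact: cvg_id.
  by rewrite divr_gt0 // ltr_wpDl.
apply: (@le_trans _ _ (L * (e / (L + 1)))); first exact: ler_wpM2l.
by rewrite mulrCA ger_pMr // ler_pdivrMr ?ltr_wpDl // mul1r lerDl.
Unshelve. all: by end_near. Qed.

Definition prim (f : R -> R) (t : R) : R := (\int[mu]_(u in `[0%R, t]) f u)%R.

Lemma prim0 f : prim f 0 = 0.
Proof. by rewrite /prim set_itv1 Rintegral_set1. Qed.

Lemma prim_diff (f : R -> R) : lip01 f -> exists L : R, 0 <= L /\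
  forall s t : R, 0 <= s -> s <= t -> t <= 1 ->
   `|prim f t - prim f s - f s * (t - s)| <= L * (t - s) ^+ 2 /\
   `|prim f t - prim f s - f t * (t - s)| <= L * (t - s) ^+ 2.
Proof.
move=> lf; have [L [L0 h]] := lf; exists L; split => // s t s0 st t1.
have sub : [set` `]s, t]%R] `<=` `[0, 1]%classic.
  move=> u /=; rewrite !in_itv /= => /andP[su ut].
  by rewrite (le_trans s0 (ltW su)) (le_trans ut t1).
have sub0 : [set` `[0, t]%R] `<=` `[0, 1]%classic.
  by move=> u /=; rewrite !in_itv /= => /andP[-> ut]; exact: le_trans ut t1.
have -> : prim f t - prim f s = (\int[mu]_(u in `]s, t]) f u)%R.
  by rewrite /prim Rintegral_itvB //; exact: lip01_integrable.
have key (v : R) : s <= v <= t -> `|(\int[mu]_(u in `]s, t]) f u)%R - f v * (t - s)| <= L * (t - s) ^+ 2.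
  move=> /andP[sv vt].
  have mus : fine (mu (`]s, t]%classic : set R)) = t - s.
    rewrite lebesgue_measure_itv /= lte_fin; case: ltP => // ts.
    by have -> : s = t; [apply/eqP; rewrite eq_le st ts|rewrite subrr].
  have hic (c : R) : mu.-integrable `]s, t]%classic (EFin \o (fun _ : R => c)).
    apply: lip01_integrable => //; exists 0; split => // u w _ _.
    by rewrite subrr normr0 mul0r.
  have hif := lip01_integrable sub lf.
  have b u : `]s, t]%classic u -> f v - L * (t - s) <= f u <= f v + L * (t - s).
    rewrite /= in_itv /= => /andP[su ut].
    have hu : 0 <= u <= 1 by rewrite (le_trans s0 (ltW su)) (le_trans ut t1).
    have hv : 0 <= v <= 1 by rewrite (le_trans s0 sv) (le_trans vt t1).
    have := h u v hu hv.
    have : `|u - v| <= t - s by rewrite ler_norml; apply/andP; split; lra.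
    rewrite ler_norml => hd hh.
    have {hh} : `|f u - f v| <= L * (t - s) by apply: le_trans hh _; rewrite ler_wpM2l // ler_norml.
    rewrite ler_norml; set X := L * _; lra.
  have h1 : (\int[mu]_(u in `]s, t]) f u)%R <= (\int[mu]_(u in `]s, t]) (f v + L * (t - s)))%R.
    by apply: le_Rintegral => // u /b /andP[].
  have h2 : (\int[mu]_(u in `]s, t]) (f v - L * (t - s)))%R <= (\int[mu]_(u in `]s, t]) f u)%R.
    by apply: le_Rintegral => // u /b /andP[].
  move: h1 h2; rewrite !Rintegral_cst // mus ler_norml.
  set I := (\int[mu]_(u in _) _)%R => h1 h2; apply/andP; split; nra.
by split; apply: key; rewrite ?lexx st.
Qed.

Lemma prim_mono (f : R -> R) s t : lip01 f -> (forall u, 0 <= u <= 1 -> 0 <= f u) ->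
  0 <= s -> s <= t -> t <= 1 -> prim f s <= prim f t.
Proof.
move=> lf f0 s0 st t1; rewrite -subr_ge0 /prim.
have sub0 : [set` `[0, t]%R] `<=` `[0, 1]%classic.
  by move=> u /=; rewrite !in_itv /= => /andP[-> ut]; exact: le_trans ut t1.
rewrite Rintegral_itvB //; last exact: lip01_integrable.
apply: Rintegral_ge0 => u /=; rewrite in_itv /= => /andP[su ut].
by apply: f0; rewrite (le_trans s0 (ltW su)) (le_trans ut t1).
Qed.

Lemma prim1_gt0 (f : R -> R) (c : R) : lip01 f -> 0 < c -> (forall u, 0 <= u <= 1 -> c <= f u) ->
  c <= prim f 1.
Proof.
move=> lf c0 fc; have hic : mu.-integrable `[0%R, 1%R]%classic (EFin \o (fun _ : R => c)).
  apply: lip01_integrable => //; exists 0; split => // u w _ _.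
  by rewrite subrr normr0 mul0r.
have : (\int[mu]_(u in `[0%R, 1%R]) c)%R <= prim f 1.
  by apply: le_Rintegral => //; first exact: lip01_integrable.
have mus : fine (mu (`[0%R, 1%R]%classic : set R)) = 1.
  by rewrite lebesgue_measure_itv /= lte_fin ltr01 oppr0 adde0.
by rewrite Rintegral_cst // mus mulr1.
Qed.
End Primitive.

(** * Cauchy-Schwarz inequalities and geometric moments *)

Section Tools.
Variable R : realType.

Lemma cauchy_schwarz (I : finType) (P : pred I) (a b : I -> R) :
  (\sum_(i | P i) a i * b i) ^+ 2 <= (\sum_(i | P i) a i ^+ 2) * (\sum_(i | P i) b i ^+ 2).
Proof.
have h : 0 <= \sum_(i | P i) \sum_(j | P j) (a i * b j - a j * b i) ^+ 2.
  by do 2!apply: sumr_ge0 => ? _; exact: sqr_ge0.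
suff : \sum_(i | P i) \sum_(j | P j) (a i * b j - a j * b i) ^+ 2 =
  2 * ((\sum_(i | P i) a i ^+ 2) * (\sum_(i | P i) b i ^+ 2) - (\sum_(i | P i) a i * b i) ^+ 2).
  by move=> e; move: h; rewrite e pmulr_rge0 // subr_ge0.
rewrite expr2 !big_distrlr /= -sumrB mulr_sumr.
transitivity (\sum_(i | P i) \sum_(j | P j) (a i ^+ 2 * b j ^+ 2 + a j ^+ 2 * b i ^+ 2 - 2 * (a i * b i * (a j * b j)))).
  by apply: eq_bigr => i _; apply: eq_bigr => j _; ring.
transitivity (\sum_(i | P i) (\sum_(j | P j) a i ^+ 2 * b j ^+ 2 - \sum_(j | P j) a i * b i * (a j * b j))
  + \sum_(i | P i) (\sum_(j | P j) a j ^+ 2 * b i ^+ 2 - \sum_(j | P j) a i * b i * (a j * b j))).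
  rewrite -big_split /=; apply: eq_bigr => i _.
  by rewrite -!sumrB -big_split /=; apply: eq_bigr => j _; ring.
have -> : \sum_(i | P i) (\sum_(j | P j) a j ^+ 2 * b i ^+ 2 - \sum_(j | P j) a i * b i * (a j * b j))
  = \sum_(i | P i) (\sum_(j | P j) a i ^+ 2 * b j ^+ 2 - \sum_(j | P j) a i * b i * (a j * b j)).
  by rewrite !sumrB; congr (_ - _); rewrite exchange_big.
by rewrite -mulr_sumr mulrDl mul1r.
Qed.

(** Used with [c] a conductance and [b] a gradient of [cw]: the second factor is then at most the
    square root of the energy, and [Y] bounds the energy of the flow [X]. *)
Lemma weighted_cs (I : finType) (P : pred I) (X Y c b : I -> R) :
  (forall i, P i -> 0 <= c i) -> (forall i, P i -> 0 <= Y i) ->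
  (forall i, P i -> X i ^+ 2 <= c i * Y i) ->
  `|\sum_(i | P i) X i * b i| <=
  Num.sqrt (\sum_(i | P i) Y i) * Num.sqrt (\sum_(i | P i) c i * b i ^+ 2).
Proof.
move=> c0 Y0 XY; apply: le_trans (ler_norm_sum _ _ _) _.
apply: (@le_trans _ _ (\sum_(i | P i) Num.sqrt (Y i) * (Num.sqrt (c i) * `|b i|))).
  apply: ler_sum => i Pi; rewrite normrM mulrA ler_wpM2r // -sqrtrM ?Y0 //.
  by rewrite -sqrtr_sqr ler_sqrt ?mulr_ge0 ?Y0 ?c0 // mulrC XY.
rewrite -sqrtrM ?sumr_ge0 // -[leLHS]ger0_norm; last first.
  by apply: sumr_ge0 => i _; rewrite !mulr_ge0 ?sqrtr_ge0.
rewrite -sqrtr_sqr ler_sqrt; last first.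
  by rewrite mulr_ge0 // sumr_ge0 // => i Pi; rewrite mulr_ge0 ?sqr_ge0 ?c0.
apply: le_trans (cauchy_schwarz _ _ _) _.
apply: le_of_eq; congr (_ * _); apply: eq_bigr => i Pi.
  by rewrite sqr_sqrtr ?Y0.
by rewrite exprMn sqr_sqrtr ?c0 // real_normK // num_real.
Qed.

Lemma exprD1_diff (a : R) p : 0 <= a -> (a + 1) ^+ p.+1 - a ^+ p.+1 <= p.+1%:R * (a + 1) ^+ p.
Proof.
move=> a0; rewrite subrXX addrAC subrr add0r mul1r.
rewrite (_ : p.+1%:R * (a + 1) ^+ p = \sum_(i < p.+1) (a + 1) ^+ p); last first.
  by rewrite sumr_const card_ord mulr_natl.
apply: ler_sum => i _; have ip : (i <= p)%N by rewrite -ltnS.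
rewrite -[X in _ <= X ^+ _]/(a + 1) -[in leRHS](subnK ip) exprD.
apply: ler_pM; rewrite ?exprn_ge0 ?addr_ge0 //.
by rewrite lerXn2r // ?nnegrE ?addr_ge0 // lerDl.
Qed.

Lemma geom_moment (a : R) p : 0 <= a -> a < 1 ->
  exists K : R, 0 <= K /\ forall n, \sum_(j < n) j.+1%:R ^+ p * a ^+ j <= K.
Proof.
move=> a0 a1; have a1' : 0 < 1 - a by rewrite subr_gt0.
elim: p => [|p [K [K0 hK]]].
  exists (1 - a)^-1; split; first by rewrite invr_ge0 ltW.
  move=> n; under eq_bigr do rewrite expr0 mul1r.
  have := subrX1 a n => e.
  rewrite -[leRHS]mul1r ler_pdivlMr // mulrC.
  have -> : (1 - a) * \sum_(i < n) a ^+ i = 1 - a ^+ n by rewrite -opprB mulNr -e opprB.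
  by rewrite lerBlDr lerDl exprn_ge0.
exists (p.+1%:R * K / (1 - a)); split; first by rewrite divr_ge0 ?mulr_ge0 // ltW.
move=> n; rewrite ler_pdivlMr // mulrBr mulr1.
(* Summation by parts: multiplication by [1 - a] replaces the power [p.+1] by its discrete
   derivative, up to a boundary term of the favourable sign. *)
apply: (@le_trans _ _ (\sum_(j < n) (j.+1%:R ^+ p.+1 - j%:R ^+ p.+1) * a ^+ j)); last first.
  apply: (@le_trans _ _ (\sum_(j < n) p.+1%:R * (j.+1%:R ^+ p * a ^+ j))); last first.
    by rewrite -mulr_sumr ler_wpM2l.
  apply: ler_sum => j _; rewrite mulrA ler_wpM2r ?exprn_ge0 //.
  by have := @exprD1_diff j%:R p (ler0n _ _); rewrite natr1.
have -> : \sum_(j < n) (j.+1%:R ^+ p.+1 - j%:R ^+ p.+1) * a ^+ j =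
    \sum_(i < n) i.+1%:R ^+ p.+1 * a ^+ i - (\sum_(i < n) i.+1%:R ^+ p.+1 * a ^+ i) * a
    + n%:R ^+ p.+1 * a ^+ n.
  elim: n => [|n IH]; first by rewrite !big_ord0 mul0r subr0 add0r expr0n mul0r.
  by rewrite !big_ord_recr /= IH [a ^+ n.+1]exprS; ring.
by rewrite lerDl mulr_ge0 ?exprn_ge0.
Qed.
End Tools.

(** * Classes, profiles and admissible data *)

Section Classes.
Variables (R : realType) (S : finType) (r : S -> S -> R) (m : S -> R).
Hypothesis r0 : forall x y, 0 <= r x y.
Hypothesis rxx : forall x, r x x = 0.
Hypothesis irr : forall x y, connect [rel a b | 0 < r a b] x y.
Hypothesis m0 : forall x, 0 <= m x.
Hypothesis m1 : \sum_x m x = 1.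
Hypothesis rev : forall x y, m x * r x y = m y * r y x.
Local Notation Sstar := (Sstar m).
Local Notation ms := (mstar m).
Local Notation cls := (cls r m).
Local Notation sst := (#|Sstar|%:R : R).

Lemma m_gt0 x : 0 < m x.
Proof.
have [x0 mx0] : exists x0, 0 < m x0.
  case: (pickP (fun x => 0 < m x)) => [x0 h|h]; first by exists x0.
  have := m1; rewrite big1 => [/eqP|z _]; first by rewrite eq_sym oner_eq0.
  by apply/eqP; rewrite eq_le m0 andbT leNgt h.
have step a b : 0 < m a -> 0 < r a b -> 0 < m b.
  move=> ma rab; rewrite lt_def m0 andbT; apply/eqP => mb.
  by have := rev a b; rewrite mb mul0r => /eqP; rewrite mulf_eq0 !gt_eqF.
have /connectP[p pp ->] := irr x0 x.
elim: p x0 mx0 pp => //= u p IH y my /andP[yu]; apply: IH; exact: step yu.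
Qed.

Lemma m_le_Mstar x : m x <= Mstar m.
Proof. exact: le_bigmax. Qed.

Lemma Mstar_gt0 : 0 < Mstar m.
Proof.
have [x _] : exists x : S, True.
  case: (pickP (fun x : S => true)) => [x _|h]; first by exists x.
  by have := m1; rewrite big_pred0 // => /eqP; rewrite eq_sym oner_eq0.
exact: lt_le_trans (m_gt0 x) (m_le_Mstar x).
Qed.

Lemma SstarP x : (x \in Sstar) = (m x == Mstar m).
Proof. by rewrite finset.inE. Qed.

Lemma ms_gt0 x : 0 < ms x.
Proof. by rewrite divr_gt0 ?m_gt0 // Mstar_gt0. Qed.

Lemma ms_le1 x : ms x <= 1.
Proof. by rewrite ler_pdivrMr ?Mstar_gt0 // mul1r m_le_Mstar. Qed.

Lemma ms_star x : x \in Sstar -> ms x = 1.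
Proof. by rewrite SstarP => /eqP e; rewrite /mstar e divff // gt_eqF // Mstar_gt0. Qed.

Lemma ms_lt1 x : x \notin Sstar -> ms x < 1.
Proof.
rewrite SstarP => h; rewrite ltr_pdivrMr ?Mstar_gt0 // mul1r lt_neqAle h; exact: m_le_Mstar.
Qed.

Lemma ms_rev x y : ms x * r x y = ms y * r y x.
Proof. by rewrite /mstar mulrAC rev mulrAC. Qed.

(** Geometric rate at which mass outside [Sstar] is suppressed. The default [2^-1] keeps it strictly
    between 0 and 1 even when the complement of [Sstar] is empty. *)
Definition mm : R := \big[Num.max/2^-1]_(y | y \notin Sstar) ms y.

Lemma mm_gt0 : 0 < mm.
Proof. by apply: lt_le_trans (bigmax_ge_id _ _ _ _); rewrite invr_gt0. Qed.

Lemma mm_lt1 : mm < 1.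
Proof.
apply/bigmax_ltP; split => [|y]; last exact: ms_lt1.
by rewrite invf_lt1 // ltr1n.
Qed.

Lemma ms_le_mm y : y \notin Sstar -> ms y <= mm.
Proof. move=> h; exact: (le_bigmax_cond _ ms). Qed.

Lemma rsym x y : (0 < r x y) = (0 < r y x).
Proof.
have h a b : 0 < r a b -> 0 < r b a.
  move=> rab; rewrite lt_def r0 andbT; apply/eqP => e.
  by have := rev a b; rewrite e mulr0 => /eqP; rewrite mulf_eq0 !gt_eqF // m_gt0.
by apply/idP/idP; exact: h.
Qed.

Lemma cls_sub (C : cls) x : x \in val C -> x \in Sstar.
Proof.
case: C => C /= /imsetP[z zS ->]; rewrite finset.inE => /andP[//].
Qed.

Lemma cls_neq0 (C : cls) : exists x, x \in val C.
Proof.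
by case: C => C /= /imsetP[z zS ->]; exists z; rewrite finset.inE zS connect0.
Qed.

Lemma rstar_sym : connect_sym (rstar r m).
Proof.
by apply: sym_connect_sym => x y; rewrite /rstar /= rsym andbCA.
Qed.

Lemma cls_mem (C : cls) x : x \in val C -> val C = rclass r m x.
Proof.
case: C => C /= /imsetP[z zS ->]; rewrite finset.inE => /andP[xS zx].
by apply/setP => y; rewrite !finset.inE (same_connect rstar_sym zx).
Qed.

Lemma cls_eq (C D : cls) x : x \in val C -> x \in val D -> C = D.
Proof. by move=> xC xD; apply: val_inj; rewrite (cls_mem xC) (cls_mem xD). Qed.

Lemma cls_ex x : x \in Sstar -> exists C : cls, x \in val C.
Proof.
move=> xS; have h : rclass r m x \in classes r m by apply/imsetP; exists x.
by exists (Sub (rclass r m x) h); rewrite SubK finset.inE xS connect0.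
Qed.

Lemma cls_r (C : cls) x y : x \in val C -> y \in Sstar -> 0 < r x y -> y \in val C.
Proof.
move=> xC yS rxy; rewrite (cls_mem xC) finset.inE yS; apply: connect1.
by rewrite /rstar /= (cls_sub xC) yS.
Qed.

Lemma cls_conn (C : cls) x y : x \in val C -> y \in val C -> connect (rstar r m) x y.
Proof. by move=> xC; rewrite (cls_mem xC) finset.inE => /andP[]. Qed.

Lemma cls_card_gt0 (C : cls) : (0 < #|val C|)%N.
Proof. by have [x xC] := cls_neq0 C; apply/card_gt0P; exists x. Qed.

Lemma sum_Sstar (F : S -> R) :
  \sum_(x in Sstar) F x = \sum_(C : cls) \sum_(x in val C) F x.
Proof.
rewrite (exchange_big_dep (mem Sstar)) /=; last by move=> C x _; exact: cls_sub.
apply: eq_bigr => x xS; have [C xC] := cls_ex xS.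
rewrite (bigD1 C) //= big1 ?addr0 // => D /andP[xD /eqP]; case.
exact: cls_eq xD xC.
Qed.

(** Conductance of the resistances [(1 - t) / a] and [t / b] in series, written so that it is 0 when
    one of the rates vanishes. *)
Definition kap (t a b : R) : R := a * b / ((1 - t) * b + t * a).

Lemma kap_den (t a b : R) : 0 <= t <= 1 -> 0 < a -> 0 < b ->
  Num.min a b <= (1 - t) * b + t * a.
Proof.
move=> /andP[t0 t1] a0 b0.
have ma : Num.min a b <= a by rewrite ge_min lexx.
have mb : Num.min a b <= b by rewrite ge_min lexx orbT.
nra.
Qed.

Lemma RsummandE (t : R) x x' y : 0 <= t <= 1 ->
  Rsummand r m t x x' y = kap t (r x y) (r x' y) / (1 - ms y).
Proof.
move=> t01; rewrite /Rsummand /kap.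
case: eqP => [->|/eqP]; first by rewrite !mul0r.
rewrite mulf_eq0 negb_or => /andP[ra rb].
have ra0 : 0 < r x y by rewrite lt_def ra r0.
have rb0 : 0 < r x' y by rewrite lt_def rb r0.
have := kap_den t01 ra0 rb0 => hd.
have m0' : 0 < Num.min (r x y) (r x' y) by rewrite lt_min ra0.
have d0 : (1 - t) * r x' y + t * r x y != 0 by rewrite gt_eqF // (lt_le_trans m0' hd).
have [->|my] := eqVneq (1 - ms y) 0; first by rewrite mul0r invr0 !mulr0.
by field; rewrite my ra rb d0.
Qed.

Definition csum (C D : cls) (t : R) : R :=
  \sum_(x in val C) \sum_(x' in val D) \sum_(y in ~: Sstar) kap t (r x y) (r x' y) / (1 - ms y).

Lemma csum_sym C D t : csum D C (1 - t) = csum C D t.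
Proof.
rewrite /csum exchange_big /=; apply: eq_bigr => x _; apply: eq_bigr => x' _; apply: eq_bigr => y _.
by congr (_ / _); rewrite /kap; congr (_ / _); ring.
Qed.

Lemma lip01_kap (a b : R) : 0 <= a -> 0 <= b -> lip01 (fun t => kap t a b).
Proof.
rewrite le_eqVlt => /predU1P[<- _|a0].
  by exists 0; split => // s t _ _; rewrite /kap !mul0r subrr normr0.
rewrite le_eqVlt => /predU1P[<-|b0].
  by exists 0; split => // s t _ _; rewrite /kap mulr0 !mul0r subrr normr0.
have hd : lip01 (fun t => (1 - t) * b + t * a).
  exists `|a - b|; split => // s t _ _; rewrite -normrM.
  by apply: le_of_eq; congr (`|_|); ring.
have : lip01 (fun t => ((1 - t) * b + t * a)^-1).
  apply: (@lip01_inv _ _ (Num.min a b)) hd; first by rewrite lt_min a0.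
  by move=> t ht; apply: kap_den.
move=> /(@lip01_mulr _ _ (a * b)) [L [L0 h]]; exists L; split => // s t hs ht.
by have := h s t hs ht; rewrite /kap ![(_)^-1 * (a * b)]mulrC.
Qed.

Lemma kap_ge0 (t a b : R) : 0 <= a -> 0 <= b -> 0 <= t <= 1 -> 0 <= kap t a b.
Proof.
move=> a0 b0 /andP[t0 t1]; rewrite /kap divr_ge0 ?mulr_ge0 // addr_ge0 ?mulr_ge0 //.
by rewrite subr_ge0.
Qed.

Lemma lip01_csum (C D : cls) : lip01 (csum C D).
Proof.
rewrite /csum; apply: lip01_sum => x _; apply: lip01_sum => x' _; apply: lip01_sum => y _.
by apply: lip01_mulr; exact: lip01_kap.
Qed.

Lemma ms_compl_gt0 y : y \in ~: Sstar -> 0 < 1 - ms y.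
Proof. by rewrite finset.inE subr_gt0 => /(ms_lt1). Qed.

Lemma csum_ge0 (C D : cls) t : 0 <= t <= 1 -> 0 <= csum C D t.
Proof.
move=> ht; do 2!apply: sumr_ge0 => ? _; apply: sumr_ge0 => y yS.
by rewrite divr_ge0 ?kap_ge0 // ltW // ms_compl_gt0.
Qed.

Lemma csum_vanish (C D : cls) t : all_vanish r m (val C) (val D) -> csum C D t = 0.
Proof.
move=> /forall_inP h; apply: big1 => x xC; apply: big1 => x' xD; apply: big1 => y yS.
have /forall_inP h1 := h x xC; have /forall_inP h2 := h1 x' xD.
by have /eqP e := h2 y yS; rewrite /kap e !mul0r.
Qed.

Lemma csum_pos (C D : cls) : ~~ all_vanish r m (val C) (val D) ->
  exists2 c : R, 0 < c & forall t, 0 <= t <= 1 -> c <= csum C D t.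
Proof.
move=> /forall_inPn[x xC] /forall_inPn[x' xD] /forall_inPn[y yS].
rewrite mulf_eq0 negb_or => /andP[ra rb].
have a0 : 0 < r x y by rewrite lt_def ra r0.
have b0 : 0 < r x' y by rewrite lt_def rb r0.
exists (r x y * r x' y / (r x y + r x' y) / (1 - ms y)).
  by apply: divr_gt0; [apply: divr_gt0; [exact: mulr_gt0|exact: addr_gt0]|exact: ms_compl_gt0].
move=> t ht; rewrite /csum (bigD1 x) //= (bigD1 x') //= (bigD1 y) //=.
rewrite -!addrA; apply: ler_wpDr; last first.
  rewrite ler_wpM2r ?invr_ge0 ?(ltW (ms_compl_gt0 yS)) // /kap ler_wpM2l ?(mulr_ge0 (ltW a0) (ltW b0)) //.
  have hmin : 0 < Num.min (r x y) (r x' y) by rewrite lt_min a0.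
  have hd := lt_le_trans hmin (kap_den ht a0 b0).
  rewrite lef_pV2 ?posrE //; last exact: addr_gt0.
  by case/andP: ht => t0 t1; nra.
have pos x1 x2 y1 : y1 \in ~: Sstar -> 0 <= kap t (r x1 y1) (r x2 y1) / (1 - ms y1).
  by move=> h; rewrite divr_ge0 ?kap_ge0 // ltW // ms_compl_gt0.
rewrite !addr_ge0 // sumr_ge0 // => [u /andP[uS _]|u _|u _]; first exact: pos.
  by apply: sumr_ge0 => y1; exact: pos.
by apply: sumr_ge0 => u1 _; apply: sumr_ge0 => y1; exact: pos.
Qed.

(** The inverse of the resistance between the two classes. Unlike [rate2] it is symmetric: the
    cardinalities of the classes are the reversible weights of the limit chain. *)
Definition rho (C D : cls) : R := #|val C|%:R * rate2 C D.

Lemma RintE (C D : cls) : Defs.Rint r m (val C) (val D) = prim (fun t => (csum C D t)^-1) 1.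
Proof.
rewrite /Defs.Rint /prim; congr fine; apply: eq_integral => t.
rewrite inE /= in_itv /= => ht; congr EFin; rewrite div1r; congr (_^-1).
apply: eq_bigr => x _; apply: eq_bigr => x' _; apply: eq_bigr => y _.
exact: RsummandE.
Qed.

Lemma rhoE (C D : cls) : C != D -> rho C D =
  if all_vanish r m (val C) (val D) then 0 else (prim (fun t => (csum C D t)^-1) 1)^-1.
Proof.
move=> /negbTE CD; rewrite /rho /rate2 CD /Rres; case: ifP => _; first by rewrite mulr0.
rewrite RintE invfM mulrA divff ?mul1r // pnatr_eq0 -lt0n; exact: cls_card_gt0.
Qed.

Lemma all_vanishC (C D : cls) : all_vanish r m (val C) (val D) = all_vanish r m (val D) (val C).
Proof.
have h (C' D' : cls) : all_vanish r m (val C') (val D') -> all_vanish r m (val D') (val C').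
  move=> /forall_inP h; apply/forall_inP => x xD; apply/forall_inP => x' xC; apply/forall_inP => y yS.
  have /forall_inP h1 := h x' xC; have /forall_inP h2 := h1 x xD.
  by rewrite mulrC; exact: h2.
by apply/idP/idP; exact: h.
Qed.

(** Exchanging the classes reverses the parameter of [csum]; the substitution of [1 - t] for [t]
    leaves the integral unchanged. *)
Lemma rho_sym (C D : cls) : C != D -> rho C D = rho D C.
Proof.
move=> CD; rewrite !rhoE // 1?eq_sym // all_vanishC; case: ifP => // nv; congr (_^-1).
have [c c0 hc] := @csum_pos C D (negbT (etrans (all_vanishC C D) nv)).
have lf := lip01_inv c0 hc (lip01_csum C D).
rewrite /prim /Rintegral; congr fine.
have cont : {within `[0%R, 1%R], continuous (fun t => (csum C D t)^-1)}.
  have [L [L0 h]] := lf.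
  apply/subspace_continuousP => x x01; apply/cvgrPdist_le => e e0.
  rewrite near_withinE; near=> u => u01.
  have hx : 0 <= x <= 1 by move: x01; rewrite /= in_itv.
  have hu : 0 <= u <= 1 by move: u01; rewrite /= in_itv.
  apply: le_trans (h x u hx hu) _.
  have hd : `|x - u| <= e / (L + 1).
    near: u; apply: cvgr_dist_le; first exact: cvg_id.
    by rewrite divr_gt0 // ltr_wpDl.
  apply: (@le_trans _ _ (L * (e / (L + 1)))); first exact: ler_wpM2l.
  by rewrite mulrCA ger_pMr // ler_pdivrMr ?ltr_wpDl // mul1r lerDl.
rewrite (integration_by_substitution_onem _ cont) ?lexx ?ler01 //.
rewrite [X in `[X, _]](_ : _ = 0%R); last by rewrite /unstable.onem subrr.
apply: eq_integral => t _; congr EFin; congr (_^-1).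
by rewrite -(csum_sym D C) /unstable.onem.
Unshelve. all: by end_near. Qed.

(* [b] is the equilibrium potential between [D] (at 0) and [C] (at 1) of the limiting
   one-dimensional conductance problem, and [g] its derivative. *)
Definition profile_spec (C D : cls) (g b : R -> R) (L : R) : Prop :=
  [/\ 0 <= L, b 0 = 0 /\ b 1 = 1,
     forall t, 0 <= t <= 1 -> (0 <= g t <= L) /\ (0 <= b t <= 1),
     forall s t, 0 <= s <= 1 -> 0 <= t <= 1 ->
       `|g s - g t| <= L * `|s - t| /\ `|b s - b t - g t * (s - t)| <= L * (s - t) ^+ 2 &
     forall t, 0 <= t <= 1 -> csum C D t * g t = rho C D].

Lemma profile (C D : cls) : C != D -> exists g b L, profile_spec C D g b L.
Proof.
move=> CD; case: (boolP (all_vanish r m (val C) (val D))) => nv.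
  (* Without conductance between the classes [rho] is 0, and any profile with the right end values
     will do. *)
  exists (fun _ => 1), id, 1; split => // [t ht|s t _ _|t _].
  - by rewrite !lexx !ler01.
  - by rewrite subrr normr0 !mul1r subrr normr0 normr_ge0 sqr_ge0.
  - by rewrite csum_vanish // rhoE // nv mul0r.
have [c c0 hc] := csum_pos nv.
(* [f] is the resistance per unit length. Its normalized primitive is the potential, and dividing by
   the total resistance makes the current [csum * g] constant and equal to [rho]. *)
pose f t := (csum C D t)^-1.
have lf : lip01 f := lip01_inv c0 hc (lip01_csum C D).
have f0 u : 0 <= u <= 1 -> 0 <= f u by move=> hu; rewrite invr_ge0 csum_ge0.
have [K [K0 hK]] := lip01_bound (lip01_csum C D).
have I0 : (K + 1)^-1 <= prim f 1.
  apply: prim1_gt0 => //; first by rewrite invr_gt0 ltr_wpDl.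
  move=> u hu; rewrite lef_pV2 ?posrE ?ltr_wpDl ?(lt_le_trans c0 (hc u hu)) //.
  by apply: le_trans (ler_norm _) _; apply: le_trans (hK u hu) _; rewrite lerDl.
have I1 : 0 < prim f 1 by apply: lt_le_trans I0; rewrite invr_gt0 ltr_wpDl.
set I := prim f 1 in I0 I1.
have [Lf [Lf0 hf]] := lf; have [Kf [Kf0 hKf]] := lip01_bound lf.
have [Lp [Lp0 hp]] := prim_diff lf.
exists (fun t => f t / I), (fun t => prim f t / I), ((Lf + Kf + Lp) / I).
have L0 : 0 <= (Lf + Kf + Lp) / I by rewrite divr_ge0 ?addr_ge0 // ltW.
split => //.
- by rewrite prim0 mul0r divff // gt_eqF.
- move=> t ht; have := hKf t ht; rewrite (ger0_norm (f0 t ht)) => h1.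
  case/andP: (ht) => t0 t1; rewrite !divr_ge0 ?(ltW I1) ?f0 //=; last first.
    by rewrite -(prim0 f); apply: prim_mono.
  rewrite ler_pM2r ?invr_gt0 // ler_pdivrMr // mul1r (prim_mono lf) //; split => //.
  by lra.
- move=> s t hs ht; split.
    rewrite -mulrBl normrM [`|I^-1|]gtr0_norm ?invr_gt0 // [leRHS]mulrAC ler_pM2r ?invr_gt0 //.
    by apply: le_trans (hf s t hs ht) _; rewrite ler_wpM2r // -addrA lerDl addr_ge0.
  have -> : prim f s / I - prim f t / I - f t / I * (s - t) = (prim f s - prim f t - f t * (s - t)) / I by ring.
  rewrite normrM [`|I^-1|]gtr0_norm ?invr_gt0 // [leRHS]mulrAC ler_pM2r ?invr_gt0 //.
  apply: (@le_trans _ _ (Lp * (s - t) ^+ 2)); last first.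
    by rewrite ler_wpM2r ?sqr_ge0 // lerDr addr_ge0.
  case/andP: hs => s0 s1; case/andP: ht => t0 t1.
  case: (leP t s) => [ts|/ltW st]; first by have [] := hp t s t0 ts s1.
  have [_] := hp s t s0 st t1; rewrite -normrN => h1.
  have -> : (s - t) ^+ 2 = (t - s) ^+ 2 by ring.
  by apply: le_trans h1; apply: le_of_eq; congr (`|_|); ring.
- move=> t ht; rewrite rhoE // (negbTE nv) mulrA /f divff ?mul1r //.
  by rewrite gt_eqF // (lt_le_trans c0 (hc t ht)).
Qed.

Lemma sst_gt0 : 0 < sst.
Proof.
rewrite ltr0n; apply/card_gt0P.
have [x _] : exists x : S, True.
  case: (pickP (fun x : S => true)) => [x _|h]; first by exists x.
  by have := m1; rewrite big_pred0 // => /eqP; rewrite eq_sym oner_eq0.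
case: (@Order.TotalTheory.arg_maxP _ _ _ x xpredT m isT) => y _ hy.
exists y; rewrite SstarP eq_le m_le_Mstar /=.
by apply/bigmax_leP; split => // z _; exact: hy.
Qed.

Lemma sst_ge1 : 1 <= sst.
Proof. by have := sst_gt0; rewrite ltr0n ler1n. Qed.

(** * Admissible data and the calculus of errors *)

Definition gr n (f : Hn S n.+1 -> R) (zeta : Hn S n) x y : R := f (addp zeta x) - f (addp zeta y).

(* System size [cn + 1], parameter [cd], error scale [cq], function [cw] and a bound [cM] on it; errors are measured
   against [err], uniformly over such data. *)
Record ctx := Ctx { cn : nat; cd : R; cq : R; cw : Hn S cn.+1 -> R; cM : R }.
Arguments cw : clear implicits.

Definition cN c : R := (cn c).+1%:R.
Definition ch c : R := 1 + harm R (cn c).+1.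
Definition theta_ c : R := cN c / cd c ^+ 2.
Definition cZ c : R := Zn ms (cd c) (cn c).
(** Rescaled partition function. A condensate on [Sstar] has weight about [d / N], so this quantity
    counts the sites of [Sstar] in the limit. *)
Definition zN c : R := cN c * cZ c / cd c.
Definition cnd c (zeta : Hn S (cn c)) x y : R := theta_ c * Kc r ms (cd c) zeta x y.
Arguments cnd : clear implicits.
Definition En c : R := theta_ c * Dir r ms (cd c) (cw c) (cw c).

(** All smallness is expressed through the single scale [cq]: the bound on [omg] makes the weights
    [d / k] accurate; [d N^2 h^2] pays for two extra occupied sites; the exponential bound beats the
    conductance [N ^ 2 / d] times the number of configurations, at most [N ^ #|S|]; the next one
    yields [1 / N <= cq]. *)
Definition valid c : Prop :=
  [/\ 0 < cd c, cd c <= 1, (0 < cn c)%N, 0 < cq c <= 2^-1 &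
   [/\ omg (cd c) (cn c).+1 <= 1 + cq c,
       cd c * cN c ^+ 2 * ch c ^+ 2 <= cq c,
       cN c ^+ (#|S| + 2) * mm ^+ cn c <= cq c * cd c,
       ch c ^+ 2 <= cq c * cN c &
       `|zN c - sst| <= cq c /\ forall eta, `|cw c eta| <= cM c]].

(** Every error comes from a Cauchy-Schwarz inequality against the energy of [cw], hence the square
    roots; boundary terms only see the bound [cM]. *)
Definition err c : R := Num.sqrt (cq c) * (Num.sqrt (En c) + cM c).

(** A big-O with one constant for all admissible data, so that [cw] may later depend on time and on
    the size of the system. *)
Definition small (F : ctx -> R) : Prop :=
  exists K : R, 0 <= K /\ forall c, valid c -> `|F c| <= K * err c.

Lemma some_site : exists x0 : S, x0 \in Sstar.
Proof. by have := sst_gt0; rewrite ltr0n => /card_gt0P[x]; exists x. Qed.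

Lemma cM_ge0 c : valid c -> 0 <= cM c.
Proof.
move=> [_ _ _ _ [_ _ _ _ [_ h]]]; have [x0 _] := some_site.
exact: le_trans (h (xi (cn c).+1 x0)).
Qed.

Lemma small0 : small (fun _ => 0).
Proof. by exists 0; split => // c _; rewrite normr0 mul0r. Qed.

Lemma small_eq F G : (forall c, valid c -> F c = G c) -> small F -> small G.
Proof. by move=> e [K [K0 h]]; exists K; split => // c v; rewrite -e // h. Qed.

Lemma small_add F G : small F -> small G -> small (fun c => F c + G c).
Proof.
move=> [K [K0 h]] [K' [K'0 h']]; exists (K + K'); split; first exact: addr_ge0.
move=> c v; apply: le_trans (ler_normD _ _) _; rewrite mulrDl; apply: lerD; [exact: h|exact: h'].
Qed.

Lemma small_mul F (k : R) : small F -> small (fun c => k * F c).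
Proof.
move=> [K [K0 h]]; exists (`|k| * K); split; first exact: mulr_ge0.
by move=> c v; rewrite normrM -mulrA ler_wpM2l // h.
Qed.

Lemma small_trans F G H : small (fun c => F c - G c) -> small (fun c => G c - H c) ->
  small (fun c => F c - H c).
Proof. by move=> h1 h2; apply: small_eq (small_add h1 h2) => c _; rewrite addrA subrK. Qed.

Lemma small_sum (I : finType) (P : pred I) (F : I -> ctx -> R) :
  (forall i, P i -> small (F i)) -> small (fun c => \sum_(i | P i) F i c).
Proof.
move=> h; elim: (index_enum I) => [|i s IH].
  by apply: small_eq small0 => c _; rewrite big_nil.
case Pi : (P i); last by apply: small_eq IH => c _; rewrite big_cons Pi.
by apply: small_eq (small_add (h i Pi) IH) => c _; rewrite big_cons Pi.
Qed.

Lemma theta_gt0 c : valid c -> 0 < theta_ c.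
Proof. by move=> [d0 _ _ _ _]; rewrite divr_gt0 ?exprn_gt0 // ltr0n. Qed.

Lemma cond_ge0 c zeta x y : valid c -> 0 <= cnd c zeta x y.
Proof.
move=> v; have t0 := theta_gt0 v; case: v => d0 _ _ _ _; have [x0 _] := some_site.
rewrite mulr_ge0 ?(ltW t0) //; apply: Kc_ge0 => //.
exact: ms_gt0.
Qed.

Lemma En_sum c : En c = 2^-1 * \sum_zeta \sum_x \sum_y cnd c zeta x y * (gr (cw c) zeta x y) ^+ 2.
Proof.
rewrite /En /Dir mulrCA; congr (_ * _); rewrite mulr_sumr; apply: eq_bigr => z _.
rewrite mulr_sumr; apply: eq_bigr => x _; rewrite mulr_sumr; apply: eq_bigr => y _.
by rewrite /cnd /gr -mulrA expr2.
Qed.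

Lemma cond_sym c zeta x y : cnd c zeta x y = cnd c zeta y x.
Proof. by rewrite /cnd Kc_sym //; exact: ms_rev. Qed.

Lemma En_ge0 c : valid c -> 0 <= En c.
Proof.
move=> v; rewrite En_sum mulr_ge0 ?invr_ge0 //; do 3!apply: sumr_ge0 => ? _.
by rewrite mulr_ge0 ?cond_ge0 ?sqr_ge0.
Qed.

(** The two orientations of an edge occur in the form and compensate the factor 1/2. *)
Lemma edge_En c x y (P : pred (Hn S (cn c))) : valid c -> x != y ->
  \sum_(zeta | P zeta) cnd c zeta x y * (gr (cw c) zeta x y) ^+ 2 <= En c.
Proof.
move=> v xy; set f := fun zeta u w => cnd c zeta u w * (gr (cw c) zeta u w) ^+ 2.
have f0 z u w : 0 <= f z u w by rewrite mulr_ge0 ?cond_ge0 ?sqr_ge0.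
apply: (@le_trans _ _ (\sum_zeta f zeta x y)).
  by rewrite [leRHS](bigID P) /= lerDl sumr_ge0.
rewrite En_sum -[leRHS]/(2^-1 * \sum_zeta \sum_u \sum_w f zeta u w) mulr_sumr.
apply: ler_sum => z _; rewrite ler_pdivlMl // (bigD1 x) //= (bigD1 y) //= [X in _ + X](bigD1 y) 1?eq_sym //=.
rewrite [X in _ + (X + _)](bigD1 x) //=.
have -> : f z y x = f z x y by rewrite /f cond_sym -sqrrN opprB.
rewrite mulr2n mulrDl mul1r -!addrA lerD2l addrCA lerDl.
by rewrite !addr_ge0 // sumr_ge0 // => u _; apply: sumr_ge0.
Qed.

Lemma dh_le c : valid c -> 2 * cd c * ch c <= 1 /\ cd c * ch c <= cq c.
Proof.
move=> [d0 d1 n0 /andP[q0 q1] [_ h _ _ _]].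
have N1 : 1 <= cN c by rewrite ler1n.
have h1 : 1 <= ch c by rewrite lerDl harm_ge0.
have NN : 1 <= cN c ^+ 2 by rewrite exprn_ege1.
have hh : ch c <= ch c ^+ 2 by rewrite expr2 ler_peMl // (le_trans ler01 h1).
have : cd c * ch c <= cq c.
  apply: le_trans h; rewrite -mulrA ler_pM2l //; apply: le_trans hh _.
  by rewrite ler_peMl // sqr_ge0.
by split => //; lra.
Qed.

Lemma omg_le2 c n : valid c -> (n <= (cn c).+1)%N -> omg (cd c) n <= 1 + cq c.
Proof. by move=> [d0 _ _ _ [h _ _ _ _]] hn; apply: le_trans (omg_mono d0 hn) h. Qed.

Lemma q2 c : valid c -> 1 + cq c <= 2.
Proof. by move=> [_ _ _ /andP[_ q] _]; lra. Qed.

Lemma sum_wgt_pos c : valid c -> \sum_(i < (cn c).+1 | (0 < i)%N) wgt (cd c) i <= 2 * cd c * ch c.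
Proof.
move=> v; have d0 : 0 < cd c by case: v.
rewrite big_mkcond big_ord_recl /= add0r.
apply: (@le_trans _ _ (\sum_(i < cn c) wgt (cd c) i.+1)); first by apply: ler_sum.
apply: le_trans (sum_wgtS d0 _) _.
have ho : omg (cd c) (cn c) <= 2 by apply: le_trans (omg_le2 v (leqnSn _)) (q2 v).
have hh : harm R (cn c) <= ch c.
  by apply: (@le_trans _ _ (harm R (cn c).+1)); rewrite ?harm_mono // lerDr.
have := ler_pM (le_trans ler01 (omg_ge1 d0 _)) (harm_ge0 _ _) ho hh.
by move=> h; rewrite -mulrA [2 * _]mulrC -mulrA ler_pM2l.
Qed.

Lemma sum_wgt c : valid c -> \sum_(i < (cn c).+1) wgt (cd c) i <= 2.
Proof.
move=> v; rewrite (bigID (fun i : 'I__ => (0 < i)%N)) /=.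
have -> : \sum_(i < (cn c).+1 | ~~ (0 < i)%N) wgt (cd c) i = 1.
  rewrite (big_pred1 ord0) ?wgt0 // => i; rewrite -leqNgt leqn0 /=.
  by apply/eqP/eqP => [e|->//]; apply/val_inj.
by have := sum_wgt_pos v; have [] := dh_le v; lra.
Qed.
End Classes.
Arguments cw {R S} c _.
Arguments cnd {R S} r m c zeta x y.

(** Reduces the quotient [sfr], when each of the two classes is occupied at a single site, to a
    function of the fraction [l / N] alone. *)
Lemma frac_scale (R : fieldType) (l k N u v : R) : N != 0 -> k != 0 ->
  l * u / (l * u + (N - l) * (k * v) / k) = l / N * u / ((1 - l / N) * v + l / N * u).
Proof.
move=> N0 k0; have -> : (N - l) * (k * v) / k = N * ((1 - l / N) * v) by field; rewrite ?N0 ?k0.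
have -> : l * u = N * (l / N * u) by field.
by rewrite -mulrDr invfM mulrACA mulfV // mul1r [_ + (1 - _) * _]addrC.
Qed.

Lemma arith3 l j k n : (l + j + k = n)%N -> (0 < k)%N ->
  [/\ (l <= n.+1)%N, (l.+1 <= n.+1)%N, (l.+1 + j <= n.+1)%N, (l + j.+1 <= n.+1)%N &
   [/\ (k <= n.+1)%N, n.+1 = (l + j + k + 1)%N, (k + j <= n.+1)%N & (k + j.+1 <= n.+1)%N]].
Proof. by move=> *; split=> //; last split=> //; lia. Qed.

(** * Coordinates of configurations on three and on two sites *)

Section Configs.
Variables (S : finType) (x y z : S).
Hypotheses (xy : x != y) (xz : x != z) (yz : y != z).

Let yx : y == x = false. Proof. by rewrite eq_sym (negbTE xy). Qed.
Let zx : z == x = false. Proof. by rewrite eq_sym (negbTE xz). Qed.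
Let zy : z == y = false. Proof. by rewrite eq_sym (negbTE yz). Qed.

Lemma addp_c3x n j l : (j + l <= n)%N -> addp (c3 x y z n j l) x = c3 x y z n.+1 j l.+1.
Proof.
move=> h; apply: cfg_inj => s; rewrite cfg_addp !cfg_c3 //; last by lia.
by case: eqP => _; [rewrite addn1|rewrite addn0; do 2!case: eqP => // _; lia].
Qed.

Lemma addp_c3y n j l : (j + l <= n)%N -> addp (c3 x y z n j l) y = c3 x y z n.+1 j.+1 l.
Proof.
move=> h; apply: cfg_inj => s; rewrite cfg_addp !cfg_c3 //.
case: (eqVneq s x) => [->|sx]; first by rewrite (negbTE xy) addn0.
by case: eqP => _; [rewrite addn1|rewrite addn0 subSS].
Qed.

Lemma addp_c3z n j l : (j + l <= n)%N -> addp (c3 x y z n j l) z = c3 x y z n.+1 j l.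
Proof.
move=> h; apply: cfg_inj => s; rewrite cfg_addp !cfg_c3 //; last by lia.
case: (eqVneq s x) => [->|sx]; first by rewrite (negbTE xz) addn0.
case: (eqVneq s y) => [->|sy]; first by rewrite (negbTE yz) addn0.
by case: (eqVneq s z) => [_|_]; [rewrite -subnDA addn1 -subSn // subnDA|].
Qed.

Lemma c3C n j l : (j + l <= n)%N -> c3 x y z n j l = c3 z y x n j (n - j - l).
Proof.
move=> h; apply: cfg_inj => s; rewrite (cfg_c3 xy xz yz) // cfg_c3 ?zy ?zx ?yx //; last by lia.
case: (eqVneq s x) => [->|_]; last by case: (eqVneq s z) => [->|_]; rewrite ?zy.
by rewrite (negbTE xz) (negbTE xy); lia.
Qed.

End Configs.

Section Sums.
Variable R : realType.

(** Resummation of the triangle along the lines [j + l = s], which are the lines followed by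
    particles moving between the first two sites while the third is frozen. *)
Lemma sum_diag n (h : nat -> nat -> R) :
  \sum_(j < n.+1) \sum_(l < n.+1 | (j + l <= n)%N) h j l =
  \sum_(s < n.+1) \sum_(j < n.+1 | (j <= s)%N) h j (s - j)%N.
Proof.
rewrite [RHS](exchange_big_dep xpredT) //=; apply: eq_bigr => j _.
have jn : (j <= n)%N by rewrite -ltnS.
rewrite -(big_mkord (fun l => (j + l <= n)%N) (h j)) -(big_mkord (fun s => (j <= s)%N) (fun s => h j (s - j)%N)).
rewrite [RHS](@big_cat_nat _ _ _ j 0 n.+1) //=; last exact: leqW.
rewrite [X in _ = X + _]big_nat_cond [X in _ = X + _]big1 ?add0r => [|s]; last by case/andP; case/andP => *; lia.
rewrite [LHS](@big_cat_nat _ _ _ (n.+1 - j) 0 n.+1) //= ?leq_subr //.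
rewrite [X in _ + X = _]big_nat_cond [X in _ + X = _]big1 ?addr0 => [|s]; last by case/andP; case/andP => *; lia.
rewrite -[RHS]/(\sum_(0 + j <= i < n.+1 | (j <= i)%N) h j (i - j)%N) big_addn [LHS]big_nat_cond [RHS]big_nat_cond; apply: eq_big => s.
  by case: (ltnP s (n.+1 - j)); rewrite ?andbF //= leq_addl; lia.
by rewrite addnK.
Qed.

Lemma geom_tail (a : R) (i M : nat) : 0 <= a -> a < 1 -> \sum_(j < M | (i < j)%N) a ^+ j <= a ^+ i / (1 - a).
Proof.
move=> a0 a1; have a1' : 0 < 1 - a by rewrite subr_gt0.
have pos k : 0 <= a ^+ k by exact: exprn_ge0.
have dec k : a ^+ k.+1 <= a ^+ k by rewrite exprS ler_piMl // ltW.
rewrite ler_pdivlMr //.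
(* The added term, what remains of the geometric series, lets the induction on [M] close. *)
suff : (\sum_(j < M | (i < j)%N) a ^+ j) * (1 - a) + (if (i < M)%N then a ^+ M else a ^+ i) <= a ^+ i.
  by apply: le_trans; rewrite lerDl; case: ifP.
elim: M => [|M IH]; first by rewrite big_ord0 mul0r add0r.
rewrite big_mkcond big_ord_recr -big_mkcond /=; move: IH; set s := \sum_(_ | _) _ => IH.
case: (ltngtP i M) IH => [iM|Mi|<-] IH; rewrite ltnS.
- rewrite (ltnW iM) mulrDl; apply: le_trans IH; rewrite -addrA lerD2l; apply: le_of_eq.
  by rewrite exprS; ring.
- by rewrite leqNgt Mi /= addr0.
- by rewrite leqnn addr0; apply: le_trans IH; rewrite lerD2l dec.
Qed.
End Sums.

Lemma arith_rev l j N : (l <= N)%N -> (j <= N - l)%N ->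
  [/\ (j + (N - l - j) <= N)%N, (N - j - (N - l - j) = l)%N, (N - l == N)%N = (l == 0)%N & (j + l <= N)%N].
Proof. by move=> *; split; lia. Qed.

Section Pairs.
Variables (S : finType) (x z : S).
Hypothesis xz : x != z.

Definition c2 (n l : nat) : Hn S n := mkc x n (fun s => if s == x then l else if s == z then n - l else 0)%N.

Lemma cfg_c2 n l s : (l <= n)%N -> cfg (c2 n l) s = (if s == x then l else if s == z then n - l else 0)%N.
Proof.
move=> ln; rewrite /c2 cfg_mkc // (bigD1 x) //= (bigD1 z) /=; last by rewrite eq_sym.
rewrite !eqxx (eq_sym z x) (negbTE xz).
by rewrite big1 ?addn0 ?subnKC // => i /andP[/negbTE -> /negbTE ->].
Qed.

Lemma c3_c2 y n l : x != y -> y != z -> (l <= n)%N -> c3 x y z n 0 l = c2 n l.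
Proof.
move=> xy yz ln; apply: cfg_inj => s; rewrite cfg_c3 // cfg_c2 //.
by case: eqP => // _; case: (eqVneq s y) => [->|_]; rewrite ?(negbTE yz) // subn0.
Qed.

Lemma c3_c2' y n l : x != y -> y != z -> (l <= n)%N -> c3 y x z n l 0 = c2 n l.
Proof.
move=> xy yz ln; have yx : y != x by rewrite eq_sym.
apply: cfg_inj => s; rewrite (cfg_c3 yx yz xz) ?addn0 //.
rewrite cfg_c2 // subn0; case: (eqVneq s y) => [->|_]; last by [].
by rewrite eq_sym (negbTE xy) (negbTE yz).
Qed.

Lemma c2_max n : c2 n n = xi n x.
Proof. by apply: cfg_inj => s; rewrite cfg_c2 // cfg_xi subnn; case: eqP => // _; case: eqP. Qed.
End Pairs.

Lemma c2C (S : finType) (x z : S) n l : x != z -> (l <= n)%N -> c2 x z n l = c2 z x n (n - l).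
Proof.
move=> xz ln; apply: cfg_inj => s; rewrite !cfg_c2 ?leq_subr // 1?eq_sym // subKn //.
by case: (eqVneq s x) => [->|_]; first rewrite (negbTE xz).
Qed.

Lemma c2_0 (S : finType) (x z : S) n : x != z -> c2 x z n 0 = xi n z.
Proof. by move=> xz; rewrite c2C // subn0 c2_max // eq_sym. Qed.

(** * The Dirichlet form against the test function *)

Section Condensates.
Variables (R : realType) (S : finType) (r : S -> S -> R) (m : S -> R).
Hypothesis r0 : forall x y, 0 <= r x y.
Hypothesis rxx : forall x, r x x = 0.
Hypothesis irr : forall x y, connect [rel a b | 0 < r a b] x y.
Hypothesis m0 : forall x, 0 <= m x.
Hypothesis m1 : \sum_x m x = 1.
Hypothesis rev : forall x y, m x * r x y = m y * r y x.
Local Notation Sstar := (Sstar m).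
Local Notation ms := (mstar m).
Local Notation sst := (#|Sstar|%:R : R).
Local Notation cls := (cls r m).
Local Notation ctx := (ctx R S).
Local Notation valid := (valid m).
Local Notation small := (small r m).
Let ms0 x : 0 < ms x. Proof. exact: (ms_gt0 irr m0 m1 rev). Qed.
Let ms1 x : ms x <= 1. Proof. exact: (ms_le1 irr m0 m1 rev). Qed.
Local Notation cond c z x y := (@cnd R S r m c z x y).
Local Notation En := (En r m).
Local Notation gw c := (gr (cw c)).
Let mm0 : 0 <= mm m. Proof. exact: ltW (mm_gt0 m). Qed.
Let mm1 : mm m < 1. Proof. exact: (mm_lt1 irr m0 m1 rev). Qed.
Let sst1 : 1 <= sst. Proof. exact: sst_ge1. Qed.

Lemma msX_le1 x k : ms x ^+ k <= 1.
Proof. by rewrite exprn_ile1 // ltW. Qed.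

Lemma msX_ge0 x k : 0 <= ms x ^+ k.
Proof. by rewrite exprn_ge0 // ltW. Qed.

Lemma wgt_ge0 (c : ctx) k : valid c -> 0 <= wgt (cd c) k.
Proof. by move=> [d0 _ _ _ _]; exact: ltW (wgt_gt0 d0 k). Qed.

(** Weight normalized by its leading behaviour: [wgt d k] is [d / k * uu k.-1] for positive [k], and
    [uu] lies between 1 and [1 + cq]. *)
Definition uu (c : ctx) (k : nat) : R := (cd c + k%:R) * wgt (cd c) k / cd c.

Lemma uu_bounds (c : ctx) k : valid c -> (k <= (cn c).+1)%N -> 1 <= uu c k <= 1 + cq c.
Proof.
move=> v kn; have d0 : 0 < cd c by case: v.
rewrite /uu ler_pdivlMr // mul1r wgtD_ge //= ler_pdivrMr //.
by apply: le_trans (wgtD_le d0 _) _; rewrite mulrC ler_pM2r // (omg_le2 v).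
Qed.

Lemma wgt_uu (c : ctx) k : valid c -> (0 < k)%N -> wgt (cd c) k = cd c / k%:R * uu c k.-1.
Proof.
move=> v; case: k => // k _; have d0 : 0 < cd c by case: v.
rewrite /uu /=; have := wgtS (cd c) k => <-.
have k0 : k.+1%:R != 0 :> R by rewrite pnatr_eq0.
by field; rewrite ?natr1 ?pnatr_eq0 ?gt_eqF.
Qed.

Lemma zN_bounds (c : ctx) : valid c -> sst / 2 <= zN m c <= 2 * sst.
Proof.
move=> [_ _ _ /andP[q0 q1] [_ _ _ _ [+ _]]]; rewrite ler_norml => /andP[h1 h2].
have s1 : 1 <= sst by exact: sst1.
by apply/andP; split; lra.
Qed.

Lemma condE (c : ctx) zeta x y : valid c -> x != y ->
  cond c zeta x y = cN c ^+ 2 / (cd c * zN m c) * (ms x * r x y) *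
   (uu c (cfg zeta x) * uu c (cfg zeta y)) * (ms x ^+ cfg zeta x * ms y ^+ cfg zeta y) *
   \prod_(s | (s != x) && (s != y)) (wgt (cd c) (cfg zeta s) * ms s ^+ cfg zeta s).
Proof.
move=> v xy; have d0 : 0 < cd c by case: v.
rewrite /cnd /theta_ /Kc /nu (bigD1 x) //= (bigD1 y) 1?eq_sym //=.
set P := \prod_(_ | _) _; rewrite /zN /uu -/(cZ m c).
have Z0 : 0 < cZ m c by have [x0 _] := some_site m0 m1; exact: Zn_gt0.
have N0 : cN c != 0 by rewrite pnatr_eq0.
set a := wgt _ (cfg zeta x); set b := wgt _ (cfg zeta y).
set p := ms x ^+ _; set p' := ms y ^+ _; set i := (cfg zeta x)%:R; set j := (cfg zeta y)%:R.
by field; rewrite ?N0 ?gt_eqF.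
Qed.

Definition rmax : R := \sum_x \sum_y r x y.

Lemma r_le_rmax x y : r x y <= rmax.
Proof.
rewrite /rmax (bigD1 x) //= (bigD1 y) //= -addrA lerDl addr_ge0 ?sumr_ge0 // => u _.
by apply: sumr_ge0.
Qed.

Lemma rmax_ge0 : 0 <= rmax.
Proof. by do 2!apply: sumr_ge0 => ? _. Qed.

(** The 8 is 2 from the inverse of [zN], at least 1/2, times 4 from the two factors [uu], at most 2
    each. *)
Definition K0 : R := 8 * rmax.

Lemma K0_ge0 : 0 <= K0. Proof. by rewrite mulr_ge0 // rmax_ge0. Qed.

Ltac pos := repeat first [ assumption | (apply: ltW; assumption) | exact: ler01 | match goal with H : forall _, is_true (0 <= _) |- _ => exact: H end | exact: K0_ge0 | exact: rmax_ge0 | apply: mulr_ge0 | apply: addr_ge0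
  | apply: exprn_ge0 | apply: sqrtr_ge0 | exact: ler0n | exact: harm_ge0 | rewrite invr_ge0 | (apply: ltW; assumption)
  | (apply: ltW; exact: ms0) ].

Lemma rest_ge0 (c : ctx) (zeta : Hn S (cn c)) (P : pred S) : valid c ->
  0 <= \prod_(s | P s) (wgt (cd c) (cfg zeta s) * ms s ^+ cfg zeta s).
Proof. by move=> v; apply: prodr_ge0 => s _; rewrite mulr_ge0 ?wgt_ge0 ?msX_ge0. Qed.

Lemma ler_pM3 (a b c' a' b' c'' : R) : 0 <= a -> 0 <= b -> 0 <= c' -> a <= a' -> b <= b' -> c' <= c'' ->
  a * b * c' <= a' * b' * c''.
Proof. by move=> a0 b0 c0 h1 h2 h3; apply: ler_pM => //; [exact: mulr_ge0|exact: ler_pM]. Qed.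

Lemma cond_up (c : ctx) zeta x y : valid c -> x != y ->
  cond c zeta x y <= K0 * (cN c ^+ 2 / cd c) * (ms x ^+ cfg zeta x * ms y ^+ cfg zeta y) *
   \prod_(s | (s != x) && (s != y)) (wgt (cd c) (cfg zeta s) * ms s ^+ cfg zeta s).
Proof.
move=> v xy; have d0 : 0 < cd c by case: v.
rewrite condE // ler_wpM2r ?rest_ge0 // ler_wpM2r ?mulr_ge0 ?msX_ge0 //.
have cx := leq_trans (cfg_le zeta x) (leqnSn _); have cy := leq_trans (cfg_le zeta y) (leqnSn _).
have /andP[ux1 ux2] := uu_bounds v cx; have /andP[uy1 uy2] := uu_bounds v cy.
have q2 := q2 v; have /andP[z1 z2] := zN_bounds v.
have s1 : 1 <= sst by exact: sst1.
have z0 : 0 < zN m c by lra.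
have hu : uu c (cfg zeta x) * uu c (cfg zeta y) <= 4.
  have -> : (4 : R) = 2 * 2 by rewrite -natrM.
  by apply: ler_pM; lra.
have hz : cN c ^+ 2 / (cd c * zN m c) <= 2 * (cN c ^+ 2 / cd c).
  have -> : cN c ^+ 2 / (cd c * zN m c) = (zN m c)^-1 * (cN c ^+ 2 / cd c) by field; rewrite ?gt_eqF.
  rewrite ler_wpM2r //; first by pos.
  by rewrite -[X in _ <= X]invrK lef_pV2 ?posrE ?invr_gt0 //; lra.
have hr : ms x * r x y <= rmax.
  by apply: le_trans (r_le_rmax x y); rewrite ler_piMl.
have h0 : 0 <= cN c ^+ 2 / (cd c * zN m c) by pos.
have hu0 : 0 <= uu c (cfg zeta x) * uu c (cfg zeta y) by rewrite mulr_ge0 //; lra.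
apply: le_trans (ler_pM3 h0 _ hu0 hz hr hu) _; first by rewrite mulr_ge0 ?r0 // ltW.
by rewrite /K0; apply: le_of_eq; ring.
Qed.

Lemma prod_le_pow2 (F : S -> R) (P : pred S) : (forall s, 0 <= F s <= 2) ->
  \prod_(s | P s) F s <= 2 ^+ #|S|.
Proof.
move=> h; apply: (@le_trans _ _ (\prod_(s | P s) (2 : R))); first by apply: ler_prod => s _.
by rewrite prodr_const; apply: ler_weXn2l; rewrite ?ler1n // max_card.
Qed.

(** The total number of particles fixes the content of [x], so the other occupation numbers may be
    summed independently; each site without a prescribed weight contributes at most 2. *)
Lemma PW3 (c : ctx) x y z1 z2 (A B1 B2 : nat -> R) : valid c -> uniq [:: x; y; z1; z2] ->
  (forall i, 0 <= A i) -> (forall i, 0 <= B1 i) -> (forall i, 0 <= B2 i) ->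
  \sum_(zeta : Hn S (cn c)) A (cfg zeta y) * B1 (cfg zeta z1) * B2 (cfg zeta z2) *
    \prod_(s | (s != x) && (s != y) && (s != z1) && (s != z2)) (wgt (cd c) (cfg zeta s) * ms s ^+ cfg zeta s)
  <= (\sum_(i < (cn c).+1) A i) * (\sum_(i < (cn c).+1) B1 i) * (\sum_(i < (cn c).+1) B2 i) * 2 ^+ #|S|.
Proof.
move=> v; rewrite /= !inE !negb_or andbT => /and3P[/and3P[xy x1 x2] /andP[y1 y2] z12] A0 B10 B20.
pose a s i := if s == y then A i else if s == z1 then B1 i else if s == z2 then B2 i
              else wgt (cd c) i * ms s ^+ i.
have a0 s i : 0 <= a s i.
  by rewrite /a; case: ifP => // _; case: ifP => // _; case: ifP => // _; rewrite mulr_ge0 ?wgt_ge0 ?msX_ge0.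
have split3 (F : S -> R) : \prod_(s | s != x) F s =
   F y * F z1 * F z2 * \prod_(s | (s != x) && (s != y) && (s != z1) && (s != z2)) F s.
  rewrite (bigD1 y) 1?eq_sym //= (bigD1 z1) /=; last by rewrite eq_sym x1 eq_sym.
  rewrite (bigD1 z2) /=; last by rewrite eq_sym x2 eq_sym y2 eq_sym.
  by rewrite !mulrA.
have := @sum_prod_le R S (cn c) x a a0.
have ay i : a y i = A i by rewrite /a eqxx.
have az1 i : a z1 i = B1 i by rewrite /a eq_sym (negbTE y1) eqxx.
have az2 i : a z2 i = B2 i by rewrite /a eq_sym (negbTE y2) eq_sym (negbTE z12) eqxx.
rewrite [X in _ <= X -> _]split3; under [X in _ <= X * _ * _ * _ -> _]eq_bigr do rewrite ay.
under [X in _ <= _ * X * _ * _ -> _]eq_bigr do rewrite az1.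
under [X in _ <= _ * _ * X * _ -> _]eq_bigr do rewrite az2.
move=> h; apply: (@le_trans _ _ (\sum_(zeta : Hn S (cn c)) \prod_(s | s != x) a s (cfg zeta s))).
  apply: ler_sum => z _; rewrite split3 ay az1 az2.
  apply: le_of_eq; congr (_ * _); apply: eq_bigr => s.
  by rewrite /a; move=> /andP[/andP[/andP[_ /negbTE -> ] /negbTE ->] /negbTE ->].
apply: le_trans h _; rewrite ler_wpM2l ?mulr_ge0 ?sumr_ge0 //.
apply: (@le_trans _ _ (\prod_(s | (s != x) && (s != y) && (s != z1) && (s != z2)) \sum_(i < (cn c).+1) wgt (cd c) i * ms s ^+ i)).
  apply: le_of_eq; apply: eq_bigr => s.
  by move=> /andP[/andP[/andP[_ h1] h2] h3]; apply: eq_bigr => i _; rewrite /a (negbTE h1) (negbTE h2) (negbTE h3).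
apply: prod_le_pow2 => s; apply/andP; split.
  by apply: sumr_ge0 => i _; rewrite mulr_ge0 ?wgt_ge0 ?msX_ge0.
apply: le_trans (sum_wgt v); apply: ler_sum => i _.
by rewrite ler_piMr ?wgt_ge0 ?msX_le1.
Qed.

Lemma rest_split2 (c : ctx) (zeta : Hn S (cn c)) x y z1 z2 : uniq [:: x; y; z1; z2] ->
  \prod_(s | (s != x) && (s != y)) (wgt (cd c) (cfg zeta s) * ms s ^+ cfg zeta s) =
  (wgt (cd c) (cfg zeta z1) * ms z1 ^+ cfg zeta z1) * (wgt (cd c) (cfg zeta z2) * ms z2 ^+ cfg zeta z2) *
  \prod_(s | (s != x) && (s != y) && (s != z1) && (s != z2)) (wgt (cd c) (cfg zeta s) * ms s ^+ cfg zeta s).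
Proof.
rewrite /= !inE !negb_or andbT => /and3P[/and3P[xy x1 x2] /andP[y1 y2] z12].
rewrite (bigD1 z1) /=; last by rewrite eq_sym x1 eq_sym.
rewrite (bigD1 z2) /=; last by rewrite eq_sym x2 eq_sym y2 eq_sym.
by rewrite mulrA.
Qed.

(** Each of the two extra occupied sites contributes [2 * d * h]. Against the conductance
    [N ^ 2 / d] this leaves [d * N ^ 2 * h ^ 2], at most [cq]. *)
Lemma two_others x y z1 z2 : uniq [:: x; y; z1; z2] -> y \notin Sstar ->
  exists K : R, 0 <= K /\ forall c : ctx, valid c ->
   \sum_(zeta : Hn S (cn c) | (0 < cfg zeta z1)%N && (0 < cfg zeta z2)%N) cond c zeta x y <= K * cq c.
Proof.
move=> uq yS; have [G [G0 hG]] := geom_moment 0 mm0 mm1.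
exists (K0 * G * 4 * 2 ^+ #|S|); split; first by pos.
move=> c v; have d0 : 0 < cd c by case: v.
have xy : x != y by move: uq; rewrite /= !inE !negb_or => /andP[/andP[]].
pose B (i : nat) := if (0 < i)%N then wgt (cd c) i else 0.
have B0 i : 0 <= B i by rewrite /B; case: ifP => // _; exact: wgt_ge0.
have K00 : 0 <= K0 * (cN c ^+ 2 / cd c) by rewrite mulr_ge0 ?K0_ge0 ?divr_ge0 ?sqr_ge0 // ltW.
apply: (@le_trans _ _ (K0 * (cN c ^+ 2 / cd c) * \sum_(zeta : Hn S (cn c))
   (mm m ^+ cfg zeta y * B (cfg zeta z1) * B (cfg zeta z2) *
    \prod_(s | (s != x) && (s != y) && (s != z1) && (s != z2)) (wgt (cd c) (cfg zeta s) * ms s ^+ cfg zeta s)))).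
  rewrite mulr_sumr [leLHS]big_mkcond /=; apply: ler_sum => zeta _; case: ifP => [/andP[h1 h2]|_]; last first.
    by do 2!apply: mulr_ge0; rewrite ?rest_ge0 //; pos.
  apply: le_trans (cond_up _ v xy) _; rewrite -mulrA ler_wpM2l //.
  rewrite (rest_split2 _ uq) !mulrA ler_wpM2r ?rest_ge0 // /B h1 h2.
  have e1 : ms x ^+ cfg zeta x * ms y ^+ cfg zeta y <= mm m ^+ cfg zeta y.
    apply: (@le_trans _ _ (ms y ^+ cfg zeta y)); first by rewrite ler_piMl ?msX_ge0 ?msX_le1.
    by rewrite lerXn2r ?nnegrE ?(ltW (ms0 _)) // ms_le_mm.
  have e2 z : wgt (cd c) (cfg zeta z) * ms z ^+ cfg zeta z <= wgt (cd c) (cfg zeta z).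
    by rewrite ler_piMr ?wgt_ge0 ?msX_le1.
  rewrite -!mulrA; rewrite mulrA; apply: ler_pM => //.
  - by rewrite mulr_ge0 ?msX_ge0.
  - by rewrite !mulr_ge0 ?wgt_ge0 ?msX_ge0.
  - by rewrite mulrA; apply: ler_pM => //; rewrite !mulr_ge0 ?wgt_ge0 ?msX_ge0.
apply: (@le_trans _ _ (K0 * (cN c ^+ 2 / cd c) * (G * (2 * cd c * ch c) * (2 * cd c * ch c) * 2 ^+ #|S|))).
  rewrite ler_wpM2l //; apply: le_trans (PW3 v uq _ B0 B0) _ => [i|]; first exact: exprn_ge0.
  rewrite ler_wpM2r ?exprn_ge0 //.
  have hB : \sum_(i < (cn c).+1) B i <= 2 * cd c * ch c.
    by rewrite /B -big_mkcond /=; exact: (sum_wgt_pos v).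
  have hA : \sum_(i < (cn c).+1) mm m ^+ i <= G.
    by have := hG (cn c).+1; under eq_bigr do rewrite expr0 mul1r.
  by apply: ler_pM3 => //; apply: sumr_ge0 => i _; rewrite ?exprn_ge0.
have [_ _ _ _ [_ h _ _ _]] := v.
have -> : K0 * (cN c ^+ 2 / cd c) * (G * (2 * cd c * ch c) * (2 * cd c * ch c) * 2 ^+ #|S|) =
   K0 * G * 4 * 2 ^+ #|S| * (cd c * cN c ^+ 2 * ch c ^+ 2).
  by field; rewrite gt_eqF.
by rewrite ler_wpM2l //; pos.
Qed.

Lemma wgt_le2 (c : ctx) k : valid c -> (k <= (cn c).+1)%N -> wgt (cd c) k <= 2.
Proof.
move=> v; case: k => [_|k kn]; first by rewrite wgt0 ler1n.
have d0 : 0 < cd c by case: v. have d1 : cd c <= 1 by case: v.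
apply: le_trans (wgtS_le d0 _) _; rewrite ler_pdivrMr ?ltr0n //.
have h := omg_le2 v (ltnW kn); have := q2 v => q2.
have o0 := omg_ge1 d0 k.
have k1 : 1 <= k.+1%:R :> R by rewrite ler1n.
nra.
Qed.

(** Every particle then pays a factor at most [mm], and [mm ^ n] beats the polynomial number of
    configurations. *)
Lemma no_star x y : x != y ->
  exists K : R, 0 <= K /\ forall c : ctx, valid c ->
   \sum_(zeta : Hn S (cn c) | [forall s in Sstar, cfg zeta s == 0%N]) cond c zeta x y <= K * cq c.
Proof.
move=> xy; exists (K0 * 2 ^+ #|S|); split; first by rewrite mulr_ge0 ?K0_ge0 ?exprn_ge0.
move=> c v; have d0 : 0 < cd c by case: v.
have K00 : 0 <= K0 * (cN c ^+ 2 / cd c) by rewrite mulr_ge0 ?K0_ge0 ?divr_ge0 ?sqr_ge0 // ltW.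
apply: (@le_trans _ _ (\sum_(zeta : Hn S (cn c)) K0 * (cN c ^+ 2 / cd c) * (mm m ^+ cn c * 2 ^+ #|S|))).
  rewrite [leLHS]big_mkcond; apply: ler_sum => zeta _; case: ifP => [/forall_inP h|_]; last first.
    by rewrite mulr_ge0 // mulr_ge0 ?exprn_ge0.
  apply: le_trans (cond_up _ v xy) _; rewrite -mulrA ler_wpM2l //.
  rewrite big_split /= mulrCA mulrC; apply: ler_pM.
  - by rewrite !mulr_ge0 ?msX_ge0 ?prodr_ge0 // => s _; exact: msX_ge0.
  - by apply: prodr_ge0 => s _; exact: wgt_ge0.
  - rewrite -mulrA.
    have -> : ms x ^+ cfg zeta x * (ms y ^+ cfg zeta y * \prod_(i | (i != x) && (i != y)) ms i ^+ cfg zeta i)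
      = \prod_s ms s ^+ cfg zeta s by rewrite [RHS](bigD1 x) //= [in RHS](bigD1 y) 1?eq_sym.
    rewrite -[X in mm m ^+ X](cfg_sum zeta) expr_sum; apply: ler_prod => s _.
    rewrite msX_ge0 /=; case: (boolP (s \in Sstar)) => [/h/eqP ->|sS]; first by rewrite !expr0.
    by rewrite lerXn2r ?nnegrE ?(ltW (ms0 _)) // ms_le_mm.
  - apply: prod_le_pow2 => s; rewrite wgt_ge0 //= wgt_le2 //.
    exact: leq_trans (cfg_le zeta s) (leqnSn _).
rewrite sumr_const -[X in X <= _]mulr_natr.
have hc : #|Hn S (cn c)|%:R <= cN c ^+ #|S|.
  rewrite -natrX ler_nat; apply: leq_trans (max_card _) _ => /=.
  rewrite card_sig; apply: leq_trans (max_card _) _.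
  by rewrite card_ffun card_ord.
apply: (@le_trans _ _ (K0 * (cN c ^+ 2 / cd c) * (mm m ^+ cn c * 2 ^+ #|S|) * cN c ^+ #|S|)).
  by rewrite ler_wpM2l // mulr_ge0 // mulr_ge0 ?exprn_ge0.
have [_ _ _ _ [_ _ h _ _]] := v.
have -> : K0 * (cN c ^+ 2 / cd c) * (mm m ^+ cn c * 2 ^+ #|S|) * cN c ^+ #|S| =
   K0 * 2 ^+ #|S| * ((cN c ^+ (#|S| + 2) * mm m ^+ cn c) / cd c).
  by rewrite exprD; ring.
by rewrite ler_wpM2l //; [pos|rewrite ler_pdivrMr].
Qed.

(** The factor [(k / N) ^ 2] cancels the [N ^ 2] of the conductance. The free site [y] costs a
    factor [N], and the occupied sites [y'] and [z'] cost [d] and [d * h], so [d * N * h]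
    remains. *)
Lemma star_pair x y y' z' : uniq [:: x; y; y'; z'] -> y' \notin Sstar ->
  exists K : R, 0 <= K /\ forall c : ctx, valid c ->
   \sum_(zeta : Hn S (cn c) | (0 < cfg zeta z')%N) ((cfg zeta y')%:R / cN c) ^+ 2 * cond c zeta x y <= K * cq c.
Proof.
move=> uq yS; have [G [G0 hG]] := geom_moment 1 mm0 mm1.
exists (K0 * G * 4 * 2 ^+ #|S|); split; first by pos.
move=> c v; have d0 : 0 < cd c by case: v.
have xy : x != y by move: uq; rewrite /= !inE !negb_or => /andP[/andP[]].
pose B (i : nat) := if (0 < i)%N then wgt (cd c) i else 0.
have B0 i : 0 <= B i by rewrite /B; case: ifP => // _; exact: wgt_ge0.
pose B1 (i : nat) := i%:R ^+ 2 * (wgt (cd c) i * mm m ^+ i).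
have B10 i : 0 <= B1 i by rewrite /B1 !mulr_ge0 ?wgt_ge0 ?exprn_ge0.
have K00 : 0 <= K0 / cd c by rewrite mulr_ge0 ?K0_ge0 // invr_ge0 ltW.
have N0 : 0 < cN c by rewrite ltr0n.
apply: (@le_trans _ _ (K0 / cd c * \sum_(zeta : Hn S (cn c))
   (1 * B1 (cfg zeta y') * B (cfg zeta z') *
    \prod_(s | (s != x) && (s != y) && (s != y') && (s != z')) (wgt (cd c) (cfg zeta s) * ms s ^+ cfg zeta s)))).
  rewrite mulr_sumr [leLHS]big_mkcond /=; apply: ler_sum => zeta _; case: ifP => [h1|_]; last first.
    by do 2!apply: mulr_ge0; rewrite ?rest_ge0 //; pos.
  apply: (@le_trans _ _ (((cfg zeta y')%:R / cN c) ^+ 2 * (K0 * (cN c ^+ 2 / cd c) * (ms x ^+ cfg zeta x * ms y ^+ cfg zeta y) *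
   \prod_(s | (s != x) && (s != y)) (wgt (cd c) (cfg zeta s) * ms s ^+ cfg zeta s)))).
    by rewrite ler_wpM2l ?sqr_ge0 // cond_up.
  rewrite (rest_split2 _ uq) /B h1 /B1.
  set P := \prod_(_ | _) _; have P0 : 0 <= P by exact: rest_ge0.
  set k := (cfg zeta y')%:R.
  have -> : (k / cN c) ^+ 2 * (K0 * (cN c ^+ 2 / cd c) * (ms x ^+ cfg zeta x * ms y ^+ cfg zeta y) *
   (wgt (cd c) (cfg zeta y') * ms y' ^+ cfg zeta y' * (wgt (cd c) (cfg zeta z') * ms z' ^+ cfg zeta z') * P))
    = K0 / cd c * ((ms x ^+ cfg zeta x * ms y ^+ cfg zeta y) * (k ^+ 2 * (wgt (cd c) (cfg zeta y') * ms y' ^+ cfg zeta y')) *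
       (wgt (cd c) (cfg zeta z') * ms z' ^+ cfg zeta z') * P).
    by field; rewrite !gt_eqF.
  rewrite ler_wpM2l // ler_wpM2r //; apply: ler_pM.
  - by rewrite !mulr_ge0 ?wgt_ge0 ?msX_ge0.
  - by rewrite !mulr_ge0 ?wgt_ge0 ?msX_ge0.
  - apply: ler_pM; rewrite ?mulr_ge0 ?wgt_ge0 ?msX_ge0 //.
      by rewrite mulr_ile1 ?msX_ge0 ?msX_le1.
    rewrite ler_wpM2l ?sqr_ge0 // ler_wpM2l ?wgt_ge0 //.
    by rewrite lerXn2r ?nnegrE ?(ltW (ms0 _)) // ms_le_mm.
  - by rewrite ler_piMr ?wgt_ge0 ?msX_le1.
apply: (@le_trans _ _ (K0 / cd c * (cN c * (2 * cd c * G) * (2 * cd c * ch c) * 2 ^+ #|S|))).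
  rewrite ler_wpM2l //; apply: le_trans (@PW3 c x y y' z' (fun _ => 1) B1 B v uq _ B10 B0) _ => //.
  rewrite ler_wpM2r ?exprn_ge0 //.
  have hB : \sum_(i < (cn c).+1) B i <= 2 * cd c * ch c.
    by rewrite /B -big_mkcond /=; exact: (sum_wgt_pos v).
  have hA : \sum_(i < (cn c).+1) (1 : R) <= cN c by rewrite sumr_const card_ord.
  have hB1 : \sum_(i < (cn c).+1) B1 i <= 2 * cd c * G.
    apply: (@le_trans _ _ (\sum_(i < (cn c).+1) 2 * cd c * (i.+1%:R ^+ 1 * mm m ^+ i))); last first.
      by rewrite -mulr_sumr ler_wpM2l ?hG // mulr_ge0 // ltW.
    apply: ler_sum => -[i hi] _ /=; rewrite /B1 !mulrA ler_wpM2r ?exprn_ge0 //.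
    have [->|i0] := posnP i.
      have e0 : (0%:R : R) ^+ 2 * wgt (cd c) 0 = 0 by rewrite expr2 !mul0r.
      have e1 : 0 <= 2 * cd c * 1%:R ^+ 1.
        by apply: mulr_ge0; [apply: mulr_ge0 => //; exact: ltW|exact: exprn_ge0].
      by apply: le_trans e1; rewrite e0.
    case: i i0 hi => // i _ hi.
    have h2 : wgt (cd c) i.+1 <= cd c * 2 / i.+1%:R.
      apply: le_trans (wgtS_le d0 _) _; rewrite ler_wpM2r ?invr_ge0 // ler_pM2l //.
      have hi' : (i <= (cn c).+1)%N := ltnW (ltnW hi).
      by apply: le_trans (omg_le2 v hi') (q2 v).
    apply: (@le_trans _ _ (i.+1%:R ^+ 2 * (cd c * 2 / i.+1%:R))); first by rewrite ler_wpM2l ?sqr_ge0.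
    have -> : i.+1%:R ^+ 2 * (cd c * 2 / i.+1%:R) = 2 * cd c * i.+1%:R :> R.
      by field; rewrite ?nat1r ?natr1 ?pnatr_eq0.
    by rewrite ler_wpM2l ?mulr_ge0 ?(ltW d0) // expr1 ler_nat.
  by apply: ler_pM3 => //; apply: sumr_ge0 => i _.
have [_ _ _ _ [_ h _ _ _]] := v.
have -> : K0 / cd c * (cN c * (2 * cd c * G) * (2 * cd c * ch c) * 2 ^+ #|S|) =
   K0 * G * 4 * 2 ^+ #|S| * (cd c * cN c * ch c).
  by field; rewrite gt_eqF.
apply: ler_wpM2l; first by pos.
apply: le_trans h.
have N1 : 1 <= cN c by rewrite ler1n.
have h1 : 1 <= ch c by rewrite lerDl harm_ge0.
have e1 : cN c <= cN c ^+ 2 by rewrite expr2 ler_peMl // ltW.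
have e2 : ch c <= ch c ^+ 2 by rewrite expr2 ler_peMl // (le_trans ler01).
have h0 := le_trans ler01 h1.
by apply: ler_pM3 => //; exact: ltW.
Qed.

(** Cauchy-Schwarz in the energy: edges on which the test function has energy of order [cq] may be
    discarded whatever the function [cw] is. *)
Lemma small_of_energy (P : forall c : ctx, pred (Hn S (cn c))) (V : forall n, Hn S n.+1 -> R) x y :
  x != y ->
  (exists K : R, 0 <= K /\ forall c : ctx, valid c ->
     \sum_(zeta | P c zeta) cond c zeta x y * gr (@V (cn c)) zeta x y ^+ 2 <= K * cq c) ->
  small (fun c => \sum_(zeta | P c zeta) cond c zeta x y * (gr (@V (cn c)) zeta x y * gr (cw c) zeta x y)).
Proof.
move=> xy [K [K00 hK]]; exists (Num.sqrt K); split; first exact: sqrtr_ge0.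
move=> c v; under eq_bigr do rewrite mulrA.
have cd0 zeta : 0 <= cond c zeta x y by exact: cond_ge0.
apply: le_trans (weighted_cs (c := fun zeta => cond c zeta x y)
   (Y := fun zeta => cond c zeta x y * gr (@V (cn c)) zeta x y ^+ 2) _ _ _ _) _ => //.
- by move=> z _; rewrite mulr_ge0 ?sqr_ge0.
- by move=> z _; rewrite exprMn expr2 -mulrA.
have [_ _ _ /andP[q0 _] _] := v.
have h1 : Num.sqrt (\sum_(i | P c i) cond c i x y * gr (V (cn c)) i x y ^+ 2) <= Num.sqrt K * Num.sqrt (cq c).
  by rewrite -sqrtrM // ler_sqrt ?hK //; pos.
have h2 : Num.sqrt (\sum_(i | P c i) cond c i x y * gr (cw c) i x y ^+ 2) <= Num.sqrt (En c) + cM c.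
  apply: (@le_trans _ _ (Num.sqrt (En c))); last by rewrite lerDl (cM_ge0 m0 m1 v).
  by rewrite ler_sqrt ?En_ge0 //; apply: edge_En.
by apply: le_trans (ler_pM (sqrtr_ge0 _) (sqrtr_ge0 _) h1 h2) _; rewrite /err mulrA.
Qed.

(** * The test function of a class and its negligible edges *)

Section TestFunction.

Variables (C : cls) (g b : cls -> R -> R) (L : R).
Hypothesis prof : forall D, D != C -> profile_spec C D (g D) (b D) L.

Definition tot (A : {set S}) n (eta : Hn S n) : nat := (\sum_(x in A) cfg eta x)%N.
Definition occp (D : cls) n (eta : Hn S n) : bool := [exists x in val D, (0 < cfg eta x)%N].
(* Probability that a particle at [y] returns to [C] rather than to [D]; [posn] thus sends every particle outside
   [Sstar] to its expected destination. *)
Definition sfr (D : cls) n (eta : Hn S n) (y : S) : R :=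
  let a := \sum_(x in val C) (cfg eta x)%:R * r x y in
  let a' := (n - tot (val C) eta)%:R * (\sum_(z in val D) (cfg eta z)%:R * r z y) / (tot (val D) eta)%:R in
  a / (a + a').
Definition posn (D : cls) n (eta : Hn S n) : R :=
  ((tot (val C) eta)%:R + \sum_(y | y \notin Sstar) (cfg eta y)%:R * sfr D eta y) / n%:R.
Definition act (D : cls) n (eta : Hn S n) : bool :=
  occp D eta && [forall D' : cls, (D' != C) && (D' != D) ==> ~~ occp D' eta].
Definition onlyC n (eta : Hn S n) : bool := [forall D : cls, (D != C) ==> ~~ occp D eta].
(** The value 0 when [C] and at least two other classes are occupied is arbitrary; the edges where
    this choice creates a gradient are controlled by [two_others]. *)
Definition V n (eta : Hn S n) : R :=
  if ~~ occp C eta then 0 else if onlyC eta then 1 else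
  \sum_(D | D != C) (if act D eta then b D (posn D eta) else 0).

Let clsE (D D' : cls) x : x \in val D -> x \in val D' -> D = D'.
Proof. exact: cls_eq. Qed.

Lemma occpP (D : cls) n (eta : Hn S n) : reflect (exists2 x, x \in val D & (0 < cfg eta x)%N) (occp D eta).
Proof. exact: exists_inP. Qed.

Lemma occp_addp D n (zeta : Hn S n) x : occp D (addp zeta x) = occp D zeta || (x \in val D).
Proof.
apply/occpP/orP => [[u uD]|[/occpP[u uD h]|xD]].
- rewrite cfg_addp; case: eqP => [<-|_]; first by right.
  by rewrite addn0 => h; left; apply/occpP; exists u.
- by exists u => //; rewrite cfg_addp ltn_addr.
- by exists x => //; rewrite cfg_addp eqxx addn1.
Qed.

Lemma V_none n (eta : Hn S n) : ~~ occp C eta -> V eta = 0.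
Proof. by rewrite /V => ->. Qed.

Lemma V_only n (eta : Hn S n) : occp C eta -> onlyC eta -> V eta = 1.
Proof. by rewrite /V => -> ->. Qed.

Lemma act_notonly D n (eta : Hn S n) : D != C -> act D eta -> onlyC eta = false.
Proof.
move=> DC /andP[oD _]; apply/negP => /forallP /(_ D); by rewrite DC oD.
Qed.

Lemma V_act D n (eta : Hn S n) : D != C -> occp C eta -> act D eta -> V eta = b D (posn D eta).
Proof.
move=> DC oC aD; rewrite /V oC (act_notonly DC aD) /= (bigD1 D) //= aD big1 ?addr0 // => D' /andP[D'C D'D].
case: ifP => // /andP[oD' _]; case/andP: aD => _ /forallP /(_ D').
by rewrite D'C D'D oD'.
Qed.

Lemma V_noact n (eta : Hn S n) : occp C eta -> ~~ onlyC eta -> (forall D, D != C -> ~~ act D eta) -> V eta = 0.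
Proof.
move=> oC /negbTE nC na; rewrite /V oC nC /= big1 // => D DC; by rewrite (negbTE (na D DC)).
Qed.

Lemma V_congr n (eta eta' : Hn S n) : (forall D, occp D eta = occp D eta') ->
  (forall D, D != C -> occp C eta -> act D eta -> posn D eta = posn D eta') -> V eta = V eta'.
Proof.
move=> oe pe; have oa D : act D eta = act D eta'.
  by rewrite /act oe; congr (_ && _); apply: eq_forallb => D'; rewrite oe.
have oc : onlyC eta = onlyC eta' by apply: eq_forallb => D'; rewrite oe.
case: (boolP (occp C eta)) => oC; last by rewrite !V_none // -oe.
case: (boolP (onlyC eta)) => oo; first by rewrite !V_only // -?oe -?oc.
rewrite /V -oe oC -oc (negbTE oo) /=; apply: eq_bigr => D DC; rewrite -oa.
by case: ifP => // aD; rewrite pe.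
Qed.

Lemma sfr_range D n (eta : Hn S n) y : 0 <= sfr D eta y <= 1.
Proof.
rewrite /sfr; set a := \sum_(_ in val C) _; set a' := (n - _)%:R * _ / _.
have a0 : 0 <= a by apply: sumr_ge0 => x _; rewrite mulr_ge0.
have a'0 : 0 <= a'.
  by rewrite /a' divr_ge0 // mulr_ge0 // sumr_ge0 // => x _; rewrite mulr_ge0.
rewrite divr_ge0 ?addr_ge0 //=; have [->|h] := eqVneq (a + a') 0; first by rewrite invr0 mulr0.
by rewrite ler_pdivrMr ?mul1r ?lerDl // lt_def h addr_ge0.
Qed.

Definition totY n (eta : Hn S n) : nat := (\sum_(y | y \notin Sstar) cfg eta y)%N.

Lemma totC_totY n (eta : Hn S n) : (tot (val C) eta + totY eta <= n)%N.
Proof.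
rewrite -[X in (_ <= X)%N](cfg_sum eta) (bigID (fun x => x \in Sstar)) /=.
rewrite leq_add2r /tot [leqRHS](bigID (fun x => x \in val C)) /=.
rewrite [X in (_ <= X + _)%N](eq_bigl (fun x => x \in val C)) ?leq_addr // => x.
by apply: andb_idl => xC; exact: cls_sub xC.
Qed.

Lemma posn_range D n (eta : Hn S n.+1) :
  (tot (val C) eta)%:R / n.+1%:R <= posn D eta <= ((tot (val C) eta)%:R + (totY eta)%:R) / n.+1%:R.
Proof.
rewrite /posn !ler_pM2r ?invr_gt0 ?ltr0n // lerDl lerD2l; apply/andP; split.
  by apply: sumr_ge0 => y _; rewrite mulr_ge0 //; case/andP: (sfr_range D eta y).
rewrite /totY natr_sum; apply: ler_sum => y _; rewrite ler_piMr //.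
by case/andP: (sfr_range D eta y).
Qed.

Lemma posn01 D n (eta : Hn S n.+1) : 0 <= posn D eta <= 1.
Proof.
have /andP[h1 h2] := posn_range D eta; apply/andP; split.
  by apply: le_trans h1; rewrite divr_ge0.
apply: le_trans h2 _; rewrite ler_pdivrMr ?ltr0n // mul1r -natrD ler_nat; exact: totC_totY.
Qed.

Lemma V_range n (eta : Hn S n.+1) : 0 <= V eta <= 1.
Proof.
case: (boolP (occp C eta)) => oC; last by rewrite V_none // lexx ler01.
case: (boolP (onlyC eta)) => oo; first by rewrite V_only // lexx ler01.
case: (pickP (fun D => (D != C) && act D eta)) => [D /andP[DC aD]|na].
  rewrite (V_act DC oC aD); have [_ _ h _ _] := prof DC.
  by have [] := h _ (posn01 D eta).
by rewrite V_noact ?lexx ?ler01 // => D DC; have := na D; rewrite DC /= => ->.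
Qed.

Lemma gr_V_le1 n (zeta : Hn S n) x y : gr (@V n.+1) zeta x y ^+ 2 <= 1.
Proof.
rewrite /gr; have /andP[a1 a2] := V_range (addp zeta x); have /andP[b1 b2] := V_range (addp zeta y).
by set u := V _ in a1 a2 *; set v := V _ in b1 b2 *; rewrite expr2; nra.
Qed.

Lemma b_lip D (s t : R) : D != C -> 0 <= s <= 1 -> 0 <= t <= 1 -> `|b D s - b D t| <= 2 * L * `|s - t|.
Proof.
move=> DC hs ht; have [L0 _ h1 h2 _] := prof DC.
have [_ hb] := h2 s t hs ht; have [/andP[g0 gL] _] := h1 t ht.
have hst : `|s - t| <= 1 by rewrite ler_norml; apply/andP; split; lra.
have : `|b D s - b D t| <= `|b D s - b D t - g D t * (s - t)| + `|g D t * (s - t)|.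
  by apply: le_trans (ler_normD _ _); rewrite subrK.
rewrite normrM (ger0_norm g0).
have n0 := normr_ge0 (s - t).
rewrite -[(s - t) ^+ 2]real_normK ?num_real // in hb.
have e1 : g D t * `|s - t| <= L * `|s - t| by rewrite ler_wpM2r.
have e2 : L * `|s - t| ^+ 2 <= L * `|s - t| by rewrite ler_wpM2l // expr2 ler_piMl.
move: hb e1 e2; set X := L * `|s - t|; set Y := g D t * _; set Z := L * _ ^+ 2.
by rewrite -mulrA -/X; lra.
Qed.

Lemma V_xi n x : x \in Sstar -> V (xi n.+1 x) = (x \in val C)%:R.
Proof.
move=> xS; have occ_xi D : occp D (xi n.+1 x) = (x \in val D).
  apply/occpP/idP => [[u uD]|xD]; last by exists x; rewrite // cfg_xi eqxx.
  by rewrite cfg_xi; case: eqP => // <-.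
case: (boolP (x \in val C)) => xC; last by rewrite V_none // occ_xi.
rewrite V_only ?occ_xi //; apply/forallP => D; apply/implyP => DC; rewrite occ_xi.
by apply/negP => xD; case/eqP: DC; exact: clsE xD xC.
Qed.

Definition qbound (F : ctx -> R) := exists K : R, 0 <= K /\ forall c, valid c -> F c <= K * cq c.

Lemma qbound_sum (I : finType) (P : pred I) (F : I -> ctx -> R) :
  (forall i, P i -> qbound (F i)) -> qbound (fun c => \sum_(i | P i) F i c).
Proof.
move=> h; elim: (index_enum I) => [|i s [K [K00 IH]]].
  by exists 0; split => // c _; rewrite big_nil mul0r.
case Pi : (P i); last by exists K; split => // c v; rewrite big_cons Pi IH.
have [K' [K'0 h']] := h i Pi; exists (K' + K); split; first exact: addr_ge0.
by move=> c v; rewrite big_cons Pi mulrDl; apply: lerD; [exact: h'|exact: IH].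
Qed.

Lemma qbound_le F G : (forall c, valid c -> F c <= G c) -> qbound G -> qbound F.
Proof.
by move=> h [K [K00 hK]]; exists K; split => // c v; apply: le_trans (h c v) (hK c v).
Qed.

Lemma qbound_add F G : qbound F -> qbound G -> qbound (fun c => F c + G c).
Proof.
move=> [K [K00 h]] [K' [K'0 h']]; exists (K + K'); split; first exact: addr_ge0.
by move=> c v; rewrite mulrDl; apply: lerD; [exact: h|exact: h'].
Qed.

Lemma qbound_mul F (k : R) : 0 <= k -> qbound F -> qbound (fun c => k * F c).
Proof.
move=> k0 [K [K00 h]]; exists (k * K); split; first exact: mulr_ge0.
by move=> c v; rewrite -mulrA ler_wpM2l // h.
Qed.

(** The edges that carry the current: the particles that stay occupy only [x], [y] and one site [z]
    of [Sstar], and the exclusive or asks that exactly one of [x] and [z] belong to [C]. *)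
Definition mainp x y z n (zeta : Hn S n) : bool :=
  [&& z \in Sstar, (x \in val C) (+) (z \in val C), supp3 x y z zeta & (0 < cfg zeta z)%N].

Definition twoocc x y n (zeta : Hn S n) : bool :=
  [exists z1, exists z2, [&& uniq [:: x; y; z1; z2], (0 < cfg zeta z1)%N & (0 < cfg zeta z2)%N]].

Lemma twooccP x y n (zeta : Hn S n) : x != y -> ~~ twoocc x y zeta ->
  exists z, forall s, s != x -> s != y -> s != z -> cfg zeta s = 0%N.
Proof.
move=> xy h; case: (pickP (fun s => [&& s != x, s != y & (0 < cfg zeta s)%N])) => [z /and3P[zx zy hz]|h0].
  exists z => s sx sy sz; apply/eqP; rewrite -leqn0 leqNgt; apply/negP => hs.
  case/negP: h; apply/existsP; exists z; apply/existsP; exists s.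
  by rewrite hz hs /= !inE !negb_or xy !(eq_sym x) zx sx !(eq_sym y) zy sy eq_sym sz.
exists x => s sx sy _; have := h0 s; rewrite sx sy /= => /negbT; by rewrite lt0n negbK => /eqP.
Qed.

(** A gradient across such an edge needs mass both in [C] and in another class. With at most one
    occupied site besides [x] and [y], that forces the situation of [mainp]. *)
Lemma nonmain_SY x y n (zeta : Hn S n) : x \in Sstar -> y \notin Sstar ->
  ~~ [exists z, mainp x y z zeta] -> ~~ twoocc x y zeta ->
  ~~ [forall s in Sstar, cfg zeta s == 0%N] -> V (addp zeta x) = V (addp zeta y).
Proof.
move=> xS yS nm nt ns; have xy : x != y by apply: contraNneq yS => <-.
have [z hz] := twooccP xy nt; have [X xX] := cls_ex r xS.
have yD (D : cls) : (y \in val D) = false by apply/negP => /cls_sub; rewrite (negbTE yS).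
have oy D : occp D (addp zeta y) = occp D zeta by rewrite occp_addp yD orbF.
have ox D : occp D (addp zeta x) = occp D zeta || (D == X).
  by rewrite occp_addp; congr (_ || _); apply/idP/eqP => [xD|->//]; exact: clsE xD xX.
(* If all particles of [zeta] on [Sstar] lie in the class of [x], the jump changes neither the
   occupied classes nor any value of [posn] that enters [V]. *)
have case1 : (forall s, s \in Sstar -> (0 < cfg zeta s)%N -> s \in val X) -> V (addp zeta x) = V (addp zeta y).
  move=> h; have [s sS s0] : exists2 s, s \in Sstar & (0 < cfg zeta s)%N.
    by move/forall_inPn: ns => [s sS]; rewrite -lt0n; exists s.
  have oX D : occp D zeta = (D == X).
    apply/occpP/eqP => [[u uD u0]|->]; last by exists s => //; exact: h.
    by apply: clsE uD (h u (cls_sub uD) u0).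
  apply: V_congr => D; first by rewrite ox oy oX orbb.
  move=> DC; rewrite ox oX orbb => /eqP CX /andP[]; rewrite ox oX orbb => /eqP DX.
  by case/eqP: DC; rewrite DX.
have [zS|zS] := boolP (z \in Sstar); last first.
  apply: case1 => s sS s0; case: (eqVneq s x) => [->//|sx].
  have sy : s != y by apply: contraNneq yS => <-.
  have sz : s != z by apply: contraNneq zS => <-.
  by rewrite hz in s0.
have [zx|zx] := eqVneq z x.
  apply: case1 => s sS s0; case: (eqVneq s x) => [->//|sx].
  have sy : s != y by apply: contraNneq yS => <-.
  by rewrite hz // ?zx in s0.
have [z0|z0] := posnP (cfg zeta z).
  apply: case1 => s sS s0; case: (eqVneq s x) => [->//|sx].
  have sy : s != y by apply: contraNneq yS => <-.
  by case: (eqVneq s z) => [sz|sz]; rewrite ?sz ?z0 // hz in s0.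
have [zX|zX] := boolP (z \in val X).
  apply: case1 => s sS s0; case: (eqVneq s x) => [->//|sx].
  have sy : s != y by apply: contraNneq yS => <-.
  by case: (eqVneq s z) => [->//|sz]; rewrite hz in s0.
have sp : supp3 x y z zeta.
  by apply/forallP => s; apply/implyP => /andP[/andP[sx sy] sz]; rewrite hz.
have : ~~ mainp x y z zeta by apply: contra nm => h; apply/existsP; exists z.
rewrite /mainp zS sp z0 andbT /= => hx.
have zC : z \in val C = false.
  apply/negP => zC; move: hx; rewrite zC addbT andbT negbK => xC.
  by case/negP: zX; rewrite (clsE xX xC).
have xC : x \in val C = false by move: hx; rewrite zC addbF andbT => /negbTE.
have nC : occp C zeta = false.
  apply/negbTE/negP => /occpP[u uC u0].
  have ux : u != x by apply: contraTneq uC => ->; rewrite xC.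
  have uz : u != z by apply: contraTneq uC => ->; rewrite zC.
  have uy : u != y by apply: contraTneq uC => ->; rewrite yD.
  by rewrite hz in u0.
by rewrite !V_none // occp_addp nC ?xC ?yD.
Qed.

(** Besides [x] and [y] only one site is occupied, hence at most one class, and [V] then depends
    only on which class it is. *)
Lemma nonmain_YY x y n (zeta : Hn S n) : x != y -> x \notin Sstar -> y \notin Sstar ->
  ~~ twoocc x y zeta -> V (addp zeta x) = V (addp zeta y).
Proof.
move=> xy xS yS nt; have [z hz] := twooccP xy nt.
have nD u (D : cls) : u \notin Sstar -> (u \in val D) = false by move=> uS; apply/negP => /cls_sub; rewrite (negbTE uS).
apply: V_congr => D; first by rewrite !occp_addp !nD.
move=> DC; rewrite occp_addp nD // orbF => /occpP[u uC u0] /andP[]; rewrite occp_addp nD // orbF.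
move=> /occpP[v vD v0] _.
have nn s (D' : cls) : s \in val D' -> (s != x) && (s != y).
  by move=> /cls_sub sS; apply/andP; split; apply: contraTneq sS => ->.
have uz : u = z.
  by apply/eqP; apply: contraLR u0 => uz; have /andP[ux uy] := nn u C uC; rewrite hz.
have vz : v = z.
  by apply/eqP; apply: contraLR v0 => vz; have /andP[vx vy] := nn v D vD; rewrite hz.
by case/eqP: DC; apply: clsE vD _; rewrite vz -uz.
Qed.

(** A jump inside a class changes neither the occupied classes nor the content of [C]. Only the
    return probabilities move, so [posn] changes by at most the fraction of particles outside
    [Sstar]. *)
Lemma nonmain_SS (X : cls) x y n (zeta : Hn S n) : x \in val X -> y \in val X -> x != y ->
  gr (@V n.+1) zeta x y ^+ 2 <=
  (4 * L ^+ 2 * #|S|%:R) * \sum_(y' | y' \notin Sstar) \sum_(z' | uniq [:: x; y; y'; z'])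
     (0 < cfg zeta z')%N%:R * ((cfg zeta y')%:R / n.+1%:R) ^+ 2.
Proof.
move=> xX yX xy.
have RHS0 : 0 <= (4 * L ^+ 2 * #|S|%:R) * \sum_(y' | y' \notin Sstar) \sum_(z' | uniq [:: x; y; y'; z'])
     (0 < cfg zeta z')%N%:R * ((cfg zeta y')%:R / n.+1%:R) ^+ 2.
  apply: mulr_ge0; first by do 2!(apply: mulr_ge0 => //); exact: sqr_ge0.
  by do 2!apply: sumr_ge0 => ? _; rewrite mulr_ge0 ?sqr_ge0.
have oe (D : cls) : occp D (addp zeta x) = occp D (addp zeta y).
  rewrite !occp_addp; congr (_ || _); apply/idP/idP => h.
    by rewrite (clsE h xX).
  by rewrite (clsE h yX).
have same (D : cls) : (x \in val D) = (y \in val D).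
  by apply/idP/idP => h; rewrite ?(clsE h xX) ?(clsE h yX).
case: (boolP (occp C (addp zeta x))) => oC; last first.
  by rewrite /gr !V_none -?oe // subrr expr0n.
case: (pickP (fun D => (D != C) && act D (addp zeta x))) => [D /andP[DC aD]|na]; last first.
  rewrite /gr (V_congr oe) ?subrr ?expr0n // => D DC _ aD.
  by have := na D; rewrite DC aD.
have aD' : act D (addp zeta y).
  by move: aD; rewrite /act oe => /andP[-> /forallP h]; apply/forallP => D'; rewrite -oe.
have oC' : occp C (addp zeta y) by rewrite -oe.
rewrite /gr (V_act DC oC aD) (V_act DC oC' aD').
have totE : tot (val C) (addp zeta x) = tot (val C) (addp zeta y).
  rewrite /tot; under eq_bigr do rewrite cfg_addp; under [RHS]eq_bigr do rewrite cfg_addp.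
  rewrite !big_split /=; congr (_ + _)%N.
  have aux u : (\sum_(i in val C) (i == u) = (u \in val C))%N.
    case: (boolP (u \in val C)) => uC; last first.
      by rewrite big1 // => i iC; case: eqP => // e; rewrite -e iC in uC.
    by rewrite (bigD1 u) //= eqxx big1 // => i /andP[_ /negbTE ->].
  by rewrite !aux same.
have totYE u : u \in Sstar -> totY (addp zeta u) = totY zeta.
  move=> uS; apply: eq_bigr => i iS; rewrite cfg_addp.
  case: eqP => [e|_]; last by rewrite addn0.
  by rewrite e uS in iS.
have /andP[p1 p2] := posn_range D (addp zeta x).
have /andP[p1' p2'] := posn_range D (addp zeta y).
rewrite totYE ?(cls_sub xX) // in p2; rewrite totYE ?(cls_sub yX) // -totE in p2'; rewrite -totE in p1'.
have hd : `|posn D (addp zeta x) - posn D (addp zeta y)| <= (totY zeta)%:R / n.+1%:R.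
  have e : ((tot (val C) (addp zeta x))%:R + (totY zeta)%:R) / n.+1%:R =
    (tot (val C) (addp zeta x))%:R / n.+1%:R + (totY zeta)%:R / n.+1%:R :> R by rewrite mulrDl.
  move: p1 p2 p1' p2'; rewrite e; set A := _ / _; set B := _ / _; set u := posn _ _; set v := posn _ _.
  by move=> h1 h2 h3 h4; rewrite ler_norml; apply/andP; split; lra.
have hb := b_lip DC (posn01 D (addp zeta x)) (posn01 D (addp zeta y)).
have [L0 _ _ _ _] := prof DC.
have h1 : (b D (posn D (addp zeta x)) - b D (posn D (addp zeta y))) ^+ 2 <= (2 * L * ((totY zeta)%:R / n.+1%:R)) ^+ 2.
  rewrite -[leLHS]real_normK ?num_real // lerXn2r ?nnegrE ?normr_ge0 //.
    by rewrite !mulr_ge0 // invr_ge0.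
  by apply: le_trans hb _; rewrite ler_wpM2l // mulr_ge0.
apply: le_trans h1 _.
(* Both [C] and [D] are occupied while [x] and [y] share a class, so one of the two provides an
   occupied site [z'] away from the edge. *)
have [z' z'S z'0] : exists2 z', [&& z' != x, z' != y & z' \in Sstar] & (0 < cfg zeta z')%N.
  have [Y [YX oY]] : exists Y : cls, Y != X /\ occp Y (addp zeta x).
    case: (eqVneq C X) => [CX|CX]; last by exists C.
    by exists D; rewrite -CX; split => //; case/andP: aD.
  move: oY; rewrite occp_addp => /orP[/occpP[u uY u0]|xY]; last first.
    by case/eqP: YX; exact: clsE xY xX.
  exists u => //; rewrite (cls_sub uY) andbT; apply/andP; split; apply: contraNneq YX => e.
    by rewrite (clsE uY (_ : u \in val X)) // e.
  by rewrite (clsE uY (_ : u \in val X)) // e.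
case/and3P: z'S => z'x z'y z'S.
have -> : (2 * L * ((totY zeta)%:R / n.+1%:R)) ^+ 2 = 4 * L ^+ 2 * (\sum_(y' | y' \notin Sstar) (cfg zeta y')%:R / n.+1%:R) ^+ 2.
  by rewrite -mulr_suml -natr_sum -/(totY zeta); ring.
rewrite -[leRHS]mulrA; apply: ler_wpM2l; first by apply: mulr_ge0 => //; exact: sqr_ge0.
have := @cauchy_schwarz R S (fun y' => y' \notin Sstar) (fun _ => 1 : R) (fun y' => (cfg zeta y')%:R / n.+1%:R).
under eq_bigr do rewrite mul1r.
move=> h; apply: le_trans h _; apply: ler_pM.
- by apply: sumr_ge0 => i _; exact: sqr_ge0.
- by apply: sumr_ge0 => i _; exact: sqr_ge0.
- under eq_bigr do rewrite expr1n.
  by rewrite sumr_const ler_nat max_card.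
apply: ler_sum => y' y'S; rewrite (bigD1 z') /=; last first.
  have y'S' u : u \in Sstar -> u != y' by apply: contraTneq => ->.
  rewrite !inE !negb_or xy !(eq_sym x) !(eq_sym y) z'x z'y.
  by rewrite (eq_sym y') !(eq_sym y') ?y'S' ?(cls_sub xX) ?(cls_sub yX) // eq_sym y'S' // eq_sym y'S' // (cls_sub yX).
by rewrite z'0 mul1r lerDl sumr_ge0 // => u _; rewrite mulr_ge0 ?sqr_ge0.
Qed.

Local Notation gV c := (gr (@V (cn c).+1)).

Lemma cond0 (c : ctx) zeta x y : r x y = 0 -> cond c zeta x y = 0.
Proof. by move=> e; rewrite /cnd /Kc e mulr0 !mul0r mulr0. Qed.

Lemma T_SS x y : x \in Sstar -> y \in Sstar -> x != y ->
  small (fun c => \sum_zeta cond c zeta x y * (gV c zeta x y * gr (cw c) zeta x y)).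
Proof.
move=> xS yS xy; have [rxy|rxy] := eqVneq (r x y) 0.
  apply: small_eq (@small0 R S r m) => c _; rewrite big1 // => zeta _.
  by rewrite cond0 // mul0r.
have [X xX] := cls_ex r xS.
have rp : 0 < r x y by rewrite lt_def rxy r0.
have yX : y \in val X by exact: cls_r xX yS rp.
apply: (small_of_energy (V := fun n => @V n.+1) (P := fun c _ => true)) => //.
suff : qbound (fun c => \sum_(zeta : Hn S (cn c)) (4 * L ^+ 2 * #|S|%:R) * \sum_(y' | y' \notin Sstar) \sum_(z' | uniq [:: x; y; y'; z'])
     (0 < cfg zeta z')%N%:R * ((cfg zeta y')%:R / (cn c).+1%:R) ^+ 2 * cond c zeta x y).
  apply: qbound_le => c v; apply: ler_sum => zeta _; rewrite mulrC.
  have h := nonmain_SS zeta xX yX xy; apply: le_trans (ler_wpM2r (cond_ge0 r0 irr m0 m1 rev zeta x y v) h) _.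
  rewrite -[X in X <= _]mulrA; apply: le_of_eq; congr (_ * _).
  by rewrite mulr_suml; apply: eq_bigr => y' _; rewrite mulr_suml.
have : qbound (fun c => (4 * L ^+ 2 * #|S|%:R) * \sum_(y' | y' \notin Sstar) \sum_(z' | uniq [:: x; y; y'; z'])
   \sum_(zeta : Hn S (cn c)) (0 < cfg zeta z')%N%:R * ((cfg zeta y')%:R / (cn c).+1%:R) ^+ 2 * cond c zeta x y).
  apply: qbound_mul; first by do 2!(apply: mulr_ge0 => //); exact: sqr_ge0.
  apply: qbound_sum => y' y'S; apply: qbound_sum => z' uq.
  apply: qbound_le (star_pair uq y'S) => c v.
  rewrite [leRHS]big_mkcond /=; apply: ler_sum => zeta _; case: ifP => h; rewrite ?mul1r ?mul0r //.
apply: qbound_le => c v; rewrite -mulr_sumr.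
apply: le_of_eq; congr (_ * _).
rewrite exchange_big /=; apply: eq_bigr => y' _; by rewrite exchange_big.
Qed.

Lemma twoocc_bound x y : x != y -> y \notin Sstar ->
  qbound (fun c => \sum_(zeta : Hn S (cn c) | twoocc x y zeta) cond c zeta x y).
Proof.
move=> xy yS.
have : qbound (fun c => \sum_(p : S * S | uniq [:: x; y; p.1; p.2])
  \sum_(zeta : Hn S (cn c) | (0 < cfg zeta p.1)%N && (0 < cfg zeta p.2)%N) cond c zeta x y).
  by apply: qbound_sum => -[z1 z2] uq; exact: two_others.
apply: qbound_le => c v; have c0 zeta := cond_ge0 r0 irr m0 m1 rev zeta x y v.
under [leRHS]eq_bigr do rewrite big_mkcond /=.
rewrite exchange_big /= big_mkcond /=; apply: ler_sum => zeta _; case: ifP => [|_]; last first.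
  by apply: sumr_ge0 => p _; case: ifP.
move=> /existsP[z1 /existsP[z2 /and3P[uq h1 h2]]].
rewrite (bigD1 (z1, z2)) //= h1 h2 lerDl; apply: sumr_ge0 => p _; by case: ifP.
Qed.

Lemma cond_gV_le (c : ctx) zeta x y : valid c -> cond c zeta x y * gV c zeta x y ^+ 2 <= cond c zeta x y.
Proof.
by move=> v; rewrite ler_piMr ?gr_V_le1 //; exact: cond_ge0.
Qed.

Lemma T_YY x y : x \notin Sstar -> y \notin Sstar -> x != y ->
  small (fun c => \sum_zeta cond c zeta x y * (gV c zeta x y * gr (cw c) zeta x y)).
Proof.
move=> xS yS xy; apply: (small_of_energy (V := fun n => @V n.+1) (P := fun c _ => true)) => //.
apply: qbound_le (twoocc_bound xy yS) => c v.
rewrite [leRHS]big_mkcond /=; apply: ler_sum => zeta _; case: ifP => [_|/negbT nt].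
  exact: cond_gV_le.
by rewrite /gr (nonmain_YY xy xS yS nt) subrr expr0n mulr0.
Qed.

Lemma T_SY x y : x \in Sstar -> y \notin Sstar ->
  small (fun c => \sum_(zeta | ~~ [exists z, mainp x y z zeta])
     cond c zeta x y * (gV c zeta x y * gr (cw c) zeta x y)).
Proof.
move=> xS yS; have xy : x != y by apply: contraNneq yS => <-.
apply: (small_of_energy (V := fun n => @V n.+1) (P := fun c zeta => ~~ [exists z, mainp x y z zeta])) => //.
apply: qbound_le (qbound_add (twoocc_bound xy yS) (no_star xy)) => c v.
have c0 zeta := cond_ge0 r0 irr m0 m1 rev zeta x y v.
rewrite [X in _ <= X + _]big_mkcond [X in _ <= _ + X]big_mkcond /= -big_split [leLHS]big_mkcond /=.
apply: ler_sum => zeta _; case: ifP => nm; last first.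
  by apply: addr_ge0; case: ifP.
case: ifP => [_|/negbT nt].
  by apply: ler_wpDr; [case: ifP|exact: cond_gV_le].
case: ifP => [_|/negbT ns]; first by rewrite add0r cond_gV_le.
by rewrite /gr (nonmain_SY xS yS nm nt ns) subrr expr0n mulr0 addr0.
Qed.

Lemma main_unique x y z z' n (zeta : Hn S n) : y \notin Sstar ->
  mainp x y z zeta -> mainp x y z' zeta -> z = z'.
Proof.
move=> yS /and4P[zS xz _ z0] /and4P[_ _ /forallP sp _]; apply/eqP; apply: contraTT z0 => zz.
have zx : z != x by apply: contraTneq xz => ->; rewrite addbb.
have zy : z != y by apply: contraTneq zS => ->.
by have := sp z; rewrite zx zy zz /= => /eqP ->.
Qed.

Lemma reduce_main :
  small (fun c => theta_ c * Dir r ms (cd c) (@V (cn c).+1) (cw c) -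
    \sum_(x in Sstar) \sum_(y | y \notin Sstar) \sum_z \sum_(zeta | mainp x y z zeta)
      cond c zeta x y * (gV c zeta x y * gr (cw c) zeta x y)).
Proof.
pose T x y c := \sum_zeta cond c zeta x y * (gV c zeta x y * gr (cw c) zeta x y).
have Tsym x y c : T x y c = T y x c.
  apply: eq_bigr => zeta _; rewrite (cond_sym rev); congr (_ * _).
  by rewrite /gr -mulrNN !opprB.
have TE c : theta_ c * Dir r ms (cd c) (@V (cn c).+1) (cw c) = 2^-1 * \sum_x \sum_y T x y c.
  rewrite /Dir mulrCA; congr (_ * _); rewrite mulr_sumr.
  under eq_bigr do rewrite mulr_sumr.
  rewrite exchange_big /=; apply: eq_bigr => x _.
  under eq_bigr do rewrite mulr_sumr.
  by rewrite exchange_big /=; apply: eq_bigr => y _; apply: eq_bigr => zeta _; rewrite /cnd /gr -mulrA.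
have T0 x c : T x x c = 0.
  by rewrite /T big1 // => zeta _; rewrite cond0 ?rxx // mul0r.
have sSS : small (fun c => \sum_(x in Sstar) \sum_(y in Sstar) T x y c).
  apply: small_sum => x xS; apply: small_sum => y yS; have [->|xy] := eqVneq x y.
    by apply: small_eq (@small0 R S r m) => c _; rewrite T0.
  exact: T_SS.
have sYY : small (fun c => \sum_(x | x \notin Sstar) \sum_(y | y \notin Sstar) T x y c).
  apply: small_sum => x xS; apply: small_sum => y yS; have [->|xy] := eqVneq x y.
    by apply: small_eq (@small0 R S r m) => c _; rewrite T0.
  exact: T_YY.
have sSY : small (fun c => \sum_(x in Sstar) \sum_(y | y \notin Sstar) (T x y c - \sum_z \sum_(zeta | mainp x y z zeta)
      cond c zeta x y * (gV c zeta x y * gr (cw c) zeta x y))).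
  apply: small_sum => x xS; apply: small_sum => y yS.
  apply: small_eq (T_SY xS yS) => c _; rewrite /T.
  rewrite [X in _ = X - _](bigID (fun zeta => [exists z, mainp x y z zeta])) /=.
  rewrite -[LHS]add0r addrAC; congr (_ + _); apply/esym/eqP; rewrite subr_eq0; apply/eqP.
  under [RHS]eq_bigr do rewrite big_mkcond.
  rewrite exchange_big /= big_mkcond /=; apply: eq_bigr => zeta _; case: ifP => [/existsP[z hz]|h].
    rewrite (bigD1 z) //= hz big1 ?addr0 // => z' zz; case: ifP => // hz'.
    by rewrite (main_unique yS hz' hz) eqxx in zz.
  rewrite big1 // => z _; case: ifP => // hz.
  by move/negbT/existsP: h => []; exists z.
have := small_add (small_add (small_mul 2^-1 sSS) (small_mul 2^-1 sYY)) sSY.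
apply: small_eq => c _; rewrite TE.
under [X in _ + _ + X]eq_bigr do rewrite sumrB.
rewrite sumrB addrA; congr (_ - _).
rewrite [in RHS](bigID (fun x => x \in Sstar)) /=.
under [X in _ = _ * (X + _)]eq_bigr do rewrite (bigID (fun y => y \in Sstar)) /=.
under [X in _ = _ * (_ + X)]eq_bigr do rewrite (bigID (fun y => y \in Sstar)) /=.
rewrite !big_split /=.
(* The two orientations of the mixed edges contribute equally and cancel the factor 1/2 of the
   form. *)
have -> : \sum_(x | x \notin Sstar) \sum_(y in Sstar) T x y c = \sum_(x in Sstar) \sum_(y | y \notin Sstar) T x y c.
  by rewrite exchange_big /=; apply: eq_bigr => x _; apply: eq_bigr => y _; exact: Tsym.
by lra.
Qed.
End TestFunction.

(** * Flows on the edges that carry the current *)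

Lemma cN_gt0 (c : ctx) : 0 < cN c. Proof. by rewrite ltr0n. Qed.
Lemma cN_ge1 (c : ctx) : 1 <= cN c. Proof. by rewrite ler1n. Qed.

Lemma inN_le (c : ctx) : valid c -> (cN c)^-1 <= cq c.
Proof.
move=> [_ _ _ _ [_ _ _ h _]]; have h1 : 1 <= ch c by rewrite lerDl harm_ge0.
rewrite -div1r ler_pdivrMr ?cN_gt0 //; apply: le_trans h; rewrite expr2; nra.
Qed.

Lemma dN2_le (c : ctx) : valid c -> cd c * cN c ^+ 2 <= cq c.
Proof.
move=> v; have [d0 _ _ _ [_ h _ _ _]] := v; apply: le_trans h.
have h1 : 1 <= ch c by rewrite lerDl harm_ge0.
by rewrite ler_peMr ?exprn_ege1 // mulr_ge0 ?sqr_ge0 // ltW.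
Qed.

Lemma supp3C x y z n (zeta : Hn S n) : supp3 x y z zeta = supp3 z y x zeta.
Proof.
apply: eq_forallb => s; congr (_ ==> _).
by case: (s != x); case: (s != y); case: (s != z).
Qed.

Lemma sum3_bound u y v (c : ctx) (f : nat -> R) : u != y -> u != v -> y != v -> (forall j, 0 <= f j) ->
  \sum_(zeta : Hn S (cn c) | supp3 u y v zeta) f (cfg zeta y) * ((cN c)^-1 + (cfg zeta u == 0%N)%:R)
  <= 2 * \sum_(j < (cn c).+1) f j.
Proof.
move=> uy uv yv f0; rewrite sum_supp3 // mulr_sumr; apply: ler_sum => j _.
have h (l : 'I_(cn c).+1) : (j + l <= cn c)%N ->
  f (cfg (c3 u y v (cn c) j l) y) * ((cN c)^-1 + (cfg (c3 u y v (cn c) j l) u == 0%N)%:R)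
  = f j * ((cN c)^-1 + (l == 0%N :> nat)%:R).
  by move=> hl; rewrite !cfg_c3 // !eqxx (eq_sym y u) (negbTE uy).
rewrite (eq_bigr _ h) -mulr_sumr mulrC ler_wpM2r //.
apply: (@le_trans _ _ (\sum_(l < (cn c).+1) ((cN c)^-1 + (l == 0%N :> nat)%:R))).
  by rewrite [leLHS]big_mkcond; apply: ler_sum => l _; case: ifP => // _; rewrite addr_ge0 ?invr_ge0.
rewrite big_split /= sumr_const card_ord -[X in X + _]mulr_natr mulVf ?gt_eqF ?cN_gt0 //.
rewrite -[2]/(1 + 1) lerD2l (bigD1 ord0) //= big1 ?addr0 // => l; rewrite -val_eqE /= => /negbTE -> //.
Qed.

Lemma sum3_bound' u y v (c : ctx) (f : nat -> R) : u != y -> u != v -> y != v -> (forall j, 0 <= f j) ->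
  \sum_(zeta : Hn S (cn c) | supp3 u y v zeta) f (cfg zeta y) * ((cN c)^-1 + (cfg zeta v == 0%N)%:R)
  <= 2 * \sum_(j < (cn c).+1) f j.
Proof.
move=> uy uv yv f0; under eq_bigl do rewrite supp3C.
by apply: sum3_bound => //; rewrite eq_sym.
Qed.

Lemma cond3 (c : ctx) (zeta : Hn S (cn c)) u y v : valid c -> u != y -> u != v -> y != v ->
  u \in Sstar -> v \in Sstar -> supp3 u y v zeta ->
  cond c zeta u y = cN c ^+ 2 / (cd c * zN m c) * r u y * (uu c (cfg zeta u) * uu c (cfg zeta y)) *
    ms y ^+ cfg zeta y * wgt (cd c) (cfg zeta v).
Proof.
move=> va uy uv yv uS vS sp; rewrite condE // (ms_star irr m0 m1 rev uS) expr1n !mul1r -!mulrA.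
do 5!congr (_ * _); rewrite (bigD1 v) /=; last by rewrite !(eq_sym v) uv.
rewrite (ms_star irr m0 m1 rev vS) expr1n mulr1 big1 ?mulr1 // => s h.
have := forallP sp s; rewrite h /= => /eqP ->; by rewrite wgt0 expr0 mulr1.
Qed.

Let uub (c : ctx) (zeta : Hn S (cn c)) s : valid c -> 1 <= uu c (cfg zeta s) <= 1 + cq c.
Proof. by move=> v; apply: uu_bounds => //; exact: leq_trans (cfg_le zeta s) (leqnSn _). Qed.

Let zNb (c : ctx) : valid c -> sst / 2 <= zN m c <= 2 * sst.
Proof. exact: zN_bounds. Qed.

Let zN0 (c : ctx) : valid c -> 0 < zN m c.
Proof. by move=> /zNb/andP[h _]; have s1 := sst1; lra. Qed.

(** Upper bound for the resistance of an edge, up to constants and the factor [ms y ^ j]. When [v]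
    is empty its weight is 1 instead of about [d / k], which lowers the resistance from [1 / N] to
    [d / N ^ 2]. *)
Definition lowc (c : ctx) (zeta : Hn S (cn c)) (v : S) : R :=
  if cfg zeta v == 0%N then cd c / cN c ^+ 2 else (cN c)^-1.

Lemma lowc_ge0 (c : ctx) zeta v : valid c -> 0 <= lowc (c:=c) zeta v.
Proof.
move=> [d0 _ _ _ _]; rewrite /lowc; case: ifP => _; rewrite ?invr_ge0 //.
by rewrite divr_ge0 ?sqr_ge0 // ltW.
Qed.

Lemma cond_low (c : ctx) (zeta : Hn S (cn c)) u y v : valid c -> u != y -> u != v -> y != v ->
  u \in Sstar -> v \in Sstar -> supp3 u y v zeta ->
  r u y * ms y ^+ cfg zeta y <= 2 * sst * (lowc zeta v * cond c zeta u y).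
Proof.
move=> va uy uv yv uS vS sp; rewrite (cond3 va uy uv yv uS vS sp).
have d0 : 0 < cd c by case: va. have N0 := cN_gt0 c.
have z0 := zN0 va. have /andP[_ zu] := zNb va.
have /andP[u1 _] := uub zeta u va; have /andP[u2 _] := uub zeta y va.
have p0 : 0 <= r u y * ms y ^+ cfg zeta y by rewrite mulr_ge0 ?exprn_ge0 // ltW.
have U1 : 1 <= uu c (cfg zeta u) * uu c (cfg zeta y) by rewrite mulr_ege1.
have key (W : R) : 1 <= W -> r u y * ms y ^+ cfg zeta y <=
   2 * sst / zN m c * (W * (r u y * ms y ^+ cfg zeta y)).
  move=> W1; rewrite mulrA ler_peMl // mulr_ege1 //.
  by rewrite ler_pdivlMr // mul1r.
rewrite /lowc; case: eqP => [k0|/eqP k0].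
  rewrite k0 wgt0; apply: le_trans (key _ U1) _; apply: le_of_eq.
  by field; rewrite ?gt_eqF.
have kp : (0 < cfg zeta v)%N by rewrite lt0n.
rewrite (wgt_uu va kp).
have /andP[u3 _] : 1 <= uu c (cfg zeta v).-1 <= 1 + cq c.
  by apply: uu_bounds => //; apply: leq_trans (leq_pred _) (leq_trans (cfg_le zeta v) (leqnSn _)).
have W1 : 1 <= uu c (cfg zeta u) * uu c (cfg zeta y) * uu c (cfg zeta v).-1 * (cN c / (cfg zeta v)%:R).
  rewrite mulr_ege1 //; first by rewrite mulr_ege1.
  rewrite ler_pdivlMr ?ltr0n // mul1r ler_nat; exact: leq_trans (cfg_le zeta v) (leqnSn _).
apply: le_trans (key _ W1) _; apply: le_of_eq.
by field; rewrite ?pnatr_eq0 ?k0 ?gt_eqF.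
Qed.

(** [X] is read as a flow paired with the gradient of [cw]; by Cauchy-Schwarz the pairing is small
    as soon as the energy of the flow, squared flow times resistance, is of order [cq]. *)
Lemma edge_small0 u y v (X : forall c : ctx, Hn S (cn c) -> R) :
  u != y -> u != v -> y != v -> u \in Sstar -> v \in Sstar -> 0 < r u y ->
  (exists K : R, 0 <= K /\ forall c : ctx, valid c ->
    \sum_(zeta | supp3 u y v zeta) X c zeta ^+ 2 / ms y ^+ cfg zeta y * lowc zeta v <= K * cq c) ->
  small (fun c => \sum_(zeta | supp3 u y v zeta) X c zeta * gw c zeta u y).
Proof.
move=> uy uv yv uS vS ruy [K [K00 hK]].
have a0 : 0 <= 2 * sst / r u y by rewrite divr_ge0 ?mulr_ge0 // ltW.
exists (Num.sqrt (2 * sst / r u y * K)); split; first exact: sqrtr_ge0.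
move=> c va; have cd0 zeta : 0 <= cond c zeta u y by exact: cond_ge0.
pose Y zeta := 2 * sst / r u y * (X c zeta ^+ 2 / ms y ^+ cfg zeta y * lowc zeta v).
have Y0 zeta : 0 <= Y zeta.
  by apply: mulr_ge0 => //; rewrite mulr_ge0 ?lowc_ge0 // divr_ge0 ?sqr_ge0 ?exprn_ge0 // ltW.
apply: le_trans (weighted_cs (c := fun zeta => cond c zeta u y) (Y := Y) _ _ _ _) _ => //.
  move=> zeta sp; have h := cond_low va uy uv yv uS vS sp.
  have mp : 0 < ms y ^+ cfg zeta y by rewrite exprn_gt0.
  rewrite /Y; set p := ms y ^+ _ in h mp *; set co := cond _ _ _ _ in h *; set lo := lowc _ _ in h *.
  have -> : co * (2 * sst / r u y * (X c zeta ^+ 2 / p * lo)) = X c zeta ^+ 2 * ((2 * sst * (lo * co)) / (r u y * p)).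
    by field; rewrite ?gt_eqF.
  by rewrite ler_peMr ?sqr_ge0 // ler_pdivlMr ?mul1r // mulr_gt0.
have [_ _ _ /andP[q0 _] _] := va.
have h1 : Num.sqrt (\sum_(i | supp3 u y v i) Y i) <= Num.sqrt (2 * sst / r u y * K) * Num.sqrt (cq c).
  rewrite -sqrtrM; last exact: mulr_ge0.
  rewrite ler_sqrt; last by apply: mulr_ge0; [apply: mulr_ge0|exact: ltW].
  by rewrite /Y -mulr_sumr -[leRHS]mulrA; apply: ler_wpM2l => //; exact: hK.
have h2 : Num.sqrt (\sum_(i | supp3 u y v i) cond c i u y * gw c i u y ^+ 2) <= Num.sqrt (En c) + cM c.
  apply: (@le_trans _ _ (Num.sqrt (En c))); last by rewrite lerDl (cM_ge0 m0 m1 va).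
  by rewrite ler_sqrt ?En_ge0 //; apply: edge_En.
by apply: le_trans (ler_pM (sqrtr_ge0 _) (sqrtr_ge0 _) h1 h2) _; rewrite /err mulrA.
Qed.

(** Where [v] is occupied a factor [cq] in the flow suffices; where [v] is empty the resistance
    [d / N ^ 2] makes even a flow of order 1 harmless. *)
Lemma edge_small_geo u y v (X : forall c : ctx, Hn S (cn c) -> R) (K : R) :
  u != y -> u != v -> u \in Sstar -> v \in Sstar -> y \notin Sstar -> 0 < r u y -> 0 <= K ->
  (forall c zeta, valid c -> supp3 u y v zeta ->
     `|X c zeta| <= K * ms y ^+ cfg zeta y * (if cfg zeta v == 0%N then 1 else cq c)) ->
  small (fun c => \sum_(zeta | supp3 u y v zeta) X c zeta * gw c zeta u y).
Proof.
move=> uy uv uS vS yS ruy K00 hX; have yv : y != v by apply: contraNneq yS => ->.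
apply: edge_small0 => //; have [G [G0 hG]] := geom_moment 0 mm0 mm1.
exists (K ^+ 2 * (2 * G)); split; first by do 2?apply: mulr_ge0 => //; exact: sqr_ge0.
move=> c va; have [d0 d1 _ /andP[q0 q1] _] := va; have N1 := cN_ge1 c; have N0 := cN_gt0 c.
apply: (@le_trans _ _ (\sum_(zeta : Hn S (cn c) | supp3 u y v zeta)
    (K ^+ 2 * cq c * mm m ^+ cfg zeta y) * ((cN c)^-1 + (cfg zeta v == 0%N)%:R))).
  apply: ler_sum => zeta sp; have := hX c zeta va sp.
  have pp : 0 < ms y ^+ cfg zeta y by rewrite exprn_gt0.
  have pm : ms y ^+ cfg zeta y <= mm m ^+ cfg zeta y by rewrite lerXn2r ?nnegrE ?(ltW (ms0 _)) // ms_le_mm.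
  rewrite /lowc; set p := ms y ^+ _ in pp pm *.
  have sq (B : R) : `|X c zeta| <= K * p * B -> X c zeta ^+ 2 / p <= K ^+ 2 * p * B ^+ 2.
    move=> h; rewrite ler_pdivrMr //.
    have -> : K ^+ 2 * p * B ^+ 2 * p = (K * p * B) ^+ 2 by ring.
    rewrite -[leLHS]real_normK ?num_real // lerXn2r ?nnegrE //; exact: le_trans h.
  have K2 := sqr_ge0 K.
  case: eqP => _ /sq h.
    apply: (@le_trans _ _ (K ^+ 2 * p * 1 ^+ 2 * (cd c / cN c ^+ 2))).
      by rewrite ler_wpM2r // divr_ge0 ?sqr_ge0 // ltW.
    apply: (@le_trans _ _ (K ^+ 2 * cq c * mm m ^+ cfg zeta y * 1)); last first.
      by rewrite ler_wpM2l ?lerDr ?invr_ge0 //; do 2?apply: mulr_ge0 => //; [exact: ltW|exact: exprn_ge0].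
    apply: (@le_trans _ _ (K ^+ 2 * (mm m ^+ cfg zeta y * cq c))); last first.
      by apply: le_of_eq; ring.
    rewrite expr1n mulr1 -mulrA ler_wpM2l //; apply: ler_pM => //.
    - exact: ltW.
    - by rewrite divr_ge0 ?sqr_ge0 // ltW.
    - apply: le_trans (dN2_le va); rewrite ler_pM2l //.
      apply: (@le_trans _ _ 1); last by rewrite exprn_ege1.
      by rewrite invf_le1 ?exprn_gt0 // exprn_ege1.
  apply: (@le_trans _ _ (K ^+ 2 * p * cq c ^+ 2 * (cN c)^-1)).
    by rewrite ler_wpM2r // invr_ge0.
  have -> : K ^+ 2 * cq c * mm m ^+ cfg zeta y = K ^+ 2 * (mm m ^+ cfg zeta y * cq c) by ring.
  rewrite addr0 ler_wpM2r ?invr_ge0 // -mulrA ler_wpM2l //; apply: ler_pM => //; first exact: ltW.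
    exact: sqr_ge0.
  by rewrite expr2 ler_piMl ?(ltW q0) //; lra.
apply: le_trans (@sum3_bound' u y v c (fun j => K ^+ 2 * cq c * mm m ^+ j) uy uv yv _) _.
  by move=> j; do 2?apply: mulr_ge0; rewrite ?sqr_ge0 ?exprn_ge0 // ltW.
rewrite -mulr_sumr.
have hA : \sum_(i < (cn c).+1) mm m ^+ i <= G.
  by have := hG (cn c).+1; under eq_bigr do rewrite expr0 mul1r.
have -> : K ^+ 2 * (2 * G) * cq c = 2 * (K ^+ 2 * cq c * G) by ring.
by rewrite ler_wpM2l // ler_wpM2l // mulr_ge0 ?sqr_ge0 // ltW.
Qed.

(** Here [y] may lie in [Sstar], so [ms y ^ j] need not decay. A flow of order [1 / N] spread over
    about [N ^ 2] edges of resistance [1 / N] has energy [1 / N]. *)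
Lemma edge_small_flat u y v (X : forall c : ctx, Hn S (cn c) -> R) (K : R) :
  u != y -> u != v -> y != v -> u \in Sstar -> v \in Sstar -> 0 < r u y -> 0 <= K ->
  (forall c zeta, valid c -> supp3 u y v zeta ->
     `|X c zeta| <= K * ms y ^+ cfg zeta y * ((cN c)^-1 + (cfg zeta v == 0%N)%:R)) ->
  small (fun c => \sum_(zeta | supp3 u y v zeta) X c zeta * gw c zeta u y).
Proof.
move=> uy uv yv uS vS ruy K00 hX; apply: edge_small0 => //.
exists (K ^+ 2 * 4 * 2); split; first by do 2?apply: mulr_ge0 => //; exact: sqr_ge0.
move=> c va; have [d0 d1 _ /andP[q0 q1] _] := va; have N1 := cN_ge1 c; have N0 := cN_gt0 c.
have iN0 : 0 <= (cN c)^-1 by rewrite invr_ge0.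
have iN1 : (cN c)^-1 <= 1 by rewrite invf_le1.
apply: (@le_trans _ _ (\sum_(zeta : Hn S (cn c) | supp3 u y v zeta)
    (K ^+ 2 * 4 / cN c ^+ 2) * ((cN c)^-1 + (cfg zeta v == 0%N)%:R))).
  apply: ler_sum => zeta sp; have := hX c zeta va sp.
  have pp : 0 < ms y ^+ cfg zeta y by rewrite exprn_gt0.
  have pm : ms y ^+ cfg zeta y <= 1 by rewrite exprn_ile1 // ltW.
  rewrite /lowc; set p := ms y ^+ _ in pp pm *.
  have sq (B : R) : `|X c zeta| <= K * p * B -> X c zeta ^+ 2 / p <= K ^+ 2 * B ^+ 2.
    move=> h; rewrite ler_pdivrMr //.
    apply: (@le_trans _ _ ((K * p * B) ^+ 2)).
      by rewrite -[leLHS]real_normK ?num_real // lerXn2r ?nnegrE //; exact: le_trans h.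
    have -> : (K * p * B) ^+ 2 = K ^+ 2 * B ^+ 2 * p * p by ring.
    have e0 : 0 <= K ^+ 2 * B ^+ 2 by rewrite mulr_ge0 ?sqr_ge0.
    by apply: ler_piMr => //; apply: mulr_ge0 => //; exact: ltW.
  have K2 := sqr_ge0 K; have iN2 : cN c ^- 2 = (cN c)^-1 ^+ 2 by rewrite exprVn.
  case: eqP => _ /sq h.
    apply: (@le_trans _ _ (K ^+ 2 * 4 * cN c ^- 2 * 1)); last first.
      by rewrite ler_wpM2l ?lerDr //; do 2?apply: mulr_ge0 => //; rewrite iN2 sqr_ge0.
    apply: (@le_trans _ _ (K ^+ 2 * ((cN c)^-1 + 1) ^+ 2 * (1 / cN c ^+ 2))).
      apply: ler_pM => //.
      - by rewrite divr_ge0 ?sqr_ge0 // ltW.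
      - by rewrite divr_ge0 ?sqr_ge0 // ltW.
      - by rewrite ler_wpM2r // iN2 sqr_ge0.
    rewrite mulr1 mul1r ler_wpM2r ?iN2 ?sqr_ge0 // ler_wpM2l //.
    have : (cN c)^-1 * (cN c)^-1 <= (cN c)^-1 by rewrite ler_piMr.
    by rewrite expr2; set i := _^-1 in iN1 *; lra.
  apply: (@le_trans _ _ (K ^+ 2 * ((cN c)^-1 + 0) ^+ 2 * (cN c)^-1)).
    by rewrite ler_wpM2r.
  rewrite !addr0 ler_wpM2r // -mulrA ler_wpM2l // iN2.
  by rewrite ler_peMl ?sqr_ge0 // ler1n.
apply: le_trans (@sum3_bound' u y v c (fun j => K ^+ 2 * 4 / cN c ^+ 2) uy uv yv _) _.
  by move=> j; rewrite divr_ge0 ?sqr_ge0 // mulr_ge0 ?sqr_ge0.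
rewrite sumr_const card_ord -[X in 2 * X]mulr_natr -/(cN c).
have -> : 2 * (K ^+ 2 * 4 / cN c ^+ 2 * cN c) = K ^+ 2 * 4 * 2 * (cN c)^-1 by field; rewrite gt_eqF.
by rewrite ler_wpM2l ?inN_le // !mulr_ge0 ?sqr_ge0.
Qed.

(* [G * ms y ^ j / #|Sstar|] is the flow of the test function through the edge. *)
Lemma main_edge u y v (V : forall n, Hn S n.+1 -> R) (G : forall c : ctx, Hn S (cn c) -> R) (K : R) :
  u != y -> u != v -> u \in Sstar -> v \in Sstar -> y \notin Sstar -> 0 < r u y -> 0 <= K ->
  (forall c zeta, valid c -> `|G c zeta| <= K) ->
  (forall c (zeta : Hn S (cn c)), valid c -> supp3 u y v zeta -> (0 < cfg zeta v)%N ->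
     `|gr (@V (cn c)) zeta u y - G c zeta * (cfg zeta v)%:R / (cN c ^+ 2 * r u y)|
       <= K * (cfg zeta y).+1%:R ^+ 2 * ((cN c) ^- 2 + (cfg zeta u == 0%N)%:R / cN c)) ->
  small (fun c => \sum_(zeta | supp3 u y v zeta && (0 < cfg zeta v)%N)
           cond c zeta u y * (gr (@V (cn c)) zeta u y * gw c zeta u y)
       - sst^-1 * \sum_(zeta | supp3 u y v zeta && (0 < cfg zeta v)%N)
           ms y ^+ cfg zeta y * G c zeta * gw c zeta u y).
Proof.
move=> uy uv uS vS yS ruy K00 hG hV; have yv : y != v by apply: contraNneq yS => ->.
(* Leading part of the gradient. Since the conductance is proportional to [1 / k] with [k] the
   content of [v], the product is a flow that no longer depends on [k]. *)
pose T (c : ctx) (zeta : Hn S (cn c)) := G c zeta * (cfg zeta v)%:R / (cN c ^+ 2 * r u y).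
pose Q (c : ctx) (zeta : Hn S (cn c)) := supp3 u y v zeta && (0 < cfg zeta v)%N.
have s1 : small (fun c => \sum_(zeta | Q c zeta) cond c zeta u y * (gr (@V (cn c)) zeta u y - T c zeta) * gw c zeta u y).
  (* The fifth moment: four powers of [j + 1] come from the squared gradient error, one from the
     bound on [1 / k] when [u] is empty. *)
  have [Gm [G0 hGm]] := geom_moment 5 mm0 mm1.
  pose KK := 2 * K0 * K ^+ 2 * 4 * (2 * Gm).
  have KK0 : 0 <= KK.
    apply: mulr_ge0; last by apply: mulr_ge0.
    by do 2!(apply: mulr_ge0 => //); rewrite ?sqr_ge0 // mulr_ge0 // K0_ge0.
  exists (Num.sqrt KK); split; first exact: sqrtr_ge0.
  move=> c va; have [d0 d1 _ /andP[q0 q1] _] := va; have N1 := cN_ge1 c; have N0 := cN_gt0 c.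
  have cd0 zeta : 0 <= cond c zeta u y by exact: cond_ge0.
  apply: le_trans (weighted_cs (c := fun zeta => cond c zeta u y)
    (Y := fun zeta => cond c zeta u y * (gr (@V (cn c)) zeta u y - T c zeta) ^+ 2) _ _ _ _) _ => //.
  - by move=> zeta _; rewrite mulr_ge0 ?sqr_ge0.
  - by move=> zeta _; rewrite exprMn expr2 -mulrA.
  have h2 : Num.sqrt (\sum_(i | Q c i) cond c i u y * gw c i u y ^+ 2) <= Num.sqrt (En c) + cM c.
    apply: (@le_trans _ _ (Num.sqrt (En c))); last by rewrite lerDl (cM_ge0 m0 m1 va).
    by rewrite ler_sqrt ?En_ge0 //; apply: edge_En.
  suff h1 : \sum_(zeta | Q c zeta) cond c zeta u y * (gr (@V (cn c)) zeta u y - T c zeta) ^+ 2 <= KK * cq c.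
    have h1' : Num.sqrt (\sum_(zeta | Q c zeta) cond c zeta u y * (gr (@V (cn c)) zeta u y - T c zeta) ^+ 2)
       <= Num.sqrt KK * Num.sqrt (cq c) by rewrite -sqrtrM // ler_sqrt // mulr_ge0 // ltW.
    by apply: le_trans (ler_pM (sqrtr_ge0 _) (sqrtr_ge0 _) h1' h2) _; rewrite /err mulrA.
  pose f (j : nat) := 2 * K0 * K ^+ 2 * 4 / cN c * (j.+1%:R ^+ 5 * mm m ^+ j).
  have f0 j : 0 <= f j.
    rewrite /f; apply: mulr_ge0; last by rewrite mulr_ge0 ?exprn_ge0.
    by rewrite divr_ge0 // !mulr_ge0 ?sqr_ge0 // rmax_ge0.
  apply: (@le_trans _ _ (\sum_(zeta : Hn S (cn c) | supp3 u y v zeta) f (cfg zeta y) * ((cN c)^-1 + (cfg zeta u == 0%N)%:R))).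
    rewrite [leLHS]big_mkcond [leRHS]big_mkcond; apply: ler_sum => zeta _.
    have hR : 0 <= f (cfg zeta y) * ((cN c)^-1 + (cfg zeta u == 0%N)%:R).
      by rewrite mulr_ge0 // addr_ge0 ?invr_ge0.
    rewrite /Q; case: (boolP (supp3 u y v zeta)) => //= sp; case: ifP => // kp.
    have hv := hV c zeta va sp kp; rewrite -/(T c zeta) in hv.
    have hc : cond c zeta u y <= K0 * cN c ^+ 2 * ms y ^+ cfg zeta y * (2 / (cfg zeta v)%:R).
      apply: le_trans (cond_up zeta va uy) _.
      have -> : \prod_(s | (s != u) && (s != y)) (wgt (cd c) (cfg zeta s) * ms s ^+ cfg zeta s) = wgt (cd c) (cfg zeta v).
        rewrite (bigD1 v) /=; last by rewrite !(eq_sym v) uv.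
        rewrite (ms_star irr m0 m1 rev vS) expr1n mulr1 big1 ?mulr1 // => s h.
        by have := forallP sp s; rewrite h /= => /eqP ->; rewrite wgt0 expr0 mulr1.
      rewrite (ms_star irr m0 m1 rev uS) expr1n mul1r (wgt_uu va kp).
      have /andP[u3 u4] : 1 <= uu c (cfg zeta v).-1 <= 1 + cq c.
        by apply: uu_bounds => //; apply: leq_trans (leq_pred _) (leq_trans (cfg_le zeta v) (leqnSn _)).
      have kp' : 0 < (cfg zeta v)%:R :> R by rewrite ltr0n.
      have -> : K0 * (cN c ^+ 2 / cd c) * ms y ^+ cfg zeta y * (cd c / (cfg zeta v)%:R * uu c (cfg zeta v).-1)
        = K0 * cN c ^+ 2 * ms y ^+ cfg zeta y * (uu c (cfg zeta v).-1 / (cfg zeta v)%:R).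
        by field; rewrite !gt_eqF.
      rewrite ler_wpM2l //; last by rewrite ler_pM2r ?invr_gt0 //; lra.
      rewrite mulr_ge0 ?exprn_ge0 ?(ltW (ms0 _)) // mulr_ge0 ?sqr_ge0 // K0_ge0 //.
    have pm : ms y ^+ cfg zeta y <= mm m ^+ cfg zeta y by rewrite lerXn2r ?nnegrE ?(ltW (ms0 _)) // ms_le_mm.
    (* When [u] is empty, [N = j + k + 1] is at most [(j + 2) * k], so [1 / k] is at most
       [(j + 2) / N]. *)
    have hk : ((cN c)^-1 + (cfg zeta u == 0%N)%:R) / (cfg zeta v)%:R <=
        (cN c)^-1 + (cfg zeta u == 0%N)%:R * ((cfg zeta y).+2%:R / cN c).
      rewrite mulrDl; apply: lerD; first by rewrite ler_piMr ?invr_ge0 // invf_le1 ?ltr0n // ler1n.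
      case: eqP => [a0|_]; last by rewrite !mul0r.
      rewrite !mul1r ler_pdivlMr // mulrC ler_pdivrMr ?ltr0n // -natrM ler_nat.
      have := supp3_sum uy uv yv sp; rewrite a0; move: kp; set J := cfg zeta y; set k := cfg zeta v.
      by clearbody J k; clear; move: J k => J k; nia.
    set j := cfg zeta y in hv hc pm hk *; set k := (cfg zeta v)%:R in hv hc hk *.
    set e := (cfg zeta u == 0%N)%:R in hv hk *.
    have e01 : e = 0 \/ e = 1 by rewrite /e; case: eqP => _; [right|left].
    have k1 : 1 <= k by rewrite ler1n.
    have iN0 : 0 < (cN c)^-1 by rewrite invr_gt0.
    have iN1 : (cN c)^-1 <= 1 by rewrite invf_le1.
    have B0 : 0 <= cN c ^- 2 + e / cN c.
      by rewrite addr_ge0 ?invr_ge0 ?sqr_ge0 // mulr_ge0 ?(ltW iN0) //; case: e01 => ->.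
    have h3 : (gr (@V (cn c)) zeta u y - T c zeta) ^+ 2 <= (K * j.+1%:R ^+ 2 * (cN c ^- 2 + e / cN c)) ^+ 2.
      rewrite -[leLHS]real_normK ?num_real // lerXn2r ?nnegrE //.
      by rewrite mulr_ge0 // mulr_ge0 ?sqr_ge0.
    apply: le_trans (ler_pM (cd0 _) (sqr_ge0 _) hc h3) _.
    have KK1 : 0 <= K0 * ms y ^+ j by rewrite mulr_ge0 ?K0_ge0 // exprn_ge0 // ltW.
    have -> : K0 * cN c ^+ 2 * ms y ^+ j * (2 / k) * (K * j.+1%:R ^+ 2 * (cN c ^- 2 + e / cN c)) ^+ 2
      = 2 * K0 * K ^+ 2 * (ms y ^+ j * (j.+1%:R ^+ 4 * (((cN c)^-1 + e) ^+ 2 / k))).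
      by field; rewrite !gt_eqF // (lt_le_trans ltr01).
    have -> : f j * ((cN c)^-1 + e) = 2 * K0 * K ^+ 2 * (4 / cN c * (j.+1%:R ^+ 5 * mm m ^+ j) * ((cN c)^-1 + e)).
      by rewrite /f; ring.
    apply: ler_wpM2l; first by do 2!(apply: mulr_ge0; rewrite ?sqr_ge0 ?K0_ge0 //).
    have hj : 1 <= j.+1%:R :> R by rewrite ler1n.
    have eb : ((cN c)^-1 + e) ^+ 2 / k <= (4 / cN c * j.+1%:R) * ((cN c)^-1 + e).
      rewrite expr2 -mulrA mulrC ler_wpM2r ?addr_ge0 ?(ltW iN0) //.
      apply: le_trans hk _; have hj2 : j.+2%:R = j.+1%:R + 1 :> R by rewrite natr1.
      have t1 : (cN c)^-1 <= (cN c)^-1 * j.+1%:R by rewrite ler_peMr // ltW.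
      have -> : 4 / cN c * j.+1%:R = 4 * ((cN c)^-1 * j.+1%:R) by rewrite mulrA.
      rewrite hj2 mulrDl mul1r [j.+1%:R / _]mulrC; set t := (cN c)^-1 * _ in t1 *; set i := _^-1 in t1 iN0 *.
      by case: e01 => ->; lra.
    have -> : 4 / cN c * (j.+1%:R ^+ 5 * mm m ^+ j) * ((cN c)^-1 + e) =
       mm m ^+ j * (j.+1%:R ^+ 4 * (4 / cN c * j.+1%:R * ((cN c)^-1 + e))) by ring.
    have j4 : 0 <= j.+1%:R ^+ 4 :> R by rewrite exprn_ge0.
    have b0 : 0 <= ((cN c)^-1 + e) ^+ 2 / k by rewrite mulr_ge0 ?sqr_ge0 ?invr_ge0.
    apply: ler_pM => //; first by rewrite exprn_ge0 // ltW.
      by rewrite mulr_ge0.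
    by rewrite ler_wpM2l.
  apply: le_trans (sum3_bound c uy uv yv f0) _; rewrite /f -mulr_sumr.
  have h := hGm (cn c).+1.
  have -> : KK * cq c = 2 * (2 * K0 * K ^+ 2 * 4 * cq c * Gm) by rewrite /KK; ring.
  rewrite ler_wpM2l //; apply: ler_pM => //.
  - by rewrite divr_ge0 // !mulr_ge0 ?sqr_ge0 // rmax_ge0.
  - by apply: sumr_ge0 => i _; rewrite mulr_ge0 ?exprn_ge0.
  - by rewrite ler_wpM2l ?inN_le // !mulr_ge0 ?sqr_ge0 // rmax_ge0.
(* What remains is the relative error of the conductance: three factors [uu] and the replacement of
   [zN] by its limit. *)
pose X (c : ctx) (zeta : Hn S (cn c)) : R := if (0 < cfg zeta v)%N then
   (uu c (cfg zeta u) * uu c (cfg zeta y) * uu c (cfg zeta v).-1 / zN m c - sst^-1) * ms y ^+ cfg zeta y * G c zeta else 0.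
have s2 : small (fun c => \sum_(zeta | supp3 u y v zeta) X c zeta * gw c zeta u y).
  apply: (@edge_small_geo u y v X (12 * K)) => //; first exact: mulr_ge0.
  move=> c zeta va sp; have [d0 d1 _ /andP[q0 q1] [_ _ _ _ [zb _]]] := va.
  have pp : 0 <= ms y ^+ cfg zeta y by rewrite exprn_ge0 // ltW.
  rewrite /X lt0n; case: eqP => _ /=.
    by rewrite normr0 mulr1 mulr_ge0 // mulr_ge0.
  rewrite !normrM (ger0_norm pp).
  suff hU : `|uu c (cfg zeta u) * uu c (cfg zeta y) * uu c (cfg zeta v).-1 / zN m c - sst^-1| <= 12 * cq c.
    have -> : 12 * K * ms y ^+ cfg zeta y * cq c = 12 * cq c * ms y ^+ cfg zeta y * K by ring.
    by apply: ler_pM; rewrite ?mulr_ge0 ?hG // ler_wpM2r.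
  have u1 := uub zeta u va; have u2 := uub zeta y va.
  have u3 : 1 <= uu c (cfg zeta v).-1 <= 1 + cq c.
    by apply: uu_bounds => //; apply: leq_trans (leq_pred _) (leq_trans (cfg_le zeta v) (leqnSn _)).
  set a := uu c _ in u1 *; set b := uu c (cfg zeta y) in u2 *; set e := uu c _ in u3 *.
  have z0 := zN0 va; have /andP[zl _] := zNb va; have ss1 := sst1.
  have ab : 1 <= a * b <= 1 + 5 / 2 * cq c.
    move: u1 u2 => /andP[a1 a2] /andP[b1 b2]; rewrite mulr_ege1 //=.
    apply: (@le_trans _ _ ((1 + cq c) * (1 + cq c))); last by nra.
    by apply: ler_pM => //; apply: le_trans ler01 _.
  have abe : 1 <= a * b * e <= 1 + 5 * cq c.
    move: ab u3 => /andP[a1 a2] /andP[b1 b2]; rewrite mulr_ege1 //=.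
    apply: (@le_trans _ _ ((1 + 5 / 2 * cq c) * (1 + cq c))); last by nra.
    by apply: ler_pM => //; apply: le_trans ler01 _.
  move: abe; set W := a * b * e => /andP[w1 w2].
  have s0 : 0 < sst by exact: lt_le_trans ltr01 ss1.
  have -> : W / zN m c - sst^-1 = ((W - 1) * sst - (zN m c - sst)) / (zN m c * sst).
    by field; rewrite !gt_eqF.
  have p0 : 0 < zN m c * sst by exact: mulr_gt0.
  have w0 : 0 <= (W - 1) * sst by apply: mulr_ge0; [rewrite subr_ge0|exact: ltW].
  rewrite normrM normfV (gtr0_norm p0) ler_pdivrMr //.
  apply: le_trans (ler_normB _ _) _; rewrite (ger0_norm w0).
  apply: le_trans (lerD (lexx _) zb) _.
  apply: (@le_trans _ _ (6 * cq c * sst)).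
    have : (W - 1) * sst <= 5 * cq c * sst by rewrite ler_wpM2r ?(ltW s0) //; lra.
    have : cq c <= cq c * sst by rewrite ler_peMr // ltW.
    by lra.
  have -> : 12 * cq c * (zN m c * sst) = cq c * sst * (12 * zN m c) by ring.
  have -> : 6 * cq c * sst = cq c * sst * 6 by ring.
  by apply: ler_wpM2l; [apply: mulr_ge0; exact: ltW|lra].
apply: small_eq (small_add s1 s2) => c va.
rewrite [X in _ + X](bigID (fun zeta => (0 < cfg zeta v)%N)) /=.
rewrite [X in _ + (_ + X)]big1 ?addr0; last by move=> zeta /andP[_ /negbTE h]; rewrite /X h mul0r.
rewrite mulr_sumr -big_split -sumrB /=; apply: eq_bigr => zeta /andP[sp kp].
rewrite /X kp /T (cond3 va uy uv yv uS vS sp) (wgt_uu va kp).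
have d0 : 0 < cd c by case: va. have z0 := zN0 va; have N0 := cN_gt0 c.
have s0 : 0 < sst by exact: lt_le_trans ltr01 sst1.
have k0 : 0 < (cfg zeta v)%:R :> R by rewrite ltr0n.
by field; rewrite !gt_eqF.
Qed.

(** * Gradient of the test function on three sites *)

Section Gradient.
Variables (C : cls) (g b : cls -> R -> R) (L : R).
Hypothesis prof : forall D, D != C -> profile_spec C D (g D) (b D) L.
Local Notation V := (V C b).
Variables (D : cls) (x y z : S).
Hypotheses (DC : D != C) (xC : x \in val C) (zD : z \in val D) (yS : y \notin Sstar).

Let xS : x \in Sstar. Proof. exact: cls_sub xC. Qed.
Let zS : z \in Sstar. Proof. exact: cls_sub zD. Qed.
Lemma cls_xy : x != y. Proof. by apply: contraNneq yS => <-. Qed.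
Lemma cls_yz : y != z. Proof. by apply: contraNneq yS => ->. Qed.
Lemma cls_xz : x != z.
Proof. by apply: contraNneq DC => e; rewrite (cls_eq r0 irr m0 m1 rev (_ : x \in val D) xC) ?eqxx // e. Qed.
Let xy := cls_xy.
Let yz := cls_yz.
Let xz := cls_xz.

Lemma supp_occp (A : cls) n (eta : Hn S n) : supp3 x y z eta ->
  occp A eta = ((A == C) && (0 < cfg eta x)%N) || ((A == D) && (0 < cfg eta z)%N).
Proof.
move=> sp; apply/exists_inP/orP => [[u uA u0]|[/andP[/eqP -> h]|/andP[/eqP -> h]]]; last 2 first.
- by exists x.
- by exists z.
have uy : u != y by apply: contraNneq yS => <-; exact: cls_sub uA.
have [ux|ux] := eqVneq u x.
  by left; rewrite -ux u0 andbT; apply/eqP; apply: (cls_eq r0 irr m0 m1 rev uA); rewrite ux.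
have [uz|uz] := eqVneq u z.
  by right; rewrite -uz u0 andbT; apply/eqP; apply: (cls_eq r0 irr m0 m1 rev uA); rewrite uz.
by have := forallP sp u; rewrite ux uy uz /= => /eqP e; rewrite e in u0.
Qed.

Let supp_sum (A : cls) (u : S) n (eta : Hn S n) (F : S -> R) : supp3 x y z eta -> u \in val A ->
  (forall v, v \in val A -> v != u -> v != x /\ v != z) ->
  \sum_(v in val A) (cfg eta v)%:R * F v = (cfg eta u)%:R * F u.
Proof.
move=> sp uA h; rewrite (bigD1 u) //= big1 ?addr0 // => v /andP[vA vu].
have [vx vz] := h v vA vu; have vy : v != y by apply: contraNneq yS => <-; exact: cls_sub vA.
by have := forallP sp v; rewrite vx vy vz /= => /eqP ->; rewrite mul0r.
Qed.

Let hC v : v \in val C -> v != x -> v != x /\ v != z.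
Proof.
move=> vC vx; split => //; apply: contraNneq DC => e.
by rewrite (cls_eq r0 irr m0 m1 rev (_ : v \in val D) vC) // e.
Qed.

Let hD v : v \in val D -> v != z -> v != x /\ v != z.
Proof.
move=> vD vz; split => //; apply: contraNneq DC => e.
by rewrite (cls_eq r0 irr m0 m1 rev (_ : v \in val C) vD) // e.
Qed.

Let tot1 (A : cls) u n (eta : Hn S n) : supp3 x y z eta -> u \in val A ->
  (forall v, v \in val A -> v != u -> v != x /\ v != z) -> tot (val A) eta = cfg eta u.
Proof.
move=> sp uA h; apply/eqP; rewrite -(eqr_nat R) natr_sum.
have := supp_sum (fun _ => 1) sp uA h; rewrite mulr1 => <-.
by apply/eqP; apply: eq_bigr => v _; rewrite mulr1.
Qed.

(** The return probability of a particle at [y] when the fraction [t] of all particles sits at [x].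
    Since [sfr] weighs [D] by all particles outside [C], it depends on [t] only and not on the
    number of particles at [y]. *)
Definition sg (t : R) : R := t * r x y / ((1 - t) * r z y + t * r x y).

Lemma V_eval n (eta : Hn S n.+1) : supp3 x y z eta -> (0 < cfg eta x)%N -> (0 < cfg eta z)%N ->
  V eta = b D (((cfg eta x)%:R + (cfg eta y)%:R * sg ((cfg eta x)%:R / n.+1%:R)) / n.+1%:R).
Proof.
move=> sp x1 z1; have oC : occp C eta by rewrite supp_occp // eqxx x1.
have aD : @act C D n.+1 eta.
  rewrite /act supp_occp // eqxx z1 orbT /=; apply/forallP => D'; apply/implyP => /andP[/negbTE h1 /negbTE h2].
  by rewrite supp_occp // h1 h2.
rewrite (V_act b DC oC aD) /posn; congr (b D ((_ + _) / _)).
  by rewrite (tot1 sp xC hC).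
rewrite (bigD1 y) //= big1 ?addr0 => [|v /andP[vS vy]]; last first.
  have vx : v != x by apply: contraNneq vS => ->.
  have vz : v != z by apply: contraNneq vS => ->.
  by have := forallP sp v; rewrite vx vy vz /= => /eqP ->; rewrite mul0r.
congr (_ * _); rewrite /sfr (supp_sum _ sp xC hC) (supp_sum _ sp zD hD) !(tot1 sp xC hC) !(tot1 sp zD hD).
have ln : (cfg eta x <= n.+1)%N := cfg_le eta x.
have N0 : n.+1%:R != 0 :> R by rewrite pnatr_eq0.
have k0 : (cfg eta z)%:R != 0 :> R by rewrite pnatr_eq0 -lt0n.
rewrite natrB //; set l := (cfg eta x)%:R; set k := (cfg eta z)%:R in k0 *; set N := n.+1%:R in N0 *.
by rewrite frac_scale.
Qed.

Lemma V_evalC n (eta : Hn S n.+1) : supp3 x y z eta -> (0 < cfg eta x)%N -> cfg eta z = 0%N -> V eta = 1.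
Proof.
move=> sp x1 z0; rewrite V_only //; first by rewrite supp_occp // eqxx x1.
by apply/forallP => A; apply/implyP => /negbTE h; rewrite supp_occp // h z0 andbF.
Qed.

Lemma V_eval0 n (eta : Hn S n.+1) : supp3 x y z eta -> cfg eta x = 0%N -> V eta = 0.
Proof.
move=> sp x0; rewrite V_none // supp_occp // x0 andbF /=.
by rewrite negb_and eq_sym DC.
Qed.

Local Notation kp t := (kap t (r x y) (r z y)).

Lemma sg_range (t : R) : 0 <= t <= 1 -> 0 <= sg t <= 1.
Proof.
move=> /andP[t0 t1]; have a0 : 0 <= t * r x y by exact: mulr_ge0.
have b0 : 0 <= (1 - t) * r z y by rewrite mulr_ge0 // subr_ge0.
rewrite /sg divr_ge0 ?addr_ge0 //=; have [->|h] := eqVneq ((1 - t) * r z y + t * r x y) 0; first by rewrite invr0 mulr0.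
by rewrite ler_pdivrMr ?mul1r ?lerDr // lt_def h addr_ge0.
Qed.

(** [sg] and [1 - sg] are the shares of the potential drop across the two resistances in series
    [t / r z y] and [(1 - t) / r x y], whose joint conductance is [kap]. *)
Lemma sg_kap (t : R) : 0 <= t < 1 -> 0 < r z y -> sg t = t * kp t / r z y.
Proof.
move=> /andP[t0 t1] h; have d0 : 0 < (1 - t) * r z y + t * r x y.
  by rewrite ltr_wpDr ?mulr_ge0 // mulr_gt0 // subr_gt0.
by rewrite /sg /kap; field; rewrite !gt_eqF.
Qed.

Lemma sg_kap' (t : R) : 0 < t <= 1 -> 0 < r x y -> 1 - sg t = (1 - t) * kp t / r x y.
Proof.
move=> /andP[t0 t1] h; have d0 : 0 < (1 - t) * r z y + t * r x y.
  by rewrite ltr_wpDl ?mulr_gt0 // mulr_ge0 // subr_ge0.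
by rewrite /sg /kap; field; rewrite !gt_eqF.
Qed.

Lemma sg_lip : 0 < r x y -> 0 < r z y -> exists2 A : R, 0 <= A &
  forall s t : R, 0 <= s <= 1 -> 0 <= t <= 1 -> `|sg s - sg t| <= A * `|s - t|.
Proof.
move=> h1 h2; have kl := @lip01_kap R _ _ (r0 x y) (r0 z y).
have [B [B0 hB]] := lip01_bound kl; have [A [A0 hA]] := kl.
exists ((B + A) / r z y) => [|s t hs ht]; first by rewrite divr_ge0 ?addr_ge0.
have e (u : R) : 0 <= u <= 1 -> sg u = u * kp u / r z y.
  move=> hu; rewrite /sg /kap; have d0 : 0 < (1 - u) * r z y + u * r x y.
    by apply: lt_le_trans (kap_den hu h1 h2); rewrite lt_min h1 h2.
  by field; rewrite !gt_eqF.
rewrite !e // -mulrBl normrM [`|(r z y)^-1|]ger0_norm ?invr_ge0 // mulrAC ler_wpM2r ?invr_ge0 //.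
have -> : s * kp s - t * kp t = (s - t) * kp s + t * (kp s - kp t) by ring.
apply: le_trans (ler_normD _ _) _; rewrite [`|(s - t) * _|]normrM [`|t * _|]normrM [leRHS]mulrDl; apply: lerD.
  by rewrite mulrC ler_wpM2r // hB.
case/andP: ht => t0 t1; rewrite (ger0_norm t0); apply: le_trans (hA _ _ hs _); last by rewrite t0.
by rewrite ler_piMl.
Qed.

Lemma frac_range (k n : nat) : (k <= n.+1)%N -> 0 <= (k%:R / n.+1%:R : R) <= 1.
Proof. by move=> h; rewrite divr_ge0 //= ler_pdivrMr ?ltr0n // mul1r ler_nat. Qed.

Lemma supp_addp u n (zeta : Hn S n) : supp3 x y z zeta -> [|| u == x, u == y | u == z] ->
  supp3 x y z (addp zeta u).
Proof.
move=> sp hu; apply/forallP => s; apply/implyP => h; rewrite cfg_addp.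
rewrite (eqP (implyP (forallP sp s) h)); move: h; case: (eqVneq s u) => //= ->.
by case/or3P: hu => ->; rewrite ?andbF.
Qed.

Let pr := prof DC.

Let gbd (t : R) : 0 <= t <= 1 -> 0 <= g D t <= L. Proof. by case: pr => _ _ h _ _ /h []. Qed.
Let L0 : 0 <= L. Proof. by case: pr. Qed.

Let expand (s t : R) : 0 <= s <= 1 -> 0 <= t <= 1 ->
  `|b D s - b D t - g D t * (s - t)| <= L * (s - t) ^+ 2.
Proof. by case: pr => _ _ _ h _ hs ht; case: (h s t hs ht). Qed.
Let glip (s t : R) : 0 <= s <= 1 -> 0 <= t <= 1 -> `|g D s - g D t| <= L * `|s - t|.
Proof. by case: pr => _ _ _ h _ hs ht; case: (h s t hs ht). Qed.

Let step p1 p0 t (dl N : R) : 0 <= p1 <= 1 -> 0 <= p0 <= 1 -> 0 <= t <= 1 -> 0 < N -> 1 <= dl ->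
  `|p1 - p0| <= dl / N -> `|p0 - t| <= dl / N ->
  `|b D p1 - b D p0 - g D t * (p1 - p0)| <= 2 * L * dl ^+ 2 / N ^+ 2.
Proof.
move=> h1 h0 ht N0 dl1 e1 e2.
have q0 : 0 <= dl / N by rewrite divr_ge0 // ltW // (lt_le_trans ltr01).
have -> : b D p1 - b D p0 - g D t * (p1 - p0) =
  (b D p1 - b D p0 - g D p0 * (p1 - p0)) + (g D p0 - g D t) * (p1 - p0) by ring.
have -> : 2 * L * dl ^+ 2 / N ^+ 2 = L * (dl / N) ^+ 2 + (L * (dl / N)) * (dl / N) by field; rewrite gt_eqF.
apply: le_trans (ler_normD _ _) _; apply: lerD.
  apply: le_trans (expand h1 h0) _; rewrite ler_wpM2l // -[X in X <= _]real_normK ?num_real //.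
  by rewrite lerXn2r ?nnegrE.
by rewrite normrM; apply: ler_pM => //; apply: le_trans (glip h0 ht) _; rewrite ler_wpM2l.
Qed.

(** A particle moved from [y] to [x] shifts [posn] by about [(1 - sg) / N], which [sg_kap']
    expresses through [kap]. The current through this half of the crossing is then [kap * g], the
    same as through the other half. *)
Lemma grad_A : 0 < r x y -> exists2 K : R, 0 <= K & forall n (zeta : Hn S n),
  supp3 x y z zeta -> (0 < cfg zeta z)%N ->
  `|gr (@V n.+1) zeta x y - kp ((cfg zeta x)%:R / n.+1%:R) * g D ((cfg zeta x)%:R / n.+1%:R) * (cfg zeta z)%:R / (n.+1%:R ^+ 2 * r x y)|
  <= K * (cfg zeta y).+1%:R ^+ 2 * (n.+1%:R ^- 2 + (cfg zeta x == 0%N)%:R / n.+1%:R).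
Proof.
move=> rxy; have [B [B0 hB]] := lip01_bound (@lip01_kap R _ _ (r0 x y) (r0 z y)).
have [A A0 hA] : exists2 A : R, 0 <= A & (0 < r z y -> forall s t : R, 0 <= s <= 1 -> 0 <= t <= 1 -> `|sg s - sg t| <= A * `|s - t|).
  have [h|h] := ltP 0 (r z y); last by exists 0 => // h'; rewrite ltNge h in h'.
  by have [A A0 hA] := sg_lip rxy h; exists A.
exists (2 * L + L * (B / r x y + A) + 2 * L); first by rewrite !addr_ge0 ?mulr_ge0 ?addr_ge0 ?divr_ge0.
move=> n zeta sp k1; have sumE := supp3_sum xy xz yz sp.
have spx : supp3 x y z (addp zeta x) by rewrite supp_addp // eqxx.
have spy : supp3 x y z (addp zeta y) by rewrite supp_addp // eqxx orbT.
have yx : y == x = false by rewrite eq_sym (negbTE xy). have zx : z == x = false by rewrite eq_sym (negbTE xz).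
have zy : z == y = false by rewrite eq_sym (negbTE yz).
rewrite /gr (V_eval spx) ?cfg_addp ?eqxx ?zx ?addn1 ?addn0 // yx addn0.
set l := cfg zeta x in sumE *; set j := cfg zeta y in sumE *; set k := cfg zeta z in sumE k1 *.
pose N : R := n.+1%:R; rewrite -/N; have N0 : 0 < N by rewrite ltr0n.
have N1 : 1 <= N by rewrite ler1n.
have [f1 f2 f3 f4 [f5 f6 f7 f8]] := arith3 sumE k1.
have hl : 0 <= l%:R / N <= 1 by exact: frac_range.
have hl1 : 0 <= l.+1%:R / N <= 1 by exact: frac_range.
have NE : N = l%:R + j%:R + k%:R + 1 by rewrite /N f6 !natrD.
have pr1 i q : (i + q <= n.+1)%N -> forall s : R, 0 <= s <= 1 -> 0 <= (i%:R + q%:R * s) / N <= 1.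
  move=> iq s /andP[s0 s1]; rewrite divr_ge0 ?addr_ge0 ?mulr_ge0 ?(ltW N0) //= ler_pdivrMr // mul1r.
  apply: (@le_trans _ _ (i + q)%:R); last by rewrite ler_nat.
  by rewrite natrD lerD2l ler_piMr.
have hp1 := pr1 l.+1 j f3 _ (sg_range hl1).
have hp0 := pr1 l j.+1 f4 _ (sg_range hl).
have g0 := gbd hl; have k0 := hB _ hl.
have j1 : 1 <= j.+1%:R :> R by rewrite ler1n.
have J2 : j.+1%:R <= j.+1%:R ^+ 2 :> R by rewrite expr2 ler_peMl // (le_trans ler01).
set J : R := j.+1%:R in j1 J2 *; have JE : J = j%:R + 1 by rewrite /J -natr1.
have iN0 : 0 < N^-1 by rewrite invr_gt0.
have iN2 : 0 < N ^- 2 by rewrite invr_gt0 exprn_gt0.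
have g0' : 0 <= g D (l%:R / N) by case/andP: g0.
(* With [x] empty one end of the edge has value 0 and no expansion is available; a bound of order
   [1 / N] is enough, and it is the second term of the claim. *)
have [l0|l1] := posnP l.
  rewrite (V_eval0 spy); last by rewrite cfg_addp (negbTE xy) addn0.
  rewrite subr0; set p1 := ((l.+1%:R + _) / N) in hp1 *.
  have e1 : `|b D p1| <= 2 * L * (J / N).
    have := b_lip prof DC hp1 (_ : 0 <= (0 : R) <= 1); rewrite lexx ler01 => /(_ isT).
    have [_ [-> _] _ _ _] := pr; rewrite !subr0 => h; apply: le_trans h _.
    apply: ler_wpM2l; first by rewrite mulr_ge0.
    rewrite ger0_norm; last by case/andP: hp1.
    rewrite ler_pM2r // l0 JE addrC lerD2r ler_piMr //.
    by have := sg_range hl1; rewrite l0 => /andP[].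
  have e2 : `|kp (l%:R / N) * g D (l%:R / N) * k%:R / (N ^+ 2 * r x y)| <= L * (B / r x y) * (J / N).
    rewrite 3!normrM (ger0_norm g0') [`|k%:R|]ger0_norm // [`|_^-1|]ger0_norm; last by rewrite invr_ge0 mulr_ge0 ?sqr_ge0.
    have -> : L * (B / r x y) * (J / N) = B * L * (J * N) / (N ^+ 2 * r x y) by field; rewrite !gt_eqF.
    rewrite ler_pM2r ?invr_gt0 ?mulr_gt0 ?exprn_gt0 //; apply: ler_pM; rewrite ?mulr_ge0 //.
      by apply: ler_pM => //; case/andP: g0.
    apply: (@le_trans _ _ N); last by rewrite ler_peMl // ltW.
    by rewrite /N ler_nat.
  apply: le_trans (ler_normB _ _) _; apply: le_trans (lerD e1 e2) _.
  rewrite mul1r -mulrDl.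
  have B' : 0 <= L * (B / r x y) by rewrite mulr_ge0 ?divr_ge0.
  have A' : 0 <= L * A by exact: mulr_ge0.
  apply: (@le_trans _ _ ((2 * L + L * (B / r x y + A) + 2 * L) * J ^+ 2 * N^-1)); last first.
    by apply: ler_wpM2l; [rewrite mulr_ge0 ?sqr_ge0 // mulrDr !addr_ge0 // mulr_ge0|rewrite lerDr ltW].
  rewrite [leLHS]mulrA ler_pM2r //; apply: ler_pM => //; first by rewrite addr_ge0 // mulr_ge0.
  by rewrite mulrDr; have := L0; lra.
rewrite (V_eval spy) ?cfg_addp ?eqxx ?(negbTE xy) ?zy ?addn0 // addn1 -/l -/j -/N.
set t := l%:R / N in hl hp0 g0 k0 g0' *; set s1 := sg (l.+1%:R / N) in hp1 *; set s0 := sg t in hp0 *.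
set p1 := ((l.+1%:R + _) / N) in hp1 *; set p0 := ((l%:R + _) / N) in hp0 *.
have t0 : 0 < t by rewrite divr_gt0 // ltr0n.
have s1r : 0 <= s1 <= 1 by exact: sg_range.
have s0r : 0 <= s0 <= 1 by exact: sg_range.
have sdiff : `|s1 - s0| <= A / N.
  have [r2|r2] := ltP 0 (r z y).
    by apply: le_trans (hA r2 _ _ hl1 hl) _; rewrite /t -mulrBl -natr1 addrAC subrr add0r mul1r ger0_norm // ltW.
  (* Without the second resistance [sg] is the constant 1 on positive arguments. It jumps at 0,
     which is excluded here because [x] is occupied. *)
  have r20 : r z y = 0 by apply/eqP; rewrite eq_le r2 r0.
  have one u : 0 < u <= 1 -> sg u = 1.
    by move=> hu; have := sg_kap' hu rxy; rewrite /kap r20 mulr0 mul0r mulr0 mul0r; lra.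
  rewrite /s1 /s0 !one ?subrr ?normr0 ?divr_ge0 // ?(ltW N0) ?t0 //=; first by case/andP: hl.
  by case/andP: hl1 => _ ->; rewrite andbT divr_gt0 // ltr0n.
have s0E : 1 - s0 = (N - l%:R) * kp t / (N * r x y).
  rewrite /s0 sg_kap' //; last by case/andP: hl => _ ->; rewrite t0.
  by rewrite -/(kp t); set K' := kp t; rewrite /t; field; rewrite !gt_eqF.
have dE : p1 - p0 = ((1 - s0) + j%:R * (s1 - s0)) / N.
  by rewrite /p1 /p0 -!natr1; ring.
have jE : 0 <= j%:R :> R by [].
have d1 : `|p1 - p0| <= J / N.
  rewrite dE normrM (gtr0_norm iN0) ler_pM2r // JE [j%:R + 1]addrC.
  apply: le_trans (ler_normD _ _) _; apply: lerD.
    by rewrite ler_norml; move: s0r => /andP[a1 a2]; apply/andP; split; lra.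
  rewrite normrM ger0_norm // ler_piMr // ler_norml.
  by move: s0r s1r => /andP[a1 a2] /andP[a3 a4]; apply/andP; split; lra.
have d2 : `|p0 - t| <= J / N.
  have -> : p0 - t = J * s0 / N by rewrite /p0 /t /J; ring.
  have J0 : 0 <= J by exact: le_trans ler01 j1.
  have /andP[a1 a2] := s0r.
  rewrite ger0_norm; last by apply: mulr_ge0; [exact: mulr_ge0|exact: ltW].
  by rewrite ler_pM2r // ler_piMr.
have h1 := step hp1 hp0 hl N0 j1 d1 d2.
have h2 : `|p1 - p0 - kp t * k%:R / (N ^+ 2 * r x y)| <= (B / r x y + A) * J ^+ 2 / N ^+ 2.
  have -> : p1 - p0 - kp t * k%:R / (N ^+ 2 * r x y) = kp t * J / (N ^+ 2 * r x y) + j%:R * (s1 - s0) / N.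
    have NE' : N - l%:R = k%:R + J by rewrite JE [X in X - _]NE; ring.
    by rewrite dE s0E NE'; set K' := kp t; field; rewrite !gt_eqF.
  apply: le_trans (ler_normD _ _) _; rewrite 2!mulrDl; apply: lerD.
    rewrite 2!normrM [`|J|]ger0_norm // [`|_^-1|]ger0_norm; last by rewrite invr_ge0 mulr_ge0 ?sqr_ge0.
    have -> : B / r x y * J ^+ 2 / N ^+ 2 = B * J ^+ 2 / (N ^+ 2 * r x y) by field; rewrite !gt_eqF.
    by rewrite ler_pM2r ?invr_gt0 ?mulr_gt0 ?exprn_gt0 //; apply: ler_pM.
  rewrite !normrM (gtr0_norm iN0) [`|j%:R|]ger0_norm //.
  have -> : A * J ^+ 2 / N ^+ 2 = J ^+ 2 * (A / N) / N by field; rewrite gt_eqF.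
  rewrite ler_pM2r //; apply: ler_pM => //; apply: le_trans J2; rewrite JE; lra.
have -> : b D p1 - b D p0 - kp t * g D t * k%:R / (N ^+ 2 * r x y) =
  (b D p1 - b D p0 - g D t * (p1 - p0)) + g D t * (p1 - p0 - kp t * k%:R / (N ^+ 2 * r x y)) by ring.
apply: le_trans (ler_normD _ _) _; rewrite normrM (ger0_norm g0').
have h3 := ler_pM g0' (normr_ge0 _) (proj2 (andP g0)) h2.
apply: le_trans (lerD h1 h3) _.
have -> : 2 * L * J ^+ 2 / N ^+ 2 + L * ((B / r x y + A) * J ^+ 2 / N ^+ 2) =
  (2 * L + L * (B / r x y + A)) * J ^+ 2 * N ^- 2 by ring.
have c0 : 0 <= L * (B / r x y + A) by rewrite mulr_ge0 // addr_ge0 // divr_ge0.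
apply: ler_pM; [by rewrite mulr_ge0 ?sqr_ge0 // addr_ge0 // mulr_ge0|exact: ltW| |].
  by rewrite ler_wpM2r ?sqr_ge0 // lerDl mulr_ge0.
by rewrite lerDl mulr_ge0 // ltW.
Qed.

(** The other half of the crossing. It is simpler: exchanging [y] for [z] leaves the content of [x],
    hence [sg], unchanged. *)
Lemma grad_B : 0 < r z y -> exists2 K : R, 0 <= K & forall n (zeta : Hn S n),
  supp3 x y z zeta -> (0 < cfg zeta x)%N ->
  `|gr (@V n.+1) zeta z y - - (kp ((cfg zeta x)%:R / n.+1%:R) * g D ((cfg zeta x)%:R / n.+1%:R)) * (cfg zeta x)%:R / (n.+1%:R ^+ 2 * r z y)|
  <= K * (cfg zeta y).+1%:R ^+ 2 * (n.+1%:R ^- 2 + (cfg zeta z == 0%N)%:R / n.+1%:R).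
Proof.
move=> rzy; have [B [B0 hB]] := lip01_bound (@lip01_kap R _ _ (r0 x y) (r0 z y)).
exists (2 * L + L * (B / r z y)); first by apply: addr_ge0; apply: mulr_ge0 => //; exact: divr_ge0.
move=> n zeta sp l1; have sumE := supp3_sum xy xz yz sp.
have spz : supp3 x y z (addp zeta z) by rewrite supp_addp // eqxx !orbT.
have spy : supp3 x y z (addp zeta y) by rewrite supp_addp // eqxx orbT.
have yx : y == x = false by rewrite eq_sym (negbTE xy). have zx : z == x = false by rewrite eq_sym (negbTE xz).
have zy : z == y = false by rewrite eq_sym (negbTE yz).
rewrite /gr (V_eval spz) ?cfg_addp ?eqxx ?(negbTE xz) ?(negbTE yz) ?addn1 ?addn0 //.
set l := cfg zeta x in l1 sumE *; set j := cfg zeta y in sumE *; set k := cfg zeta z in sumE *.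
pose N : R := n.+1%:R; rewrite -/N; have N0 : 0 < N by rewrite ltr0n.
have sumE' : (k + j + l = n)%N by rewrite -sumE addnC addnA addnAC.
have [f1 f2 f3 f4 [f5 f6 f7 f8]] := arith3 sumE' l1.
have hl : 0 <= l%:R / N <= 1 by exact: frac_range.
have NE : N = k%:R + j%:R + l%:R + 1 by rewrite /N f6 !natrD.
have pr1 i q : (i + q <= n.+1)%N -> forall s : R, 0 <= s <= 1 -> 0 <= (i%:R + q%:R * s) / N <= 1.
  move=> iq s /andP[s0 s1]; rewrite divr_ge0 ?addr_ge0 ?mulr_ge0 ?(ltW N0) //= ler_pdivrMr // mul1r.
  apply: (@le_trans _ _ (i + q)%:R); last by rewrite ler_nat.
  by rewrite natrD lerD2l ler_piMr.
have j1 : 1 <= j.+1%:R :> R by rewrite ler1n.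
have J2 : j.+1%:R <= j.+1%:R ^+ 2 :> R by rewrite expr2 ler_peMl // (le_trans ler01).
set J : R := j.+1%:R in j1 J2 *; have JE : J = j%:R + 1 by rewrite /J -natr1.
have iN0 : 0 < N^-1 by rewrite invr_gt0.
have iN2 : 0 < N ^- 2 by rewrite invr_gt0 exprn_gt0.
set t := l%:R / N in hl *; have g0 := gbd hl; have k0 := hB _ hl.
have g0' : 0 <= g D t by case/andP: g0.
have t1 : t < 1 by rewrite /t ltr_pdivrMr // mul1r NE; have : 0 <= k%:R + j%:R :> R by []; lra.
set s0 := sg t; have s0r : 0 <= s0 <= 1 by exact: sg_range.
have s0E : s0 / N = kp t * l%:R / (N ^+ 2 * r z y).
  rewrite /s0 sg_kap //; last by rewrite t1 andbT; case/andP: hl.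
  by rewrite -/(kp t); set K' := kp t; rewrite /t; field; rewrite !gt_eqF.
have hp1 : 0 <= (l%:R + j%:R * s0) / N <= 1 by exact: pr1.
set p1 := ((l%:R + j%:R * _) / N) in hp1 *.
have B' : 0 <= L * (B / r z y) by rewrite mulr_ge0 ?divr_ge0 // ltW.
rewrite !mulNr opprK; have [k00|k1] := posnP k.
  (* With [z] empty only [C] remains occupied at one end of the edge, whose value is 1. *)
  rewrite (V_evalC spy) ?cfg_addp ?(negbTE yz) ?zy ?addn0 //; last by rewrite ltn_addr.
  have e1 : `|b D p1 - 1| <= 2 * L * (J / N).
    have := b_lip prof DC hp1 (_ : 0 <= (1 : R) <= 1); rewrite lexx ler01 => /(_ isT).
    have [_ [_ ->] _ _ _] := pr; move=> h; apply: le_trans h _.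
    apply: ler_wpM2l; first by rewrite mulr_ge0.
    rewrite distrC ger0_norm ?subr_ge0; last by case/andP: hp1.
    rewrite lerBlDr -mulrDl ler_pdivlMr // mul1r NE k00 JE add0r.
    have : 0 <= j%:R * s0 by case/andP: s0r => *; exact: mulr_ge0.
    by lra.
  have e2 : `|kp t * g D t * l%:R / (N ^+ 2 * r z y)| <= L * (B / r z y) * (J / N).
    rewrite 3!normrM (ger0_norm g0') [`|l%:R|]ger0_norm // [`|_^-1|]ger0_norm; last by rewrite invr_ge0 mulr_ge0 ?sqr_ge0.
    have -> : L * (B / r z y) * (J / N) = B * L * (J * N) / (N ^+ 2 * r z y) by field; rewrite !gt_eqF.
    rewrite ler_pM2r ?invr_gt0 ?mulr_gt0 ?exprn_gt0 //; apply: ler_pM; rewrite ?mulr_ge0 //.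
      by apply: ler_pM => //; case/andP: g0.
    apply: (@le_trans _ _ N); last by rewrite ler_peMl // ltW.
    by rewrite /N ler_nat.
  apply: le_trans (ler_normD _ _) _; apply: le_trans (lerD e1 e2) _.
  rewrite mul1r -mulrDl.
  apply: (@le_trans _ _ ((2 * L + L * (B / r z y)) * J ^+ 2 * N^-1)); last first.
    by apply: ler_wpM2l; [rewrite mulr_ge0 ?sqr_ge0 // addr_ge0 // mulr_ge0|rewrite lerDr ltW].
  by rewrite [leLHS]mulrA ler_pM2r // ler_wpM2l // addr_ge0 // mulr_ge0.
rewrite (V_eval spy) ?cfg_addp ?eqxx ?yx ?(negbTE xy) ?(negbTE yz) ?zy ?addn0 // ?ltn_addr // addn1 -/l -/j -/N -/t -/s0.
have hp0 : 0 <= (l%:R + j.+1%:R * s0) / N <= 1 by exact: pr1.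
set p0 := ((l%:R + j.+1%:R * _) / N) in hp0 *.
have J0 : 0 <= J by exact: le_trans ler01 j1.
have /andP[a1 a2] := s0r.
have dE : p1 - p0 = - (kp t * l%:R / (N ^+ 2 * r z y)).
  by rewrite -s0E /p1 /p0 -!natr1; ring.
have d1 : `|p1 - p0| <= J / N.
  have e0 : 0 <= s0 / N by exact: mulr_ge0 a1 (ltW iN0).
  rewrite dE -s0E normrN (ger0_norm e0) ler_pM2r //; exact: le_trans a2 j1.
have d2 : `|p0 - t| <= J / N.
  have -> : p0 - t = J * s0 / N by rewrite /p0 /t /J; ring.
  rewrite ger0_norm; last by apply: mulr_ge0; [exact: mulr_ge0|exact: ltW].
  by rewrite ler_pM2r // ler_piMr.
have h1 := step hp1 hp0 hl N0 j1 d1 d2.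
have -> : b D p1 - b D p0 + kp t * g D t * l%:R / (N ^+ 2 * r z y) =
  b D p1 - b D p0 - g D t * (p1 - p0) by rewrite dE; ring.
apply: le_trans h1 _; apply: ler_pM; [by rewrite mulr_ge0 ?sqr_ge0 // mulr_ge0|exact: ltW| |].
  by rewrite ler_wpM2r ?sqr_ge0 // lerDl.
by rewrite lerDl mulr_ge0 // ltW.
Qed.
End Gradient.

Lemma small_le F G : (forall c, valid c -> `|F c| <= G c) -> small G -> small F.
Proof.
move=> h [K [K00 hK]]; exists K; split => // c v; apply: le_trans (h c v) _.
exact: le_trans (ler_norm _) (hK c v).
Qed.

Definition W (c : ctx) x y z (j l : nat) : R := cw c (c3 x y z (cn c).+1 j l).

(** * Moving particles along one edge *)

Section OneEdge.
Variables (u y v : S).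
Hypotheses (uy : u != y) (uv : u != v) (yv : y != v) (uS : u \in Sstar) (vS : v \in Sstar) (ruy : 0 < r u y).

Lemma W_path (c : ctx) s j : (j <= s)%N -> (s <= (cn c).+1)%N ->
  `|W c u y v 0 s - W c u y v j (s - j)| <= \sum_(i < (cn c).+1 | (i < j)%N) `|gw c (c3 u y v (cn c) i (s.-1 - i)) u y|.
Proof.
move=> js sN; elim: j js => [|j IH] js.
  by rewrite subn0 subrr normr0 sumr_ge0.
have jn : (j < (cn c).+1)%N by exact: leq_trans js sN.
rewrite (bigD1 (Ordinal jn)) //= addrC.
rewrite (_ : W c u y v 0 s - W c u y v j.+1 (s - j.+1) = (W c u y v 0 s - W c u y v j (s - j)) + (W c u y v j (s - j) - W c u y v j.+1 (s - j.+1))); last by ring.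
apply: le_trans (ler_normD _ _) _; apply: lerD.
  apply: le_trans (IH (ltnW js)) _; apply: le_of_eq.
  by apply: eq_bigl => i; rewrite -val_eqE /= ltnS andbC ltn_neqAle.
apply: le_of_eq; congr `|_|; rewrite /gr /W addp_c3x ?addp_c3y //; [|clear -js sN jn; lia..].
by clear -js sN jn; congr (cw c (c3 _ _ _ _ _ _) - cw c (c3 _ _ _ _ _ _)); lia.
Qed.

(** Telescoping along the jumps from [u] to [y] with [v] frozen: the load of an edge is the total
    weight of the targets beyond it. Multiplying by the sign of the gradient turns the absolute
    values into a flow to which [edge_small_flat] applies. *)
Lemma transport (a : ctx -> nat -> nat -> R) (K : R) : 0 <= K ->
  (forall c j s, valid c -> 0 <= a c j s) ->
  (forall c i s, valid c -> (i <= s)%N -> (s <= cn c)%N ->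
     \sum_(j < (cn c).+2 | (i < j <= s.+1)%N) a c j s.+1 <= K * ms y ^+ i * ((cN c)^-1 + (s == cn c)%:R)) ->
  small (fun c => \sum_(s < (cn c).+2) \sum_(j < (cn c).+2 | (j <= s)%N)
     a c j s * `|W c u y v 0 s - W c u y v j (s - j)|).
Proof.
move=> K00 a0 ha.
pose X (c : ctx) (zeta : Hn S (cn c)) := K * ms y ^+ cfg zeta y * ((cN c)^-1 + (cfg zeta v == 0%N)%:R) * Num.sg (gw c zeta u y).
have iN0 (c : ctx) : 0 <= (cN c)^-1 by rewrite invr_ge0.
have : small (fun c => \sum_(zeta | supp3 u y v zeta) X c zeta * gw c zeta u y).
  apply: (edge_small_flat (K := K)) => // c zeta va sp.
  have p0 : 0 <= K * ms y ^+ cfg zeta y * ((cN c)^-1 + (cfg zeta v == 0%N)%:R).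
    by rewrite mulr_ge0 ?addr_ge0 // mulr_ge0 // exprn_ge0 // ltW.
  rewrite /X normrM (ger0_norm p0) ler_piMr // normr_sg; by case: eqP.
apply: small_le => c va; rewrite ger0_norm; last first.
  by apply: sumr_ge0 => s _; apply: sumr_ge0 => j _; rewrite mulr_ge0 ?a0.
pose G i s := `|gw c (c3 u y v (cn c) i (s - i)) u y|.
apply: (@le_trans _ _ (\sum_(s < (cn c).+1) \sum_(i < (cn c).+1 | (i <= s)%N) K * ms y ^+ i * ((cN c)^-1 + (s == cn c :> nat)%:R) * G i s)); last first.
  rewrite sum_supp3 // (sum_diag _ (fun j l => X c (c3 u y v (cn c) j l) * gw c (c3 u y v (cn c) j l) u y)); apply: ler_sum => s _; apply: ler_sum => i is_.
  have sn : (s <= cn c)%N by rewrite -ltnS.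
  have h : (i + (s - i) <= cn c)%N by rewrite subnKC.
  rewrite /X -[X in _ <= X]mulrA -normrEsg !cfg_c3 // (eq_sym y u) (negbTE uy) eqxx !(eq_sym v) (negbTE uv) (negbTE yv) eqxx -/(G i s).
  by rewrite -subnDA subnKC // subn_eq0 eqn_leq sn.
rewrite big_ord_recl /= big1 ?add0r => [|j]; last first.
  by rewrite leqn0 => /eqP ->; rewrite subrr normr0 mulr0.
apply: ler_sum => s _; rewrite /bump /= add1n.
have sN : (s.+1 <= (cn c).+1)%N by [].
apply: (@le_trans _ _ (\sum_(j < (cn c).+2 | (j <= s.+1)%N) \sum_(i < (cn c).+1 | (i < j)%N) a c j s.+1 * G i s)).
  apply: ler_sum => j js; rewrite -mulr_sumr; apply: ler_wpM2l; first exact: a0.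
  exact: W_path js sN.
rewrite (exchange_big_dep (fun i : 'I_(cn c).+1 => (i <= s)%N)) /=; last by move=> j i; lia.
apply: ler_sum => i is_; rewrite -mulr_suml ler_wpM2r ?normr_ge0 //.
apply: le_trans (ha c i s va is_ _); last by rewrite -ltnS.
by under eq_bigl do rewrite andbC.
Qed.

Lemma transport_geo : y \notin Sstar ->
  small (fun c => \sum_(s < (cn c).+2) \sum_(j < (cn c).+2 | (j <= s)%N)
     ms y ^+ j * ((cN c)^-1 + (s == (cn c).+1 :> nat)%:R) * `|W c u y v 0 s - W c u y v j (s - j)|).
Proof.
move=> yS; have my1 : ms y < 1 by exact: (ms_lt1 irr m0 m1 rev).
have iN0 (c : ctx) : 0 <= (cN c)^-1 by rewrite invr_ge0.
apply: (transport (a := fun c j s => ms y ^+ j * ((cN c)^-1 + (s == (cn c).+1 :> nat)%:R)) (K := (1 - ms y)^-1)).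
- by rewrite invr_ge0 subr_ge0.
- by move=> c j s va; rewrite mulr_ge0 ?addr_ge0 // exprn_ge0 // ltW.
move=> c i s va is_ sn; rewrite -mulr_suml eqSS; apply: ler_wpM2r; first by rewrite addr_ge0.
rewrite mulrC; apply: le_trans (geom_tail i (cn c).+2 (ltW (ms0 y)) my1).
rewrite [leRHS](bigID (fun j : 'I__ => (j <= s.+1)%N)) /= lerDl.
by apply: sumr_ge0 => j _; rewrite exprn_ge0 // ltW.
Qed.

Lemma transport_flat : y \in Sstar ->
  small (fun c => \sum_(s < (cn c).+2)
     ((cN c)^-1 + (s == (cn c).+1 :> nat)%:R) * `|W c u y v 0 s - W c u y v s 0|).
Proof.
move=> yS; have iN0 (c : ctx) : 0 <= (cN c)^-1 by rewrite invr_ge0.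
apply: small_eq (transport (a := fun c j s => (j == s)%:R * ((cN c)^-1 + (s == (cn c).+1 :> nat)%:R)) (K := 1) _ _ _) => //.
- move=> c va; apply: eq_bigr => s _; rewrite (bigD1 s) //= eqxx mul1r subnn big1 ?addr0 // => j /andP[_ /negbTE].
  by rewrite -val_eqE /= => ->; rewrite !mul0r.
- by move=> c j s va; rewrite mulr_ge0 ?addr_ge0.
move=> c i s va is_ sn; rewrite -mulr_suml eqSS (ms_star irr m0 m1 rev yS) expr1n mul1r ler_wpM2r ?addr_ge0 //.
have sN : (s.+1 < (cn c).+2)%N by [].
rewrite (bigD1 (Ordinal sN)) /=; last by rewrite ltnS is_ leqnn.
rewrite eqxx big1 ?addr0 // => j /andP[_ /negbTE].
by rewrite -val_eqE /= => ->.
Qed.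
End OneEdge.

Lemma small_Mq (K : R) : small (fun c => K * (cM c * cq c)).
Proof.
apply: small_mul; exists 1; split => // c va; have [_ _ _ /andP[q0 q1] _] := va.
have M0 := cM_ge0 m0 m1 va.
rewrite mul1r ger0_norm; last by rewrite mulr_ge0 // ltW.
have sq : cq c <= Num.sqrt (cq c).
  have e : Num.sqrt (cq c) ^+ 2 = cq c by rewrite sqr_sqrtr // ltW.
  rewrite -[X in X <= _]e expr2 ler_piMl ?sqrtr_ge0 // -[leRHS]sqrtr1 ler_sqrt //; lra.
rewrite /err mulrC; apply: ler_pM; rewrite ?(ltW q0) // lerDr sqrtr_ge0 //.
Qed.

(** * From three sites to a line of configurations on two sites *)

Section Triple.
Variables (x y z : S).
Hypotheses (xy : x != y) (xz : x != z) (yz : y != z).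
Hypotheses (xS : x \in Sstar) (zS : z \in Sstar) (yS : y \notin Sstar).

Lemma transport_z : 0 < r z y ->
  small (fun c => \sum_(l < (cn c).+2) \sum_(j < (cn c).+2 | (j + l <= (cn c).+1)%N)
    ms y ^+ j * ((cN c)^-1 + (l == 0%N :> nat)%:R) * `|W c x y z 0 l - W c x y z j l|).
Proof.
move=> rzy; have yx : y != x by rewrite eq_sym. have zy : z != y by rewrite eq_sym. have zx : z != x by rewrite eq_sym.
apply: small_eq (transport_geo zy zx yx zS xS rzy yS) => c va.
rewrite (reindex_inj rev_ord_inj) /=; apply: eq_bigr => l _.
have lN : (l <= (cn c).+1)%N by rewrite -ltnS.
rewrite subSS; apply: eq_big => [j|j js]; first by rewrite leq_subRL // addnC.
have [a1 a2 a3 a4] := arith_rev lN js.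
have e1 : W c z y x 0 ((cn c).+1 - l) = W c x y z 0 l.
  by rewrite /W (c3C zy zx yx) ?leq_subr // subn0 subKn.
have e2 : W c z y x j ((cn c).+1 - l - j) = W c x y z j l by rewrite /W (c3C zy zx yx) // a2.
by rewrite e1 e2 a3.
Qed.

Lemma transport_x : 0 < r x y ->
  small (fun c => \sum_(j < (cn c).+2) ms y ^+ j * `|W c x y z 0 (cn c).+1 - W c x y z j ((cn c).+1 - j)|).
Proof.
move=> rxy; have iN0 (c : ctx) : 0 <= (cN c)^-1 by rewrite invr_ge0.
apply: small_le (transport_geo xy xz yz xS zS rxy yS) => c va.
have p0 j : 0 <= ms y ^+ j by rewrite exprn_ge0 // ltW.
rewrite ger0_norm; last by apply: sumr_ge0 => j _; rewrite mulr_ge0.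
rewrite [leRHS](bigD1 ord_max) //= ler_wpDr //.
  by apply: sumr_ge0 => s _; apply: sumr_ge0 => j _; do 2?apply: mulr_ge0 => //; exact: addr_ge0.
rewrite [leRHS]big_mkcond; apply: ler_sum => j _; rewrite -ltnS ltn_ord eqxx.
by rewrite ler_wpM2r // ler_peMr // lerDr.
Qed.

Variables (F : R -> R) (B A : R).
Hypotheses (B0 : 0 <= B) (A0 : 0 <= A) (FB : forall t, 0 <= t <= 1 -> `|F t| <= B).
Hypothesis FA : forall s t, 0 <= s <= 1 -> 0 <= t <= 1 -> `|F s - F t| <= A * `|s - t|.
Hypothesis F0 : r x y * r z y = 0 -> forall t, F t = 0.
Local Notation fr c l := (F (l%:R / cN c)).

Definition edgeflow (c : ctx) : R :=
  \sum_(zeta | supp3 x y z zeta && (0 < cfg zeta z)%N) ms y ^+ cfg zeta y * fr c (cfg zeta x) * gw c zeta x y +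
  \sum_(zeta | supp3 z y x zeta && (0 < cfg zeta x)%N) ms y ^+ cfg zeta y * (- fr c (cfg zeta x)) * gw c zeta z y.

(** The sum of [F (l / N) * (w l.+1 - w l)] after summation by parts. The increments of [F] are of
    order [1 / N], so only the two ends of the line have coefficients of order 1. *)
Definition lineflow (c : ctx) (w : nat -> R) : R :=
  fr c (cn c) * w (cn c).+1 - fr c 0%N * w 0%N - \sum_(l < cn c) (fr c l.+1 - fr c l) * w l.+1.

Lemma abel (f w : nat -> R) n : \sum_(l < n.+1) f l * (w l.+1 - w l) =
  f n * w n.+1 - f 0%N * w 0%N - \sum_(l < n) (f l.+1 - f l) * w l.+1.
Proof.
elim: n => [|n IH]; first by rewrite big_ord_recl !big_ord0; ring.
by rewrite big_ord_recr IH [in RHS]big_ord_recr /=; ring.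
Qed.

Lemma frB (c : ctx) l : (l <= (cn c).+1)%N -> `|fr c l| <= B.
Proof. by move=> h; apply: FB; exact: frac_range. Qed.

Lemma frA (c : ctx) k l : (k <= l <= (cn c).+1)%N -> `|fr c l - fr c k| <= A * ((l - k)%:R / cN c).
Proof.
case/andP => h1 h2; apply: le_trans (FA _ _) _; try by exact: frac_range.
  by apply: frac_range; exact: leq_trans h2.
rewrite -mulrBl -natrB // ger0_norm //; exact: divr_ge0.
Qed.

(** The two halves of a crossing add up to a direct jump from [z] to [x]; the lines with [j]
    particles at [y] are compared with the line [j = 0], and their weights [ms y ^ j] sum to the
    prefactor. *)
Lemma edge_line : small (fun c => edgeflow c - (1 - ms y)^-1 * lineflow c (W c x y z 0)).
Proof.
have [e0|ne0] := eqVneq (r x y * r z y) 0.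
  apply: small_eq (@small0 R S r m) => c va; rewrite /edgeflow /lineflow.
  rewrite big1 => [|zeta _]; last by rewrite F0 // mulr0 mul0r.
  rewrite big1 => [|zeta _]; last by rewrite F0 // oppr0 mulr0 mul0r.
  by rewrite big1 => [|zeta _]; rewrite !F0 // ?subrr ?mul0r // !subr0 mulr0 addr0 subr0.
have [rx ry] : 0 < r x y /\ 0 < r z y.
  by move: ne0; rewrite mulf_eq0 negb_or => /andP[h1 h2]; rewrite !lt_def h1 h2 !r0.
have my1 : ms y < 1 by exact: (ms_lt1 irr m0 m1 rev).
have p0 j : 0 <= ms y ^+ j by rewrite exprn_ge0 // ltW.
have yx : y != x by rewrite eq_sym. have zy : z != y by rewrite eq_sym. have zx : z != x by rewrite eq_sym.
pose T (c : ctx) := \sum_(zeta | supp3 x y z zeta) ms y ^+ cfg zeta y * fr c (cfg zeta x) * (cw c (addp zeta x) - cw c (addp zeta z)).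
(* The value of [cw] with the particle at [y] cancels between the halves. Only configurations with
   [x] or [z] empty are missing from one of them. *)
have s1 : small (fun c => edgeflow c - T c).
  pose X1 (c : ctx) (zeta : Hn S (cn c)) : R := if cfg zeta z == 0%N then - (ms y ^+ cfg zeta y * fr c (cfg zeta x)) else 0.
  pose X2 (c : ctx) (zeta : Hn S (cn c)) : R := if cfg zeta x == 0%N then ms y ^+ cfg zeta y * fr c (cfg zeta x) else 0.
  have fb (c : ctx) (zeta : Hn S (cn c)) : `|ms y ^+ cfg zeta y * fr c (cfg zeta x)| <= B * ms y ^+ cfg zeta y.
    by rewrite normrM (ger0_norm (p0 _)) mulrC ler_wpM2r // frB // (leq_trans (cfg_le zeta x)).
  have h1 : small (fun c => \sum_(zeta | supp3 x y z zeta) X1 c zeta * gw c zeta x y).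
    apply: (edge_small_geo (K := B)) => // c zeta [_ _ _ /andP[q0 _] _] sp.
    rewrite /X1; case: ifP => _; rewrite ?normrN ?mulr1 ?fb // normr0; do 2?apply: mulr_ge0 => //; exact: ltW.
  have h2 : small (fun c => \sum_(zeta | supp3 z y x zeta) X2 c zeta * gw c zeta z y).
    apply: (edge_small_geo (K := B)) => // c zeta [_ _ _ /andP[q0 _] _] sp.
    rewrite /X2; case: ifP => _; rewrite ?mulr1 ?fb // normr0; do 2?apply: mulr_ge0 => //; exact: ltW.
  apply: small_eq (small_add h1 h2) => c va; rewrite /edgeflow /T.
  under [X in _ + X = _]eq_bigl do rewrite supp3C.
  under [X in _ = (_ + X) - _]eq_bigl do rewrite supp3C.
  rewrite [X in _ = X + _ - _]big_mkcondr [X in _ = _ + X - _]big_mkcondr /= -!big_split -sumrB /=.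
  apply: eq_bigr => zeta sp; rewrite /X1 /X2 /gr !lt0n.
  by case: eqP => _; case: eqP => _ /=; ring.
have [G [G0 hG]] := geom_moment 1 (ltW (ms0 y)) my1.
have s2 : small (fun c => T c - (1 - ms y)^-1 * lineflow c (W c x y z 0)).
  pose D (c : ctx) j l := `|W c x y z 0 l - W c x y z j l|.
  have sz := transport_z ry; have sx := transport_x rx.
  have := small_add (small_add (small_mul (A + B) sz) (small_mul B sx)) (small_Mq (2 * A * G + (2 * B + A) * (1 - ms y)^-1)).
  apply: small_le => c va; have [d0 d1 _ /andP[q0 q1] [_ _ hm _ [_ wM]]] := va.
  have N0 := cN_gt0 c; have N1 := cN_ge1 c; have M0 := cM_ge0 m0 m1 va.
  set n := cn c in hm *.
  have TE : T c = \sum_(j < n.+1) ms y ^+ j * (fr c (n - j)%N * W c x y z j (n - j).+1 - fr c 0%N * W c x y z j 0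
      - \sum_(l < n - j) (fr c l.+1 - fr c l) * W c x y z j l.+1).
    rewrite /T sum_supp3 //; apply: eq_bigr => j _; have jn : (j <= n)%N by rewrite -ltnS.
    rewrite -(abel (fun l => fr c l) (W c x y z j)) mulr_sumr.
    rewrite (big_ord_widen_cond n.+1 xpredT (fun l => ms y ^+ j * (fr c l * (W c x y z j l.+1 - W c x y z j l)))) ?ltnS ?leq_subr //=.
    apply: eq_big => l; first by rewrite ltnS leq_subRL.
    by move=> jl; rewrite !cfg_c3 // (negbTE yx) eqxx eqxx addp_c3x // addp_c3z // -mulrA.
  pose Bs := lineflow c (W c x y z 0).
  (* The tail of the geometric series is added so that the prefactor is exact; it is smaller than
     [cq]. *)
  have gsum : (1 - ms y)^-1 = \sum_(j < n.+1) ms y ^+ j + ms y ^+ n.+1 / (1 - ms y).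
    have h0 : 1 - ms y != 0 by rewrite subr_eq0 eq_sym lt_eqF.
    have := subrX1 (ms y) n.+1 => e.
    apply: (mulIf h0); rewrite mulVf // mulrDl mulfVK // mulrC.
    have -> : (1 - ms y) * \sum_(j < n.+1) ms y ^+ j = 1 - ms y ^+ n.+1 by rewrite -opprB mulNr -e opprB.
    by ring.
  have WM j l : `|W c x y z j l| <= cM c by exact: wM.
  have dlB l : (l <= n)%N -> `|fr c l.+1 - fr c l| <= A / cN c.
    move=> ln; have := @frA c l l.+1; rewrite leqnSn ltnS => /(_ ln).
    by rewrite subSnn mul1r.
  have BsM : `|Bs| <= (2 * B + A) * cM c.
    have h l : (l <= n)%N -> `|fr c l * W c x y z 0 l.+1| <= B * cM c /\ `|fr c l * W c x y z 0 l| <= B * cM c.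
      by move=> ln; rewrite !normrM; split; apply: ler_pM => //; apply: frB; exact: leqW.
    rewrite /Bs /lineflow; apply: le_trans (ler_normB _ _) _.
    have -> : (2 * B + A) * cM c = B * cM c + B * cM c + A * cM c by ring.
    apply: lerD.
      apply: le_trans (ler_normB _ _) _; apply: lerD; [by case: (h n (leqnn n))|by case: (h 0%N (leq0n n))].
    apply: le_trans (ler_norm_sum _ _ _) _.
    apply: (@le_trans _ _ (\sum_(l < n) A * (cM c / cN c))).
      apply: ler_sum => l _; rewrite normrM.
      have -> : A * (cM c / cN c) = A * (cN c)^-1 * cM c by ring.
      by apply: ler_pM => //; apply: dlB; exact: ltnW.
    rewrite sumr_const card_ord -[leLHS]mulr_natr -mulrA ler_wpM2l // -mulrA ler_piMr //.
    by rewrite mulrC ler_pdivrMr // mul1r ler_nat.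
  have Bdiff (j : 'I_n.+1) : `|(fr c (n - j)%N * W c x y z j (n - j).+1 - fr c 0%N * W c x y z j 0
      - \sum_(l < n - j) (fr c l.+1 - fr c l) * W c x y z j l.+1) - Bs| <=
     2 * A * (j.+1%:R * (cM c / cN c)) + B * `|W c x y z 0 n.+1 - W c x y z j (n.+1 - j)| +
     (A + B) * \sum_(l < n.+2 | (j + l <= n.+1)%N) ((cN c)^-1 + (l == 0%N :> nat)%:R) * D c j l.
    have jn : (j <= n)%N by rewrite -ltnS.
    pose w0 l := W c x y z 0 l; pose wj l := W c x y z j l; pose dl l := fr c l.+1 - fr c l.
    have -> : fr c (n - j)%N * W c x y z j (n - j).+1 - fr c 0%N * W c x y z j 0
      - \sum_(l < n - j) (fr c l.+1 - fr c l) * W c x y z j l.+1 - Bs =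
      ((fr c (n - j)%N - fr c n) * wj (n - j).+1 + \sum_(n - j <= l < n) dl l * w0 l.+1)
      + fr c n * (wj (n - j).+1 - w0 n.+1)
      + (fr c 0%N * (w0 0%N - wj 0%N) + \sum_(l < n - j) dl l * (w0 l.+1 - wj l.+1)).
      rewrite /Bs /lineflow -/n.
      have -> : \sum_(l < n) (fr c l.+1 - fr c l) * W c x y z 0 l.+1 =
        \sum_(l < n - j) dl l * w0 l.+1 + \sum_(n - j <= l < n) dl l * w0 l.+1.
        by rewrite -(big_mkord xpredT (fun l => dl l * w0 l.+1)) -(big_mkord xpredT (fun l => (fr c l.+1 - fr c l) * W c x y z 0 l.+1)) -big_cat_nat //= leq_subr.
      under [X in _ = _ + (_ + X)]eq_bigr do rewrite mulrBr.
      by rewrite sumrB /wj /w0 /dl; ring.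
    apply: le_trans (ler_normD _ _) _; apply: lerD.
      apply: le_trans (ler_normD _ _) _; apply: lerD.
        apply: le_trans (ler_normD _ _) _.
        have jj : j%:R * (cM c / cN c) <= j.+1%:R * (cM c / cN c) by rewrite ler_wpM2r ?divr_ge0 // ler_nat.
        have h1 : `|(fr c (n - j)%N - fr c n) * wj (n - j).+1| <= A * (j%:R * (cM c / cN c)).
          have := @frA c (n - j) n; rewrite leq_subr leqnSn subKn // => /(_ isT) h.
          rewrite normrM distrC; have -> : A * (j%:R * (cM c / cN c)) = A * (j%:R / cN c) * cM c by ring.
          by apply: ler_pM => //; exact: WM.
        have h2 : `|\sum_(n - j <= l < n) dl l * w0 l.+1| <= A * (j%:R * (cM c / cN c)).
          apply: le_trans (ler_norm_sum _ _ _) _.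
          apply: (@le_trans _ _ (\sum_(n - j <= l < n) A / cN c * cM c)).
            rewrite big_nat_cond [leRHS]big_nat_cond; apply: ler_sum => l /andP[/andP[_ ln] _].
            by rewrite normrM; apply: ler_pM => //; [exact: dlB (ltnW ln)|exact: WM].
          by rewrite sumr_const_nat subKn // -[leLHS]mulr_natr; apply: le_of_eq; ring.
        apply: le_trans (lerD h1 h2) _.
        have -> : 2 * A * (j.+1%:R * (cM c / cN c)) = A * (j.+1%:R * (cM c / cN c)) + A * (j.+1%:R * (cM c / cN c)) by ring.
        by apply: lerD; exact: ler_wpM2l A0 _ _ jj.
      rewrite normrM distrC /wj /w0 -subSn //; apply: ler_wpM2r => //; exact: frB.
    apply: (@le_trans _ _ (B * D c j 0%N + \sum_(l < n - j) A / cN c * D c j l.+1)).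
      apply: le_trans (ler_normD _ _) _; apply: lerD; first by rewrite normrM ler_wpM2r //; exact: frB.
      apply: le_trans (ler_norm_sum _ _ _) _; apply: ler_sum => l _.
      by rewrite normrM ler_wpM2r //; apply: dlB; rewrite (leq_trans (ltnW (ltn_ord l))) // leq_subr.
    have D0 l : 0 <= D c j l by exact: normr_ge0.
    have iN : 0 <= (cN c)^-1 by rewrite invr_ge0.
    rewrite [in leRHS]big_mkcond [in leRHS]big_ord_recl /= addn0 (leqW jn) mulrDr; apply: lerD.
      rewrite mulrA; apply: ler_wpM2r => //; apply: (@le_trans _ _ ((A + B) * 1)); first by rewrite mulr1 lerDr.
      by rewrite ler_wpM2l ?addr_ge0 // lerDr.
    rewrite (big_ord_widen_cond n.+1 xpredT (fun l => A / cN c * D c j l.+1)) ?(leq_trans (leq_subr _ _)) //=.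
    rewrite mulr_sumr big_mkcond; apply: ler_sum => l _; rewrite /bump /= add1n addnS ltnS addr0.
    have [h|h] := ltnP l (n - j).
      have -> : (j + l <= n)%N by rewrite -leq_subRL // ltnW.
      by rewrite mulrA ler_wpM2r // ler_wpM2r // lerDl.
    by case: ifP => // _; rewrite ?mulr0 // !mulr_ge0 // addr_ge0.
  have -> : T c - (1 - ms y)^-1 * lineflow c (W c x y z 0) =
     \sum_(j < n.+1) ms y ^+ j * ((fr c (n - j)%N * W c x y z j (n - j).+1 - fr c 0%N * W c x y z j 0
      - \sum_(l < n - j) (fr c l.+1 - fr c l) * W c x y z j l.+1) - Bs) - ms y ^+ n.+1 / (1 - ms y) * Bs.
    by rewrite TE [X in _ - X * lineflow _ _]gsum -/Bs; under [in RHS]eq_bigr do rewrite mulrBr; rewrite sumrB -mulr_suml; ring.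
  apply: le_trans (ler_normB _ _) _.
  have iN : 0 <= (cN c)^-1 by rewrite invr_ge0.
  have h1 : `|ms y ^+ n.+1 / (1 - ms y) * Bs| <= (2 * B + A) * (1 - ms y)^-1 * (cM c * cq c).
    have y0 : 0 < (1 - ms y)^-1 by rewrite invr_gt0 subr_gt0.
    rewrite 2!normrM (ger0_norm (p0 _)) (gtr0_norm y0).
    have mq : ms y ^+ n.+1 <= cq c.
      apply: (@le_trans _ _ (mm m ^+ n)).
        apply: (@le_trans _ _ (ms y ^+ n)); first by rewrite exprS ler_piMl.
        by rewrite lerXn2r ?nnegrE ?(ltW (ms0 _)) ?(ltW (mm_gt0 m)) // ms_le_mm.
      apply: (@le_trans _ _ (cq c * cd c)); last by rewrite ler_piMr // ltW.
      apply: le_trans hm; rewrite ler_peMl ?exprn_ge0 ?(ltW (mm_gt0 m)) // exprn_ege1 //.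
    have -> : (2 * B + A) * (1 - ms y)^-1 * (cM c * cq c) = cq c * (1 - ms y)^-1 * ((2 * B + A) * cM c) by ring.
    by apply: ler_pM => //; [rewrite mulr_ge0 // ltW|rewrite ler_wpM2r // ltW].
  have h2 : `|\sum_(j < n.+1) ms y ^+ j * ((fr c (n - j)%N * W c x y z j (n - j).+1 - fr c 0%N * W c x y z j 0
      - \sum_(l < n - j) (fr c l.+1 - fr c l) * W c x y z j l.+1) - Bs)| <=
      \sum_(j < n.+1) ms y ^+ j * (2 * A * (j.+1%:R * (cM c / cN c)) + B * `|W c x y z 0 n.+1 - W c x y z j (n.+1 - j)| +
       (A + B) * \sum_(l < n.+2 | (j + l <= n.+1)%N) ((cN c)^-1 + (l == 0%N :> nat)%:R) * D c j l).
    apply: le_trans (ler_norm_sum _ _ _) _; apply: ler_sum => j _.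
    by rewrite normrM (ger0_norm (p0 _)); apply: ler_wpM2l => //; exact: Bdiff.
  apply: le_trans (lerD h2 h1) _.
  under eq_bigr do rewrite 2!mulrDr; rewrite !big_split /=.
  have g1 : \sum_(i < n.+1) ms y ^+ i * (2 * A * (i.+1%:R * (cM c / cN c))) <= 2 * A * G * (cM c * cq c).
    apply: (@le_trans _ _ (2 * A * (cM c / cN c) * \sum_(i < n.+1) i.+1%:R ^+ 1 * ms y ^+ i)).
      by rewrite mulr_sumr; apply: le_of_eq; apply: eq_bigr => i _; ring.
    have -> : 2 * A * G * (cM c * cq c) = 2 * A * (cM c * cq c) * G by ring.
    apply: ler_pM => //; first by rewrite !mulr_ge0.
      by apply: sumr_ge0 => i _; rewrite mulr_ge0.
    by rewrite ler_wpM2l ?mulr_ge0 // ler_wpM2l // (inN_le va).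
  have g2 : \sum_(i < n.+1) ms y ^+ i * (B * `|W c x y z 0 n.+1 - W c x y z i (n.+1 - i)|) <=
    B * \sum_(j < n.+2) ms y ^+ j * `|W c x y z 0 n.+1 - W c x y z j (n.+1 - j)|.
    rewrite mulr_sumr [leRHS]big_ord_recr /=; apply: ler_wpDr; first by do 2?apply: mulr_ge0.
    by apply: le_of_eq; apply: eq_bigr => i _; ring.
  have g3 : \sum_(i < n.+1) ms y ^+ i * ((A + B) * \sum_(l < n.+2 | (i + l <= n.+1)%N) ((cN c)^-1 + (l == 0%N :> nat)%:R) * D c i l)
    <= (A + B) * \sum_(l < n.+2) \sum_(j < n.+2 | (j + l <= n.+1)%N) ms y ^+ j * ((cN c)^-1 + (l == 0%N :> nat)%:R) * D c j l.
    rewrite (exchange_big_dep xpredT) //= mulr_sumr [leRHS]big_ord_recr /=; apply: ler_wpDr.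
      apply: mulr_ge0; first exact: addr_ge0.
      by apply: sumr_ge0 => l _; apply: mulr_ge0; [apply: mulr_ge0 => //; exact: addr_ge0|exact: normr_ge0].
    apply: ler_sum => j _; rewrite !mulr_sumr; apply: le_of_eq; apply: eq_bigr => l _; ring.
  rewrite /D in g3 *.
  move: g1 g2 g3; set a1 := \sum_(_ | _) _; set a2 := \sum_(_ | _) _; set a3 := \sum_(_ | _) _.
  set b2 := B * _; set b3 := (A + B) * _; move=> g1 g2 g3.
  by have := lerD (lerD g1 g2) g3; rewrite mulrDl; lra.
have := small_add s1 s2; apply: small_eq => c va; ring.
Qed.
End Triple.

(** * Exchanging sites inside a class *)

Definition U (c : ctx) x z l : R := cw c (c2 x z (cn c).+1 l).

(** The weights [1 / N] inside and 1 at both ends are those with which [lineflow] sees a function,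
    so exchangeable pairs of sites give the same [lineflow] up to a small error. *)
Definition exch x z x' z' := small (fun c => \sum_(l < (cn c).+2)
  ((cN c)^-1 + (l == 0%N :> nat)%:R + (l == (cn c).+1 :> nat)%:R) * `|U c x z l - U c x' z' l|).

Let iN0 (c : ctx) : 0 <= (cN c)^-1. Proof. by rewrite invr_ge0. Qed.

Lemma exch_refl x z : exch x z x z.
Proof.
by apply: small_eq (@small0 R S r m) => c _; rewrite big1 // => l _; rewrite subrr normr0 mulr0.
Qed.

Lemma exch_trans x z x' z' x'' z'' : exch x z x' z' -> exch x' z' x'' z'' -> exch x z x'' z''.
Proof.
move=> h1 h2; apply: small_le (small_add h1 h2) => c va.
rewrite ger0_norm; last by apply: sumr_ge0 => l _; rewrite mulr_ge0 // !addr_ge0.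
rewrite -big_split /=; apply: ler_sum => l _; rewrite -mulrDr ler_wpM2l ?addr_ge0 //.
by apply: le_trans (ler_normD _ _); rewrite addrA subrK.
Qed.

Lemma exch_swap x z x' z' : x != z -> x' != z' -> exch x z x' z' -> exch z x z' x'.
Proof.
move=> xz xz'; apply: small_eq => c _; rewrite (reindex_inj rev_ord_inj) /=; apply: eq_bigr => l _.
have lN : (l <= (cn c).+1)%N by rewrite -ltnS.
rewrite subSS /U (c2C xz) ?leq_subr // (c2C xz') ?leq_subr // subKn //.
have -> : ((cn c).+1 - l == 0)%N = (l == (cn c).+1 :> nat) by rewrite subn_eq0 eqn_leq lN.
have -> : ((cn c).+1 - l == (cn c).+1)%N = (l == 0 :> nat)%N.
  by apply/eqP/eqP => [h|->]; [have := subKn lN; rewrite h subnn|rewrite subn0].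
by rewrite addrAC.
Qed.

Lemma exch_adj x x' z : x \in Sstar -> x' \in Sstar -> z \in Sstar -> x != x' -> x != z -> x' != z ->
  0 < r x x' -> exch x z x' z.
Proof.
move=> xS x'S zS xx xz xz' rr.
apply: small_eq (transport_flat xx xz xz' xS zS rr x'S) => c va.
apply: eq_bigr => l _; have lN : (l <= (cn c).+1)%N by rewrite -ltnS.
rewrite /W c3_c2 // (c3_c2' (x := x')) //; last by rewrite eq_sym.
(* At [l = 0] all particles are at [z] in both configurations, so the end that [transport_flat] does
   not weigh contributes nothing. *)
have [->|l0] := posnP l; last by rewrite addr0.
by rewrite /U !c2_0 // subrr normr0 !mulr0.
Qed.

Lemma exch_class (C : cls) x x' z : x \in val C -> x' \in val C -> z \in Sstar -> z \notin val C -> exch x z x' z.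
Proof.
move=> xC x'C zS zC; have /connectP[p] := cls_conn r0 irr m0 m1 rev xC x'C.
elim: p x xC => [|y p IH] x xC /=; first by move=> _ ->; exact: exch_refl.
move=> /andP[/and3P[xS yS rxy] pp] e.
have yC : y \in val C by exact: (cls_r r0 irr m0 m1 rev xC yS rxy).
have nz u : u \in val C -> u != z by apply: contraTneq => ->.
apply: exch_trans (IH y yC pp e); have [->|xy] := eqVneq x y; first exact: exch_refl.
by apply: exch_adj; rewrite ?nz.
Qed.

Lemma exch_classes (C D : cls) x x' z z' : C != D -> x \in val C -> x' \in val C -> z \in val D -> z' \in val D ->
  exch x z x' z'.
Proof.
move=> CD xC x'C zD z'D.
have dis u : u \in val C -> u \in val D -> False.
  by move=> uC uD; case/eqP: CD; exact: (cls_eq r0 irr m0 m1 rev uC uD).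
have nxz a b : a \in val C -> b \in val D -> a != b.
  by move=> aC bD; apply: contraTneq isT => e; case: (dis a aC); rewrite e.
apply: (exch_trans (x' := x') (z' := z)).
  by apply: exch_class xC x'C (cls_sub zD) _; apply/negP => h; exact: dis h zD.
apply: exch_swap; rewrite 1?eq_sym ?nxz //.
by apply: exch_class zD z'D (cls_sub x'C) _; apply/negP; exact: dis.
Qed.

(** * Assembling the Dirichlet form *)

Variables (C : cls) (g b : cls -> R -> R) (L : R).
Hypothesis prof : forall D, D != C -> profile_spec C D (g D) (b D) L.
Local Notation gV c := (gr (@V C b (cn c).+1)).

Definition eterm u y v (c : ctx) : R :=
  \sum_(zeta | supp3 u y v zeta && (0 < cfg zeta v)%N) cond c zeta u y * (gV c zeta u y * gw c zeta u y).

Definition flux D x y z t : R := kap t (r x y) (r z y) * g D t.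

Lemma flux_lip D x y z : D != C -> exists B A : R, [/\ 0 <= B, 0 <= A,
  forall t, 0 <= t <= 1 -> `|flux D x y z t| <= B &
  forall s t, 0 <= s <= 1 -> 0 <= t <= 1 -> `|flux D x y z s - flux D x y z t| <= A * `|s - t|].
Proof.
move=> DC; have kl := lip01_kap (r0 x y) (r0 z y).
have [B [B0 hB]] := lip01_bound kl; have [A [A0 hA]] := kl.
have [L0 _ hb hl _] := prof DC.
have gb t : 0 <= t <= 1 -> `|g D t| <= L.
  by move=> ht; have [/andP[g0 gL] _] := hb t ht; rewrite ger0_norm.
exists (B * L), (A * L + B * L); split; rewrite ?addr_ge0 ?mulr_ge0 //.
  by move=> t ht; rewrite /flux normrM; apply: ler_pM => //; [exact: hB|exact: gb].
move=> s t hs ht; rewrite /flux.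
have -> : kap s (r x y) (r z y) * g D s - kap t (r x y) (r z y) * g D t =
  (kap s (r x y) (r z y) - kap t (r x y) (r z y)) * g D s + kap t (r x y) (r z y) * (g D s - g D t) by ring.
apply: le_trans (ler_normD _ _) _; rewrite [leRHS]mulrDl; apply: lerD.
  by rewrite normrM mulrAC; apply: ler_pM => //; [exact: hA|exact: gb].
rewrite normrM -mulrA; apply: ler_pM => //; first exact: hB.
by have [] := hl s t hs ht.
Qed.

Lemma edge_main D x y z : D != C -> x \in val C -> z \in val D -> y \notin Sstar ->
  small (fun c => eterm x y z c + eterm z y x c -
    sst^-1 * (1 - ms y)^-1 * lineflow (flux D x y z) c (U c x z)).
Proof.
move=> DC xC zD yS; have xS := cls_sub xC; have zS := cls_sub zD.
have xy := cls_xy xC yS; have yz := cls_yz zD yS.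
have xz := cls_xz DC xC zD.
have yx : y != x by rewrite eq_sym. have zy : z != y by rewrite eq_sym. have zx : z != x by rewrite eq_sym.
have [B [A [B0 A0 FB FA]]] := flux_lip x y z DC.
have F0 : r x y * r z y = 0 -> forall t, flux D x y z t = 0.
  by move=> e t; rewrite /flux /kap e !mul0r.
have fb (c : ctx) (zeta : Hn S (cn c)) : `|flux D x y z ((cfg zeta x)%:R / cN c)| <= B.
  by apply: FB; apply: frac_range; rewrite (leq_trans (cfg_le zeta x)).
have s1 : small (fun c => eterm x y z c - sst^-1 * \sum_(zeta | supp3 x y z zeta && (0 < cfg zeta z)%N)
     ms y ^+ cfg zeta y * flux D x y z ((cfg zeta x)%:R / cN c) * gw c zeta x y).
  (* A vanishing rate kills the conductance and the flux together, so the division by the rate in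
     [main_edge] is never at stake. *)
  have [e|ne] := eqVneq (r x y) 0.
    apply: small_eq (@small0 R S r m) => c _; rewrite /eterm !big1 ?mulr0 ?subrr // => zeta _.
      by rewrite F0 ?e ?mul0r // mulr0 mul0r.
    by rewrite /cnd /Kc e mulr0 !mul0r mulr0 mul0r.
  have rp : 0 < r x y by rewrite lt_def ne r0.
  have [K K0 hK] := grad_A prof DC xC zD yS rp.
  apply: (main_edge (V := fun n => @V C b n.+1) (K := K + B)) => //; first exact: addr_ge0.
    by move=> c zeta _; apply: le_trans (fb c zeta) _; rewrite lerDr.
  move=> c zeta va sp kp; apply: le_trans (hK _ _ sp kp) _.
  apply: ler_wpM2r; first by rewrite addr_ge0 ?invr_ge0 ?sqr_ge0 // divr_ge0.
  by apply: ler_wpM2r; rewrite ?sqr_ge0 // lerDl.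
have s2 : small (fun c => eterm z y x c - sst^-1 * \sum_(zeta | supp3 z y x zeta && (0 < cfg zeta x)%N)
     ms y ^+ cfg zeta y * (- flux D x y z ((cfg zeta x)%:R / cN c)) * gw c zeta z y).
  have [e|ne] := eqVneq (r z y) 0.
    apply: small_eq (@small0 R S r m) => c _; rewrite /eterm !big1 ?mulr0 ?subrr // => zeta _.
      by rewrite F0 ?e ?mulr0 // oppr0 mulr0 mul0r.
    by rewrite /cnd /Kc e mulr0 !mul0r mulr0 mul0r.
  have rp : 0 < r z y by rewrite lt_def ne r0.
  have [K K0 hK] := grad_B prof DC xC zD yS rp.
  apply: (main_edge (V := fun n => @V C b n.+1) (K := K + B)) => //; first exact: addr_ge0.
    by move=> c zeta _; rewrite normrN; apply: le_trans (fb c zeta) _; rewrite lerDr.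
  move=> c zeta va; rewrite supp3C => sp kp; apply: le_trans (hK _ _ sp kp) _.
  apply: ler_wpM2r; first by rewrite addr_ge0 ?invr_ge0 ?sqr_ge0 // divr_ge0.
  by apply: ler_wpM2r; rewrite ?sqr_ge0 // lerDl.
have s3 := edge_line xy xz yz xS zS yS B0 A0 FB FA F0.
apply: small_eq (small_add (small_add s1 s2) (small_mul sst^-1 s3)) => c va.
have -> : lineflow (flux D x y z) c (U c x z) = lineflow (flux D x y z) c (W c x y z 0).
  have e l : (l <= (cn c).+1)%N -> U c x z l = W c x y z 0 l by move=> ln; rewrite /U /W c3_c2.
  rewrite /lineflow !e //; congr (_ - _); apply: eq_bigr => l _; by rewrite e // ltnS ltnW.
by rewrite /edgeflow; ring.
Qed.

Lemma lineflow_exch (F : R -> R) (B A : R) x z x' z' : 0 <= B -> 0 <= A ->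
  (forall t, 0 <= t <= 1 -> `|F t| <= B) ->
  (forall s t, 0 <= s <= 1 -> 0 <= t <= 1 -> `|F s - F t| <= A * `|s - t|) ->
  exch x z x' z' -> small (fun c => lineflow F c (U c x z) - lineflow F c (U c x' z')).
Proof.
move=> B0 A0 FB FA h; apply: small_le (small_mul (B + A) h) => c va.
pose D l := `|U c x z l - U c x' z' l|.
have D0 l : 0 <= D l by exact: normr_ge0.
have -> : lineflow F c (U c x z) - lineflow F c (U c x' z') =
  F ((cn c)%:R / cN c) * (U c x z (cn c).+1 - U c x' z' (cn c).+1) - F (0%:R / cN c) * (U c x z 0 - U c x' z' 0)
  - \sum_(l < cn c) (F (l.+1%:R / cN c) - F (l%:R / cN c)) * (U c x z l.+1 - U c x' z' l.+1).
  rewrite /lineflow; under [X in _ = _ - X]eq_bigr do rewrite mulrBr.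
  by rewrite sumrB; ring.
have fB l : (l <= (cn c).+1)%N -> `|F (l%:R / cN c)| <= B by move=> ln; apply: FB; exact: frac_range.
apply: (@le_trans _ _ (B * D (cn c).+1 + B * D 0%N + \sum_(l < cn c) A / cN c * D l.+1)).
  apply: le_trans (ler_normB _ _) _; apply: lerD.
    by apply: le_trans (ler_normB _ _) _; apply: lerD; rewrite normrM ler_wpM2r // fB.
  apply: le_trans (ler_norm_sum _ _ _) _; apply: ler_sum => l _; rewrite normrM ler_wpM2r //.
  by have := frA FA (c := c) (k := l) (l := l.+1); rewrite leqnSn ltnS ltnW // subSnn mul1r => /(_ isT).
rewrite big_ord_recl big_ord_recr /= addr0.
have h0 k : 0 <= (cN c)^-1 + k%:R :> R by exact: addr_ge0.
have e1 : B * D (cn c).+1 <= (B + A) * (((cN c)^-1 + (bump 0 (cn c) == 0%N)%:R + (bump 0 (cn c) == (cn c).+1)%:R) * D (cn c).+1).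
  rewrite mulrA; apply: ler_wpM2r => //; rewrite eqxx -[X in X <= _]mulr1; apply: ler_pM => //; first by rewrite lerDl.
  by rewrite addr0 lerDr.
have e2 : B * D 0%N <= (B + A) * (((cN c)^-1 + 1) * D 0%N).
  rewrite mulrA; apply: ler_wpM2r => //; rewrite -[X in X <= _]mulr1; apply: ler_pM => //; first by rewrite lerDl.
  by rewrite lerDr.
have e3 : \sum_(l < cn c) A / cN c * D l.+1 <= (B + A) * \sum_(l < cn c) (((cN c)^-1 + (bump 0 l == 0%N)%:R + (bump 0 l == (cn c).+1)%:R) * D (bump 0 l)).
  rewrite mulr_sumr; apply: ler_sum => l _; rewrite mulrA /bump add1n; apply: ler_wpM2r => //.
  apply: ler_pM => //; first by rewrite lerDr.
  by rewrite -addrA lerDl addr_ge0.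
rewrite mulrDr mulrDr; apply: le_trans (lerD (lerD e1 e2) e3) _.
by rewrite -[leLHS]addrA [leLHS]addrC -[leLHS]addrA.
Qed.

Variable rep : cls -> S.
Hypothesis repP : forall D, rep D \in val D.

Let sumE : forall F : S -> R, \sum_(x in Sstar) F x = \sum_(A : cls) \sum_(x in val A) F x.
Proof. exact: (sum_Sstar r0 irr m0 m1 rev). Qed.

Let clsE (D D' : cls) x : x \in val D -> x \in val D' -> D = D'.
Proof. exact: cls_eq. Qed.

Lemma inC (D : cls) x : x \in val D -> (x \in val C) = (D == C).
Proof. by move=> xD; apply/idP/eqP => [h|<-//]; exact: clsE xD h. Qed.

Lemma main_sum (c : ctx) :
  \sum_(x in Sstar) \sum_(y | y \notin Sstar) \sum_z \sum_(zeta | mainp C x y z zeta)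
      cond c zeta x y * (gV c zeta x y * gw c zeta x y) =
  \sum_(D | D != C) \sum_(x in val C) \sum_(z in val D) \sum_(y | y \notin Sstar)
     (eterm x y z c + eterm z y x c).
Proof.
pose e x y z : R := if (x \in val C) (+) (z \in val C) then eterm x y z c else 0.
transitivity (\sum_(x in Sstar) \sum_(z in Sstar) \sum_(y | y \notin Sstar) e x y z).
  apply: eq_bigr => x xS; rewrite [RHS]exchange_big /=; apply: eq_bigr => y yS.
  rewrite [RHS]big_mkcond /=; apply: eq_bigr => z _; rewrite /e /eterm /mainp.
  case: ifP => zS; last by rewrite big_pred0.
  by case: ifP => h; [|rewrite big_pred0].
rewrite sumE; under eq_bigr do under eq_bigr do rewrite sumE.
transitivity (\sum_(A : cls) \sum_(D : cls) \sum_(x in val A) \sum_(z in val D) \sum_(y | y \notin Sstar)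
   if (A == C) (+) (D == C) then eterm x y z c else 0).
  apply: eq_bigr => A _; rewrite exchange_big /=; apply: eq_bigr => D _; apply: eq_bigr => x xA.
  by apply: eq_bigr => z zD; apply: eq_bigr => y _; rewrite /e (inC xA) (inC zD).
have z0 (A D : cls) : (A == C) (+) (D == C) = false -> \sum_(x in val A) \sum_(z in val D) \sum_(y | y \notin Sstar)
   (if (A == C) (+) (D == C) then eterm x y z c else 0) = 0.
  by move=> ->; do 3!(apply: big1 => ? _).
rewrite (bigD1 C) //= (bigD1 C) //= z0 ?addbb // add0r.
have -> : \sum_(i | i != C) \sum_(D : cls) \sum_(x in val i) \sum_(z in val D) \sum_(y | y \notin Sstar)
    (if (i == C) (+) (D == C) then eterm x y z c else 0) =
  \sum_(D | D != C) \sum_(x in val C) \sum_(z in val D) \sum_(y | y \notin Sstar) eterm z y x c.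
  apply: eq_bigr => D /negbTE DC; rewrite (bigD1 C) //= [X in _ + X]big1 => [|A /negbTE nA]; last by rewrite z0 // DC nA.
  rewrite addr0 [RHS]exchange_big /=; do 3!(apply: eq_bigr => ? _); by rewrite DC eqxx.
rewrite -big_split /=; apply: eq_bigr => D /negbTE DC; rewrite -big_split /=; apply: eq_bigr => x _.
rewrite -big_split /=; apply: eq_bigr => z _; rewrite -big_split /=; apply: eq_bigr => y _.
by rewrite DC eqxx.
Qed.

(* Hydrodynamic form of the generator against the test function [V]: only the values at the condensates survive. *)
Theorem Dir_V : small (fun c => theta_ c * Dir r ms (cd c) (@V C b (cn c).+1) (cw c) -
  sst^-1 * \sum_(D | D != C) rho C D * (cw c (xi (cn c).+1 (rep C)) - cw c (xi (cn c).+1 (rep D)))).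
Proof.
apply: small_trans (reduce_main prof) _.
pose x0 := rep C.
(* The flux through a single triple of sites is not constant along the line. All lines joining [C]
   to [D] are first replaced by the one between the representatives, so that their fluxes can be
   added. *)
pose T D x z y (c : ctx) := sst^-1 * (1 - ms y)^-1 * lineflow (flux D x y z) c (U c x z).
pose T0 D x z y (c : ctx) := sst^-1 * (1 - ms y)^-1 * lineflow (flux D x y z) c (U c x0 (rep D)).
have h1 : small (fun c => \sum_(D | D != C) \sum_(x in val C) \sum_(z in val D) \sum_(y | y \notin Sstar)
   ((eterm x y z c + eterm z y x c - T D x z y c) + (T D x z y c - T0 D x z y c))).
  apply: small_sum => D DC; apply: small_sum => x xC; apply: small_sum => z zD; apply: small_sum => y yS.
  apply: small_add; first exact: edge_main.
  have [B [A [B0 A0 FB FA]]] := flux_lip x y z DC.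
  have ex : exch x z x0 (rep D) by apply: (exch_classes (C := C) (D := D)); rewrite ?repP // eq_sym.
  apply: small_eq (small_mul (sst^-1 * (1 - ms y)^-1) (lineflow_exch B0 A0 FB FA ex)) => c _.
  by rewrite /T /T0 mulrBr.
apply: small_eq h1 => c va; rewrite main_sum.
(* This is where the profile enters: the total flux over all triples is [csum * g], constant and
   equal to [rho]. The interior terms of [lineflow] then vanish and only the two condensates
   remain. *)
have ends l : (l <= (cn c).+1)%N -> forall D, D != C ->
  \sum_(x in val C) \sum_(z in val D) \sum_(y | y \notin Sstar) (1 - ms y)^-1 * flux D x y z (l%:R / cN c) = rho C D.
  move=> ln D DC; have [_ _ _ _ h] := prof DC; rewrite -(h _ (frac_range ln)) /csum mulr_suml.
  apply: eq_bigr => x _; rewrite mulr_suml; apply: eq_bigr => z _; rewrite mulr_suml.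
  apply: eq_big => [y|y _]; first by rewrite finset.in_setC.
  by rewrite /flux -/(cN c); ring.
have T0E D : D != C -> \sum_(x in val C) \sum_(z in val D) \sum_(y | y \notin Sstar) T0 D x z y c =
  sst^-1 * (rho C D * (cw c (xi (cn c).+1 (rep C)) - cw c (xi (cn c).+1 (rep D)))).
  move=> DC; have xz : x0 != rep D.
    by apply: contraNneq DC => e; rewrite (clsE (repP D) (_ : rep D \in val C)) // -e repP.
  transitivity (sst^-1 * (rho C D * U c x0 (rep D) (cn c).+1 - rho C D * U c x0 (rep D) 0 - \sum_(l < cn c) (rho C D - rho C D) * U c x0 (rep D) l.+1)).
    rewrite -[X in X * U _ _ _ (cn c).+1](ends (cn c)) // -[X in X * U _ _ _ 0](ends 0%N) //.
    have -> : \sum_(l < cn c) (rho C D - rho C D) * U c x0 (rep D) l.+1 = \sum_(l < cn c)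
      \sum_(x in val C) \sum_(z in val D) \sum_(y | y \notin Sstar) (1 - ms y)^-1 * (flux D x y z (l.+1%:R / cN c) - flux D x y z (l%:R / cN c)) * U c x0 (rep D) l.+1.
      apply: eq_bigr => l _; rewrite -{1}(ends l.+1) ?ltnS ?(ltnW (ltn_ord l)) // -(ends l) ?(leqW (ltnW (ltn_ord l))) //.
      rewrite -sumrB mulr_suml; apply: eq_bigr => x _; rewrite -sumrB mulr_suml; apply: eq_bigr => z _.
      by rewrite -sumrB mulr_suml; apply: eq_bigr => y _; ring.
    rewrite [X in _ * (_ - X)]exchange_big /= !mulr_suml -!sumrB mulr_sumr; apply: eq_bigr => x _.
    rewrite [X in _ * (_ - X)]exchange_big /= !mulr_suml -!sumrB mulr_sumr; apply: eq_bigr => z _.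
    rewrite [X in _ * (_ - X)]exchange_big /= !mulr_suml -!sumrB mulr_sumr; apply: eq_bigr => y _.
    rewrite /T0 /lineflow.
    have -> : \sum_(i < cn c) (1 - ms y)^-1 * (flux D x y z (i.+1%:R / cN c) - flux D x y z (i%:R / cN c)) * U c x0 (rep D) i.+1 =
      (1 - ms y)^-1 * \sum_(i < cn c) (flux D x y z (i.+1%:R / cN c) - flux D x y z (i%:R / cN c)) * U c x0 (rep D) i.+1.
      by rewrite mulr_sumr; apply: eq_bigr => i _; rewrite mulrA.
    by ring.
  rewrite big1 => [|l _]; last by rewrite subrr mul0r.
  by rewrite subr0 /U c2_max // c2_0 // -mulrBr.
rewrite mulr_sumr -sumrB; apply: eq_bigr => D DC; rewrite -T0E //.
rewrite -sumrB; apply: eq_bigr => x _; rewrite -sumrB; apply: eq_bigr => z _; rewrite -sumrB; apply: eq_bigr => y _.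
by ring.
Qed.
End Condensates.

(** * Eventual statements and growth estimates *)

Definition ev (P : nat -> Prop) := exists n0, forall n, (n0 <= n)%N -> P n.

Lemma ev_and (P Q : nat -> Prop) : ev P -> ev Q -> ev (fun n => P n /\ Q n).
Proof.
move=> [a ha] [b hb]; exists (maxn a b) => n; rewrite geq_max => /andP[h1 h2]; split; [exact: ha|exact: hb].
Qed.

Lemma ev_impl (P Q : nat -> Prop) : (forall n, P n -> Q n) -> ev P -> ev Q.
Proof. by move=> h [a ha]; exists a => n an; apply: h; exact: ha. Qed.

Lemma ev_shift (P : nat -> Prop) : ev P -> ev (fun n => P n.+1).
Proof. by move=> [a ha]; exists a => n an; apply: ha; exact: leqW. Qed.

Lemma ev_unshift (P : nat -> Prop) : ev (fun n => P n.+1) -> ev P.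
Proof. by move=> [a ha]; exists a.+1 => -[//|n] an; exact: ha. Qed.

Lemma ev_all (I : finType) (P : I -> nat -> Prop) : (forall i, ev (P i)) -> ev (fun n => forall i, P i n).
Proof.
move=> h; have [f hf] := choice h.
exists (\max_i f i) => n hn i; apply: (hf i); apply: leq_trans hn; exact: leq_bigmax.
Qed.

Section Asymptotics.
Variable R : realType.

Lemma ev_near (P : nat -> Prop) : ev P -> \forall n \near \oo, P n.
Proof. by move=> [a ha]; exists a => // n /= an; exact: ha. Qed.

Lemma near_ev (P : nat -> Prop) : (\forall n \near \oo, P n) -> ev P.
Proof. by move=> [a _ ha]; exists a => n an; exact: ha. Qed.

Lemma cvg0_ev (u : nat -> R) : u @ \oo --> (0 : R) -> forall e, 0 < e -> ev (fun n => `|u n| <= e).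
Proof.
move=> /cvgrPdist_le h e e0; apply: near_ev; have := h e e0.
by apply: filterS => n; rewrite sub0r normrN.
Qed.

Lemma cvgy_ev (u : nat -> R) : u @ \oo --> +oo -> forall A : R, ev (fun n => A <= u n).
Proof. by move=> /cvgryPge h A; apply: near_ev; exact: h. Qed.

Lemma harm_ln n : harm R n.+1 <= 1 + ln (n.+1%:R : R).
Proof.
elim: n => [|n IH]; first by rewrite /harm big_ord_recl big_ord0 addr0 invr1 ln1 addr0.
rewrite /harm big_ord_recr /= -/(harm R n.+1).
apply: le_trans (lerD IH (lexx _)) _; rewrite -addrA lerD2l.
have n2 : 0 < n.+2%:R :> R by rewrite ltr0n.
have n1 : 0 < n.+1%:R :> R by rewrite ltr0n.
rewrite -lerBrDl -ln_div ?posrE // -ler_expR lnK ?posrE ?divr_gt0 //.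
have : 1 + - n.+2%:R^-1 <= expR (- n.+2%:R^-1 : R) by exact: expR_ge1Dx.
move=> h; rewrite -[X in _ <= X]invrK -invf_div -[leLHS]invrK lef_pV2 ?posrE ?invr_gt0 ?expR_gt0 ?divr_gt0 //.
rewrite -expRN; apply: le_trans h; apply: le_of_eq.
by field; rewrite ?pnatr_eq0 -?natr1 ?gt_eqF.
Qed.

(** The cube leaves one spare logarithm, which beats any constant when the square of the logarithm
    is compared with [N]. *)
Lemma ln_cube (x : R) : 1 <= x -> (ln x) ^+ 3 <= 27 * x.
Proof.
move=> x1; have x0 : 0 < x by exact: lt_le_trans ltr01 x1.
have l0 : 0 <= ln x by exact: ln_ge0.
have h : ln x / 3 <= expR (ln x / 3) by apply: le_trans (expR_ge1Dx _); rewrite lerDr.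
have -> : 27 * x = (3 * expR (ln x / 3)) ^+ 3.
  rewrite exprMn -expRM_natl; have -> : 3%:R * (ln x / 3) = ln x by rewrite mulrC divfK // pnatr_eq0.
  by rewrite lnK ?posrE //; ring.
rewrite lerXn2r ?nnegrE // ?mulr_ge0 ?expR_ge0 //.
by rewrite -ler_pdivrMl // mulrC.
Qed.

Lemma ev_ln (A : R) : ev (fun n => A <= ln (n%:R : R)).
Proof.
have [k hk] : exists k : nat, expR A <= k%:R by exists (Num.bound (expR A)); apply: ltW; apply: archi_boundP; exact: expR_ge0.
exists k.+1 => n kn; rewrite -ler_expR lnK ?posrE ?ltr0n; last by case: n kn.
by apply: le_trans hk _; rewrite ler_nat ltnW.
Qed.

Lemma pow_exp_bound (k : nat) (e : R) : 0 < e -> exists C : R, 0 <= C /\ forall n : nat, n%:R ^+ k <= C * expR (e * n%:R).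
Proof.
move=> e0; have [->|k0] := posnP k.
  exists 1; split => // n; rewrite expr0 mul1r -expR0 ler_expR; apply: mulr_ge0 => //; exact: ltW.
have kk : 0 < k%:R :> R by rewrite ltr0n.
exists ((k%:R / e) ^+ k); split; first by rewrite exprn_ge0 // divr_ge0 // ltW.
move=> n; have -> : expR (e * n%:R) = expR (e * n%:R / k%:R) ^+ k.
  by rewrite -expRM_natl [k%:R * _]mulrC divfK // gt_eqF.
rewrite -exprMn lerXn2r ?nnegrE //; first by rewrite mulr_ge0 ?expR_ge0 // divr_ge0 // ltW.
have h : e * n%:R / k%:R <= expR (e * n%:R / k%:R) by apply: le_trans (expR_ge1Dx _); rewrite lerDr.
apply: le_trans (ler_wpM2l _ h); last by rewrite divr_ge0 // ltW.
apply: le_of_eq; field; by rewrite !gt_eqF.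
Qed.
End Asymptotics.

(** A square linear system is solvable as soon as it is injective; the rows of boundary points are
    those of the identity. *)
Lemma solve_boundary (R : realType) (E : finType) (G : E -> E -> R) (B : {set E}) :
  (forall f : E -> R, (forall x, x \notin B -> \sum_y G x y * f y = 0) -> (forall x, x \in B -> f x = 0) -> forall x, f x = 0) ->
  forall h : E -> R, exists f : E -> R, (forall x, x \notin B -> \sum_y G x y * f y = h x) /\ (forall x, x \in B -> f x = h x).
Proof.
move=> inj h; pose M : 'M[R]_#|E| := \matrix_(j, i) if enum_val i \in B then (i == j)%:R else G (enum_val i) (enum_val j).
have ME (v : 'rV[R]_#|E|) x : (v *m M) 0 (enum_rank x) = if x \in B then v 0 (enum_rank x) else \sum_y G x y * v 0 (enum_rank y).
  rewrite mxE; under eq_bigr do rewrite mxE enum_rankK.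
  case: ifP => xB.
    rewrite (bigD1 (enum_rank x)) //= eqxx mulr1 big1 ?addr0 // => j /negbTE jx.
    by rewrite eq_sym jx mulr0.
  rewrite (reindex (@enum_rank E)); last by apply: onW_bij; exact: enum_rank_bij.
  by apply: eq_bigr => y _; rewrite enum_rankK mulrC.
have fM : row_free M.
  apply: inj_row_free => v vM; have v0 : forall x, v 0 (enum_rank x) = 0.
    apply: (inj (fun x => v 0 (enum_rank x))) => x xB.
      by have := ME v x; rewrite vM mxE (negbTE xB) => <-.
    by have := ME v x; rewrite vM mxE xB => <-.
  by apply/rowP => j; rewrite mxE -(enum_valK j) v0.
have uM : M \in unitmx by rewrite -row_free_unit.
pose v := (\row_j h (enum_val j)) *m invmx M.
have vM : v *m M = \row_j h (enum_val j) by rewrite mulmxKV.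
exists (fun x => v 0 (enum_rank x)); split => x xB; have := ME v x; rewrite vM mxE enum_rankK ?xB // (negbTE xB) => <- //.
Qed.

(** * Finitely valued random variables and covering of events *)

Section FiniteVariable.
Variables (R : realType) (dT : measure_display) (T : measurableType dT) (P : probability T R).
Variables (I : finType) (V : T -> I).
Hypothesis mV : forall i, measurable [set w | V w = i].

Lemma measurable_finpred (A : pred I) : measurable [set w | A (V w)].
Proof.
have -> : [set w | A (V w)] = \bigcup_(i in [set i | A i]) [set w | V w = i].
  by apply/seteqP; split => w /=; [move=> Aw; exists (V w)|move=> [i Ai /= ->]].
by apply: fin_bigcup_measurable => //; exact: finite_finset.
Qed.

Lemma measurable_finfun (Phi : I -> R) : measurable_fun [set: T] (fun w => Phi (V w)).
Proof.
move=> _ Y mY; rewrite setTI.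
have -> : (fun w => Phi (V w)) @^-1` Y = [set w | (fun i => `[< Y (Phi i) >]) (V w)].
  by apply/seteqP; split => w /=; [move=> h; apply/asboolP|move/asboolP].
exact: (measurable_finpred (fun i => `[< Y (Phi i) >])).
Qed.

Variable p : I -> R.
Hypothesis hp : forall i, P [set w | V w = i] = (p i)%:E.

Lemma finite_expectation (Phi : I -> R) : (\int[P]_w (Phi (V w))%:E = (\sum_i Phi i * p i)%:E)%E.
Proof.
have e w : ((Phi (V w))%:E = \sum_(i <- index_enum I) (Phi i)%:E * (\1_[set w | V w = i] w)%:E)%E.
  rewrite (bigD1 (V w)) //= [X in (_ + X)%E]big1 ?adde0; last first.
    by move=> i /eqP iV; rewrite indicE memNset ?mule0 // => /esym.
  by rewrite indicE mem_set // mule1.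
under eq_integral do rewrite e.
have ind i : P.-integrable setT (fun w => (\1_[set w | V w = i] w)%:E)%E.
  apply: integrable_indic => //; exact: measurableT.
rewrite integral_sum //=; last by move=> i; apply: integrableZl.
rewrite -sumEFin; apply: eq_bigr => i _.
by rewrite integralZl //= integral_indic //= setIT hp.
Qed.

Lemma finite_probability (A : pred I) : P [set w | A (V w)] = (\sum_(i | A i) p i)%:E.
Proof.
have h := finite_expectation (fun i => (A i)%:R).
have mA := measurable_finpred A.
rewrite -[LHS](_ : \int[P]_w (\1_[set w | A (V w)] w)%:E = _)%E; last by rewrite integral_indic // setIT.
transitivity (\int[P]_w ((A (V w))%:R : R)%:E)%E.
  apply: eq_integral => w _; rewrite indicE; congr (_%:R%:E).
  by case: (boolP (A (V w))) => h'; [rewrite mem_set|rewrite memNset // => /=; rewrite (negbTE h')].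
rewrite h; congr (_%:E); rewrite [RHS]big_mkcond; apply: eq_bigr => i _.
by case: (A i); rewrite ?mul1r ?mul0r.
Qed.
End FiniteVariable.

(* Event times are only seen through grids: an event implying [A p] for all large [p] is as rare as the [A p] are. *)
Lemma liminf_cover (R : realType) dT (T : measurableType dT) (P : probability T R) (Ev : set T) (A : nat -> set T) (b : R) :
  (forall p, measurable (A p)) -> (forall w, Ev w -> ev (fun p => A p w)) ->
  (forall e : R, 0 < e -> ev (fun p => (P (A p) <= (b + e)%:E)%E)) ->
  exists M, [/\ measurable M, Ev `<=` M & (P M <= b%:E)%E].
Proof.
move=> mA cov bd; pose F n := \bigcap_(p in [set p | (n <= p)%N]) A p.
have mF n : measurable (F n) by apply: bigcap_measurable => [|k _]; [exists n => /=|exact: mA].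
exists (\bigcup_n F n); split.
- exact: bigcupT_measurable.
- by move=> w /cov [n hn]; exists n => // p /= np; exact: hn.
- have cF : nondecreasing_seq F.
    by move=> n n' nn'; apply/subsetPset => w Fw p /= n'p; apply: Fw => /=; exact: leq_trans nn' n'p.
  have cv := nondecreasing_cvg_mu (mu := P) mF (bigcupT_measurable _ mF) cF.
  rewrite -(cvg_lim _ cv) //; apply/lee_addgt0Pr => e e0.
  have [n0 h0] := bd e e0.
  apply: lime_le; first by apply/cvg_ex; eexists; exact: cv.
  apply: nearW => n /=; apply: (@le_trans _ _ (P (A (maxn n n0)))).
    by apply: le_measure; rewrite ?inE //; move=> w; apply => /=; exact: leq_maxl.
  by rewrite -EFinD; apply: h0; exact: leq_maxr.
Qed.

(** * Sampled paths and occupation times *)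

Section Process.
Variables (R : realType) (E : finType) (Q : E -> E -> R).
Variables (dT : measure_display) (T : measurableType dT) (P : probability T R) (x0 : E) (X : R -> T -> E).
Hypothesis hX : is_ctmc Q P x0 X.

Lemma ctmc_meas t (A : pred E) : measurable [set w | A (X t w)].
Proof. by case: hX => _ mX _; exact: measurable_finpred. Qed.

Lemma ctmc_cadlag w : cadlag (X^~ w). Proof. by case: hX. Qed.

(** Expectation of a functional of [n] samples taken at mesh [h], by first-step recursion. The
    functional receives the states after the initial one, which is why its users put the initial
    state back at the head. *)
Fixpoint epath n (h : R) (x : E) (Phi : seq E -> R) : R :=
  if n is n'.+1 then \sum_y trans Q h x y * epath n' h y (fun s => Phi (y :: s)) else Phi [::].

Definition grid (t h : R) n : seq R := [seq t + h *+ i | i <- iota 0 n.+1].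
Definition smp (t h : R) n (w : T) : seq E := [seq X s w | s <- grid t h n].

Lemma gridS t h n : grid t h n.+1 = t :: grid (t + h) h n.
Proof.
rewrite /grid [iota 0 n.+2]/= map_cons mulr0n addr0; congr (_ :: _).
by rewrite -[(1 :: _)%N]/(iota (1 + 0) n.+1) iotaDl -map_comp; apply: eq_map => i /=; rewrite -addrA -mulrS.
Qed.

Lemma size_smp t h n w : size (smp t h n w) == n.+1.
Proof. by rewrite size_map size_map size_iota. Qed.

Lemma nth_smp t h n w i y : (i <= n)%N -> nth y (smp t h n w) i = X (t + h *+ i) w.
Proof.
move=> ni; have si : (i < size (iota 0 n.+1))%N by rewrite size_iota ltnS.
by rewrite (nth_map 0) ?size_map // (nth_map 0%N) // nth_iota ?ltnS.
Qed.

Lemma epath_law t t0 h n (Phi : seq E -> R) x :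
  \sum_(xs : n.+1.-tuple E) Phi xs * fdd_prod Q t x (zip (grid t0 h n) xs) =
  \sum_y trans Q (t0 - t) x y * epath n h y (fun s => Phi (y :: s)).
Proof.
elim: n t t0 x Phi => [|n ih] t t0 x Phi.
  rewrite (reindex (fun y : E => [tuple y])) /=; last first.
    by exists (fun s : 1.-tuple E => thead s) => [y _|xs _] //=; rewrite [RHS]tuple_eta; apply: val_inj => /=; rewrite [behead _](congr1 val (tuple0 (behead_tuple xs))).
  by apply: eq_bigr => y _; rewrite addr0 mulr1 mulrC.
rewrite gridS (reindex (fun p : E * n.+1.-tuple E => cons_tuple p.1 p.2)) /=; last first.
  exists (fun xs : n.+2.-tuple E => (thead xs, behead_tuple xs)) => [[y s] _|xs _] /=.
    by congr (_, _); apply: val_inj.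
  by rewrite [RHS]tuple_eta; apply: val_inj.
rewrite -(pair_big xpredT xpredT (fun y (s : n.+1.-tuple E) => Phi (y :: s) * fdd_prod Q t x (zip (t0 :: grid (t0 + h) h n) (y :: s)))) /=.
apply: eq_bigr => y _.
transitivity (trans Q (t0 - t) x y * \sum_(s : n.+1.-tuple E) Phi (y :: s) * fdd_prod Q t0 y (zip (grid (t0 + h) h n) s)).
  by rewrite mulr_sumr; apply: eq_bigr => s _; rewrite mulrCA.
by congr (_ * _); rewrite (ih t0 (t0 + h) y (fun s => Phi (y :: s))) addrAC subrr add0r.
Qed.

Lemma grid_sorted t h n : 0 <= h -> path <=%R t (grid t h n).
Proof.
move=> h0; elim: n t => [|n ih] t; first by rewrite /grid /= addr0 lexx.
rewrite gridS /= lexx /=; have := ih (t + h); rewrite /grid /= addr0 lexx /= => ->.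
by rewrite andbT lerDl.
Qed.

Lemma smp_meas t h n (xs : n.+1.-tuple E) : measurable [set w | Tuple (size_smp t h n w) = xs].
Proof.
have -> : [set w | Tuple (size_smp t h n w) = xs] =
  \bigcap_(i in [set i : nat | True]) [set w | (n < i)%N || (X (t + h *+ i) w == nth x0 xs i)].
  apply/seteqP; split => w /=.
    by move=> <- i _; case: (ltnP n i) => //= ni; rewrite nth_smp.
  move=> hw; apply: val_inj => /=; apply: (@eq_from_nth _ x0); first by rewrite size_tuple (eqP (size_smp _ _ _ _)).
  move=> i; rewrite (eqP (size_smp _ _ _ _)) ltnS => ni; rewrite nth_smp //.
  by have := hw i I => /=; rewrite ltnNge ni => /eqP.
apply: bigcap_measurable => [|i _]; first by exists 0%N.
by apply: (ctmc_meas (t + h *+ i) (fun x => (n < i)%N || (x == nth x0 xs i))).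
Qed.

Lemma smp_prob t h n (xs : n.+1.-tuple E) : 0 <= t -> 0 <= h ->
  P [set w | Tuple (size_smp t h n w) = xs] = (fdd_prod Q 0 x0 (zip (grid t h n) xs))%:E.
Proof.
move=> t0 h0; case: hX => _ _ fdd.
have sz : size (grid t h n) = n.+1 by rewrite size_map size_iota.
rewrite -(fdd (grid t h n) xs) ?sz ?size_tuple //; last first.
  have := grid_sorted t n h0; rewrite /grid /= addr0 => /andP[_ ->].
  by rewrite andbT.
congr (P _); apply/seteqP; split => w /=.
  by move=> <- i ni; rewrite /= nth_smp // /grid (nth_map 0%N) ?size_iota // nth_iota.
move=> hw; apply: val_inj => /=; apply: (@eq_from_nth _ x0); first by rewrite size_tuple (eqP (size_smp _ _ _ _)).
by move=> i; rewrite (eqP (size_smp _ _ _ _)) => ni; rewrite (nth_map 0) ?sz // hw.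
Qed.

Lemma path_expectation t h n (Phi : seq E -> R) : 0 <= t -> 0 <= h ->
  (\int[P]_w (Phi (smp t h n w))%:E = (\sum_y trans Q t x0 y * epath n h y (fun s => Phi (y :: s)))%:E)%E.
Proof.
move=> t0 h0.
rewrite (finite_expectation (V := fun w => Tuple (size_smp t h n w)) (@smp_meas t h n)
  (fun xs => smp_prob xs t0 h0) (fun xs : n.+1.-tuple E => Phi xs)).
by congr (_%:E); rewrite epath_law subr0.
Qed.

Lemma path_meas t h n (A : seq E -> bool) : measurable [set w | A (smp t h n w)].
Proof. exact: (measurable_finpred (@smp_meas t h n) (fun xs : n.+1.-tuple E => A xs)). Qed.

Lemma path_fun_meas t h n (Phi : seq E -> R) : measurable_fun [set: T] (fun w => Phi (smp t h n w)).
Proof. exact: (measurable_finfun (@smp_meas t h n) (fun xs : n.+1.-tuple E => Phi xs)). Qed.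

Lemma path_probability t h n (A : seq E -> bool) : 0 <= t -> 0 <= h ->
  P [set w | A (smp t h n w)] = (\sum_y trans Q t x0 y * epath n h y (fun s => (A (y :: s))%:R))%:E.
Proof.
move=> t0 h0; have := epath_law 0 t h n (fun s => (A s)%:R) x0; rewrite subr0 => <-.
rewrite (finite_probability (V := fun w => Tuple (size_smp t h n w)) (@smp_meas t h n)
  (fun xs => smp_prob xs t0 h0) (fun xs : n.+1.-tuple E => A xs)).
congr (_%:E); rewrite big_mkcond; apply: eq_bigr => s _.
by case: (A s); rewrite ?mul1r ?mul0r.
Qed.

Lemma marginal t (A : pred E) : 0 <= t -> P [set w | A (X t w)] = (\sum_(y | A y) trans Q t x0 y)%:E.
Proof.
move=> t0; have := path_probability 0 (fun s => A (head x0 s)) t0 (lexx 0).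
rewrite /smp /grid /= addr0 => ->; congr (_%:E); rewrite [RHS]big_mkcond; apply: eq_bigr => y _.
by case: (A y); rewrite ?mulr1 ?mulr0.
Qed.

(** An infimum need not be compared through attained times: right-continuity keeps the path out of
    [B] for a while after the witness [t], which makes the inequality strict. *)
Lemma hit_lt (A B : {set E}) w : (hit X A w < hit X B w)%E <->
  exists2 t : R, 0 <= t & X t w \in A /\ forall s : R, 0 <= s <= t -> X s w \notin B.
Proof.
split.
  move=> /ereal_inf_lt[_ [t [t0 tA] <-] tB]; exists t => //; split => // s /andP[s0 st].
  apply/negP => sB; move: tB; rewrite ltNge => /negP; apply.
  by apply: (@le_trans _ _ s%:E); [apply: ereal_inf_lbound; exists s|rewrite lee_fin].
move=> [t t0 [tA tB]]; have [[e [e0 he]] _] := ctmc_cadlag w t0.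
apply: (@le_lt_trans _ _ t%:E); first by apply: ereal_inf_lbound; exists t.
apply: (@lt_le_trans _ _ (t + e)%:E); first by rewrite lte_fin ltrDl.
apply: le_ereal_inf_tmp => _ [s [s0 sB] <-]; rewrite lee_fin leNgt; apply/negP => se.
case: (leP s t) => st; first by move: (tB s); rewrite s0 st sB => /(_ isT).
by move: (tB t); rewrite lexx t0 => /(_ isT); rewrite -(he s) ?sB // (ltW st) se.
Qed.

(** By right-continuity both the witness and the times to be checked before it may be taken
    rational. *)
Lemma hit_lt_meas (A B : {set E}) : measurable [set w | (hit X A w < hit X B w)%E].
Proof.
pose ok (q q' : rat) w := [&& 0 <= (ratr q : R), X (ratr q) w \in A, X (ratr q) w \notin B
     & (0 <= (ratr q' : R) <= ratr q) ==> (X (ratr q') w \notin B)].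
have -> : [set w | (hit X A w < hit X B w)%E] = \bigcup_q ~` (\bigcup_q' [set w | ~~ ok q q' w]).
  apply/seteqP; split => w.
    move/hit_lt => [t t0 [tA tB]]; have [[e [e0 he]] _] := ctmc_cadlag w t0.
    have te : t < t + e by rewrite ltrDl.
    have [q] := rat_in_itvoo te; rewrite in_itv /= => /andP[tq qe].
    have qX : X (ratr q) w = X t w by rewrite -(he (ratr q)) // (ltW tq) qe.
    exists q => //= -[q' _] /=; apply/negP; rewrite negbK /ok qX tA tB ?t0 ?lexx // (le_trans t0 (ltW tq)) /=.
    apply/implyP => /andP[q0 qq]; case: (leP (ratr q' : R) t) => qt; first by rewrite tB // q0 qt.
    by rewrite he ?tB ?t0 ?lexx // (ltW qt) (le_lt_trans qq qe).
  move=> [q _ hq]; apply/hit_lt; have okq q' : ok q q' w.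
    by apply/negP => /negP h; apply: hq; exists q'.
  have /and4P[q0 qA qB _] := okq q.
  exists (ratr q) => //; split => // s /andP[s0 sq].
  case: (ltgtP s (ratr q)) sq => // [sq _|-> _] //.
  have [[e [e0 he]] _] := ctmc_cadlag w s0; have te : s < Num.min (s + e) (ratr q) by rewrite lt_min ltrDl e0.
  have [q'] := rat_in_itvoo te; rewrite in_itv /= lt_min => /and3P[sq' qe' qq'].
  rewrite -(he (ratr q')) ?(ltW sq') //; have /and4P[_ _ _] := okq q'.
  by rewrite (le_trans s0 (ltW sq')) (ltW qq').
apply: bigcupT_measurable_rat => q; apply: measurableC; apply: bigcupT_measurable_rat => q'.
have mA t (B' : {set E}) : measurable [set w | X t w \in B'] by exact: (ctmc_meas t (fun x => x \in B')).
rewrite /ok; case: (0 <= ratr q) => /=; last by rewrite (_ : mkset _ = setT) //; apply/seteqP.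
have -> : [set w | ~~ [&& X (ratr q) w \in A, X (ratr q) w \notin B & (0 <= (ratr q' : R) <= ratr q) ==> (X (ratr q') w \notin B)]] =
   (~` [set w | X (ratr q) w \in A] `|` [set w | X (ratr q) w \in B]) `|`
   (if 0 <= (ratr q' : R) <= ratr q then [set w | X (ratr q') w \in B] else set0).
  apply/seteqP; split => w /=.
    case: (boolP (X (ratr q) w \in A)) => [_|/negP na _]; last by left; left.
    case: (boolP (X (ratr q) w \in B)) => [bB _|_]; first by left; right.
    by case: (_ <= _ <= _) => //= /negPn; right.
  move=> [[/negP /negbTE -> |->]|]; rewrite ?andbF //=.
  by case: (_ <= _ <= _) => //= ->; rewrite !andbF.
apply: measurableU; first by apply: measurableU => //; apply: measurableC.
by case: ifP.
Qed.
End Process.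

(** * Bounds for sampled chains by induction on the number of steps *)

Section Recursions.
Variables (R : realType) (E : finType) (Q : E -> E -> R) (h : R).
Hypothesis pos : nonneg_kernel Q.
Hypothesis h0 : 0 <= h.

Lemma epath_cst n x (c : R) : epath Q n h x (fun _ => c) = c.
Proof.
elim: n x => [|n ih] x //=; under eq_bigr do rewrite ih.
by rewrite -mulr_suml trans_sum1 mul1r.
Qed.

Lemma epathZ n x (a : R) (Phi : seq E -> R) : epath Q n h x (fun s => a * Phi s) = a * epath Q n h x Phi.
Proof.
elim: n x Phi => [|n ih] x Phi //=; rewrite mulr_sumr; apply: eq_bigr => y _.
by rewrite (ih y (fun s => Phi (y :: s))) mulrCA.
Qed.

Fixpoint hit_before (A B : {set E}) (s : seq E) : bool :=
  if s is x :: s' then (x \in B) || (x \notin A) && hit_before A B s' else false.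

(** A supermartingale argument: [g] dominates the indicator of [B] and is superharmonic off [A] and
    [B] up to [e] per step, where [e] will be the Taylor error of a harmonic function over one
    mesh. *)
Lemma hit_before_le (A B : {set E}) (g : E -> R) (e : R) n x : 0 <= e -> (forall x, 0 <= g x) -> (forall x, x \in B -> 1 <= g x) ->
  (forall x, x \notin A -> x \notin B -> semig Q h g x <= g x + e) ->
  epath Q n h x (fun s => (hit_before A B (x :: s))%:R) <= g x + n%:R * e.
Proof.
move=> e0 g0 gB gh; have ne0 k : 0 <= k%:R * e by apply: mulr_ge0.
elim: n x => [|n ih] x.
  rewrite /= mul0r addr0 andbF orbF; case: (boolP (x \in B)) => [/gB|] // _; exact: g0.
rewrite [hit_before]lock /= -lock; case: (boolP (x \in B)) => xB.
  apply: (@le_trans _ _ 1); last by apply: le_trans (gB x xB) _; rewrite lerDl.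
  apply: le_of_eq.
  rewrite -[RHS](trans_sum1 Q h x); apply: eq_bigr => y _; rewrite /= xB /=.
  by rewrite epath_cst mulr1.
case: (boolP (x \in A)) => xA.
  rewrite big1 ?addr_ge0 // => y _; rewrite /= (negbTE xB) xA /=.
  by rewrite epath_cst mulr0.
apply: (@le_trans _ _ (\sum_y trans Q h x y * (g y + n%:R * e))).
  apply: ler_sum => y _; apply: ler_wpM2l; first exact: pos.
  by apply: le_trans (ih y); rewrite [X in epath _ _ _ _ X](_ : _ = fun s => (hit_before A B (y :: s))%:R) //; apply/funext => s; rewrite /= (negbTE xB) xA.
under eq_bigr do rewrite mulrDr; rewrite big_split /= -mulr_suml trans_sum1 mul1r.
have := gh x xA xB; rewrite /semig -(natr1 n) mulrDl mul1r => hh; lra.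
Qed.

(* Ottaviani's inequality: once the chain is in [p] it is still there at the final time with probability at least [c]. *)
Lemma has_le (p : pred E) (c : R) n x : 0 <= c ->
  (forall y, p y -> forall j, (j <= n)%N -> c <= \sum_(z | p z) trans Q (h *+ j) y z) ->
  c * epath Q n h x (fun s => (has p (x :: s))%:R) <= \sum_(z | p z) trans Q (h *+ n) x z.
Proof.
move=> c0 hc.
have sE t y : \sum_(z | p z) trans Q t y z = semig Q t (fun z => (p z)%:R) y.
  by rewrite big_mkcond; apply: eq_bigr => z _; case: (p z); rewrite ?mulr1 ?mulr0.
have one k y : p y -> epath Q k h y (fun s => (has p (y :: s))%:R) = 1.
  by move=> py; rewrite (_ : (fun s => _) = fun=> 1) ?epath_cst //; apply/funext => s; rewrite /= py.
elim: n x hc => [|n ih] x hc.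
  case: (boolP (p x)) => px; first by rewrite one // mulr1; exact: hc.
  by rewrite /= (negbTE px) mulr0 sumr_ge0 // => z _; exact: pos.
case: (boolP (p x)) => px; first by rewrite one // mulr1; exact: hc.
rewrite [has]lock /= -lock mulr_sumr sE mulrS semigD; apply: ler_sum => y _.
rewrite mulrCA; apply: ler_wpM2l; first exact: pos.
rewrite -sE; apply: le_trans (ih y _); last by move=> z pz j jn; apply: hc => //; exact: leqW.
by rewrite (_ : (fun s => _) = fun s => (has p (y :: s))%:R) //; apply/funext => s; rewrite /= (negbTE px).
Qed.

Section TwoChanges.
Variables (I : eqType) (cl : E -> option I).
Definition other (a : I) : pred E := fun x => if cl x is Some b then b != a else false.

(** States without a class are skipped: the sequence must visit some class [b] other than [a], and
    later a class other than [b], possibly [a] again. *)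
Fixpoint two_changes (a : I) (s : seq E) : bool :=
  if s is x :: s' then
    if cl x is Some b then if b != a then has (other b) s' else two_changes a s' else two_changes a s'
  else false.

Lemma two_changes_intro a s i k x b c : (i < k < size s)%N -> cl (nth x s i) = Some b -> cl (nth x s k) = Some c ->
  b != a -> c != b -> two_changes a s.
Proof.
elim: s i k => [|y s ih] i k; first by rewrite /= ltn0 andbF.
case: i k => [|i] [|k] //=.
- rewrite ltnS => ks -> hc -> cb; apply/(has_nthP x); exists k => //.
  by rewrite /other hc.
- rewrite !ltnS => ik hb hc ba cb; have /andP[ik1 ks] := ik.
  have rec : two_changes a s by exact: ih ik hb hc ba cb.
  case: (cl y) => // b'; case: ifP => // b'a; apply/(has_nthP x).
  (* The first change may already happen at [y], towards [b']; if [b'] is not [b], the visit to [b]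
     counts as the second change. *)
  case: (eqVneq b b') => [<-|bb']; first by exists k => //; rewrite /other hc.
  by exists i; [exact: ltn_trans ik1 ks|rewrite /other hb].
Qed.

(** Markov property at the first change: from there on, a second change has probability at most [q],
    uniformly in the number of steps left. *)
Lemma two_changes_le (q : R) n a x : 0 <= q ->
  (forall b y, cl y = Some b -> forall j, (j <= n)%N -> epath Q j h y (fun s => (has (other b) (y :: s))%:R) <= q) ->
  epath Q n h x (fun s => (two_changes a (x :: s))%:R) <= q * epath Q n h x (fun s => (has (other a) (x :: s))%:R).
Proof.
move=> q0; elim: n x => [|n ih] x hq; case: (boolP (other a x)) => ox.
- have [b xb ba] : exists2 b, cl x = Some b & b != a by move: ox; rewrite /other; case: (cl x) => // b; exists b.
  by rewrite /= ox xb ba /= mulr1.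
- suff e : two_changes a [:: x] = false by rewrite /= in e; rewrite /= e (negbTE ox) mulr0.
  by move: ox; rewrite /= /other; case: (cl x) => // b; case: ifP.
- have [b xb ba] : exists2 b, cl x = Some b & b != a by move: ox; rewrite /other; case: (cl x) => // b; exists b.
  rewrite [X in _ <= _ * X](_ : _ = 1); last first.
    by rewrite (_ : (fun s => _) = fun=> 1) ?epath_cst //; apply/funext => s; rewrite /= ox.
  rewrite mulr1; apply: le_trans (hq b x xb n.+1 (leqnn _)); apply: le_of_eq.
  by congr (epath _ _ _ _ _); apply/funext => s; rewrite /= xb ba /other xb eqxx.
- rewrite [two_changes]lock [has]lock /= -!lock mulr_sumr; apply: ler_sum => y _.
  rewrite mulrCA; apply: ler_wpM2l; first exact: pos.
  have := ih y (fun b z zb j jn => hq b z zb j (leqW jn)).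
  have -> : (fun s => (two_changes a (y :: s))%:R : R) = fun s => (two_changes a [:: x, y & s])%:R.
    by apply/funext => s; congr (_%:R); move: ox; rewrite [RHS]/= /other; case: (cl x) => // b; case: (b != a).
  have -> // : (fun s => (has (other a) (y :: s))%:R : R) = fun s => (has (other a) [:: x, y & s])%:R.
  by apply/funext => s; rewrite [in RHS]/= (negbTE ox).
Qed.
End TwoChanges.

(** Discrete Feynman-Kac bound with supersolution [phi]. *)
Lemma weight_le (wt phi : E -> R) (rho : R) n x : 0 <= rho -> (forall x, 0 <= wt x <= 1) -> (forall x, 1 <= phi x) ->
  (forall x, wt x * semig Q h phi x <= rho * phi x) ->
  epath Q n h x (fun s => \prod_(y <- x :: s) wt y) <= rho ^+ n * phi x.
Proof.
move=> rho0 w01 p1 hw; elim: n x => [|n ih] x.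
  by rewrite /= big_seq1 expr0 mul1r; have /andP[_ h1] := w01 x; exact: le_trans h1 (p1 x).
have /andP[w0 _] := w01 x.
rewrite (_ : (fun s => _) = fun s => wt x * \prod_(y <- s) wt y); last by apply/funext => s; rewrite big_cons.
rewrite epathZ; apply: (@le_trans _ _ (wt x * (rho ^+ n * semig Q h phi x))).
  apply: ler_wpM2l => //=; rewrite mulr_sumr; apply: ler_sum => y _.
  rewrite mulrCA; apply: ler_wpM2l; [exact: pos|exact: ih].
rewrite mulrCA exprSr -mulrA; apply: ler_wpM2l; [exact: exprn_ge0|exact: hw].
Qed.
End Recursions.

(** * Step functions, joint measurability and occupation times *)

Section Step.
Variable R : realType.
Local Notation h p := (p.+1%:R^-1 : R).
Local Notation leb := (@lebesgue_measure R).

Definition oc (a b : R) : set R := `]a, b]%classic.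
Definition cc (a b : R) : set R := `[a, b]%classic.
Definition cell (p k : nat) : set R := oc (k%:R * h p) (k.+1%:R * h p).
(** Each cell takes the value at its right endpoint, which approaches the argument from the right;
    right-continuity alone then gives pointwise convergence. *)
Definition stepf (T p : nat) (g : R -> R) (s : R) : R := \sum_(k < T * p.+1) \1_(cell p k) s * g (k.+1%:R * h p).

Lemma ocE (a b s : R) : oc a b s = (a < s <= b) :> Prop. Proof. by rewrite /oc /= in_itv. Qed.
Lemma ccE (a b s : R) : cc a b s = (a <= s <= b) :> Prop. Proof. by rewrite /cc /= in_itv. Qed.
Lemma m_oc (a b : R) : measurable (oc a b). Proof. exact: measurable_itv. Qed.
Lemma m_cc (a b : R) : measurable (cc a b). Proof. exact: measurable_itv. Qed.
Lemma leb_oc (a b : R) : a <= b -> leb (oc a b) = (b - a)%:E.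
Proof.
rewrite le_eqVlt lebesgue_measure_itv /= lte_fin => /predU1P[->|->]; last by rewrite EFinB.
by rewrite ltxx subrr.
Qed.

Lemma leb_cc_fin (a b : R) : (leb (cc a b) < +oo)%E.
Proof. by rewrite lebesgue_measure_itv /=; case: ifP => _; rewrite -?EFinB ?ltry. Qed.

Lemma h_gt0 p : 0 < h p. Proof. by rewrite invr_gt0. Qed.

Lemma ev_h_lt (e : R) : 0 < e -> ev (fun p => h p < e).
Proof. by move=> e0; apply: near_ev; exact: (near_infty_natSinv_lt (PosNum e0)). Qed.

Lemma grid_end (T p : nat) : (T * p.+1)%:R * h p = T%:R :> R.
Proof. by rewrite natrM mulfK. Qed.

Lemma cell_sub (T p k : nat) : (k < T * p.+1)%N -> cell p k `<=` oc 0 T%:R.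
Proof.
move=> kT s; rewrite /cell !ocE => /andP[ks sk]; apply/andP; split; first by apply: le_lt_trans ks; apply: mulr_ge0.
by apply: le_trans sk _; rewrite -(grid_end T p) ler_pM2r ?h_gt0 // ler_nat.
Qed.

Lemma step_at T p g (s : R) : 0 < s <= T%:R ->
  exists k, [/\ (k < T * p.+1)%N, k%:R * h p < s <= k.+1%:R * h p & stepf T p g s = g (k.+1%:R * h p)].
Proof.
move=> /andP[s0 sT]; have h0 := h_gt0 p.
have ex : exists n, s <= n%:R * h p by exists (T * p.+1)%N; rewrite grid_end.
have := ex_minnP ex; case; case => [|k] sk mk; first by rewrite mul0r leNgt s0 in sk.
have kT : (k < T * p.+1)%N by apply: mk; rewrite grid_end.
have ks : k%:R * h p < s by rewrite ltNge; apply/negP => /mk; rewrite ltnn.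
exists k; split => //; first by rewrite ks.
rewrite /stepf (bigD1 (Ordinal kT)) //= big1 ?addr0 => [|j jk].
  by rewrite indicE mem_set ?mul1r // /cell ocE ks sk.
rewrite indicE memNset ?mul0r // /cell ocE => /andP[js sj].
have {}jk : (j : nat) != k by apply: contra jk => /eqP jk; apply/eqP/val_inj.
case: (ltngtP j k) jk => // jk _.
- by move: ks; rewrite ltNge => /negP; apply; apply: le_trans sj _; rewrite ler_pM2r // ler_nat.
- by move: js; rewrite ltNge => /negP; apply; apply: le_trans sk _; rewrite ler_pM2r // ler_nat.
Qed.

Lemma step_out T p g (s : R) : ~~ (0 < s <= T%:R) -> stepf T p g s = 0.
Proof.
move=> sT; apply: big1 => k _; rewrite indicE memNset ?mul0r // /cell ocE => /andP[ks sk].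
move: sT; rewrite (le_lt_trans _ ks) ?mulr_ge0 //= => /negP; apply; apply: le_trans sk _.
by rewrite -(grid_end T p) ler_pM2r ?h_gt0 // ler_nat.
Qed.

Lemma step_cvg T g (s : R) : (0 <= s -> exists e : R, 0 < e /\ forall u : R, s <= u < s + e -> g u = g s) ->
  ev (fun p => stepf T p g s = \1_(oc 0 T%:R) s * g s).
Proof.
move=> rc; rewrite indicE; case: (boolP (0 < s <= T%:R)) => sT; last first.
  by exists 0%N => p _; rewrite step_out // memNset ?mul0r // ocE; apply/negP.
rewrite mem_set ?mul1r; last by rewrite ocE.
have [e [e0 he]] : exists e : R, 0 < e /\ forall u : R, s <= u < s + e -> g u = g s by apply: rc; case/andP: sT => /ltW.
apply: ev_impl (ev_h_lt e0) => p hp; have [k [_ /andP[ks sk] ->]] := step_at p g sT.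
by apply: he; rewrite sk /= -natr1 mulrDl mul1r; apply: ltrD.
Qed.

Section Measurable.
Variables (E : finType) (dT : measure_display) (Om : measurableType dT) (X : R -> Om -> E).
Hypothesis mX : forall t x, measurable [set w | X t w = x].
Hypothesis rcX : forall w t, 0 <= t -> exists e : R, 0 < e /\ forall s : R, t <= s < t + e -> X s w = X t w.

(** Limit of the step functions, each jointly measurable as a finite sum of products; the integer
    horizon keeps these sums finite. *)
Lemma joint_meas (A : pred E) (T : nat) :
  measurable_fun [set: R * Om] (fun z => \1_(oc 0 T%:R) z.1 * (A (X z.1 z.2))%:R : R).
Proof.
apply: (@measurable_fun_cvg _ _ _ _ (fun p z => stepf T p (fun t => (A (X t z.2))%:R) z.1)) => [p|z _].
  apply: measurable_sum => k; apply: measurable_funM.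
    by apply: measurableT_comp; [apply: measurable_indic; exact: m_oc|exact: measurable_fst].
  have := @measurable_finfun R _ Om _ (X (k.+1%:R * h p)) (mX _) (fun x => (A x)%:R).
  by move=> hm; apply: (measurableT_comp hm); exact: measurable_snd.
apply: cvg_near_cst; apply: ev_near; apply: (@step_cvg T (fun t => (A (X t z.2))%:R)) => s0.
by have [e [e0 he]] := rcX z.2 s0; exists e; split => // u hu; rewrite he.
Qed.

Lemma path_measurable (A : pred E) w (t : R) : measurable_fun (cc 0 t) (fun s => (A (X s w))%:R : R).
Proof.
have [T tT] : exists T : nat, t <= T%:R.
  by exists (Num.truncn t).+1; apply: ltW; exact: truncnS_gt.
have m1 : measurable_fun (oc 0 T%:R) (fun s => (A (X s w))%:R : R).
  have := measurable_fun_pair1 w (joint_meas A T); move/(measurable_funTS (D := (oc 0 T%:R))).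
  by apply: eq_measurable_fun => s sT; rewrite /= indicE sT mul1r.
apply: (@measurable_funS _ _ _ _ ([set 0] `|` (oc 0 T%:R))).
- by apply: measurableU => //; exact: m_oc.
- move=> s; rewrite ccE => /andP[s0 st]; case: (eqVneq s 0) => [->|sn]; first by left.
  by right; rewrite ocE lt_neqAle eq_sym sn s0 (le_trans st).
- by apply/measurable_funU => //; [exact: m_oc|split => //; exact: measurable_fun_set1].
Qed.

Lemma path_integrable (A : pred E) w (t : R) : leb.-integrable (cc 0 t) (EFin \o (fun s => (A (X s w))%:R : R)).
Proof.
apply: measurable_bounded_integrable => //; first exact: m_cc.
- exact: leb_cc_fin.
- exact: path_measurable.
- by exists 1; split => // M M1 s _ /=; case: (A _); rewrite ?normr1 ?normr0 ?(ltW M1) // ltW // (lt_trans _ M1).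
Qed.

Lemma riemann (A : pred E) w (T : nat) :
  (fun p => \sum_(k < T * p.+1) h p * (A (X (k.+1%:R * h p) w))%:R) @ \oo -->
   (fine (\int[leb]_(s in cc 0 T%:R) ((A (X s w))%:R : R)%:E)%E : R).
Proof.
pose g s : R := (A (X s w))%:R.
have g01 s : 0 <= g s <= 1 by rewrite /g; case: (A _); rewrite ?lexx ?ler01.
have mD : measurable ((oc 0 T%:R) : set R) by exact: m_oc.
have mg : measurable_fun (oc 0 T%:R) g.
  have mm : measurable_fun (cc 0 T%:R) g by exact: path_measurable.
  apply: measurable_funS mm; first exact: m_cc.
  by move=> s; rewrite ocE ccE => /andP[/ltW -> ->].
have Dfin : (leb (oc 0 T%:R) < +oo)%E by rewrite leb_oc ?ltry.
have mstep p : measurable_fun (oc 0 T%:R) (stepf T p g).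
  apply: measurable_sum => k; apply: measurable_funM => //.
  by apply: measurable_indic; exact: m_oc.
have intE p : (\int[leb]_(s in oc 0 T%:R) (stepf T p g s)%:E = (\sum_(k < T * p.+1) h p * g (k.+1%:R * h p))%:E)%E.
  rewrite /stepf; under eq_integral do rewrite -sumEFin.
  rewrite ge0_integral_sum //=; last 2 first.
  - move=> k; apply/measurable_EFinP; apply: measurable_funM => //.
    by apply: measurable_indic; exact: m_oc.
  - by move=> k s _; rewrite lee_fin; apply: mulr_ge0; [rewrite indicE|case/andP: (g01 (k.+1%:R * h p))].
  rewrite -sumEFin; apply: eq_bigr => k _.
  under eq_integral do rewrite EFinM muleC.
  have /andP[g0 _] := g01 (k.+1%:R * h p).
  have mi : measurable_fun (oc 0 T%:R) (fun s => (\1_(cell p k) s : R)%:E).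
    by apply/measurable_EFinP; apply: measurable_indic; exact: m_oc.
  rewrite ge0_integralZl //.
  rewrite integral_indic //; last exact: m_oc.
  rewrite (setIidl (cell_sub (ltn_ord k))).
  have kk : k%:R * h p <= k.+1%:R * h p by rewrite ler_pM2r ?h_gt0 // ler_nat.
  transitivity ((g (k.+1%:R * h p))%:E * (k.+1%:R * h p - k%:R * h p)%:E)%E.
    by congr (_ * _)%E; exact: leb_oc kk.
  by rewrite -mulrBl -natr1 addrAC subrr add0r mul1r -EFinM mulrC.
have c1 : {ae leb, forall s, oc 0 T%:R s -> (fun p => (stepf T p g s)%:E) @ \oo --> (g s)%:E}.
  apply: aeW => s sT; apply: cvg_near_cst; apply: ev_near.
  have [e [e0 he]] : exists e : R, 0 < e /\ forall u : R, s <= u < s + e -> g u = g s.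
    have s0 : 0 <= s by move: sT; rewrite ocE => /andP[/ltW].
    by have [e [e0 he]] := rcX w s0; exists e; split => // u hu; rewrite /g he.
  apply: ev_impl (step_cvg T (fun _ => ex_intro _ e (conj e0 he))) => p ->.
  by rewrite indicE mem_set // mul1r.
have c2 : {ae leb, forall s p, oc 0 T%:R s -> (`|(stepf T p g s)%:E| <= (fun=> 1%:E) s)%E}.
  apply: aeW => s p; rewrite ocE => sT /=; have [k [_ _ ->]] := step_at p g sT.
  by rewrite lee_fin ger0_norm; case/andP: (g01 (k.+1%:R * h p)).
have i1 : leb.-integrable (oc 0 T%:R) (fun=> 1%:E).
  apply: (@measurable_bounded_integrable _ _ _ _ (fun=> 1 : R)) => //.
  by exists 1; split => // M M1 s _ /=; rewrite normr1 ltW.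
have [ig _ hc] := @dominated_convergence _ _ R leb _ mD (fun p s => (stepf T p g s)%:E) (fun s => (g s)%:E) (fun=> 1%E)
  (fun p => (measurable_EFinP _ _).2 (mstep p)) ((measurable_EFinP _ _).2 mg) c1 i1 c2.
have -> : (\int[leb]_(s in cc 0 T%:R) (g s)%:E = \int[leb]_(s in oc 0 T%:R) (g s)%:E)%E.
  by rewrite /cc -integral_itv_obnd_cbnd //; exact/measurable_EFinP.
have fi : (\int[leb]_(s in oc 0 T%:R) (g s)%:E)%E \is a fin_num by exact: integrable_fin_num.
rewrite -(fineK fi) in hc; rewrite (_ : (fun p => _) = fine \o (fun p => (\int[leb]_(s in oc 0 T%:R) (stepf T p g s)%:E)%E)); first exact: fine_cvg hc.
by apply/funext => p /=; rewrite intE.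
Qed.

Lemma expected_time (P : probability Om R) (A : pred E) (b t : R) : 0 <= t ->
  (forall s, 0 <= s <= t -> (P [set w | A (X s w)] <= b%:E)%E) ->
  (\int[P]_w (\int[leb]_(s in cc 0 t) ((A (X s w))%:R : R)%:E) <= (t * b)%:E)%E /\
  measurable_fun [set: Om] (fun w => (\int[leb]_(s in cc 0 t) ((A (X s w))%:R : R)%:E)%E).
Proof.
move=> t0 hb; have [T tT] : exists T : nat, t <= T%:R by exists (Num.truncn t).+1; apply: ltW; exact: truncnS_gt.
pose f (z : R * Om) : \bar R := (\1_(oc 0 t) z.1 * (\1_(oc 0 T%:R) z.1 * (A (X z.1 z.2))%:R))%:E.
have mf : measurable_fun [set: R * Om] f.
  apply/measurable_EFinP; apply: measurable_funM; last exact: joint_meas.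
  by apply: measurableT_comp; [apply: measurable_indic; exact: m_oc|exact: measurable_fst].
have f0 z : (0 <= f z)%E by rewrite lee_fin; do 2?apply: mulr_ge0 => //; rewrite indicE.
have fE s w : f (s, w) = (((fun s => ((A (X s w))%:R : R)%:E) \_ (oc 0 t)) s)%E.
  rewrite /f /= patchE indicE; case: ifP => st; last by rewrite mul0r.
  rewrite mul1r indicE mem_set ?mul1r //; move: st; rewrite inE !ocE => /andP[-> st].
  exact: le_trans st tT.
have mo w : measurable_fun (oc 0 t) (fun s => (A (X s w))%:R : R).
  have mm : measurable_fun (cc 0 t) (fun s => (A (X s w))%:R : R) by exact: path_measurable.
  apply: measurable_funS mm; first exact: m_cc.
  by move=> s; rewrite ocE ccE => /andP[/ltW -> ->].
have inE' w : (\int[leb]_(s in cc 0 t) ((A (X s w))%:R : R)%:E = \int[leb]_s f (s, w))%E.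
  rewrite /cc -integral_itv_obnd_cbnd; last exact/measurable_EFinP.
  by rewrite integral_mkcond; apply: eq_integral => s _; rewrite fE.
under [X in (X <= _)%E]eq_integral do rewrite inE'.
split; last first.
  rewrite (_ : (fun w => _) = fubini_G leb f); last by apply/funext => w; rewrite inE'.
  exact: measurable_fun_fubini_tonelli_G.
rewrite -(@fubini_tonelli _ _ _ _ R leb P f mf f0).
have -> : (\int[leb]_s \int[P]_w f (s, w) = \int[leb]_(s in oc 0 t) \int[P]_w ((A (X s w))%:R : R)%:E)%E.
  rewrite [RHS]integral_mkcond; apply: eq_integral => s _; rewrite patchE.
  under eq_integral do rewrite fE patchE; case: ifP => //.
  by rewrite integral0.
have -> : (t * b)%:E = (\int[leb]_(s in oc 0 t) b%:E)%E.
  rewrite integral_cst; last exact: m_oc.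
  transitivity (b%:E * (t - 0)%:E)%E; first by rewrite subr0 -EFinM mulrC.
  by congr (_ * _)%E; exact: esym (leb_oc t0).
apply: ge0_le_integral => //; first exact: m_oc.
- by move=> s _; apply: integral_ge0 => w _; rewrite lee_fin.
- have mF := @measurable_fun_fubini_tonelli_F _ _ _ _ R P f mf f0.
  apply: (@eq_measurable_fun _ _ _ _ _ (fubini_F P f)); last exact: measurable_funTS.
  move=> s st; rewrite /fubini_F; apply: eq_integral => w _; rewrite fE patchE st //.
- move=> s st; have -> : (\int[P]_w ((A (X s w))%:R : R)%:E = P [set w | A (X s w)])%E.
    transitivity (\int[P]_w (\1_[set w | A (X s w)] w)%:E)%E; last first.
      by rewrite integral_indic ?setIT //; exact: measurable_finpred (mX s) A.
    by apply: eq_integral => w _; rewrite indicE; congr (_%:R%:E); case: (boolP (A (X s w))) => h'; [rewrite mem_set|rewrite memNset // => /=; rewrite (negbTE h')].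
  by apply: hb; move: st; rewrite ocE => /andP[/ltW -> ->].
Qed.
End Measurable.
End Step.

(** * The clock of the trace process *)

Section Trace.
Variables (R : realType) (E : finType) (dT : measure_display) (Om : measurableType dT) (X : R -> Om -> E).
Hypothesis mX : forall t x, measurable [set w | X t w = x].
Hypothesis cX : forall w, cadlag (X^~ w).
Local Notation leb := (@lebesgue_measure R).

Lemma cadlag_rc w t : 0 <= t -> exists e : R, 0 < e /\ forall s : R, t <= s < t + e -> X s w = X t w.
Proof. by move=> t0; have [] := cX w t0. Qed.

Section Fixed.
Variables (G : {set E}) (w : Om).
Local Notation o := (occ X G w).

Lemma occ0 (H : {set E}) : occ X H w 0 = 0.
Proof. by rewrite /occ set_itv1 integral_set1. Qed.

Lemma occ_incE (H : {set E}) (s t : R) : 0 <= s <= t -> occ X H w t - occ X H w s = fine (\int[leb]_(u in oc s t) ((X u w \in H)%:R : R)%:E)%E.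
Proof.
move=> /andP[s0 st].
have h := @Rintegral_itvB R (fun u => (X u w \in H)%:R) (BLeft 0) (BRight t) s (path_integrable mX cadlag_rc (fun x => x \in H) w t).
by apply: h; rewrite bnd_simp.
Qed.

Lemma oc_integrable (A : pred E) (s t : R) : 0 <= s -> leb.-integrable (oc s t) (EFin \o (fun u => (A (X u w))%:R : R)).
Proof.
move=> s0; apply: integrableS (path_integrable mX cadlag_rc A w t); [exact: m_cc|exact: m_oc|].
by move=> u; rewrite ocE ccE => /andP[su ->]; rewrite (le_trans s0 (ltW su)).
Qed.

Lemma fine_leb_oc (s t : R) : s <= t -> fine (leb (oc s t)) = t - s.
Proof. by move=> st; rewrite leb_oc. Qed.

Lemma oc_cst (c s t : R) : s <= t -> fine (\int[leb]_(u in oc s t) (c : R)%:E)%E = c * (t - s).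
Proof.
move=> st; have := @Rintegral_cst _ _ R leb (oc s t) (m_oc s t) c; rewrite /Rintegral => ->.
by congr (_ * _); exact: fine_leb_oc.
Qed.

Lemma occ_inc (s t : R) : 0 <= s <= t -> 0 <= o t - o s <= t - s.
Proof.
move=> st; have /andP[s0 st'] := st; rewrite occ_incE //; apply/andP; split.
  by apply: fine_ge0; apply: integral_ge0 => u _; rewrite lee_fin.
rewrite -(mul1r (t - s)) -(oc_cst 1 st').
apply: le_Rintegral; first exact: m_oc.
- exact: (oc_integrable (fun x => x \in G)).
- exact: (oc_integrable xpredT).
- by move=> u _; case: (_ \in _); rewrite ?ler01.
Qed.

Lemma occ_inc_in (s t : R) : 0 <= s <= t -> (forall u, s < u <= t -> X u w \in G) -> o t - o s = t - s.
Proof.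
move=> st hin; have /andP[s0 st'] := st; rewrite occ_incE //.
rewrite -(mul1r (t - s)) -(oc_cst 1 st').
by apply: eq_Rintegral => u; rewrite inE ocE => /hin ->.
Qed.

Lemma occ_inc_out (s t : R) : 0 <= s <= t -> (forall u, s < u <= t -> X u w \notin G) -> o t = o s.
Proof.
move=> st hout; have /andP[s0 st'] := st; apply/eqP; rewrite -subr_eq0; apply/eqP; rewrite occ_incE //.
transitivity (0 * (t - s)); last by rewrite mul0r.
rewrite -(oc_cst 0 st').
by apply: eq_Rintegral => u; rewrite inE ocE => /hout /negbTE ->.
Qed.

Lemma occ_mono (s t : R) : 0 <= s <= t -> o s <= o t.
Proof. by move=> /occ_inc /andP[]; rewrite subr_ge0. Qed.

Lemma occ_ge0 (t : R) : 0 <= t -> 0 <= o t.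
Proof. by move=> t0; rewrite -(occ0 G); apply: occ_mono; rewrite lexx. Qed.

Lemma occ_le (t : R) : 0 <= t -> o t <= t.
Proof. by move=> t0; have := @occ_inc 0 t; rewrite lexx t0 occ0 !subr0 => /(_ isT) /andP[]. Qed.

Lemma occ_setC (t : R) : 0 <= t -> occ X (~: G) w t = t - o t.
Proof.
move=> t0; have e1 : o t = fine (\int[leb]_(u in oc 0 t) ((X u w \in G)%:R : R)%:E)%E.
  by rewrite -occ_incE ?lexx ?t0 // occ0 subr0.
rewrite e1 -[X in X - _]subr0 -[X in X - _](mul1r (t - 0)) -(oc_cst 1 t0).
rewrite -RintegralB; last 3 first.
- exact: m_oc.
- exact: (oc_integrable xpredT).
- exact: (oc_integrable (fun x => x \in G)).
rewrite -[LHS]subr0 -[X in _ - X](occ0 (~: G)) occ_incE ?lexx ?t0 //.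
by apply: eq_Rintegral => u _; rewrite finset.in_setC; case: (_ \in _); rewrite ?subrr ?subr0.
Qed.

Hypothesis unb : forall a : R, exists2 t, 0 <= t & a < o t.
Local Notation S := (trtime X G w).

(** The occupation time is continuous, being 1-Lipschitz, so the supremum defining the trace time is
    attained; unboundedness makes it finite. *)
Lemma trtime_spec (t : R) : 0 <= t -> [/\ 0 <= S t, o (S t) = t & forall u : R, 0 <= u -> o u <= t -> u <= S t].
Proof.
move=> t0; pose A := [set s | 0 <= s /\ o s <= t]; have A0 : A 0 by split; rewrite ?occ0.
have [b b0 hb] := unb t.
have ubA : ubound A b.
  move=> s [s0 os]; rewrite leNgt; apply/negP => bs.
  by have := @occ_mono b s; rewrite b0 (ltW bs) => /(_ isT) h; have := le_lt_trans (le_trans h os) hb; rewrite ltxx.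
have hs : has_sup A by split; [exists 0|exists b].
have SE : S t = sup A.
  rewrite /trtime ereal_sup_EFin //; [by exists b|by exists 0].
have S0 : 0 <= S t by rewrite SE; apply: ub_le_sup => //; exists b.
have mx u : 0 <= u -> o u <= t -> u <= S t.
  by move=> u0 ou; rewrite SE; apply: ub_le_sup => //; exists b.
split => //; apply/eqP; rewrite eq_le; apply/andP; split.
  rewrite leNgt; apply/negP => lt; pose e := o (S t) - t; have e0 : 0 < e by rewrite subr_gt0.
  have [s [s0 os]] := sup_adherent e0 hs; rewrite -SE => se.
  have sS : s <= S t by exact: mx.
  have := @occ_inc s (S t); rewrite s0 sS => /(_ isT) /andP[_]; rewrite /e in se; lra.
rewrite leNgt; apply/negP => lt; pose u := S t + (t - o (S t)).
have Su : S t < u by rewrite ltrDl subr_gt0.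
have := @occ_inc (S t) u; rewrite S0 (ltW Su) => /(_ isT) /andP[_ h].
have : u <= S t by apply: mx; [exact: le_trans S0 (ltW Su)|rewrite /u in h *; lra].
by rewrite leNgt Su.
Qed.

Lemma trtime_le (t u : R) : 0 <= t -> 0 <= u -> (u <= S t) = (o u <= t).
Proof.
move=> t0 u0; have [S0 oS mx] := trtime_spec t0; apply/idP/idP => [uS|]; last exact: mx.
by rewrite -oS; apply: occ_mono; rewrite u0.
Qed.

(** Otherwise right-continuity would keep the path outside [G] just after [S t], the clock would
    stand still there, and [S t] would not be maximal. *)
Lemma trace_in (t : R) : 0 <= t -> X (S t) w \in G.
Proof.
move=> t0; have [S0 oS mx] := trtime_spec t0; apply/negPn/negP => out.
have [e [e0 he]] := cadlag_rc w S0; pose u := S t + e / 2.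
have Su : S t < u by rewrite ltrDl divr_gt0.
have : o u = o (S t).
  apply: occ_inc_out; first by rewrite S0 ltW.
  move=> v /andP[Sv vu]; rewrite he // (ltW Sv) (le_lt_trans vu) // /u; lra.
rewrite oS => ou; have := mx u (le_trans S0 (ltW Su)); rewrite ou lexx => /(_ isT).
by rewrite leNgt Su.
Qed.

(* On a stretch spent in [G] the trace clock runs at unit speed. *)
Lemma trtime_run (s e u : R) : 0 <= s -> (forall v, s <= v < s + e -> X v w \in G) -> 0 <= u < e ->
  S (o s + u) = s + u.
Proof.
move=> s0 hin /andP[u0 ue].
have inc v : 0 <= v < e -> o (s + v) = o s + v.
  move=> /andP[v0 ve]; have := @occ_inc_in s (s + v); rewrite s0 lerDl v0 => /(_ isT) h.
  suff : o (s + v) - o s = s + v - s by lra.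
  by apply: h => x /andP[sx xv]; apply: hin; rewrite (ltW sx) (le_lt_trans xv) // ltrD2l.
have osu : 0 <= o s + u by rewrite addr_ge0 // occ_ge0.
have [S0 oS mx] := trtime_spec osu.
apply/eqP; rewrite eq_le; apply/andP; split; last by rewrite (trtime_le osu (addr_ge0 s0 u0)) inc ?u0.
rewrite leNgt; apply/negP => lt; pose v := Num.min (S (o s + u) - s) ((u + e) / 2).
have uv : u < v by rewrite lt_min; apply/andP; split; lra.
have ve : v < e by rewrite gt_min; apply/orP; right; lra.
have := @occ_mono (s + v) (S (o s + u)); rewrite oS inc ?ve ?andbT; last by rewrite ltW // (le_lt_trans u0).
have vS : s + v <= S (o s + u) by rewrite -lerBrDl ge_min lexx.
by rewrite vS addr_ge0 ?(le_trans u0 (ltW uv)) // => /(_ isT); rewrite lerD2l leNgt uv.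
Qed.

Lemma trtime_occ (s : R) : 0 <= s -> X s w \in G -> S (o s) = s.
Proof.
move=> s0 sG; have [e [e0 he]] := cadlag_rc w s0.
rewrite -[in LHS](addr0 (o s)) (@trtime_run s e 0) ?addr0 ?lexx // => v hv.
by rewrite he.
Qed.

Lemma trace_cadlag : cadlag (fun t => trace X G t w).
Proof.
move=> t t0; have [S0 oS mx] := trtime_spec t0; split.
  have [e [e0 he]] := cadlag_rc w S0; exists e; split => // s /andP[ts se].
  have hin v : S t <= v < S t + e -> X v w \in G by move=> hv; rewrite he // trace_in.
  have u0 : 0 <= s - t < e by rewrite subr_ge0 ts ltrBlDl.
  have := trtime_run S0 hin u0; rewrite oS addrC subrK /trace => ->.
  by apply: he; have /andP[a b] := u0; rewrite lerDl a ltrD2l.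
(* The inverse clock jumps over excursions outside [G], so the left limit of the trace at [t] is the
   left limit of the path at the supremum of the times read strictly before [t], not at [S t]. *)
move=> tp; pose A := [set s | 0 <= s /\ o s < t]; have A0 : A 0 by split; rewrite ?occ0.
have ubA : ubound A (S t) by move=> s [s0 /ltW os]; exact: mx.
have hs : has_sup A by split; [exists 0|exists (S t)].
have inA s : 0 <= s -> o s < t -> s < sup A.
  move=> s0 os; apply: (@lt_le_trans _ _ (s + (t - o s) / 2)); first by rewrite ltrDl divr_gt0 // subr_gt0.
  have d0 : 0 <= (t - o s) / 2 by rewrite divr_ge0 // subr_ge0 ltW.
  apply: ub_le_sup; first by exists (S t).
  split; first by rewrite addr_ge0.
  have := @occ_inc s (s + (t - o s) / 2); rewrite s0 lerDl d0 => /(_ isT) /andP[_ h]; lra.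
have sA0 : 0 < sup A by apply: inA; rewrite ?occ0.
have [_ /(_ sA0) [e [l [e0 hl]]]] := cX w (ltW sA0).
have [s [s0 os] se] := sup_adherent e0 hs.
exists (t - o s), l; split; first by rewrite subr_gt0.
move=> u /andP[su ut]; have su' : o s < u by lra.
have u0 : 0 <= u by exact: le_trans (occ_ge0 s0) (ltW su').
have [Su0 oSu mxu] := trtime_spec u0.
rewrite /trace; apply: hl; apply/andP; split.
  by apply: lt_le_trans se _; apply: mxu => //; exact: ltW.
by apply: inA => //; rewrite oSu.
Qed.
End Fixed.
End Trace.

Lemma epath_le (R : realType) (E : finType) (Q : E -> E -> R) (h : R) n x (Phi Psi : seq E -> R) : nonneg_kernel Q -> 0 <= h ->
  (forall s, Phi s <= Psi s) -> epath Q n h x Phi <= epath Q n h x Psi.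
Proof.
move=> pos h0; elim: n x Phi Psi => [|n ih] x Phi Psi le //=.
by apply: ler_sum => y _; apply: ler_wpM2l; [exact: pos|exact: ih].
Qed.

Lemma path_probability0 (R : realType) (E : finType) (Q : E -> E -> R) dT (Om : measurableType dT) (P : probability Om R) x0
  (X : R -> Om -> E) (h : R) n (A : seq E -> bool) : is_ctmc Q P x0 X -> 0 <= h ->
  P [set w | A (smp X 0 h n w)] = (epath Q n h x0 (fun s => (A (x0 :: s))%:R))%:E.
Proof.
move=> hX h0; rewrite (path_probability hX) //; congr (_%:E).
rewrite (bigD1 x0) //= trans0 eqxx mul1r big1 ?addr0 // => y yx.
by rewrite trans0 eq_sym (negbTE yx) mul0r.
Qed.

(** One step outside the set: of the drift [- e], one half pays for the Taylor error and one half
    for the decay, because [ph <= 2]. *)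
Lemma killed_out (R : realType) (ph e h C : R) : 0 < h -> 0 < e -> ph <= 2 -> C * h <= e / 2 ->
  ph + h * (e * -1) + C * h ^+ 2 <= (1 - e / 4 * h) * ph.
Proof. by move=> h0 e0 p2 Ch; have : h * (C * h) <= h * (e / 2) by [apply: ler_wpM2l => //; exact: ltW]; have : 0 <= e * h * (2 - ph) by [do 2?apply: mulr_ge0; rewrite ?subr_ge0 // ltW]; nra. Qed.

(** One step inside the set: the gain [1 + h] from killing dominates a drift of either sign once [e]
    is small. *)
Lemma killed_in (R : realType) (ph e h C l L : R) : 0 < h <= 1 -> 0 < e <= 4^-1 -> 1 <= ph -> C * h <= e / 2 ->
  l <= L -> e * (L + 1) <= 4^-1 -> ph + h * (e * l) + C * h ^+ 2 <= (1 - e / 4 * h) * ph * (1 + h).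
Proof.
move=> /andP[h0 h1] /andP[e0 e4] p1 Ch lL eL.
have a1 : h * (C * h) <= h * (e / 2) by apply: ler_wpM2l => //; exact: ltW.
have a2 : h * (e * l) <= h * (e * L) by do 2!(apply: ler_wpM2l; [exact: ltW|]).
have a3 : h * (e * (L + 1)) <= h * 4^-1 by apply: ler_wpM2l => //; exact: ltW.
have a4 : 0 < h * e by exact: mulr_gt0.
have a5 : ph + h * (e * l) + C * h ^+ 2 <= ph + h * 4^-1 by nra.
apply: le_trans a5 _; have a6 : 1 + h / 4 <= (1 - e / 4 * h) * (1 + h) by nra.
apply: (@le_trans _ _ (ph * (1 + h / 4))); first by nra.
by rewrite [leRHS]mulrAC mulrC [leRHS]mulrC [leRHS]mulrC; apply: ler_wpM2r => //; apply: le_trans p1.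
Qed.

(** * Exponential tails of occupation times *)

Section Recurrence.
Variables (R : realType) (E : finType) (Q : E -> E -> R) (G : {set E}) (psi : E -> R).
Hypothesis pos : nonneg_kernel Q.
Hypothesis psi0 : forall x, 0 <= psi x.
Hypothesis psiG : forall x, x \notin G -> \sum_y gen Q x y * psi y = -1.

(** Discretized killing at rate 1 on [G], chosen to dominate [expR (- h)]. *)
Let wt (h : R) x : R := if x \in G then (1 + h)^-1 else 1.

(* [1 + eps * psi] is a supersolution for the chain killed at rate 1 on [G]. *)
Lemma killed_decay : exists c h1 : R, [/\ 0 < c, 0 < h1 & forall (h : R) n x, 0 < h <= h1 ->
  epath Q n h x (fun s => \prod_(y <- x :: s) wt h y) <= 2 * expR (- (c * (h * n%:R)))].
Proof.
pose K := \sum_x psi x; pose L := \sum_x `|\sum_y gen Q x y * psi y|.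
have K0 : 0 <= K by apply: sumr_ge0.
have L0 : 0 <= L by apply: sumr_ge0.
have hK x : psi x <= K by rewrite /K (bigD1 x) //= lerDl sumr_ge0.
have hL x : \sum_y gen Q x y * psi y <= L.
  by apply: le_trans (ler_norm _) _; rewrite /L [leRHS](bigD1 x) //= lerDl sumr_ge0.
have LK1 : 0 < L + K + 1 by rewrite ltr_wpDl // addr_ge0.
(* [K] bounds [psi] and [L] its generator. With [e * (L + K + 1) = 1/4], [phi] stays between 1 and 2
   and its drift on [G] is at most 1/4. *)
pose e : R := (4 * (L + K + 1))^-1; have LK : 0 < 4 * (L + K + 1) by rewrite mulr_gt0.
have e0 : 0 < e by rewrite invr_gt0.
have eLK : e * (L + K + 1) = 4^-1 by rewrite /e invfM -mulrA mulVf ?mulr1 // gt_eqF.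
pose phi x := 1 + e * psi x.
have eK x : 0 <= e * psi x <= 4^-1.
  rewrite mulr_ge0 ?(ltW e0) //= -eLK; apply: ler_wpM2l; first exact: ltW.
  by apply: le_trans (hK x) _; lra.
have eL1 : e * (L + 1) <= 4^-1 by rewrite -eLK; apply: ler_wpM2l; [exact: ltW|lra].
have e4 : e <= 4^-1 by rewrite -[leLHS]mulr1; apply: le_trans eL1; apply: ler_wpM2l; [exact: ltW|lra].
pose C := genbound Q ^+ 2 * 2; have C0 : 0 <= C by rewrite mulr_ge0 ?sqr_ge0.
pose h1 := Num.min 1 (e / (2 * (C + 1))).
have C1 : 0 < 2 * (C + 1) by rewrite mulr_gt0 // ltr_wpDl.
exists (e / 4), h1; split; [by rewrite divr_gt0|by rewrite lt_min ltr01 divr_gt0|].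
move=> h n x /andP[h0]; rewrite le_min => /andP[h1' hC].
have Ch : C * h <= e / 2.
  move: hC; rewrite ler_pdivlMr // => hC; nra.
have ch : 0 <= 1 - e / 4 * h by nra.
have sem y : semig Q h phi y <= phi y + h * (e * \sum_z gen Q y z * psi z) + C * h ^+ 2.
  have := @semig_taylor _ _ Q pos phi 2 h y ltac:(lra) _ (ltW h0); rewrite -/C.
  have -> : \sum_z gen Q y z * phi z = e * \sum_z gen Q y z * psi z.
    rewrite /phi; under eq_bigr do rewrite mulrDr mulr1.
    rewrite big_split /= gen_rowsum add0r mulr_sumr; apply: eq_bigr => z _; ring.
  move=> ht; have {ht} := ht (fun z => _); rewrite ler_norml => ht.
  have /ht/andP[_] : forall z, `|phi z| <= 2 by move=> z; rewrite /phi ger0_norm; have /andP[a b] := eK z; lra.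
  lra.
apply: le_trans (weight_le (phi := phi) (rho := 1 - e / 4 * h) pos (ltW h0) n x ch _ _ _) _.
- move=> y; rewrite /wt; case: ifP => _; rewrite ?ler01 ?lexx // invr_ge0 invf_le1; lra.
- by move=> y; rewrite /phi; have /andP[a b] := eK y; lra.
- move=> y; rewrite /wt; have /andP[a b] := eK y; have s := sem y.
  have p1 : 1 <= phi y by rewrite /phi lerDl.
  have p2 : phi y <= 2 by rewrite /phi; lra.
  case: ifP => yG.
    rewrite mulrC ler_pdivrMr; last by lra.
    by apply: le_trans s _; apply: (killed_in (L := L)) => //; rewrite ?h0 ?e0.
  by rewrite mul1r; apply: le_trans s _; rewrite psiG ?yG //; apply: killed_out.
rewrite mulrC; apply: ler_pM => //; first by have /andP[a _] := eK x; rewrite /phi addr_ge0.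
  by rewrite exprn_ge0.
  by have /andP[_ b] := eK x; rewrite /phi; lra.
have -> : - (e / 4 * (h * n%:R)) = n%:R * (- (e / 4 * h)) by ring.
rewrite expRM_natl; apply: lerXn2r; rewrite ?nnegrE ?expR_ge0 //.
exact: expR_ge1Dx.
Qed.

Lemma wt_prod (h : R) s : 0 <= h -> expR (- \sum_(y <- s) h * (y \in G)%:R) <= \prod_(y <- s) wt h y.
Proof.
move=> h0; elim: s => [|y s ih]; first by rewrite !big_nil oppr0 expR0.
rewrite !big_cons opprD expRD; apply: ler_pM; rewrite ?expR_ge0 // /wt.
case: (y \in G); last by rewrite mulr0 oppr0 expR0.
by rewrite mulr1 expRN lef_pV2 ?posrE ?expR_gt0 ?expR_ge1Dx // ltr_wpDr.
Qed.

Section Occupation.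
Variables (dT : measure_display) (Om : measurableType dT) (P : probability Om R) (x0 : E) (X : R -> Om -> E).
Hypothesis hX : is_ctmc Q P x0 X.

(** Exponential Chebyshev bound for Riemann sums of the occupation time. The extra 1 in the exponent
    pays for the weight of the initial sample. *)
Lemma occ_tail : exists2 c : R, 0 < c & forall (T : nat) (a : R), exists M,
  [/\ measurable M, [set w | occ X G w T%:R < a] `<=` M & (P M <= (2 * expR (a + 1 - c * T%:R))%:E)%E].
Proof.
have [c [h1 [c0 h10 hk]]] := killed_decay; exists c => // T a.
pose h p := p.+1%:R^-1 : R.
(* The sample at time 0 is dropped because the Riemann sums use right endpoints. *)
pose A p := [set w | \sum_(y <- behead (smp X 0 (h p) (T * p.+1) w)) h p * (y \in G)%:R < a].
have cX := ctmc_cadlag hX; have mX : forall t x, measurable [set w | X t w = x] by case: hX.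
apply: (liminf_cover (A := A)).
- move=> p; apply: (path_meas hX 0 (h p) _ (fun s => \sum_(y <- behead s) h p * (y \in G)%:R < a)).
- move=> w /= lt; have := @riemann _ _ _ _ X mX (cadlag_rc cX) (fun x => x \in G) w T.
  rewrite -/(occ X G w T%:R) => cv.
  apply: ev_impl (near_ev (cvgr_lt _ cv _ lt)) => p; rewrite /A /=; apply: le_lt_trans.
  rewrite -(big_mkord xpredT (fun k => h p * (X (k.+1%:R * h p) w \in G)%:R)) /index_iota subn0.
  rewrite !big_map (iotaDl 1 0) big_map; apply: ler_sum => k _.
  by rewrite add0r add1n mulr_natl.
- move=> e e0; apply: ev_impl (ev_h_lt h10) => p hp.
  have hp0 : 0 < h p by exact: h_gt0.
  rewrite (path_probability0 _ (fun s => \sum_(y <- behead s) h p * (y \in G)%:R < a) hX (ltW hp0)) lee_fin.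
  apply: (@le_trans _ _ (expR (a + 1) * epath Q (T * p.+1) (h p) x0 (fun s => \prod_(y <- x0 :: s) wt (h p) y))).
    rewrite -epathZ; apply: epath_le => // [|s]; first exact: ltW.
    have h01 : h p <= 1 by rewrite invf_le1 // ler1n.
    have := wt_prod (x0 :: s) (ltW hp0); set pr := \prod_(y <- _) _ => hpr.
    have pr0 : 0 <= pr by apply: le_trans hpr; exact: expR_ge0.
    rewrite /=; case: (boolP (_ < a)) => [lt|_]; last by rewrite mulr_ge0 ?expR_ge0.
    apply: (@le_trans _ _ (expR (a + 1) * expR (- (a + 1)))); first by rewrite -expRD subrr expR0.
    apply: ler_wpM2l; [exact: expR_ge0|apply: le_trans hpr; rewrite ler_expR lerN2 big_cons].
    rewrite addrC; apply: lerD; first exact: ltW.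
    by case: (x0 \in G); rewrite ?mulr1 ?mulr0 ?ler01.
  apply: le_trans (ler_wpM2l (expR_ge0 _) (hk _ _ x0 _)) _; first by rewrite hp0 ltW.
  rewrite mulrCA -expRD.
  have -> : h p * (T * p.+1)%:R = T%:R by rewrite mulrC grid_end.
  by rewrite -[leLHS]addr0 lerD // ltW.
Qed.

Lemma occ_unbounded : exists M, [/\ measurable M, P M = 0 & forall w, ~ M w -> forall a : R, exists2 t, 0 <= t & a < occ X G w t].
Proof.
have [c c0 tail] := occ_tail.
(* At level [p] this horizon makes the tail at most [2 * expR (- (2 * p.+1))], below [1 / p.+1]. *)
pose T p := (Num.truncn (3 * p.+1%:R / c)).+1.
have /choice[M hM] : forall p, exists M, [/\ measurable M, [set w | occ X G w (T p)%:R < p%:R] `<=` M & (P M <= (p.+1%:R^-1)%:E)%E].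
  move=> p; have [M [m1 m2 m3]] := tail (T p) p%:R; exists M; split => //; apply: le_trans m3 _; rewrite lee_fin.
  have := truncnS_gt (3 * p.+1%:R / c); rewrite -/(T p) ltr_pdivrMr // => hT.
  apply: (@le_trans _ _ (2 * expR (- (2 * p.+1%:R)))).
    by rewrite ler_pM2l // ler_expR -natr1; move: hT; rewrite -natr1 mulrC; lra.
  rewrite expRN ler_pdivrMr ?expR_gt0 // mulrC ler_pdivlMr // mulrC.
  by apply: le_trans (expR_ge1Dx _); lra.
have mM p : measurable (M p) by case: (hM p).
have [|e e0|N [mN sub PN]] := liminf_cover (P := P) (Ev := [set w | exists a : R, forall t, 0 <= t -> occ X G w t <= a]) (b := 0) mM.
- move=> w [a ha]; exists (Num.truncn a).+1 => p hp; have [_ h _] := hM p; apply: h => /=.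
  apply: le_lt_trans (ha _ _) _ => //; apply: lt_le_trans (truncnS_gt a) _; by rewrite ler_nat.
- apply: ev_impl (ev_h_lt e0) => p hp; have [_ _ h] := hM p; apply: le_trans h _.
  by rewrite add0r lee_fin ltW.
exists N; split => // [|w nN a].
  by apply/eqP; rewrite eq_le PN measure_ge0.
apply: contrapT => hn; apply: nN; apply: sub; exists a => t t0; rewrite leNgt; apply/negP => lt.
by apply: hn; exists t.
Qed.
End Occupation.
End Recurrence.

Lemma ev_cvge (R : realType) (u : nat -> \bar R) (l : R) :
  (forall e : R, 0 < e -> ev (fun n => ((l - e)%:E <= u n <= (l + e)%:E)%E)) -> u @ \oo --> l%:E.
Proof.
move=> h; have fin e n : ((l - e)%:E <= u n <= (l + e)%:E)%E -> u n \is a fin_num.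
  by move=> /andP[a b]; rewrite fin_real // (lt_le_trans _ a) ?ltNyr // (le_lt_trans b) ?ltry.
apply/fine_cvgP; split; first by apply: ev_near; apply: ev_impl (h 1 ltr01) => n /fin.
apply/cvgrPdist_le => e e0; apply: ev_near; apply: ev_impl (h e e0) => n hn; have /andP[] := hn.
by rewrite -{1 2}(fineK (fin _ _ hn)) !lee_fin /= distrC ler_distl => -> ->.
Qed.

Lemma semig_fixed (R : realType) (E : finType) (Q : E -> E -> R) (f : E -> R) t x :
  (forall x, \sum_z gen Q x z * f z = 0) -> semig Q t f x = f x.
Proof.
move=> h; have d u : is_derive u (1 : R) (fun u => semig Q u f x) 0.
  apply: is_derive_eq; first exact: is_derive_semig.
  under eq_bigr do rewrite /semig mulr_sumr.
  rewrite exchange_big /=.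
  transitivity (\sum_y \sum_z trans Q u x z * gen Q z y * f y).
    by apply: eq_bigr => y _; rewrite -mulr_suml -trans_comm mulr_suml; apply: eq_bigr => z _; rewrite mulrA.
  rewrite exchange_big /= big1 // => z _.
  by under eq_bigr do rewrite -mulrA; rewrite -mulr_sumr h mulr0.
by rewrite (derive0_const d t 0) semig0.
Qed.

Lemma hit_before_intro (E : finType) (A B : {set E}) s k x : (k < size s)%N -> nth x s k \in B ->
  (forall j, (j < k)%N -> nth x s j \notin A) -> hit_before A B s.
Proof.
elim: s k => [|y s ih] [|k] //= ks sB nA; first by rewrite sB.
apply/orP; case: (boolP (y \in B)) => yB; [by left|right].
have /= -> := nA 0%N isT; rewrite /=.
by apply: (ih k) => // j jk; exact: (nA j.+1).
Qed.

Lemma grid_after (R : realType) (h t : R) n : 0 < h -> 0 <= t <= h *+ n ->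
  exists k, [/\ (k <= n)%N, t <= h *+ k < t + h & forall j, (j < k)%N -> h *+ j < t].
Proof.
move=> h0 /andP[t0 tn]; have ex : exists k, t <= h *+ k by exists n.
have := ex_minnP ex; case => k tk mk; exists k; split; first exact: mk.
  rewrite tk /=; case: k mk {tk} => [|k] mk; first by rewrite mulr0n ltr_wpDl.
  rewrite mulrSr ltrD2r ltNge; apply/negP => /mk; by rewrite ltnn.
by move=> j jk; rewrite ltNge; apply/negP => /mk; rewrite leqNgt jk.
Qed.

(** * Hitting probabilities from harmonic functions *)

Section HitProbability.
Variables (R : realType) (E : finType) (Q : E -> E -> R) (A B : {set E}) (g psi : E -> R).
Hypothesis pos : nonneg_kernel Q.
Hypothesis psi0 : forall x, 0 <= psi x.
Hypothesis psiA : forall x, x \notin A -> \sum_y gen Q x y * psi y = -1.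
Hypothesis AB : forall x, x \in A -> x \notin B.
Hypothesis g01 : forall x, 0 <= g x <= 1.
Hypothesis gB : forall x, x \in B -> g x = 1.
Hypothesis gh : forall x, x \notin A -> x \notin B -> \sum_y gen Q x y * g y = 0.
Variables (dT : measure_display) (Om : measurableType dT) (P : probability Om R) (x0 : E) (X : R -> Om -> E).
Hypothesis hX : is_ctmc Q P x0 X.

Lemma hit_other_first : (P [set w | (hit X B w < hit X A w)%E] <= (g x0)%:E)%E.
Proof.
(* Mesh [(p + 1) ^- 2] and [(p + 1) ^ 3] steps: the horizon [p + 1] grows, while the accumulated
   Taylor error is [C / (p + 1)]. *)
pose h p : R := p.+1%:R^-1 ^+ 2; have h0 p : 0 < h p by rewrite exprn_gt0 // h_gt0.
have [n hn] : exists n, forall p, h p *+ n p = p.+1%:R.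
  pose n p := (p.+1 ^ 3)%N; exists n => p.
  have -> : h p *+ n p = h p * p.+1%:R ^+ 3 by rewrite -(mulr_natr (h p)) /n natrX.
  rewrite /h; have : p.+1%:R != 0 :> R by [].
  by move: (p.+1%:R : R) => z z0; field.
pose C := genbound Q ^+ 2 * 1; have C0 : 0 <= C by rewrite /C mulr1 sqr_ge0.
have [||e|N [mN sub PN]] // := liminf_cover (P := P) (Ev := [set w | (hit X B w < hit X A w)%E]) (b := g x0)
  (A := fun p => [set w | hit_before A B (smp X 0 (h p) (n p) w)]).
- by move=> p; exact: (path_meas hX).
- move=> w /(hit_lt hX) [t t0 [tB tA]].
  have [e [e0 he]] := cadlag_rc (ctmc_cadlag hX) w t0.
  apply: ev_impl (ev_and (ev_h_lt e0) (ev_h_lt (R := R) (e := (t + 1)^-1) _)); last by rewrite invr_gt0 ltr_wpDl.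
  move=> p [p1 p2].
  have hp1 : h p <= p.+1%:R^-1 by rewrite /h expr2 ler_piMl ?(ltW (h_gt0 R p)) // invf_le1 // ler1n.
  have tp : t <= p.+1%:R by rewrite ltf_pV2 ?posrE ?ltr_wpDl // in p2; apply: le_trans (ltW p2); rewrite lerDl.
  have [|k [kn /andP[tk kt] hj]] := @grid_after R (h p) t (n p) (h0 p); first by rewrite t0 hn.
  change (hit_before A B (smp X 0 (h p) (n p) w)).
  apply: (@hit_before_intro _ A B _ k x0); first by rewrite (eqP (size_smp _ _ _ _ _)) ltnS.
    rewrite nth_smp // add0r he // tk /=; apply: lt_trans kt _; rewrite ltrD2l; exact: le_lt_trans hp1 p1.
  move=> j jk; rewrite nth_smp; last exact: leq_trans (ltnW jk) kn.
  by rewrite add0r; apply: tA; rewrite mulrn_wge0 ?(ltW (h0 p)) //= ltW // hj.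
- move=> e0; apply: ev_impl (ev_h_lt (R := R) (e := e / (C + 1)) _); last by rewrite divr_gt0 // ltr_wpDl.
  move=> p hp; rewrite (path_probability0 _ (hit_before A B) hX (ltW (h0 p))) lee_fin.
  apply: le_trans (hit_before_le (g := g) (e := C * h p ^+ 2) pos (ltW (h0 p)) _ _ _ _ _ _) _.
  - by rewrite mulr_ge0 ?sqr_ge0.
  - by move=> x; case/andP: (g01 x).
  - by move=> x xB; rewrite gB.
  - move=> x xA xB; have := semig_taylor pos (f := g) (K := 1) x ler01 _ (ltW (h0 p)).
    rewrite gh // mulr0 subr0 => ht; have {ht} := ht (fun y => _); rewrite ler_norml => ht.
    have /ht/andP[_] : forall y, `|g y| <= 1 by move=> y; have /andP[a b] := g01 y; rewrite ger0_norm.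
    by rewrite -/C; lra.
  - rewrite lerD2l; have -> : (n p)%:R * (C * h p ^+ 2) = C * p.+1%:R^-1.
      by rewrite mulrCA; congr (_ * _); rewrite expr2 mulrA mulr_natl hn /h expr2 mulrA mulfV ?mul1r.
    move: (p.+1%:R^-1 : R) (h_gt0 R p) hp => z z0; rewrite ltr_pdivlMr ?ltr_wpDl // mulrDr mulr1 [z * C]mulrC; lra.
- by apply: le_trans PN; apply: le_measure; rewrite ?inE //; exact: (hit_lt_meas hX).
Qed.

(** A tie is impossible off a null set: [A] is hit because its occupation time is unbounded, the
    infimum is attained by right-continuity, and [A] and [B] are disjoint. *)
Lemma hit_probability : ((1 - g x0)%:E <= P [set w | (hit X A w < hit X B w)%E])%E.
Proof.
have [N [mN PN hN]] := occ_unbounded pos psi0 psiA hX.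
have m1 := hit_lt_meas hX A B; have m2 := hit_lt_meas hX B A.
have cov : setT `<=` [set w | (hit X A w < hit X B w)%E] `|` ([set w | (hit X B w < hit X A w)%E] `|` N).
  move=> w _; case: (pselect (N w)) => [|nN]; first by right; right.
  case: (ltgtP (hit X A w) (hit X B w)) => [?|?|eq]; [by left|by right; left|exfalso].
  have [t t0 ot] := hN w nN 0.
  have cX := ctmc_cadlag hX; have mX : forall t x, measurable [set w | X t w = x] by case: hX.
  have [s s0 sA] : exists2 s, 0 <= s & X s w \in A.
    apply: contrapT => hs; have : occ X A w t = occ X A w 0.
      apply: (occ_inc_out mX cX); rewrite ?lexx ?t0 // => u /andP[u0 _]; apply/negP => uA.
      by apply: hs; exists u => //; exact: ltW.
    by rewrite occ0 => o0; rewrite o0 ltxx in ot.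
  have hA0 : (0 <= hit X A w)%E by apply: le_ereal_inf_tmp => _ [u [u0 _] <-]; rewrite lee_fin.
  have hAs : (hit X A w <= s%:E)%E by apply: ereal_inf_lbound; exists s.
  case hA : (hit X A w) hA0 hAs => [v| |] //; rewrite !lee_fin => v0 _.
  have [e [e0 he]] := cadlag_rc cX w v0.
  have att C : hit X C w = v%:E -> X v w \in C.
    move=> hC; have : (hit X C w < (v + e)%:E)%E by rewrite hC lte_fin ltrDl.
    move=> /ereal_inf_lt[_ [u [u0 uC] <-]]; rewrite lte_fin => ue; rewrite -(he u) // ue andbT.
    by rewrite -lee_fin -hC; apply: ereal_inf_lbound; exists u.
  have := AB (att A hA); by rewrite (att B) // -eq.
have : (P setT <= P [set w | (hit X A w < hit X B w)%E] + (P [set w | (hit X B w < hit X A w)%E] + P N))%E.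
  apply: le_trans (le_measure _ _ _ cov) _; rewrite ?inE //; first by do 2?apply: measurableU.
  apply: le_trans (measureU2 _ _ _) _ => //; first exact: measurableU.
  by apply: leeD2l; apply: measureU2.
rewrite PN adde0 probability_setT => h1; have h2 := hit_other_first.
rewrite EFinB leeBlDr //; apply: le_trans h1 _; exact: leeD2l.
Qed.
End HitProbability.

(** * The Skorokhod topology *)

Section Skorokhod.
Variables (R : realType) (E : finType).

(* [y] follows the skeleton [c] of mesh [h]: it passes through [c j] at a time within [delta] of [j * h], and jumps at
   most once in between. *)
Definition follows (h delta : R) (n : nat) (y : R -> E) (c : nat -> E) := exists t : nat -> R,
  [/\ t 0%N = 0, forall j, (j <= n)%N -> `|t j - h *+ j| <= delta, forall j, (j <= n)%N -> y (t j) = c j,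
      forall j, (j < n)%N -> t j <= t j.+1 &
      forall j, (j < n)%N -> forall u v, t j <= u -> u <= v -> v <= t j.+1 -> y u = c j \/ y v = y u].

Lemma switch_time (y : R -> E) (p q : R) (a b : E) : cadlag y -> 0 <= p -> p <= q -> y p = a -> y q = b -> a != b ->
  (forall u v, p <= u -> u <= v -> v <= q -> y u = a \/ y v = y u) ->
  exists s, [/\ p < s, s <= q, forall u, p <= u < s -> y u = a & forall u, s <= u <= q -> y u = b].
Proof.
move=> cy p0 pq yp yq ab one; pose A := [set u | p <= u <= q /\ y u != a].
have Aq : A q by split; rewrite ?pq ?lexx // yq eq_sym.
have lA : has_lbound A by exists p => u [/andP[]].
have hA : has_inf A by split; [exists q|].
have [[e [e0 he]] _] := cy p p0.
have ps : p + e <= inf A.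
  apply: lb_le_inf; first by exists q.
  move=> u [/andP[pu _] yu]; rewrite leNgt; apply/negP => ue; move: yu.
  by rewrite he ?yp ?eqxx // pu ue.
have pi : p < inf A by apply: lt_le_trans ps; rewrite ltrDl.
have iq : inf A <= q by apply: ge_inf.
have below u : p <= u < inf A -> y u = a.
  move=> /andP[pu ui]; apply/eqP/negPn/negP => yu; have : inf A <= u; last by rewrite leNgt ui.
  by apply: ge_inf => //; split => //; rewrite pu ltW // (lt_le_trans ui).
have ya : y (inf A) != a.
  apply/negP => /eqP ya; have i0 : 0 <= inf A by exact: le_trans p0 (ltW pi).
  have [[e' [e'0 he']] _] := cy _ i0.
  have : inf A + e' <= inf A; last by rewrite gerDl leNgt e'0.
  apply: lb_le_inf; first by exists q.
  move=> u Au; rewrite leNgt; apply/negP => ue; case: (Au) => _; rewrite he' ?ya ?eqxx // ue andbT.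
  exact: ge_inf.
have yi v : inf A <= v <= q -> y v = y (inf A).
  move=> /andP[iv vq]; case: (one (inf A) v (ltW pi) iv vq) => // e1; by rewrite e1 eqxx in ya.
exists (inf A); split => // u iu; rewrite yi // -yq; symmetry; apply: yi.
by rewrite iq lexx.
Qed.

Section Alignment.
Variables (y z : R -> E).

(** A time change known only up to time [s], sending [[0, s]] onto [[0, t]]. It is built piece by
    piece, one constancy interval of the limit path at a time. *)
Definition aligned (s t e : R) := exists l : R -> R, [/\ l 0 = 0, l s = t,
  forall u v, 0 <= u -> u < v -> v <= s -> l u < l v, forall u, 0 <= u <= t -> exists2 v, 0 <= v <= s & l v = u &
  forall u, 0 <= u < s -> `|l u - u| <= e /\ y u = z (l u)].

Lemma aligned0 e : aligned 0 0 e.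
Proof.
exists id; split => // [u|u /andP[u0]]; last by rewrite ltNge u0.
by exists u.
Qed.

Lemma aligned_extend (s t s' t' e : R) : 0 <= s -> 0 <= t -> s < s' -> t < t' -> `|s - t| <= e -> `|s' - t'| <= e ->
  (forall u, t <= u < t' -> z u = z t) -> (forall u, s <= u < s' -> y u = z t) -> aligned s t e -> aligned s' t' e.
Proof.
move=> s0 t0 ss tt c1 c2 hz hy [l [l0 ls lm lsurj lc]].
pose k := (t' - t) / (s' - s); have ds : 0 < s' - s by rewrite subr_gt0.
have k0 : 0 < k by rewrite divr_gt0 // subr_gt0.
have kE : k * (s' - s) = t' - t by rewrite divfK // gt_eqF.
pose l' u := if u < s then l u else t + k * (u - s).
have l's u : s <= u -> l' u = t + k * (u - s) by rewrite /l' ltNge => ->.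
exists l'; split.
- rewrite /l'; case: ltP => // s0'; have st0 : s = 0 by apply/eqP; rewrite eq_le s0 s0'.
  have t00 : t = 0 by rewrite -ls st0.
  by rewrite t00 st0 subrr mulr0 addr0.
- by rewrite l's ?ltW // kE addrC subrK.
- move=> u v u0 uv vs; rewrite /l'; case: (ltP u s) => us; case: (ltP v s) => vs'.
  + exact: lm (ltW vs').
  + apply: (@lt_le_trans _ _ t); first by rewrite -ls; exact: lm.
    by rewrite lerDl mulr_ge0 ?(ltW k0) // subr_ge0.
  + by move: (lt_trans uv vs'); rewrite ltNge us.
  + by rewrite ltrD2l ltr_pM2l // ltrD2r.
- move=> u /andP[u0 ut]; case: (ltP u t) => hu.
    have [|v /andP[v0 vs] lv] := lsurj u; first by rewrite u0 ltW.
    have vs' : v < s by rewrite lt_neqAle vs andbT; apply/eqP => e1; move: hu; rewrite -lv e1 ls ltxx.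
    by exists v; rewrite ?v0 ?(ltW (lt_trans vs' ss)) // /l' vs'.
  exists (s + (u - t) / k); last first.
    have d0 : 0 <= (u - t) / k by rewrite divr_ge0 ?(ltW k0) // subr_ge0.
    rewrite l's ?lerDl // [s + _]addrC addrK [k * _]mulrC divfK ?gt_eqF //; lra.
  have d0 : 0 <= (u - t) / k by rewrite divr_ge0 ?(ltW k0) // subr_ge0.
  have d1 : (u - t) / k <= s' - s by rewrite ler_pdivrMr // mulrC kE; lra.
  by apply/andP; split; lra.
- move=> u /andP[u0 us]; case: (ltP u s) => hu.
    by rewrite /l' hu; apply: lc; rewrite u0.
  rewrite l's //; have ku : k * (u - s) < t' - t by rewrite -kE ltr_pM2l // ltrD2r.
  have ku0 : 0 <= k * (u - s) by rewrite mulr_ge0 ?(ltW k0) // subr_ge0.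
  split; last by rewrite hy ?hu // hz // lerDl ku0 /=; lra.
  pose w := (u - s) / (s' - s); have w0 : 0 <= w by rewrite divr_ge0 ?(ltW ds) // subr_ge0.
  have w1 : w <= 1 by rewrite ler_pdivrMr // mul1r; lra.
  (* On a linear piece the displacement is a convex combination of those at the two ends, so no
     error accumulates from piece to piece. *)
  have -> : t + k * (u - s) - u = (1 - w) * (t - s) + w * (t' - s').
    by rewrite /w /k; field; rewrite gt_eqF.
  have c1' : `|t - s| <= e by rewrite distrC.
  have c2' : `|t' - s'| <= e by rewrite distrC.
  move: c1' c2'; rewrite !ler_norml.
  move=> /andP[a1 a2] /andP[b1 b2].
  by apply/andP; split; nra.
Qed.

Lemma aligned_total (s t e : R) : 0 <= s -> 0 <= t -> aligned s t e -> exists2 l, time_change l &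
  forall u, 0 <= u < s -> `|l u - u| <= e /\ y u = z (l u).
Proof.
move=> s0 t0 [l [l0 ls lm lsurj lc]].
exists (fun u => if u < s then l u else t + (u - s)); last by move=> u /andP[u0 us]; rewrite us; apply: lc; rewrite u0.
have lge u : 0 <= u <= s -> 0 <= l u.
  move=> /andP[]; rewrite le_eqVlt => /predU1P[<-|u0] us; first by rewrite l0.
  by rewrite -l0 ltW // lm.
split.
- case: ltP => // s0'; have e0 : s = 0 by apply/eqP; rewrite eq_le s0 s0'.
  by rewrite e0 subrr addr0 -ls e0.
- move=> u v u0 uv; case: (ltP u s) => us; case: (ltP v s) => vs.
  + exact: lm (ltW vs).
  + apply: (@lt_le_trans _ _ t); first by rewrite -ls; exact: lm.
    by rewrite lerDl subr_ge0.
  + by move: (lt_trans uv vs); rewrite ltNge us.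
  + by rewrite ltrD2l ltrD2r.
- move=> u u0; case: ltP => us; first by apply: lge; rewrite u0 ltW.
  by rewrite addr_ge0 // subr_ge0.
- move=> u u0; case: (ltP u t) => ut.
    have [|v /andP[v0 vs] lv] := lsurj u; first by rewrite u0 ltW.
    exists v => //; case: ltP => // sv; have e1 : v = s by apply/eqP; rewrite eq_le vs sv.
    by move: ut; rewrite -lv e1 ls ltxx.
  exists (s + (u - t)); first by rewrite addr_ge0 // subr_ge0.
  by case: ltP => [|_]; [rewrite gtrDl subr_lt0 ltNge ut|rewrite addrAC subrr add0r addrC subrK].
Qed.
End Alignment.

(** * Convergence of paths that follow finer and finer skeletons *)

Section Convergence.
Variables (h delta : nat -> R) (n : nat -> nat) (y : nat -> R -> E) (z : R -> E).
Hypothesis h0 : forall k, 0 < h k.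
Hypothesis h_to0 : forall e : R, 0 < e -> ev (fun k => h k < e).
Hypothesis delta_to0 : forall e : R, 0 < e -> ev (fun k => delta k < e).
Hypothesis horizon : forall T : R, ev (fun k => T <= h k *+ n k).
Hypothesis cy : forall k, cadlag (y k).
Hypothesis cz : cadlag z.
Hypothesis fol : forall k, follows (h k) (delta k) (n k) (y k) (fun j => z (h k *+ j)).

Lemma follows_conv : sk_conv y z.
Proof.
have [t ht] := choice fol.
(* State of the construction at limit time [tau]: alignment up to a time [s] of [y k], the first
   grid index [j] after [tau], and constancy of [y k] from [s] until its checkpoint [t k j]. *)
pose stage k tau e := exists s j, [/\ 0 <= s, `|s - tau| <= e, aligned (y k) z s tau e &
  [/\ (j <= n k)%N, tau <= h k *+ j < tau + h k, s <= t k j & forall u, s <= u <= t k j -> y k u = z tau]].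
pose good tau := forall e, 0 < e -> ev (fun k => stage k tau e).
have good0 : good 0.
  move=> e e0; exists 0%N => k _; have [t0 _ ty _ _] := ht k; exists 0, 0%N.
  rewrite mulr0n t0 subrr normr0 !lexx (ltW e0) add0r h0; split => //; first exact: aligned0.
  split => // u u0; have -> : u = 0 by apply/eqP; rewrite eq_sym eq_le.
  by have := ty 0%N (leq0n _); rewrite t0 mulr0n.
(* Extension across an interval on which [z] is constant. For a fine mesh the skeleton is constant
   until the cell containing [tau'], and [y k] switches once inside that cell. *)
have step tau tau' : 0 <= tau -> tau < tau' -> (forall u, tau <= u < tau' -> z u = z tau) -> good tau -> good tau'.
  move=> tau0 tt hz gt e e0.
  have [[e1 [e10 he1]] _] := cz (ltW (le_lt_trans tau0 tt)).
  pose w := Num.min (Num.min (e / 2) e1) ((tau' - tau) / 4).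
  have w0 : 0 < w by rewrite !lt_min e10 !divr_gt0 // subr_gt0.
  have c1 := ev_and (gt e e0) (ev_and (h_to0 w0) (delta_to0 w0)).
  apply: ev_impl (ev_and c1 (horizon tau')) => k [[[s [j [s_0 st al [jn /andP[tj jt] sj ys]]]] [hk dk]] hor].
  have := hk; have := dk; rewrite !lt_min -!andbA => /and3P[d1 d2 d3] /and3P[k1 k2 k3].
  have tau'0 : 0 <= tau' <= h k *+ n k by rewrite hor ltW // (le_lt_trans tau0).
  have [j1 [j1n /andP[tj1 jt1] j1m]] := grid_after (h0 k) tau'0.
  have [_ td ty tm to] := ht k.
  have hmono i i' : (i <= i')%N -> h k *+ i <= h k *+ i'.
    by move=> ii; rewrite -![h k *+ _]mulr_natr ler_wpM2l ?ler_nat // ltW.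
  have jj : (j < j1)%N.
    rewrite ltnNge; apply/negP => j1j; have : h k *+ j1 <= h k *+ j by exact: hmono.
    lra.
  case: j1 jj j1n tj1 jt1 j1m => // j2 jj j2n tj2 jt2 j2m; rewrite ltnS in jj.
  have zc i : (j <= i <= j2)%N -> z (h k *+ i) = z tau.
    move=> /andP[ji ij]; apply: hz; rewrite j2m ?ltnS // andbT; apply: le_trans tj _.
    exact: hmono.
  have flat i : (i < n k)%N -> z (h k *+ i) = z tau -> z (h k *+ i.+1) = z tau ->
      forall u, t k i <= u <= t k i.+1 -> y k u = z tau.
    move=> ik zi zi1 u /andP[u1 u2]; case: (to i ik u (t k i.+1) u1 u2 (lexx _)) => [->//|<-].
    by rewrite ty.
  have const i : (j <= i <= j2)%N -> forall u, s <= u <= t k i -> y k u = z tau.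
    elim: i => [|i ih] /andP[ji ij] u /andP[su ui].
      by move: ji; rewrite leqn0 => /eqP j0; apply: ys; rewrite su j0.
    move: ji; rewrite leq_eqVlt => /predU1P[ji|]; first by apply: ys; rewrite su ji.
    rewrite ltnS => ji; case: (leP u (t k i)) => hu; first by apply: ih; rewrite ?ji ?su // ltnW.
    apply: (flat i); rewrite ?(ltW hu) ?ui //; [exact: leq_trans (ltnW _) j2n|apply: zc; rewrite ji ltnW //|].
    by apply: zc; rewrite ij leqW.
  have zb : z (h k *+ j2.+1) = z tau' by apply: he1; rewrite tj2 /=; lra.
  have := td _ j2n; have := td _ (ltnW j2n); rewrite !ler_distl => /andP[p1 p2] /andP[q1 q2].
  have tdj := td j jn; rewrite ler_distl in tdj; have /andP[r1 r2] := tdj.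
  have hS : h k *+ j2.+1 = h k *+ j2 + h k by rewrite mulrSr.
  have stj2 : s <= t k j2.
    have mono i : (j <= i <= j2)%N -> t k j <= t k i.
      elim: i => [|i ih] /andP[ji ij]; first by move: ji; rewrite leqn0 => /eqP ->.
      move: ji; rewrite leq_eqVlt => /predU1P[->//|]; rewrite ltnS => ji.
      apply: le_trans (ih _) (tm i _); first by rewrite ji ltnW.
      exact: leq_trans ij (ltnW j2n).
    by apply: le_trans sj (mono j2 _); rewrite jj leqnn.
  have [s' [ss' s'1 s'2 ya yb]] : exists s', [/\ s < s', t k j2 <= s', s' <= t k j2.+1,
     forall u, s <= u < s' -> y k u = z tau & forall u, s' <= u <= t k j2.+1 -> y k u = z tau'].
    have yj2 : y k (t k j2) = z tau by apply: (const j2); rewrite ?jj ?leqnn ?stj2 ?lexx.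
    have zj2 : z (h k *+ j2) = z tau by apply: zc; rewrite jj leqnn.
    case: (eqVneq (z tau) (z tau')) => [zz|zz].
      exists (t k j2.+1); split => //; [lra|exact: tm| |].
        move=> u /andP[su ut]; case: (leP u (t k j2)) => hu; first by apply: (const j2); rewrite ?jj ?leqnn ?su.
        by apply: (flat j2) => //; rewrite ?zb // (ltW hu) ltW.
      by move=> u /andP[u1 u2]; have -> : u = t k j2.+1; [by apply/eqP; rewrite eq_le u1 u2|rewrite ty].
    have t0 : 0 <= t k j2 by exact: le_trans s_0 stj2.
    have yj1 : y k (t k j2.+1) = z tau' by rewrite ty.
    have [s' [a1 a2 a3 a4]] := switch_time (cy k) t0 (tm j2 j2n) yj2 yj1 zz (fun u v a b c =>
      eq_ind _ (fun x => y k u = x \/ y k v = y k u) (to j2 j2n u v a b c) _ zj2).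
    exists s'; split => //; [exact: le_lt_trans stj2 a1|exact: ltW|].
    move=> u /andP[su ut]; case: (leP u (t k j2)) => hu; first by apply: (const j2); rewrite ?jj ?leqnn ?su.
    by apply: a3; rewrite ut ltW.
  have s't : `|s' - tau'| <= e by rewrite ler_distl; apply/andP; split; lra.
  exists s', j2.+1; split => //; first exact: le_trans s_0 (ltW ss').
    exact: aligned_extend tt st s't hz ya al.
  by split => //; rewrite tj2.
(* Continuous induction on the infimum of the bad times: the left limit of [z] reaches the infimum,
   right-continuity goes beyond it. *)
have all_good tau : 0 <= tau -> good tau.
  move=> tau0; apply: contrapT => bad; pose A := [set u | 0 <= u /\ ~ good u].
  have At : A tau by [].
  have lA : has_lbound A by exists 0 => u [].
  have s0 : 0 <= inf A by apply: lb_le_inf; [exists tau|move=> u []].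
  have below u : 0 <= u -> u < inf A -> good u.
    move=> u0 ui; apply: contrapT => gu; move: ui; rewrite ltNge => /negP; apply.
    by apply: ge_inf.
  have gs : good (inf A).
    move: s0; rewrite le_eqVlt => /predU1P[<-//|sp].
    have [_ /(_ sp) [e [l [e0 hl]]]] := cz (ltW sp).
    pose u := Num.max (inf A - e / 2) 0; have us : u < inf A by rewrite gt_max sp andbT; lra.
    have u0 : 0 <= u by rewrite le_max lexx orbT.
    have ue : inf A - e < u by rewrite lt_max; apply/orP; left; lra.
    apply: (step u _ u0 us _ (below u u0 us)) => v /andP[uv vs].
    by rewrite !hl ?ue ?us // vs (lt_le_trans ue).
  have [[e [e0 he]] _] := cz s0.
  have [|v [v0 bv] ve] := @inf_adherent _ A e e0; first by split; [exists tau|].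
  have Av : A v by []; apply: (bv); have := ge_inf lA Av; rewrite le_eqVlt => /predU1P[<-//|sv].
  apply: (step (inf A)) => // u /andP[su uv]; apply: he; rewrite su /=; exact: lt_trans uv ve.
pose spec k M l := forall u, 0 <= u <= M%:R -> `|l u - u| <= M.+1%:R^-1 /\ y k u = z (l u).
pose Good k M := exists2 l, time_change l & spec k M l.
have evGood M : ev (Good ^~ M).
  have M0 : 0 < M.+1%:R^-1 :> R by rewrite invr_gt0.
  have M2 : 0 <= M%:R + 2 :> R by rewrite addr_ge0.
  apply: ev_impl (all_good _ M2 _ M0) => k [s [j [s0 st al _]]].
  have [l tl hl] := aligned_total s0 M2 al; exists l => // u /andP[u0 uM]; apply: hl; rewrite u0 /=.
  have M1 : M.+1%:R^-1 <= 1 :> R by rewrite invf_le1 // ler1n.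
  move: (M.+1%:R^-1 : R) (M%:R : R) M1 uM st => a b a1 uM; rewrite ler_distl => /andP[c1 c2]; lra.
(* Diagonal choice: for each [k] the time change realizing the largest horizon and precision
   available up to level [k], so that one sequence serves all horizons. *)
have best k : exists l, time_change l /\ forall M, (M <= k)%N -> Good k M -> exists2 M', (M <= M')%N & spec k M' l.
  elim: {1}k => [|K [l [tl hl]]].
    case: (pselect (Good k 0%N)) => [[l tl sl]|ng].
      by exists l; split => // M; rewrite leqn0 => /eqP -> _; exists 0%N.
    exists id; split; last by move=> M; rewrite leqn0 => /eqP ->.
    by split => // u u0; exists u.
  case: (pselect (Good k K.+1)) => [[l' tl' sl']|ng]; first by exists l'; split => // M MK _; exists K.+1.
  exists l; split => // M; rewrite leq_eqVlt => /predU1P[->//|]; exact: hl.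
have [l hl] := choice best; exists l; split; first by move=> k; case: (hl k).
move=> T T0.
have key e : 0 < e -> \forall k \near \oo, forall u, 0 <= u <= T -> `|l k u - u| < e /\ y k u = z (l k u).
  move=> e0; have [M1 hM1] := ev_h_lt e0; pose M := maxn M1 (Num.truncn T).+1.
  have TM : T <= M%:R by apply: ltW; apply: lt_le_trans (truncnS_gt T) _; rewrite ler_nat leq_maxr.
  have [k0 hk0] := evGood M; apply: ev_near; exists (maxn k0 M) => k; rewrite geq_max => /andP[kk kM] u /andP[u0 uT].
  have [_ hb] := hl k; have [M' MM' sM'] := hb M kM (hk0 k kk).
  have [|a b] := sM' u; first by rewrite u0 (le_trans uT) // (le_trans TM) // ler_nat.
  split => //; apply: le_lt_trans a (hM1 M' _); exact: leq_trans (leq_maxl _ _) MM'.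
split.
  by move=> e e0; have := key e e0; apply: filterS => k hk u hu; case: (hk u hu).
by have := key 1 ltr01; apply: filterS => k hk u hu; case: (hk u hu).
Qed.
End Convergence.
End Skorokhod.

Lemma path_expectation0 (R : realType) (E : finType) (Q : E -> E -> R) dT (Om : measurableType dT) (P : probability Om R) x0
  (X : R -> Om -> E) (h : R) n (Phi : seq E -> R) : is_ctmc Q P x0 X -> 0 <= h ->
  (\int[P]_w (Phi (smp X 0 h n w))%:E)%E = (epath Q n h x0 (fun s => Phi (x0 :: s)))%:E.
Proof.
move=> hX h0; rewrite (path_expectation hX) //; congr (_%:E).
rewrite (bigD1 x0) //= trans0 eqxx mul1r big1 ?addr0 // => y yx.
by rewrite trans0 eq_sym (negbTE yx) mul0r.
Qed.

(** * Skeletons and the oscillation of functionals *)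

Section Skeleton.
Variables (R : realType) (E : finType).

(** With mesh [(k + 1) ^- 2] and [(k + 1) ^ 3] steps the horizon is [k + 1], and two changes in some
    cell have total probability of order [1 / (k + 1)]. The number of steps is locked to prevent its
    unfolding. *)
Definition mesh k : R := k.+1%:R^-1 ^+ 2.
Definition slack k : R := k.+1%:R^-1.
Definition steps k : nat := locked (k.+1 ^ 3)%N.

Lemma mesh_gt0 k : 0 < mesh k. Proof. by rewrite exprn_gt0 // invr_gt0. Qed.
Lemma mesh_steps k : mesh k *+ steps k = k.+1%:R.
Proof.
rewrite -(mulr_natr (mesh k)) /steps -lock natrX /mesh; have : k.+1%:R != 0 :> R by [].
by move: (k.+1%:R : R) => z z0; field.
Qed.
Lemma mesh_lt e : 0 < e -> ev (fun k => mesh k < e).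
Proof.
move=> e0; apply: ev_impl (ev_h_lt e0) => k hk; apply: le_lt_trans hk.
by rewrite /mesh expr2 ler_piMl ?invr_ge0 // invf_le1 // ler1n.
Qed.

Definition skel k (c : nat -> E) (t : R) : E := c (minn (Num.truncn (t / mesh k)) (steps k)).

Lemma skelE k c (t : R) q : mesh k *+ q <= t < mesh k *+ q.+1 -> skel k c t = c (minn q (steps k)).
Proof.
rewrite -![mesh k *+ _]mulr_natl -ler_pdivlMr ?mesh_gt0 // -ltr_pdivrMr ?mesh_gt0 // => hq.
by rewrite /skel (truncn_def hq).
Qed.

Lemma mesh_cell k (t : R) : 0 <= t -> exists q, mesh k *+ q <= t < mesh k *+ q.+1.
Proof.
move=> t0; exists (Num.truncn (t / mesh k)); rewrite -![mesh k *+ _]mulr_natl -ler_pdivlMr ?mesh_gt0 // -ltr_pdivrMr ?mesh_gt0 //.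
by apply: truncn_itv; rewrite divr_ge0 // ltW // mesh_gt0.
Qed.

Lemma mesh_mono k i j : (i <= j)%N -> mesh k *+ i <= mesh k *+ j.
Proof. by move=> ij; rewrite -![mesh k *+ _]mulr_natr ler_wpM2l ?ler_nat // ltW // mesh_gt0. Qed.

Lemma skel_cadlag k c : cadlag (skel k c).
Proof.
move=> t t0; have [q /andP[q1 q2]] := mesh_cell k t0; split.
  exists (mesh k *+ q.+1 - t); split; first by rewrite subr_gt0.
  move=> s /andP[ts]; rewrite addrC subrK => sq.
  by rewrite (@skelE k c t q) ?q1 // (@skelE k c s q) // (le_trans q1).
move=> tp; have [|[|p] [_ /andP[tp1 tp2] hp]] := @grid_after R (mesh k) t q.+1 (mesh_gt0 k).
- by rewrite t0 ltW.
- by rewrite mulr0n leNgt tp in tp1.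
have pt := hp p (ltnSn p).
exists (t - mesh k *+ p), (c (minn p (steps k))); split; first by rewrite subr_gt0.
move=> s /andP[ps st]; apply: skelE; rewrite (lt_le_trans st tp1) andbT ltW //; lra.
Qed.

Lemma skel_follows k c : follows (mesh k) (slack k) (steps k) (skel k c) c.
Proof.
have m0 := mesh_gt0 k; exists (fun j => mesh k *+ j); split => // [j jn|j jn|j jn|j jn u v ju uv vj].
- by rewrite subrr normr0 invr_ge0.
- by rewrite (@skelE k c _ j) ?lexx ?mulrSr ?ltrDl // (minn_idPl jn).
- exact: mesh_mono.
- case: (ltP u (mesh k *+ j.+1)) => hu; first by left; rewrite (@skelE k c _ j) ?ju // (minn_idPl (ltnW jn)).
  right; suff -> : v = u by []; apply/eqP; rewrite eq_le uv (le_trans vj hu) //.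
Qed.

Lemma follows_ext (h dl : R) n (y : R -> E) c c' : (forall j, (j <= n)%N -> c j = c' j) ->
  follows h dl n y c -> follows h dl n y c'.
Proof.
move=> cc [t [t0 td ty tm to]]; exists t; split => // j jn; first by rewrite -cc // ty.
by rewrite -cc ?(ltnW jn) //; exact: to.
Qed.

Lemma skel_ext k c c' : (forall j, (j <= steps k)%N -> c j = c' j) -> skel k c = skel k c'.
Proof. by move=> cc; apply/funext => t; rewrite /skel cc // geq_minr. Qed.

Variables (F : (R -> E) -> R) (M : R).
Hypothesis FM : forall f, cadlag f -> `|F f| <= M.
Hypothesis Fc : forall xs x, (forall n, cadlag (xs n)) -> cadlag x -> sk_conv xs x -> (fun n => F (xs n)) @ \oo --> (F x : R^o).

Lemma skel_conv (z : R -> E) : cadlag z -> forall y : nat -> R -> E, (forall k, cadlag (y k)) ->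
  (forall k, follows (mesh k) (slack k) (steps k) (y k) (fun j => z (mesh k *+ j))) -> (fun k => F (y k)) @ \oo --> (F z : R).
Proof.
move=> cz y cy fy; apply: Fc => //; apply: (follows_conv mesh_gt0 mesh_lt _ _ cy cz fy).
- by move=> e e0; exact: ev_h_lt.
- move=> T; exists (Num.truncn T).+1 => k hk; rewrite mesh_steps; apply: ltW; apply: lt_le_trans (truncnS_gt T) _.
  by rewrite ler_nat leqW.
Qed.

(** The supremum over all compatible paths makes the error a function of finitely many samples; it
    is measurable without any regularity of the functional beyond its values on paths. *)
Definition deviations k c := [set a : R | exists y, [/\ cadlag y, follows (mesh k) (slack k) (steps k) y c & a = `|F y - F (skel k c)|]].
Definition osc k c : R := sup (deviations k c).

Lemma dev_le k c : ubound (deviations k c) (2 * M).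
Proof.
move=> _ [y [cy _ ->]]; apply: le_trans (ler_normB _ _) _.
rewrite mulr_natl mulr2n; apply: lerD; apply: FM => //; exact: skel_cadlag.
Qed.

Lemma dev_sup k c : has_sup (deviations k c).
Proof.
split; last by exists (2 * M); exact: dev_le.
by exists 0, (skel k c); split; [exact: skel_cadlag|exact: skel_follows|rewrite subrr normr0].
Qed.

Lemma osc_ge k c y : cadlag y -> follows (mesh k) (slack k) (steps k) y c -> `|F y - F (skel k c)| <= osc k c.
Proof. by move=> cy fy; apply: ub_le_sup; [exists (2 * M); exact: dev_le|exists y]. Qed.

Lemma osc_bounds k c : 0 <= osc k c <= 2 * M.
Proof.
rewrite (le_trans _ (osc_ge (skel_cadlag k c) (skel_follows k c))) //=.
by apply: ge_sup; [case: (dev_sup k c)|exact: dev_le].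
Qed.

Lemma osc_ext k c c' : (forall j, (j <= steps k)%N -> c j = c' j) -> osc k c = osc k c'.
Proof.
move=> cc; congr sup; apply/seteqP; split => a [y [cy fy ->]]; exists y; split => //.
- exact: follows_ext fy.
- by rewrite (skel_ext cc).
- by apply: follows_ext fy => j /cc.
- by rewrite (skel_ext cc).
Qed.

(** Paths nearly attaining the supremum follow the samples of [z], hence converge to [z], as do the
    skeletons; continuity of [F] at the single point [z] closes the gap. *)
Lemma osc_to0 (z : R -> E) : cadlag z -> (fun k => osc k (fun j => z (mesh k *+ j))) @ \oo --> (0 : R).
Proof.
move=> cz; pose c k j := z (mesh k *+ j).
have pick k : exists y, [/\ cadlag y, follows (mesh k) (slack k) (steps k) y (c k) & osc k (c k) - slack k < `|F y - F (skel k (c k))|].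
  have s0 : 0 < slack k by rewrite invr_gt0.
  by have [_ [y [cy fy ->]] h] := sup_adherent s0 (dev_sup k (c k)); exists y.
have [y hy] := choice pick.
have c1 := skel_conv cz (y := y) (fun k => let: And3 a _ _ := hy k in a) (fun k => let: And3 _ a _ := hy k in a).
have c2 := skel_conv cz (fun k => skel_cadlag k (c k)) (fun k => skel_follows k (c k)).
have c3 : (fun k => F (y k) - F (skel k (c k))) @ \oo --> (0 : R) by rewrite -(subrr (F z)); exact: cvgB.
apply/cvgrPdist_le => e e0; apply: ev_near; have e2 : 0 < e / 2 by rewrite divr_gt0.
apply: ev_impl (ev_and (cvg0_ev c3 e2) (ev_h_lt e2)) => k [h1 h2].
have [_ _ h3] := hy k.
have /andP[os0 _] := osc_bounds k (c k).
rewrite sub0r normrN ger0_norm //; move: h2 h3; rewrite -/(slack k) -/(c k) => h2 h3; lra.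
Qed.

Section Limit.
Variables (Q : E -> E -> R) (dT : measure_display) (Om : measurableType dT) (P : probability Om R) (x0 : E) (Z : R -> Om -> E).
Hypothesis hZ : is_ctmc Q P x0 Z.

Lemma smp_skel (w : Om) k j : (j <= steps k)%N -> nth x0 (smp Z 0 (mesh k) (steps k) w) j = Z (mesh k *+ j) w.
Proof. by move=> jk; rewrite nth_smp // add0r. Qed.

Lemma skel_expectation : measurable_fun setT (fun w => F (Z ^~ w)) ->
  (fun k => epath Q (steps k) (mesh k) x0 (fun s => F (skel k (nth x0 (x0 :: s))))) @ \oo --> (fine (\int[P]_w (F (Z ^~ w))%:E)%E : R) /\
  (fun k => epath Q (steps k) (mesh k) x0 (fun s => osc k (nth x0 (x0 :: s)))) @ \oo --> (0 : R).
Proof.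
move=> mF.
(* Dominated convergence, path by path, for functionals of the samples of the limit chain. *)
have dct (G : nat -> seq E -> R) (f : Om -> R) (K : R) : measurable_fun setT f -> (forall k s, `|G k s| <= K) ->
    (forall w, (fun k => G k (smp Z 0 (mesh k) (steps k) w)) @ \oo --> f w) ->
    (fun k => epath Q (steps k) (mesh k) x0 (fun s => G k (x0 :: s))) @ \oo --> (fine (\int[P]_w (f w)%:E)%E : R).
  move=> mf GK cv; have mG k : measurable_fun setT (fun w => G k (smp Z 0 (mesh k) (steps k) w)).
    exact: (path_fun_meas hZ 0 (mesh k) (steps k) (G k)).
  have eE k : (\int[P]_w (G k (smp Z 0 (mesh k) (steps k) w))%:E = (epath Q (steps k) (mesh k) x0 (fun s => G k (x0 :: s)))%:E)%E.
    by rewrite (path_expectation0 _ (G k) hZ) // ltW // mesh_gt0.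
  have c1 : {ae P, forall w, setT w -> (fun k => (G k (smp Z 0 (mesh k) (steps k) w))%:E) @ \oo --> (f w)%:E}.
    by apply: aeW => w _; apply: cvg_EFin => //; [apply: nearW|exact: cv].
  have c2 : {ae P, forall w k, setT w -> (`|(G k (smp Z 0 (mesh k) (steps k) w))%:E| <= (fun=> K%:E) w)%E}.
    by apply: aeW => w k _; rewrite /= lee_fin.
  have [ig _ hc] := @dominated_convergence _ _ R P setT measurableT (fun k w => (G k (smp Z 0 (mesh k) (steps k) w))%:E)
    (fun w => (f w)%:E) (fun=> K%:E) (fun k => (measurable_EFinP _ _).2 (mG k)) ((measurable_EFinP _ _).2 mf)
    c1 (finite_measure_integrable_cst P K measurableT) c2.
  have fi : (\int[P]_w (f w)%:E)%E \is a fin_num by exact: integrable_fin_num.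
  rewrite -(fineK fi) in hc.
  rewrite (_ : (fun k => _) = fine \o (fun k => (\int[P]_w (G k (smp Z 0 (mesh k) (steps k) w))%:E)%E)); first exact: fine_cvg hc.
  by apply/funext => k /=; rewrite eE.
have sk w k : skel k (nth x0 (smp Z 0 (mesh k) (steps k) w)) = skel k (fun j => Z (mesh k *+ j) w).
  by apply: skel_ext => j jk; exact: smp_skel.
have cZ w : cadlag (Z ^~ w) by exact: (ctmc_cadlag hZ).
split.
  apply: (dct (fun k s => F (skel k (nth x0 s))) _ M mF) => [k s|w]; first by apply: FM; exact: skel_cadlag.
  under eq_fun do rewrite sk.
  exact: (skel_conv (cZ w) (fun k => skel_cadlag k _) (fun k => skel_follows k _)).
have -> : 0 = fine (\int[P]_w (0 : R)%:E)%E :> R by rewrite integral0.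
apply: (dct (fun k s => osc k (nth x0 s)) (fun=> 0) (2 * M)) => [|k s|w]; first exact: measurable_cst.
  by have /andP[a b] := osc_bounds k (nth x0 s); rewrite ger0_norm.
have e k : osc k (nth x0 (smp Z 0 (mesh k) (steps k) w)) = osc k (fun j => Z (mesh k *+ j) w).
  by apply: osc_ext => j jk; exact: smp_skel.
under eq_fun do rewrite e.
exact: (osc_to0 (cZ w)).
Qed.
End Limit.
End Skeleton.

(** * Probability estimates for the comparison with the skeleton *)

Lemma tail_bound (R : realType) dT (Om : measurableType dT) (P : probability Om R) (f : Om -> \bar R) (a b : R) :
  measurable_fun setT f -> (forall w, (0 <= f w)%E) -> 0 < a -> (\int[P]_w f w <= (a * b)%:E)%E ->
  measurable [set w | (a%:E < f w)%E] /\ (P [set w | (a%:E < f w)%E] <= b%:E)%E.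
Proof.
move=> mf f0 a0 le; have mM : measurable [set w | (a%:E < f w)%E].
  by rewrite -[X in measurable X]setTI; exact: emeasurable_fun_o_infty.
split => //; rewrite -(lee_pmul2l (x := a%:E)) // -EFinM; apply: le_trans le.
have -> : (a%:E * P [set w | (a%:E < f w)%E] = \int[P]_w (a%:E * (\1_[set w | (a%:E < f w)%E] w)%:E))%E.
  rewrite ge0_integralZl //; last by rewrite lee_fin ltW.
    by rewrite integral_indic // setIT.
  by apply/measurable_EFinP; exact: measurable_indic.
apply: ge0_le_integral => //.
- by move=> w _; rewrite mule_ge0 ?lee_fin ?(ltW a0).
- by apply/measurable_EFinP; apply: measurable_funM => //; exact: measurable_indic.
- move=> w _; rewrite indicE; case: (boolP (w \in _)) => hw; last by rewrite mule0.
  by rewrite mule1 ltW //; move: hw; rewrite inE.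
Qed.

Lemma union_bound (R : realType) dT (Om : measurableType dT) (P : probability Om R) (A : nat -> set Om) n (b : R) :
  (forall j, (j < n)%N -> measurable (A j)) -> (forall j, (j < n)%N -> (P (A j) <= b%:E)%E) ->
  measurable (\big[setU/set0]_(j < n) A j) /\ (P (\big[setU/set0]_(j < n) A j) <= (n%:R * b)%:E)%E.
Proof.
move=> mA hb; split; first by apply: bigsetU_measurable => j _; exact: mA.
apply: le_trans (Boole_inequality _ mA) _; apply: (@le_trans _ _ (\sum_(j < n) b%:E)%E).
  by apply: lee_sum => j _; exact: hb.
by rewrite sumEFin sumr_const card_ord mulr_natl.
Qed.

(** Here [z] is [k + 1]. Two changes in one cell cost [(L / z ^ 2) ^ 2] and there are [z ^ 3] cells,
    which leaves [1 / z]; [e] is taken so small that all its occurrences are of that order or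
    less. *)
Lemma rare_arith (R : realType) (L K z : R) : 0 <= L -> 0 <= K -> 1 <= z ->
  let e := (4 * z ^+ 4 * (K + 1))^-1 in
  [/\ 0 < e <= 4^-1 & z ^+ 2 * e + ((z ^+ 3 + 1) * e + z ^+ 3 * ((2 * (L * z^-1 ^+ 2 + K * e)) ^+ 2 + e)) <= (4 * (L + 1) ^+ 2 + 1) / z].
Proof.
move=> L0 K0 z1 e; have z0 : 0 < z by apply: lt_le_trans z1.
pose i := z^-1; have i0 : 0 < i by rewrite invr_gt0.
have i1 : i <= 1 by rewrite invf_le1.
have zi : z * i = 1 by rewrite divff // gt_eqF.
have Ki : 0 < (K + 1)^-1 by rewrite invr_gt0 ltr_wpDl.
have eE : e = 4^-1 * i ^+ 4 * (K + 1)^-1 by rewrite /e 2!invfM /i exprVn.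
have i4 : 0 < i ^+ 4 <= i ^+ 2.
  rewrite exprn_gt0 //= (_ : i ^+ 4 = i ^+ 2 * i ^+ 2); last by ring.
  by rewrite ler_piMl ?sqr_ge0 // expr2 mulr_ile1 // ltW.
have /andP[i4p i42] := i4.
have K1 : (K + 1)^-1 <= 1 by rewrite invf_le1 ?ltr_wpDl // lerDr.
have e0 : 0 < e by rewrite eE !mulr_gt0 // invr_gt0.
have ei : e <= 4^-1 * i ^+ 4 by rewrite eE ler_piMr // mulr_ge0 ?invr_ge0 // ltW.
have i41 : i ^+ 4 <= 1 by rewrite exprn_ile1 // ltW.
split; first by rewrite e0 /=; apply: le_trans ei _; lra.
have Ke : K * e <= i ^+ 2.
  apply: (@le_trans _ _ (4^-1 * i ^+ 4)); last lra.
  rewrite eE mulrCA ler_piMr //; first by rewrite mulr_ge0 ?invr_ge0 // ltW.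
  by rewrite ler_pdivrMr ?ltr_wpDl // mul1r lerDl.
have q1 : L * i ^+ 2 + K * e <= (L + 1) * i ^+ 2 by rewrite mulrDl mul1r lerD2l.
have q0 : 0 <= L * i ^+ 2 + K * e by rewrite addr_ge0 ?mulr_ge0 ?sqr_ge0 // ltW.
have q2 : (2 * (L * i ^+ 2 + K * e)) ^+ 2 <= 4 * (L + 1) ^+ 2 * i ^+ 4.
  apply: (@le_trans _ _ ((2 * ((L + 1) * i ^+ 2)) ^+ 2)); last by apply: le_of_eq; ring.
  have q3 : 2 * (L * i ^+ 2 + K * e) <= 2 * ((L + 1) * i ^+ 2) by exact: ler_wpM2l.
  have q4 : 0 <= 2 * (L * i ^+ 2 + K * e) by exact: mulr_ge0.
  by apply: lerXn2r => //; rewrite nnegrE // (le_trans q4).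
have z3 : 0 < z ^+ 3 by rewrite exprn_gt0.
have z31 : z ^+ 2 <= z ^+ 3 by rewrite ler_weXn2l.
have z30 : 1 <= z ^+ 3 by rewrite exprn_ege1.
have zi4 : z ^+ 3 * i ^+ 4 = i by rewrite [i ^+ 4]exprS mulrCA -exprMn zi expr1n mulr1.
have b1 : z ^+ 3 * e <= 4^-1 * i.
  apply: (@le_trans _ _ (z ^+ 3 * (4^-1 * i ^+ 4))); first by rewrite ler_wpM2l // ltW.
  by rewrite mulrCA zi4.
have b2 : z ^+ 2 * e <= z ^+ 3 * e by rewrite ler_wpM2r // ltW.
have b3 : e <= z ^+ 3 * e by rewrite ler_peMl // ltW.
have b4 : z ^+ 3 * (2 * (L * i ^+ 2 + K * e)) ^+ 2 <= 4 * (L + 1) ^+ 2 * i.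
  apply: (@le_trans _ _ (z ^+ 3 * (4 * (L + 1) ^+ 2 * i ^+ 4))); first by rewrite ler_wpM2l // ltW.
  by rewrite mulrCA zi4.
rewrite -/i !mulrDl !mul1r mulrDr; lra.
Qed.

(** On the null set [N] the path need not be cadlag, so [f] is not even bounded there; on [A] only
    the trivial bound [2 * K] is used. *)
Lemma expectation_close (R : realType) dT (Om : measurableType dT) (P : probability Om R) (f g o : Om -> R) (A N : set Om) (K a b c : R) :
  measurable_fun setT f -> measurable_fun setT g -> measurable_fun setT o -> measurable A -> measurable N -> P N = 0%E ->
  (P A <= c%:E)%E -> (forall w, ~ N w -> `|f w| <= K) -> (forall w, `|g w| <= K) -> (forall w, 0 <= o w <= 2 * K) ->
  (forall w, ~ N w -> ~ A w -> `|f w - g w| <= o w) ->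
  (\int[P]_w (g w)%:E = a%:E)%E -> (\int[P]_w (o w)%:E = b%:E)%E ->
  ((a - (b + 2 * K * c))%:E <= \int[P]_w (f w)%:E <= (a + (b + 2 * K * c))%:E)%E.
Proof.
move=> mf mg mo mA mN N0 Ac fK gK oK fg ga ob.
have [K0|K0] := ltP K 0.
  have [w Nw] : exists w, ~ N w.
    apply: contrapT => h; have NT : N = setT by apply/seteqP; split => // w _; apply: contrapT => nw; apply: h; exists w.
    by move: N0; rewrite NT probability_setT => /eqP; rewrite onee_eq0.
  by have := le_lt_trans (fK w Nw) K0; rewrite normr_lt0.
have bi (h : Om -> R) (L : R) : measurable_fun setT h -> (forall w, `|h w| <= L) -> P.-integrable setT (EFin \o h).
  move=> mh hL; apply: (le_integrable measurableT _ _ (finite_measure_integrable_cst P L measurableT)); first exact/measurable_EFinP.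
  by move=> w _; rewrite /= lee_fin (le_trans (hL w)) // ler_norm.
pose D := A `|` N; have mD : measurable D by exact: measurableU.
have PD : (P D <= c%:E)%E by apply: le_trans (measureU2 _ mA mN) _; rewrite /= [X in (_ + X)%E]N0 adde0.
pose i w : R := \1_D w; have mi : measurable_fun setT i by exact: measurable_indic.
(* Cutting [f] off on the null set makes it bounded without changing its integral. *)
pose f1 w := f w * \1_(~` N) w.
have mf1 : measurable_fun setT f1 by apply: measurable_funM => //; apply: measurable_indic; exact: measurableC.
have f1b w : `|f1 w| <= K.
  rewrite /f1 indicE; case: (boolP (w \in ~` N)) => [|_]; last by rewrite mulr0 normr0.
  by rewrite inE mulr1 => /fK.
have -> : (\int[P]_w (f w)%:E = \int[P]_w (f1 w)%:E)%E.
  apply: ae_eq_integral => //; try exact/measurable_EFinP.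
  exists N; split => // w /= h; apply: contrapT => nN; apply: h => _.
  by rewrite /f1 indicE mem_set ?mulr1.
have on w : `|o w| <= 2 * K by have /andP[p0 p1] := oK w; rewrite ger0_norm.
have i01 w : 0 <= i w <= 1 by rewrite /i indicE; case: (_ \in _); rewrite ?ler01 ?lexx.
have ii w : `|i w| <= 1 by have /andP[i0 i1] := i01 w; rewrite ger0_norm.
have f1g w : `|f1 w - g w| <= o w + 2 * K * i w.
  have /andP[p0 _] := oK w; rewrite /i indicE; case: (boolP (w \in D)) => [_|].
    by rewrite mulr1; apply: le_trans (ler_normB _ _) _; have := f1b w; have := gK w; lra.
  rewrite notin_setE mulr0 addr0 => nD; have nN : ~ N w by move=> h; apply: nD; right.
  rewrite /f1 indicE mem_set ?mulr1 //; apply: fg => // h; apply: nD; left; exact: h.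
pose q := fine (P D); have Pq : P D = q%:E by rewrite fineK // fin_num_measure.
have qc : q <= c by rewrite -lee_fin -Pq.
have comb (s : R) : `|s| = 1 -> (P.-integrable setT (fun w => (g w + s * (o w + 2 * K * i w))%:E) /\
    \int[P]_w (g w + s * (o w + 2 * K * i w))%:E = (a + s * (b + 2 * K * q))%:E)%E.
  move=> s1; have gi := bi g K mg gK; have oi := bi o _ mo on; have ji := bi i 1 mi ii.
  have ki : P.-integrable setT (fun w => ((2 * K)%:E * (i w)%:E)%E) by exact: integrableZl.
  have li := integrableD measurableT oi ki.
  have si : P.-integrable setT (fun w => (s%:E * ((o w)%:E + (2 * K)%:E * (i w)%:E))%E) by exact: (integrableZl measurableT s li).
  split; first exact: (integrableD measurableT gi si).
  under eq_integral do rewrite EFinD EFinM EFinD EFinM.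
  rewrite (integralD measurableT gi si) (integralZl measurableT li) (integralD measurableT oi ki) (integralZl measurableT ji) /=.
  have iE : (\int[P]_w (i w)%:E = q%:E)%E by transitivity (P (D `&` setT)); [exact: integral_indic|rewrite setIT].
  by rewrite ga ob iE.
have [lo lE] := comb (- 1) (normrN1 _); have [hi hE] := comb 1 (normr1 _).
have K2 : 2 * K * q <= 2 * K * c by rewrite ler_wpM2l // mulr_ge0.
have fi := bi f1 K mf1 f1b; apply/andP; split.
  apply: (@le_trans _ _ (a + -1 * (b + 2 * K * q))%:E); first by rewrite lee_fin; lra.
  rewrite -lE; apply: (le_integral measurableT lo fi) => w _; rewrite lee_fin.
  by have := f1g w; rewrite ler_norml => /andP[]; lra.
apply: (@le_trans _ _ (a + 1 * (b + 2 * K * q))%:E); last by rewrite lee_fin; lra.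
rewrite -hE; apply: (le_integral measurableT fi hi) => w _; rewrite lee_fin.
by have := f1g w; rewrite ler_norml => /andP[]; lra.
Qed.

(** * Convergence of the inclusion process *)

Section Inclusion.
Variables (R : realType) (S : finType) (r : S -> S -> R) (m : S -> R).
Hypothesis r0 : forall x y, 0 <= r x y.
Hypothesis rxx : forall x, r x x = 0.
Hypothesis irr : forall x y, connect [rel a b | 0 < r a b] x y.
Hypothesis m0 : forall x, 0 <= m x.
Hypothesis m1 : \sum_x m x = 1.
Hypothesis rev : forall x y, m x * r x y = m y * r y x.
Local Notation Sstar := (Sstar m).
Local Notation ms := (mstar m).
Local Notation sst := (#|Sstar|%:R : R).
Local Notation cls := (cls r m).
Local Notation ctx := (ctx R S).
Local Notation valid := (valid m).
Local Notation small := (small r m).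
Let ms0 x : 0 < ms x. Proof. exact: (ms_gt0 irr m0 m1 rev). Qed.
Let ms1 x : ms x <= 1. Proof. exact: (ms_le1 irr m0 m1 rev). Qed.
Hypothesis kappa2 : (2 <= #|classes r m|)%N.
Let clsE (D D' : cls) x : x \in val D -> x \in val D' -> D = D'.
Proof. exact: cls_eq. Qed.

(** * Harmonic functions of the inclusion process *)

Section FixedSize.
Variables (n : nat) (d : R).
Hypothesis d0 : 0 < d.
Local Notation Q := (Qinc r d : Hn S n.+1 -> Hn S n.+1 -> R).
Local Notation G f eta := (\sum_z gen Q eta z * f z).
Let x0ex : exists x0 : S, True. Proof. by have [x _] := some_site m0 m1; exists x. Qed.

Lemma harmonic0 (B : {set Hn S n.+1}) (f : Hn S n.+1 -> R) : B != finset.set0 ->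
  (forall x, x \notin B -> G f x = 0) -> (forall x, x \in B -> f x = 0) -> forall x, f x = 0.
Proof.
move=> /set0Pn[b bB] h1 h2 x; have [x0 _] := x0ex.
have D0 : Dir r ms d f f = 0.
  apply: oppr_inj; rewrite -(Dir_gen d rxx (ms_rev rev)) oppr0 big1 // => eta _.
  by case: (boolP (eta \in B)) => [/h2 ->|/h1 ->]; rewrite ?mulr0 ?mul0r.
by rewrite (Dir_eq0 d0 r0 ms0 x0 irr D0 x b) h2.
Qed.

(** Minimum principle through the form: testing against the negative part shows that this part has
    zero energy, so it is constant, and it vanishes on [B]. *)
Lemma harmonic_ge0 (B : {set Hn S n.+1}) (f : Hn S n.+1 -> R) : B != finset.set0 ->
  (forall x, x \notin B -> G f x <= 0) -> (forall x, x \in B -> 0 <= f x) -> forall x, 0 <= f x.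
Proof.
move=> /set0Pn[b bB] h1 h2 x; have [x0 _] := x0ex.
pose f' eta := Num.min (f eta) 0.
have f'0 eta : f' eta <= 0 by rewrite ge_min lexx orbT.
have le1 : Dir r ms d f' f' <= Dir r ms d f' f.
  rewrite /Dir ler_wpM2l ?invr_ge0 //; do 3!(apply: ler_sum => ? _).
  apply: ler_wpM2l; first exact: (Kc_ge0 d0 r0 ms0 x0).
  rewrite /f'; set a := f _; set c := f _; clearbody a c.
  by case: (leP a 0) => ha; case: (leP c 0) => hc; nra.
have le2 : Dir r ms d f' f <= 0.
  rewrite -oppr_ge0 -(Dir_gen d rxx (ms_rev rev)); apply: sumr_ge0 => eta _.
  have mu0 := ltW (mu_gt0 d0 ms0 x0 eta).
  rewrite -mulrA mulr_ge0 //; case: (boolP (eta \in B)) => eB; last by rewrite mulr_le0 ?f'0 ?h1.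
  by rewrite /f' min_r ?h2 // mul0r.
have D0 : Dir r ms d f' f' = 0 by apply/eqP; rewrite eq_le (le_trans le1 le2) (Dir_ge0 d0 r0 ms0 x0).
have e := Dir_eq0 d0 r0 ms0 x0 irr D0 x b; have fb : f' b = 0 by rewrite /f' min_r // h2.
move: e; rewrite fb /f' leNgt => e; apply/negP => fx; move: e; rewrite min_l ?(ltW fx) // => e.
by rewrite e ltxx in fx.
Qed.

Lemma solve_chain (B : {set Hn S n.+1}) (h : Hn S n.+1 -> R) : B != finset.set0 ->
  exists f : Hn S n.+1 -> R, (forall x, x \notin B -> G f x = h x) /\ (forall x, x \in B -> f x = h x).
Proof. by move=> B0; apply: solve_boundary => f h1 h2; exact: harmonic0 B0 h1 h2. Qed.

Lemma G_cst (k : R) eta : \sum_z gen Q eta z * k = 0.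
Proof. by rewrite -mulr_suml gen_rowsum mul0r. Qed.

Lemma solve_harmonic (A B : {set Hn S n.+1}) : A != finset.set0 -> (forall x, x \in A -> x \notin B) ->
  exists f : Hn S n.+1 -> R, [/\ forall x, 0 <= f x <= 1, forall x, x \notin A -> x \notin B -> G f x = 0,
    forall x, x \in A -> f x = 0 & forall x, x \in B -> f x = 1].
Proof.
move=> A0 AB; have U0 : A :|: B != finset.set0.
  by case/set0Pn: A0 => a aA; apply/set0Pn; exists a; rewrite finset.in_setU aA.
have [f [h1 h2]] := @solve_chain (A :|: B) (fun x => (x \in B)%:R) U0.
have h1' x : x \notin A :|: B -> G f x = 0.
  by move=> xU; rewrite h1 //; move: xU; rewrite finset.in_setU negb_or => /andP[_ /negbTE ->].
exists f; split.
- move=> x; apply/andP; split.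
    by apply: (harmonic_ge0 U0) => y yU; rewrite ?h1' // h2.
  rewrite -subr_ge0; apply: (harmonic_ge0 (f := fun x => 1 - f x) U0) => y yU.
    by under eq_bigr do rewrite mulrBr; rewrite sumrB G_cst h1' // subrr.
  by rewrite subr_ge0 h2 //; case: (_ \in _).
- by move=> x xA xB; rewrite h1' // finset.in_setU negb_or xA.
- move=> x xA; rewrite h2 ?finset.in_setU ?xA //.
  by rewrite (negbTE (AB x xA)).
- by move=> x xB; rewrite h2 ?finset.in_setU ?xB ?orbT.
Qed.

(** Stationarity with only the term of [eta] kept: from a state of large mass, sets of small mass
    are rarely occupied at any time. *)
Lemma stationary_bound (pos : nonneg_kernel Q) (A : pred (Hn S n.+1)) (s : R) eta : 0 <= s ->
  mu ms d eta * (\sum_(z | A z) trans Q s eta z) <= \sum_(z | A z) mu ms d z.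
Proof.
move=> s0; have [x0 _] := x0ex; rewrite mulr_sumr; apply: ler_sum => z _.
rewrite -[leRHS](trans_stationary (Q := Q) (mu := mu ms d (n:=n)) s z); last by move=> y; exact: (mu_gen d rxx (ms_rev rev)).
rewrite (bigD1 eta) //= lerDl sumr_ge0 // => e _; apply: mulr_ge0; [exact: ltW (mu_gt0 d0 ms0 x0 e)|exact: pos].
Qed.
End FixedSize.

(** * Mass of the condensates *)

Lemma xi_inj n : injective (@xi S n.+1).
Proof.
move=> x y /(congr1 (fun e => cfg e x)); rewrite !cfg_xi eqxx; by case: eqP.
Qed.

Lemma nu_xi (d : R) n x : nu ms d (xi n x) = wgt d n * ms x ^+ n.
Proof.
rewrite /nu (bigD1 x) //= cfg_xi eqxx big1 ?mulr1 // => y /negbTE yx.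
by rewrite cfg_xi yx wgt0 expr0 mulr1.
Qed.

Definition cond_at n (eta : Hn S n) := [exists x, eta == xi n x].

Lemma sum_cond_at n (F : Hn S n.+1 -> R) : \sum_(eta | cond_at eta) F eta = \sum_x F (xi n.+1 x).
Proof.
rewrite -(big_map (@xi S n.+1) xpredT F) big_mkcond /=.
rewrite [RHS]big_uniq ?map_inj_uniq ?index_enum_uniq //=; last exact: xi_inj.
rewrite [RHS]big_mkcond /=; apply: eq_bigr => eta _; congr (if _ then _ else _).
apply/existsP/mapP => [[x /eqP ->]|[x _ ->]]; exists x => //; exact: mem_index_enum.
Qed.

Lemma off_sites n (eta : Hn S n.+1) : ~~ cond_at eta ->
  exists x y, [/\ x != y, (n.+1 <= #|S| * cfg eta x)%N & (0 < cfg eta y)%N].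
Proof.
move=> h; have [x hx] : exists x, (n.+1 <= #|S| * cfg eta x)%N.
  apply/existsP; apply: contraT; rewrite negb_exists => /forallP hn.
  have [x0 _] : exists x0 : S, True.
    case: (pickP (fun x : S => true)) => [x0 _|h0]; first by exists x0.
    by have := cfg_sum eta; rewrite big_pred0.
  suff : (\sum_x #|S| * cfg eta x < \sum_(x : S) n.+1)%N.
    by rewrite -big_distrr /= cfg_sum sum_nat_const ltnn.
  rewrite (bigD1 x0) //= [X in (_ < X)%N](bigD1 x0) //= -addSn leq_add //; first by rewrite ltnNge hn.
  by apply: leq_sum => i _; apply: ltnW; rewrite ltnNge hn.
have [y yx y0] : exists2 y, y != x & (0 < cfg eta y)%N.
  apply/exists_inP; apply: contraT => /exists_inPn hn; case/negP: h; apply/existsP; exists x.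
  have z s : s != x -> cfg eta s = 0%N by move=> sx; have := hn s sx; rewrite lt0n negbK => /eqP.
  apply/eqP; apply: cfg_inj => s; rewrite cfg_xi; case: (eqVneq s x) => [->|/z //].
  by rewrite -[RHS](cfg_sum eta) (bigD1 x) //= big1 ?addn0.
by exists x, y; rewrite eq_sym.
Qed.

Lemma sum_wgt_le (d : R) n : 0 < d -> omg d n <= 2 -> \sum_(i < n.+1 | (0 < i)%N) wgt d i <= 2 * d * harm R n.
Proof.
move=> d0 ho; rewrite big_mkcond big_ord_recl /= add0r.
apply: (@le_trans _ _ (\sum_(i < n) wgt d i.+1)); first by apply: ler_sum.
apply: le_trans (sum_wgtS d0 _) _; rewrite mulrAC [2 * d]mulrC -!mulrA; apply: ler_wpM2l; first exact: ltW.
by rewrite mulrC; apply: ler_wpM2r; rewrite ?harm_ge0.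
Qed.

(** Some site holds a fraction [1 / #|S|] of the particles, with weight of order [d / N], and a
    second occupied site costs [d * h]. *)
Lemma nu_off : exists2 K : R, 0 <= K & forall (d : R) n, 0 < d -> d * harm R n.+1 <= 2^-1 -> omg d n.+1 <= 2 ->
  \sum_(eta : Hn S n.+1 | ~~ cond_at eta) nu ms d eta <= K * (d / n.+1%:R) * (d * harm R n.+1).
Proof.
exists (#|S|%:R ^+ 2 * (2 * #|S|%:R) * (2 * 2 ^+ #|S|)).
  by do 2!(apply: mulr_ge0); rewrite ?exprn_ge0 // mulr_ge0 // exprn_ge0.
move=> d n d0 dh ho; have N0 : 0 < n.+1%:R :> R by rewrite ltr0n.
have w0 i : 0 <= wgt d i by exact: ltW (wgt_gt0 d0 i).
have h0 := harm_ge0 R n.+1.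
pose a (x y : S) (s : S) i : R := if s == y then (if (0 < i)%N then wgt d i else 0) else wgt d i.
have a0 x y s i : 0 <= a x y s i by rewrite /a; do 2?case: ifP.
have swp : \sum_(i < n.+2 | (0 < i)%N) wgt d i <= 2 * d * harm R n.+1 by exact: sum_wgt_le.
have sw : \sum_(i < n.+2) wgt d i <= 2.
  rewrite (bigID (fun i : 'I__ => (0 < i)%N)) /= (big_pred1 ord0 (P := fun i : 'I_n.+2 => ~~ (0 < i)%N)); last first.
    by move=> i; rewrite -leqNgt leqn0; apply/eqP/eqP => [e|->//]; exact: val_inj.
  by rewrite wgt0; lra.
have dN : 0 <= d / n.+1%:R by rewrite divr_ge0 // ltW.
have cS : 0 <= #|S|%:R * (2 * (d / n.+1%:R)) by rewrite mulr_ge0 // mulr_ge0.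
apply: (@le_trans _ _ (\sum_(x : S) \sum_(y : S | x != y) #|S|%:R * (2 * (d / n.+1%:R)) * \sum_(eta : Hn S n.+1) \prod_(s | s != x) a x y s (cfg eta s))).
  have -> : \sum_(x : S) \sum_(y : S | x != y) #|S|%:R * (2 * (d / n.+1%:R)) * \sum_(eta : Hn S n.+1) \prod_(s | s != x) a x y s (cfg eta s) =
    \sum_(eta : Hn S n.+1) \sum_(x : S) \sum_(y : S | x != y) #|S|%:R * (2 * (d / n.+1%:R)) * \prod_(s | s != x) a x y s (cfg eta s).
    rewrite exchange_big /=; apply: eq_bigr => x _; rewrite exchange_big /=; apply: eq_bigr => y _; by rewrite mulr_sumr.
  rewrite big_mkcond /=; apply: ler_sum => eta _.
  have p0 x y : 0 <= #|S|%:R * (2 * (d / n.+1%:R)) * \prod_(s | s != x) a x y s (cfg eta s).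
    by rewrite mulr_ge0 // prodr_ge0.
  case: ifP => [h|_]; last by apply: sumr_ge0 => x _; apply: sumr_ge0.
  have [x [y [xy hx hy]]] := off_sites h.
  rewrite (bigD1 x) //= (bigD1 y) //= -addrA ler_wpDr //.
    by rewrite addr_ge0 ?sumr_ge0 // => x' _; apply: sumr_ge0.
  rewrite /nu (bigD1 x) //=; apply: ler_pM.
  - by rewrite mulr_ge0 // exprn_ge0 // ltW.
  - by apply: prodr_ge0 => s _; rewrite mulr_ge0 // exprn_ge0 // ltW.
  - apply: (@le_trans _ _ (wgt d (cfg eta x))); first by rewrite ler_piMr // exprn_ile1 // ltW.
    have xp : (0 < cfg eta x)%N by case: (cfg eta x) hx => //; rewrite muln0.
    case: (cfg eta x) xp hx (cfg_le eta x) => // k _ hk kn.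
    apply: le_trans (wgtS_le d0 k) _.
    have ok : omg d k <= 2 by apply: le_trans ho; apply: omg_mono => //; exact: ltnW.
    apply: (@le_trans _ _ (d * 2 / k.+1%:R)); first by rewrite ler_wpM2r ?invr_ge0 // ler_wpM2l // ltW.
    rewrite ler_pdivrMr ?ltr0n //.
    have -> : #|S|%:R * (2 * (d / n.+1%:R)) * k.+1%:R = d * 2 * ((#|S| * k.+1)%:R / n.+1%:R) by rewrite natrM; field; rewrite ?nat1r ?natr1 ?pnatr_eq0.
    by rewrite ler_peMr ?mulr_ge0 ?(ltW d0) // ler_pdivlMr // mul1r ler_nat.
  - apply: ler_prod => s sx; rewrite mulr_ge0 ?exprn_ge0 ?(ltW (ms0 _)) //= /a.
    case: eqP => [->|_]; rewrite ?hy ler_piMr // exprn_ile1 // ltW //.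
apply: (@le_trans _ _ (\sum_(x : S) \sum_(y : S) #|S|%:R * (2 * (d / n.+1%:R)) * (2 * d * harm R n.+1 * 2 ^+ #|S|))).
  apply: ler_sum => x _; rewrite big_mkcond; apply: ler_sum => y _; case: ifP => [xy|_]; last first.
    by rewrite mulr_ge0 // !mulr_ge0 ?exprn_ge0 // ltW.
  apply: ler_wpM2l => //; apply: le_trans (@sum_prod_le R S n.+1 x (a x y) (a0 x y)) _.
  rewrite (bigD1 y) 1?eq_sym //=; apply: ler_pM.
  - by apply: sumr_ge0.
  - by apply: prodr_ge0 => s _; apply: sumr_ge0.
  - apply: le_trans swp; rewrite [leRHS]big_mkcond; apply: ler_sum => i _; by rewrite /a eqxx.
  - apply: (@le_trans _ _ (\prod_(s | (s != x) && (s != y)) (2 : R))).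
      apply: ler_prod => s /andP[_ /negbTE sy]; rewrite sumr_ge0 //=; by rewrite /a sy.
    by rewrite prodr_const; apply: ler_weXn2l; rewrite ?ler1n // max_card.
rewrite !sumr_const -[leLHS]mulr_natr -mulr_natr; apply: le_of_eq.
by rewrite -[#|S|%:R in LHS]/(#|S|%:R); ring.
Qed.

Lemma zN_est : exists2 K : R, 0 <= K & forall (d : R) n (w : Hn S n.+1 -> R) (q M : R), 0 < d -> d <= 1 -> d * harm R n.+1 <= 2^-1 -> omg d n.+1 <= 2 ->
  `|zN m (@Ctx R S n d q w M) - sst| <= K * ((omg d n.+1 - 1) + mm m ^+ n + d * harm R n.+1).
Proof.
have [K K0 hK] := nu_off; exists (K + #|S|%:R * 2 + sst); first by rewrite !addr_ge0 // mulr_ge0.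
move=> d n w q M d0 d1 dh ho; have N0 : 0 < n.+1%:R :> R by rewrite ltr0n.
rewrite /zN /cN /cZ /Zn /=.
pose uN := n.+1%:R * wgt d n.+1 / d.
have uNE : uN = (d + n%:R) * wgt d n / d by rewrite /uN wgtS.
have o1 := omg_ge1 d0 n.
have oN : omg d n <= omg d n.+1 by exact: omg_mono.
have /andP[u1 u2] : 1 <= uN <= omg d n.+1.
  rewrite uNE ler_pdivlMr // mul1r wgtD_ge //= ler_pdivrMr //.
  by apply: le_trans (wgtD_le d0 n) _; rewrite [leRHS]mulrC ler_pM2l.
pose off := n.+1%:R / d * \sum_(eta : Hn S n.+1 | ~~ cond_at eta) nu ms d eta.
have off0 : 0 <= off.
  by rewrite mulr_ge0 ?divr_ge0 ?(ltW d0) // sumr_ge0 // => eta _; exact: ltW (nu_gt0 d0 ms0 _).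
have offK : off <= K * (d * harm R n.+1).
  apply: le_trans (ler_wpM2l _ (hK d n d0 dh ho)) _; first by rewrite divr_ge0 // ltW.
  by apply: le_of_eq; field; rewrite ?nat1r ?natr1 ?pnatr_eq0 ?gt_eqF.
pose tl := \sum_(x | x \notin Sstar) ms x ^+ n.+1.
have tl0 : 0 <= tl by apply: sumr_ge0 => x _; rewrite exprn_ge0 // ltW.
have mm0 := mm_gt0 m; have mml := mm_lt1 irr m0 m1 rev.
have mn0 : 0 <= mm m ^+ n by rewrite exprn_ge0 // ltW.
have tlK : tl <= #|S|%:R * mm m ^+ n.
  apply: (@le_trans _ _ (\sum_(x : S) mm m ^+ n)); last by rewrite sumr_const mulr_natl.
  rewrite /tl big_mkcond; apply: ler_sum => x _; case: ifP => // xS.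
  apply: (@le_trans _ _ (mm m ^+ n.+1)); first by rewrite lerXn2r ?nnegrE ?(ltW (ms0 _)) ?(ltW mm0) // ms_le_mm.
  by rewrite exprS ler_piMl // ltW.
have -> : n.+1%:R * (\sum_(eta : Hn S n.+1) nu ms d eta) / d = uN * (sst + tl) + off.
  rewrite [X in _ * X / _](bigID (@cond_at n.+1)) /= sum_cond_at.
  have -> : \sum_x nu ms d (xi n.+1 x) = wgt d n.+1 * (sst + tl).
    under eq_bigr do rewrite nu_xi; rewrite -mulr_sumr; congr (_ * _).
    rewrite (bigID (fun x => x \in Sstar)) /=; congr (_ + _).
    by rewrite (eq_bigr (fun _ => 1)) ?sumr_const // => x xS; rewrite (ms_star irr m0 m1 rev xS) expr1n.
  by rewrite /uN /off; field; rewrite gt_eqF.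
have s1 : 1 <= sst by exact: sst_ge1.
rewrite ger0_norm; last first.
  rewrite subr_ge0; apply: (@le_trans _ _ (uN * sst)); first by rewrite ler_peMl // (le_trans ler01).
  by rewrite mulrDr -addrA lerDl addr_ge0 // mulr_ge0 // (le_trans ler01).
have e0 : 0 <= omg d n.+1 - 1 by rewrite subr_ge0 (le_trans o1).
have dh0 : 0 <= d * harm R n.+1 by rewrite mulr_ge0 ?harm_ge0 // ltW.
have a1 : uN * sst <= sst + sst * (omg d n.+1 - 1).
  have -> : sst + sst * (omg d n.+1 - 1) = omg d n.+1 * sst by ring.
  by rewrite ler_wpM2r // (le_trans ler01).
have a2 : uN * tl <= 2 * (#|S|%:R * mm m ^+ n).
  by apply: ler_pM => //; [exact: le_trans ler01 u1|exact: le_trans u2 ho].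
set A := omg d n.+1 - 1 in e0 a1 *; set B := mm m ^+ n in mn0 a2 *; set D := d * harm R n.+1 in dh0 offK *.
have b1 : 0 <= K * A + K * B + #|S|%:R * 2 * A + #|S|%:R * 2 * D + sst * B + sst * D.
  by clear -K0 e0 mn0 dh0; clearbody A B D; do 5!(apply: addr_ge0; last by do 2?apply: mulr_ge0); exact: mulr_ge0.
have -> : uN * (sst + tl) = uN * sst + uN * tl by ring.
have -> : (K + #|S|%:R * 2 + sst) * (A + B + D) = (K * A + K * B + #|S|%:R * 2 * A + #|S|%:R * 2 * D + sst * B + sst * D)
   + K * D + 2 * (#|S|%:R * B) + sst * A by ring.
move: a1 a2 offK b1; set u := uN * sst; set v := uN * tl; set b := _ + sst * D; set k := K * D; set l := 2 * (_ * B).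
by move=> *; lra.
Qed.

Lemma other_cls (C : cls) : exists D : cls, D != C.
Proof.
apply/existsP; apply: contraT; rewrite negb_exists => /forallP h.
have : (#|{: cls}| <= 1)%N by rewrite -(card1 C); apply: subset_leq_card; apply/fintype.subsetP => D _; have := h D; rewrite negbK.
have -> : #|{: cls}| = #|classes r m| by rewrite card_sig.
by rewrite leqNgt kappa2.
Qed.

(** A common constant is obtained by summing those of the finitely many classes. *)
Lemma profiles (C : cls) : exists (g b : cls -> R -> R) (L : R), forall D, D != C -> profile_spec C D (g D) (b D) L.
Proof.
have h (D : cls) : exists p : (R -> R) * (R -> R) * R, D != C -> profile_spec C D p.1.1 p.1.2 p.2.
  have [->|DC] := eqVneq D C; first by exists ((fun _ => 0), (fun _ => 0), 0).
  have [|g [b [L hp]]] := @profile R S r m r0 irr m0 m1 rev C D; first by rewrite eq_sym.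
  by exists (g, b, L).
have [p hp] := choice h; exists (fun D => (p D).1.1), (fun D => (p D).1.2), (\sum_(D | D != C) (p D).2) => D DC.
have L0 D' : D' != C -> 0 <= (p D').2 by move=> /hp [].
have LL : (p D).2 <= \sum_(D' | D' != C) (p D').2.
  by rewrite (bigD1 D) //= lerDl; apply: sumr_ge0 => D' /andP[/L0].
have [a1 a2 a3 a4 a5] := hp D DC; split => //; first exact: le_trans a1 LL.
  by move=> t ht; have [/andP[b1 b2] b3] := a3 t ht; rewrite b1 (le_trans b2 LL).
move=> s t hs ht; have [b1 b2] := a4 s t hs ht; split.
  by apply: le_trans b1 _; rewrite ler_wpM2r.
by apply: le_trans b2 _; rewrite ler_wpM2r ?sqr_ge0.
Qed.

Lemma mu_xi : exists2 K : R, 0 <= K & forall c : ctx, valid c ->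
  (forall x, x \in Sstar -> `|mu ms (cd c) (xi (cn c).+1 x) - sst^-1| <= K * cq c) /\
  \sum_(eta | eta \notin EN (cn c).+1 Sstar) mu ms (cd c) (eta : Hn S (cn c).+1) <= K * cq c.
Proof.
exists (4 * sst); first by rewrite mulr_ge0.
move=> c va; have [d0 d1 n0 /andP[q0 q1] [_ _ _ _ [zb _]]] := va.
have s1 : 1 <= sst by exact: sst_ge1. have s0 : 0 < sst by exact: lt_le_trans ltr01 s1.
have /andP[zl _] := zN_bounds m0 m1 va.
have z0 : 0 < zN m c by lra.
have [x0 _] := some_site m0 m1.
have Z0 : 0 < cZ m c by exact: Zn_gt0.
have N0 : 0 < cN c by rewrite ltr0n.
have muE x : x \in Sstar -> mu ms (cd c) (xi (cn c).+1 x) = uu c (cn c) / zN m c.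
  move=> xS; rewrite /mu nu_xi (ms_star irr m0 m1 rev xS) expr1n mulr1 /uu -wgtS /zN -/(cN c) -/(cZ m c).
  by field; rewrite !gt_eqF.
have /andP[u1 u2] : 1 <= uu c (cn c) <= 1 + cq c by apply: (uu_bounds (m := m)).
have mub x : x \in Sstar -> `|mu ms (cd c) (xi (cn c).+1 x) - sst^-1| <= 4 * cq c.
  move=> xS; rewrite muE //; set U := uu c _ in u1 u2 *.
  have -> : U / zN m c - sst^-1 = ((U - 1) * sst - (zN m c - sst)) / (zN m c * sst) by field; rewrite !gt_eqF.
  have p0 : 0 < zN m c * sst by exact: mulr_gt0.
  have w0 : 0 <= (U - 1) * sst by apply: mulr_ge0; [rewrite subr_ge0|exact: ltW].
  rewrite normrM normfV (gtr0_norm p0) ler_pdivrMr //.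
  apply: le_trans (ler_normB _ _) _; rewrite (ger0_norm w0).
  apply: le_trans (lerD (lexx _) zb) _.
  have e1 : (U - 1) * sst <= cq c * sst by rewrite ler_wpM2r ?(ltW s0) //; lra.
  have e2 : cq c <= cq c * sst by rewrite ler_peMr // ltW.
  have e3 : 4 * cq c * (zN m c * sst) = cq c * sst * (4 * zN m c) by ring.
  rewrite e3; apply: (@le_trans _ _ (cq c * sst * 2)); first lra.
  by apply: ler_wpM2l; [apply: mulr_ge0; exact: ltW|lra].
split => [x xS|].
  by apply: le_trans (mub x xS) _; rewrite -mulrA ler_wpM2l // ler_peMl // ltW.
have m_ge0 eta : 0 <= mu ms (cd c) (eta : Hn S (cn c).+1) by exact: ltW (mu_gt0 d0 ms0 x0 _).
have := mu_sum1 d0 ms0 (cn c) x0; rewrite (bigID (fun eta => eta \in EN (cn c).+1 Sstar)) /=.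
have -> : \sum_(eta in EN (cn c).+1 Sstar) mu ms (cd c) (eta : Hn S (cn c).+1) = \sum_(x in Sstar) mu ms (cd c) (xi (cn c).+1 x).
  by rewrite /EN big_imset //= => x y _ _; exact: xi_inj.
have : \sum_(x in Sstar) (sst^-1 - 4 * cq c) <= \sum_(x in Sstar) mu ms (cd c) (xi (cn c).+1 x).
  by apply: ler_sum => x xS; have := mub x xS; rewrite ler_norml; set u := mu _ _ _; lra.
rewrite sumr_const -[X in X <= _]mulr_natr mulrBl mulVf ?gt_eqF // => h1 h2.
have -> : 4 * sst * cq c = 4 * cq c * sst by ring.
by move: h1 h2; set a := \sum_(_ in _) _; set b := \sum_(_ | _) _; lra.
Qed.

Lemma small_err (F : ctx -> R) (K : R) : 0 <= K -> (forall c, valid c -> `|F c| <= K * (cM c * cq c)) -> small F.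
Proof. by move=> K0 h; apply: small_le (small_Mq r m0 m1 K). Qed.

(** * Values at the condensates of one class *)

Section Representatives.
Variable rep : cls -> S.
Hypothesis repP : forall D, rep D \in val D.

(** Sites of one class are exchangeable relative to a site [z] outside it, and the end [l = N] of
    the line is the condensate itself. At least two classes are needed for [z] to exist. *)
Lemma small_xi (C : cls) x x' : x \in val C -> x' \in val C ->
  small (fun c => cw c (xi (cn c).+1 x) - cw c (xi (cn c).+1 x')).
Proof.
move=> xC x'C; have [D DC] := other_cls C; have [z zD] := cls_neq0 D.
have zC : z \notin val C by apply: contraNN DC => zC; apply/eqP; exact: clsE zD zC.
have nz u : u \in val C -> u != z by apply: contraTneq => ->.
apply: small_le (exch_class r0 irr m0 m1 rev xC x'C (cls_sub zD) zC) => c va.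
rewrite big_ord_recr /= ler_wpDl //.
  by apply: sumr_ge0 => l _; rewrite mulr_ge0 // !addr_ge0 // invr_ge0.
rewrite /U !c2_max ?nz // eqxx ler_peMl // lerDr addr_ge0 // invr_ge0 //.
Qed.

(** The measure lives on the condensates of [Sstar], where [V] is the indicator of [C], and [cw] is
    nearly constant on those of [C]. *)
Lemma mass_V (C : cls) (g b : cls -> R -> R) (L : R) : (forall D, D != C -> profile_spec C D (g D) (b D) L) ->
  small (fun c => \sum_eta mu ms (cd c) eta * (cw c eta * @V R S r m C b (cn c).+1 eta)
     - sst^-1 * (#|val C|%:R * cw c (xi (cn c).+1 (rep C)))).
Proof.
move=> prof; have [K K0 hK] := mu_xi; have [x0 _] := some_site m0 m1.
have h1 : small (fun c => \sum_(eta | eta \notin EN (cn c).+1 Sstar) mu ms (cd c) eta * (cw c eta * @V R S r m C b (cn c).+1 eta)).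
  apply: (small_err K0) => c va; have M0 := cM_ge0 m0 m1 va; have [d0 _ _ _ [_ _ _ _ [_ wM]]] := va; have [_ ho] := hK c va.
  have m_ge0 eta : 0 <= mu ms (cd c) (eta : Hn S (cn c).+1) by exact: ltW (mu_gt0 d0 ms0 x0 _).
  apply: le_trans (ler_norm_sum _ _ _) _.
  apply: (@le_trans _ _ (\sum_(eta | eta \notin EN (cn c).+1 Sstar) mu ms (cd c) (eta : Hn S (cn c).+1) * cM c)).
    apply: ler_sum => eta _; rewrite normrM ger0_norm // ler_wpM2l // normrM.
    have /andP[v0 v1] := V_range r0 prof eta.
    by rewrite -[leRHS]mulr1; apply: ler_pM => //; rewrite ger0_norm.
  rewrite -mulr_suml; have -> : K * (cM c * cq c) = K * cq c * cM c by ring.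
  by rewrite ler_wpM2r.
have h2 : small (fun c => \sum_(x in val C) (mu ms (cd c) (xi (cn c).+1 x) - sst^-1) * cw c (xi (cn c).+1 x)).
  apply: small_sum => x xC; apply: (small_err K0) => c va; have M0 := cM_ge0 m0 m1 va.
  have [_ _ _ _ [_ _ _ _ [_ wM]]] := va; have [hx _] := hK c va.
  rewrite normrM; have -> : K * (cM c * cq c) = K * cq c * cM c by ring.
  by apply: ler_pM => //; apply: hx; exact: cls_sub xC.
have h3 : small (fun c => \sum_(x in val C) sst^-1 * (cw c (xi (cn c).+1 x) - cw c (xi (cn c).+1 (rep C)))).
  by apply: small_sum => x xC; apply: small_mul; apply: (small_xi xC).
apply: small_eq (small_add h1 (small_add h2 h3)) => c va.
rewrite [in RHS](bigID (fun eta => eta \notin EN (cn c).+1 Sstar)) /= -addrA; congr (_ + _).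
have -> : \sum_(eta | ~~ (eta \notin EN (cn c).+1 Sstar)) mu ms (cd c) eta * (cw c eta * @V R S r m C b (cn c).+1 eta) =
  \sum_(x in val C) mu ms (cd c) (xi (cn c).+1 x) * cw c (xi (cn c).+1 x).
  under eq_bigl do rewrite negbK.
  rewrite /EN big_imset /=; last by move=> x y _ _; exact: xi_inj.
  rewrite (bigID (fun x => x \in val C)) /= addrC big1 ?add0r => [|x /andP[xS /negbTE xC]]; last first.
    by rewrite (V_xi r0 irr m0 m1 rev) // xC !mulr0.
  apply: eq_big => x; first by apply: andb_idl; exact: cls_sub.
  by move=> /andP[xS xC]; rewrite (V_xi r0 irr m0 m1 rev) // xC mulr1.
have -> : sst^-1 * (#|val C|%:R * cw c (xi (cn c).+1 (rep C))) = \sum_(x in val C) sst^-1 * cw c (xi (cn c).+1 (rep C)).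
  by rewrite sumr_const mulrCA mulr_natl.
by rewrite -sumrB -big_split /=; apply: eq_bigr => x _; ring.
Qed.

(** A bound by continuity on a compact interval: nonnegativity of the limit kernel is only deduced
    later, from the convergence that this bound helps to prove. *)
Lemma trans_bounded (E : finType) (Q : E -> E -> R) (T : R) : 0 <= T ->
  exists2 B : R, 0 <= B & forall t x y, 0 <= t <= T -> `|trans Q t x y| <= B.
Proof.
move=> T0; have h (p : E * E) : exists B : R, forall t, 0 <= t <= T -> `|trans Q t p.1 p.2| <= B.
  have ct : {within `[0, T], continuous (fun t => `|trans Q t p.1 p.2|)}.
    apply: continuous_subspaceT => t; apply: (@continuous_comp _ _ _ (fun t => trans Q t p.1 p.2) (fun z => `|z|)).
      apply: differentiable_continuous; apply/derivable1_diffP.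
      by have [] := is_derive_trans Q t p.1 p.2.
    exact: norm_continuous.
  have [c _ hc] := EVT_max T0 ct; exists (`|trans Q c p.1 p.2|) => t ht.
  by apply: hc; rewrite in_itv.
have [B hB] := choice h; exists (\sum_p `|B p|); first by apply: sumr_ge0.
move=> t x y ht; apply: le_trans (hB (x, y) t ht) _; apply: le_trans (ler_norm _) _.
by rewrite (bigD1 (x, y)) //= lerDl sumr_ge0.
Qed.

Lemma Dir_sumr n (dd : R) (w : Hn S n.+1 -> R) (I : finType) (a : I -> R) (f : I -> Hn S n.+1 -> R) :
  Dir r ms dd w (fun eta => \sum_i a i * f i eta) = \sum_i a i * Dir r ms dd w (f i).
Proof.
rewrite /Dir; under [RHS]eq_bigr do rewrite mulrCA mulr_sumr.
rewrite -mulr_sumr [in RHS]exchange_big /=; congr (_ * _); apply: eq_bigr => zeta _.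
under [RHS]eq_bigr do rewrite mulr_sumr; rewrite [in RHS]exchange_big /=; apply: eq_bigr => x _.
under [RHS]eq_bigr do rewrite mulr_sumr; rewrite [in RHS]exchange_big /=; apply: eq_bigr => y _.
rewrite -sumrB 2!mulr_sumr; apply: eq_bigr => i _; ring.
Qed.

End Representatives.

(** * Admissibility of the parameters for large systems *)

Variable d : nat -> R.
Hypotheses (d_pos : forall N, 0 < d N) (d_to0 : d @ \oo --> (0 : R)).
Hypothesis d_subexp : forall eps : R, 0 < eps -> (fun N => d N * expR (eps * N%:R)) @ \oo --> +oo.
Hypothesis d_sq : (fun N => d N * N%:R ^+ 2 * (ln N%:R) ^+ 2) @ \oo --> (0 : R).
Variables (dT : measure_display) (Om : measurableType dT) (P : forall N, Hn S N -> probability Om R) (X : forall N, R -> Om -> Hn S N).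
Hypothesis HX : forall N (eta : Hn S N), is_ctmc (Qinc r (d N)) (P eta) eta (X N).
Local Notation theta N := (N%:R / d N ^+ 2).
Local Notation Q N := (Qinc r (d N) : Hn S N -> Hn S N -> R).
Local Notation rt := (@rate2 R S r m).
(** The entries of the kernel are probabilities of the given realization. *)
Let pos N : nonneg_kernel (Q N).
Proof.
move=> t x y t0; have := marginal (HX x) (pred1 y) t0; rewrite big_pred1_eq => h.
by rewrite -lee_fin -h measure_ge0.
Qed.

Lemma ev_h q : 0 < q -> ev (fun n => d n.+1 * n.+1%:R ^+ 2 * (1 + harm R n.+1) ^+ 2 <= q).
Proof.
move=> q0; have q9 : 0 < q / 9 by rewrite divr_gt0.
apply: ev_impl (ev_and (ev_shift (ev_ln (1 : R))) (ev_shift (cvg0_ev d_sq q9))) => n [h1 h2].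
have hh : 1 + harm R n.+1 <= 3 * ln (n.+1%:R : R) by have := harm_ln R n; lra.
have h0 : 0 <= 1 + harm R n.+1 by rewrite addr_ge0 // harm_ge0.
have D0 : 0 <= d n.+1 * n.+1%:R ^+ 2 by rewrite mulr_ge0 ?sqr_ge0 // ltW.
apply: (@le_trans _ _ (d n.+1 * n.+1%:R ^+ 2 * (3 * ln n.+1%:R) ^+ 2)).
  by rewrite ler_wpM2l // lerXn2r ?nnegrE // (le_trans h0).
have := le_trans (ler_norm _) h2; rewrite exprMn; set a := d _ * _; set l := ln _ ^+ 2.
by have -> : a * (3 ^+ 2 * l) = 9 * (a * l); [ring|lra].
Qed.

Lemma ev_hN q : 0 < q -> ev (fun n => (1 + harm R n.+1) ^+ 2 <= q * n.+1%:R).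
Proof.
move=> q0; apply: ev_impl (ev_and (ev_shift (ev_ln (1 : R))) (ev_shift (ev_ln (243 / q)))) => n [h1 h2].
have hh : 1 + harm R n.+1 <= 3 * ln (n.+1%:R : R) by have := harm_ln R n; lra.
have h0 : 0 <= 1 + harm R n.+1 by rewrite addr_ge0 // harm_ge0.
apply: (@le_trans _ _ ((3 * ln (n.+1%:R : R)) ^+ 2)); first by rewrite lerXn2r ?nnegrE // (le_trans h0).
have N1 : 1 <= n.+1%:R :> R by rewrite ler1n.
have := ln_cube N1; set l := ln _ in h1 h2 *; rewrite ler_pdivrMr // mulrC in h2 => h3.
rewrite -(ler_pM2l (lt_le_trans ltr01 h1)).
have -> : l * (3 * l) ^+ 2 = 9 * l ^+ 3 by ring.
apply: (@le_trans _ _ (9 * (27 * n.+1%:R))); first by rewrite ler_wpM2l.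
have -> : 9 * (27 * n.+1%:R) = 243 * n.+1%:R :> R by ring.
by rewrite mulrA [l * q]mulrC ler_wpM2r.
Qed.

Lemma ev_mm q : 0 < q -> ev (fun n => n.+1%:R ^+ (#|S| + 2) * mm m ^+ n <= q * d n.+1).
Proof.
move=> q0; have mm0 := mm_gt0 m; have mml := mm_lt1 irr m0 m1 rev.
(* Half of the exponential rate absorbs the power of [N], the other half the subexponential decay of
   [d]. *)
pose e := - ln (mm m) / 2; have e0 : 0 < e by rewrite divr_gt0 // oppr_gt0 ln_lt0 // mm0.
have [C [C0 hC]] := pow_exp_bound (#|S| + 2) e0.
apply: ev_impl (ev_shift (cvgy_ev (d_subexp e0) (C / mm m / q))) => n.
rewrite ler_pdivrMr // => h; rewrite -(ler_pM2r (expR_gt0 (e * n.+1%:R))).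
apply: (@le_trans _ _ (C / mm m)); last by apply: le_trans h _; apply: le_of_eq; ring.
have -> : mm m ^+ n = (mm m)^-1 * expR (- (2 * e) * n.+1%:R).
  have -> : - (2 * e) * n.+1%:R = n.+1%:R * ln (mm m) by rewrite /e; field.
  by rewrite expRM_natl lnK ?posrE // exprS mulrA mulVf ?mul1r // gt_eqF.
apply: (@le_trans _ _ (C * expR (e * n.+1%:R) * ((mm m)^-1 * expR (- (2 * e) * n.+1%:R)) * expR (e * n.+1%:R))).
  by rewrite ler_wpM2r ?expR_ge0 // ler_wpM2r ?hC // mulr_ge0 ?expR_ge0 // invr_ge0 ltW.
have ee : expR (e * n.+1%:R) * expR (- (2 * e) * n.+1%:R) * expR (e * n.+1%:R) = 1 :> R.
  by rewrite -!expRD -[RHS]expR0; congr expR; ring.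
apply: le_of_eq.
rewrite [RHS](_ : _ = C / mm m * (expR (e * n.+1%:R) * expR (- (2 * e) * n.+1%:R) * expR (e * n.+1%:R))); last by rewrite ee mulr1.
by ring.
Qed.

(** The threshold does not depend on [w] or [M], so one threshold serves a whole family of functions
    indexed by time. *)
Lemma ev_valid q : 0 < q <= 2^-1 -> ev (fun n => forall (w : Hn S n.+1 -> R) M, (forall eta, `|w eta| <= M) ->
  valid (Ctx (cn := n) (d n.+1) q w M)).
Proof.
move=> /andP[q0 q1]; have [K K0 hK] := zN_est.
(* The smaller scale compensates the constant of [zN_est], which multiplies a sum of at most four
   contributions of that size. *)
have q'0 : 0 < q / (4 * (K + 1)) by rewrite divr_gt0 // mulr_gt0 // ltr_wpDl.
have q'q : q / (4 * (K + 1)) <= q / 4 /\ K * (4 * (q / (4 * (K + 1)))) <= q.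
  have K1 : 0 < K + 1 by rewrite ltr_wpDl.
  split; first by rewrite ler_wpM2l ?(ltW q0) // lef_pV2 ?posrE ?mulr_gt0 // ler_peMr // lerDr.
  have -> : K * (4 * (q / (4 * (K + 1)))) = q * (K / (K + 1)) by field; rewrite gt_eqF.
  by rewrite ler_piMr ?(ltW q0) // ler_pdivrMr // mul1r lerDl.
have := ev_and (ev_and (ev_h q'0) (ev_hN q0)) (ev_and (ev_mm q'0) (ev_shift (cvg0_ev d_to0 ltr01))).
move=> h; apply: ev_impl (ev_and h (ex_intro _ 1%N (fun n (h : (1 <= n)%N) => h))) => n [[[a1 a2] [a3 a4]] n1] w M wM.
have d0 := d_pos n.+1; have d1 : d n.+1 <= 1 by apply: le_trans (ler_norm _) a4.
have N1 : 1 <= n.+1%:R :> R by rewrite ler1n.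
have h0 := harm_ge0 R n.+1.
set q' := q / (4 * _) in q'0 q'q a1 a3.
have dh : d n.+1 * harm R n.+1 <= q'.
  apply: le_trans a1; rewrite -mulrA ler_wpM2l ?(ltW d0) //.
  apply: (@le_trans _ _ (1 + harm R n.+1)); first by rewrite lerDr.
  have h1 : 1 <= 1 + harm R n.+1 by rewrite lerDl.
  apply: (@le_trans _ _ ((1 + harm R n.+1) ^+ 2)); first by rewrite expr2 ler_peMl // (le_trans ler01).
  by rewrite ler_peMl ?sqr_ge0 // exprn_ege1.
have dh0 : 0 <= d n.+1 * harm R n.+1 by rewrite mulr_ge0 // ltW.
have om : omg (d n.+1) n.+1 <= 1 + 2 * q'.
  rewrite /omg; set u := d _ * _ in dh dh0 *.
  have u2 : u <= 2^-1 by case: q'q => *; lra.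
  have := expR_ge1Dx (- u); rewrite expRN => h'.
  have p : 0 < expR u by exact: expR_gt0.
  have h2 : (1 - u) * expR u <= 1 by rewrite -ler_pdivlMr // div1r.
  have : expR u <= 1 + 2 * u by rewrite -(ler_pM2l (_ : 0 < 1 - u)); [apply: le_trans h2 _; nra|lra].
  lra.
have mn : mm m ^+ n <= q'.
  apply: (@le_trans _ _ (n.+1%:R ^+ (#|S| + 2) * mm m ^+ n)).
    by rewrite ler_peMl ?exprn_ge0 ?(ltW (mm_gt0 m)) // exprn_ege1.
  by apply: le_trans a3 _; rewrite ler_piMr // ltW.
split => //=; first by rewrite q0 q1.
case: q'q => q'1 q'2; split => //=.
- lra.
- by apply: le_trans a1 _; lra.
- apply: le_trans a3 _; rewrite ler_pM2r //; lra.
split => //; apply: le_trans (hK _ n w q M d0 d1 _ _) _; [lra|lra|].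
apply: le_trans q'2; rewrite ler_wpM2l //; lra.
Qed.

Lemma is_derive_semig_scaled (E : finType) (q : E -> E -> R) (a t : R) f x :
  is_derive t (1 : R) (fun u => semig q (a * u) f x) (a * \sum_z gen q x z * semig q (a * t) f z).
Proof.
have hc : is_derive t (1 : R) (fun v : R => a * v) a.
  have := @is_deriveZ R R R id a t 1 _ (is_derive_id t 1).
  by rewrite /GRing.scale /= mulr1.
by rewrite mulrC; apply: (@is_derive1_comp R (fun v => semig q v f x) (fun v => a * v) t _ _ (is_derive_semig q _ f x) hc).
Qed.

(** * Convergence of the transition functions *)

Section OneTarget.
Variables (D0 : cls) (T : R).
Hypothesis T0 : 0 <= T.

(* The L2(mu) distance between the semigroup of the inclusion process and the test function with coefficients
   [trans rate2] grows at rate O(sqrt q), because the energy term absorbs the error of [Dir_V]. *)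
Lemma energy_estimate : exists2 K : R, 0 <= K & forall q : R, 0 < q <= 2^-1 -> ev (fun n =>
  forall t : R, 0 <= t <= T -> forall (C : cls) x, x \in val C ->
  (\sum_(y in val D0) trans (Q n.+1) (theta n.+1 * t) (xi n.+1 x) (xi n.+1 y) - trans rt t C D0) ^+ 2
   * mu ms (d n.+1) (xi n.+1 x) <= K * Num.sqrt q).
Proof.
have [rep repP] := choice (fun D : cls => cls_neq0 D).
have hp (C : cls) : exists p : (cls -> R -> R) * (cls -> R -> R) * R, forall D, D != C -> profile_spec C D (p.1.1 D) (p.1.2 D) p.2.
  by have [g [b [L h]]] := profiles C; exists (g, b, L).
have [p hpp] := choice hp.
pose VV n (C : cls) := @V R S r m C (p C).1.2 n.+1.
pose FA C (c : ctx) := theta_ c * Dir r ms (cd c) (VV (cn c) C) (cw c) -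
  sst^-1 * \sum_(D | D != C) rho C D * (cw c (xi (cn c).+1 (rep C)) - cw c (xi (cn c).+1 (rep D))).
pose FB C (c : ctx) := \sum_eta mu ms (cd c) eta * (cw c eta * VV (cn c) C eta)
     - sst^-1 * (#|val C|%:R * cw c (xi (cn c).+1 (rep C))).
have [KA hA] := choice (fun C => (Dir_V r0 rxx irr m0 m1 rev (hpp C) repP : small (FA C))).
have [KB hB] := choice (fun C => (mass_V repP (hpp C) : small (FB C))).
have [Kmu Kmu0 hmu] := mu_xi.
have [B B0 hPB] := trans_bounded rt T0.
have gb0 : 0 <= genbound rt by exact: le_trans ler01 (genbound_ge1 _).
pose M : R := 1 + #|{: cls}|%:R * B.
have M1 : 1 <= M by rewrite lerDl mulr_ge0.
have M0 : 0 <= M by exact: le_trans ler01 M1.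
pose K2 := \sum_C (B * KA C + genbound rt * B * KB C).
have K20 : 0 <= K2.
  apply: sumr_ge0 => C _; have [a0 _] := hA C; have [b0 _] := hB C.
  by rewrite addr_ge0 ?mulr_ge0.
pose K3 := K2 ^+ 2 / 4 + K2 * M.
have K30 : 0 <= K3 by rewrite addr_ge0 ?divr_ge0 ?sqr_ge0 // mulr_ge0.
have K00 : 0 <= 2 * (2^-1 * M ^+ 2 * Kmu + K3 * T).
  by rewrite mulr_ge0 // addr_ge0 ?mulr_ge0 ?invr_ge0 ?sqr_ge0.
exists (2 * (2^-1 * M ^+ 2 * Kmu + K3 * T)) => // q hq.
have hev := ev_valid hq.
apply: ev_impl hev => n hv t ht C x xC.
have /andP[q0 q1] := hq.
have dp := d_pos n.+1.
pose N := n.+1; pose th := theta N.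
have [x0 _] := some_site m0 m1.
pose mu' (eta : Hn S n.+1) := mu ms (d n.+1) eta.
have mu0 eta : 0 <= mu' eta by exact: ltW (mu_gt0 dp ms0 x0 eta).
pose f (eta : Hn S n.+1) : R := (eta \in EN n.+1 (val D0))%:R.
have f01 eta : 0 <= f eta <= 1 by rewrite /f; case: (_ \in _); rewrite ?lexx ler01.
pose u s eta := semig (Q n.+1) (th * s) f eta.
pose phi (s : R) (A : cls) := trans rt s A D0.
pose dphi (s : R) (A : cls) := \sum_z gen rt A z * phi s z.
(* Candidate for [u]: the limit transition function extended from condensates to all configurations
   by means of the test functions. *)
pose v s eta := \sum_A phi s A * VV n A eta.
pose w s eta := u s eta - v s eta.
pose dw s eta := th * (\sum_z gen (Q n.+1) eta z * u s z) - \sum_A dphi s A * VV n A eta.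
have th0 : 0 <= th by rewrite divr_ge0 // exprn_ge0 // ltW.
have Vr A (eta : Hn S n.+1) : 0 <= VV n A eta <= 1 by exact: (V_range r0 (hpp A)).
have hw s eta : is_derive s (1 : R) (fun s => w s eta) (dw s eta).
  apply: is_deriveB; first exact: is_derive_semig_scaled.
  apply: is_derive_bigsum => A.
  have h1 := is_derive_trans rt s A D0.
  rewrite (_ : (fun s => phi s A * VV n A eta) = (fun s => VV n A eta * trans rt s A D0)); last first.
    by apply/funext => s'; rewrite mulrC.
  rewrite mulrC; exact: (@is_deriveZ R R R _ (VV n A eta) s 1 _ h1).
pose h s := 2^-1 * \sum_eta mu' eta * (w s eta * w s eta).
pose dh s := \sum_eta mu' eta * (w s eta * dw s eta).
have hh s : is_derive s (1 : R) h (dh s).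
  have h1 eta : is_derive s (1 : R) (fun s => mu' eta * (w s eta * w s eta)) (mu' eta * (2 * (w s eta * dw s eta))).
    have h2 := is_deriveM (hw s eta) (hw s eta).
    have := @is_deriveZ R R R _ (mu' eta) s 1 _ h2.
    rewrite /GRing.scale /=; have -> : w s eta * dw s eta + w s eta * dw s eta = 2 * (w s eta * dw s eta) by ring.
    by [].
  have h2 := is_derive_bigsum (index_enum (Hn S n.+1)) xpredT h1.
  have := @is_deriveZ R R R _ (2^-1) s 1 _ h2; rewrite /GRing.scale /= mulr_sumr.
  rewrite (_ : \sum_i 2^-1 * (mu' i * (2 * (w s i * dw s i))) = dh s) //.
  by apply: eq_bigr => eta _; field.
have wM s eta : 0 <= s <= T -> `|w s eta| <= M.
  move=> hs; apply: le_trans (ler_normB _ _) _; apply: lerD.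
    apply: semig_bound => [|y|]; [exact: pos|by have /andP[a1 a2] := f01 y; rewrite ger0_norm|].
    by case/andP: hs => s0 _; rewrite mulr_ge0.
  apply: le_trans (ler_norm_sum _ _ _) _.
  apply: (@le_trans _ _ (\sum_(A : cls) B)); last by rewrite sumr_const mulr_natl.
  apply: ler_sum => A _; rewrite normrM -[leRHS]mulr1; apply: ler_pM => //; first exact: hPB.
  by have /andP[a1 a2] := Vr A eta; rewrite ger0_norm.
pose c s := Ctx (cn := n) (d n.+1) q (w s) M.
(* The dissipation [- En] appears, and what is left consists of the errors of [Dir_V] and [mass_V],
   weighted by the limit kernel and its derivative. *)
have dhE s : dh s = - En r m (c s) - \sum_A phi s A * FA A (c s) - \sum_A dphi s A * FB A (c s).
  have e1 : dh s = th * (\sum_eta mu' eta * w s eta * (\sum_z gen (Q n.+1) eta z * u s z))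
      - \sum_A dphi s A * \sum_eta mu' eta * (w s eta * VV n A eta).
    rewrite /dh /dw mulr_sumr; under [X in _ = _ - X]eq_bigr do rewrite mulr_sumr.
    rewrite [X in _ = _ - X]exchange_big -sumrB /=; apply: eq_bigr => eta _.
    rewrite (_ : \sum_A dphi s A * (mu' eta * (w s eta * VV n A eta)) = mu' eta * (w s eta * \sum_A dphi s A * VV n A eta)); last first.
      by rewrite !mulr_sumr; apply: eq_bigr => A _; ring.
    by ring.
  have e2 : \sum_eta mu' eta * w s eta * (\sum_z gen (Q n.+1) eta z * u s z) =
     - Dir r ms (d n.+1) (w s) (w s) - \sum_A phi s A * Dir r ms (d n.+1) (VV n A) (w s).
    have -> : \sum_A phi s A * Dir r ms (d n.+1) (VV n A) (w s) = Dir r ms (d n.+1) (w s) (v s).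
      by rewrite Dir_sumr; apply: eq_bigr => A _; rewrite DirC.
    have e3 := Dir_gen (d n.+1) rxx (ms_rev rev) (n := n).
    rewrite -opprD -[Dir _ _ _ (w s) (w s)]opprK -[Dir _ _ _ (w s) (v s)]opprK -!e3 -opprD opprK -big_split /=.
    apply: eq_bigr => eta _; rewrite -mulrDr -big_split /=; congr (_ * _); apply: eq_bigr => z _.
    by rewrite -mulrDr /w subrK.
  pose wb A := w s (xi n.+1 (rep A)).
  pose SA A := \sum_(D | D != A) rho A D * (wb A - wb D).
  (* The limiting terms cancel by the backward equation of the limit chain and the symmetry of
     [rho]. *)
  have z : \sum_A phi s A * (sst^-1 * SA A) + \sum_A dphi s A * (sst^-1 * (#|val A|%:R * wb A)) = 0.
    have rho0 A : rho A A = 0 :> R by rewrite /rho /rate2 eqxx mulr0.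
    have SAE A : SA A = \sum_D rho A D * (wb A - wb D) by rewrite /SA [RHS](bigD1 A) //= rho0 mul0r add0r.
    have dE A : dphi s A * (sst^-1 * (#|val A|%:R * wb A)) = sst^-1 * \sum_D rho A D * (phi s D - phi s A) * wb A.
      rewrite /dphi gen_apply -mulr_suml [in RHS]/rho.
      under [X in _ = _ * (X * _)]eq_bigr do rewrite -mulrA.
      by rewrite -mulr_sumr; ring.
    rewrite -big_split /=; under eq_bigr do rewrite dE SAE mulrCA -mulrDr mulr_sumr -big_split.
    rewrite -mulr_sumr /=; apply/eqP; rewrite mulf_eq0; apply/orP; right; apply/eqP.
    transitivity (\sum_A \sum_D (rho A D * phi s D * wb A) - \sum_A \sum_D (rho A D * phi s A * wb D)).
      rewrite -sumrB; apply: eq_bigr => A _; rewrite -sumrB; apply: eq_bigr => D _; ring.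
    apply/eqP; rewrite subr_eq0; apply/eqP; rewrite exchange_big /=; apply: eq_bigr => A _; apply: eq_bigr => D _.
    have [->//|AD] := eqVneq D A; by rewrite (rho_sym r0 irr m0 m1 rev AD).
  have fE : \sum_A phi s A * FA A (c s) = th * \sum_A phi s A * Dir r ms (d n.+1) (VV n A) (w s) - \sum_A phi s A * (sst^-1 * SA A).
    rewrite mulr_sumr -sumrB; apply: eq_bigr => A _; rewrite /FA -/(wb A) /= mulrBr.
    by rewrite [X in X - _]mulrCA.
  have gE : \sum_A dphi s A * FB A (c s) = \sum_A dphi s A * (\sum_eta mu' eta * (w s eta * VV n A eta)) - \sum_A dphi s A * (sst^-1 * (#|val A|%:R * wb A)).
    by rewrite -sumrB; apply: eq_bigr => A _; rewrite /FB mulrBr.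
  rewrite fE gE e1 e2 /En /=.
  rewrite -[theta_ (c s)]/th; move: z; set a := \sum_A phi s A * (_ * _); set b := \sum_A dphi s A * (sst^-1 * _); set e := \sum_A dphi s A * _.
  set k := \sum_A phi s A * _; set l := Dir _ _ _ _ _; move=> z; have -> : a = - b by apply/eqP; rewrite -addr_eq0 z.
  by ring.
have s0 : 0 < Num.sqrt q by rewrite sqrtr_gt0.
have sqE : Num.sqrt q ^+ 2 = q by rewrite sqr_sqrtr // ltW.
have q_le : q <= Num.sqrt q.
  rewrite -[X in X <= _]sqE expr2 ler_piMl ?sqrtr_ge0 // -[leRHS]sqrtr1 ler_sqrt //; lra.
have dhb s : 0 <= s <= T -> dh s <= K3 * Num.sqrt q.
  move=> hs; have va : valid (c s) by apply: hv => eta; exact: wM.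
  have h1 : `|\sum_A phi s A * FA A (c s)| + `|\sum_A dphi s A * FB A (c s)| <= K2 * err r m (c s).
    rewrite /K2 mulr_suml; apply: (@le_trans _ _ (\sum_A (`|phi s A * FA A (c s)| + `|dphi s A * FB A (c s)|))).
      by rewrite big_split; apply: lerD; exact: ler_norm_sum.
    apply: ler_sum => A _; rewrite mulrDl; have [a0 ha] := hA A; have [b0 hb] := hB A.
    apply: lerD; rewrite normrM -mulrA; apply: ler_pM => //; rewrite ?ha ?hb ?hPB //.
    by apply: gen_sum_bound => // z; exact: hPB.
  have E0 := En_ge0 r0 irr m0 m1 rev va.
  have e1 : err r m (c s) = Num.sqrt q * (Num.sqrt (En r m (c s)) + M) by [].
  have e2 : Num.sqrt (En r m (c s)) ^+ 2 = En r m (c s) by rewrite sqr_sqrtr.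
  rewrite dhE; apply: (@le_trans _ _ (- En r m (c s) + K2 * err r m (c s))).
    have a1 := ler_norm (- \sum_A phi s A * FA A (c s)); have a2 := ler_norm (- \sum_A dphi s A * FB A (c s)).
    by rewrite !normrN in a1 a2; lra.
  rewrite e1 /K3; set E := Num.sqrt (En _ _ _) in e2 *; rewrite -e2; set sq := Num.sqrt q in s0 sqE q_le *.
  (* Completing the square in the square root of the energy. *)
  have a1 : 0 <= (E - K2 * sq / 2) ^+ 2 by exact: sqr_ge0.
  have a2 : K2 ^+ 2 / 4 * q <= K2 ^+ 2 / 4 * sq by rewrite ler_wpM2l ?divr_ge0 ?sqr_ge0.
  have -> : - E ^+ 2 + K2 * (sq * (E + M)) = - (E - K2 * sq / 2) ^+ 2 + K2 ^+ 2 / 4 * sq ^+ 2 + K2 * M * sq by field.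
  by rewrite sqE mulrDl; lra.
(* At time 0 the two functions agree on the condensates of [Sstar], so only the mass elsewhere
   matters. *)
have h0 : h 0 <= 2^-1 * M ^+ 2 * Kmu * Num.sqrt q.
  have hT0 : 0 <= (0 : R) <= T by rewrite lexx.
  have va : valid (c 0) by apply: hv => eta; exact: wM.
  have [_ ho] := hmu (c 0) va.
  have -> : 2^-1 * M ^+ 2 * Kmu * Num.sqrt q = 2^-1 * (M ^+ 2 * (Kmu * Num.sqrt q)) by ring.
  rewrite /h ler_wpM2l ?invr_ge0 //.
  apply: (@le_trans _ _ (M ^+ 2 * (Kmu * q))); last by rewrite ler_wpM2l ?sqr_ge0 // ler_wpM2l.
  apply: le_trans (ler_wpM2l (sqr_ge0 M) ho); rewrite mulr_sumr [leRHS]big_mkcond /=.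
  apply: ler_sum => eta _; case: ifP => [|/negbT]; last first.
    rewrite negbK => /imsetP[y yS ->].
    have -> : w 0 (xi n.+1 y) = 0.
      rewrite /w /u mulr0 semig0 /f /v.
      have -> : \sum_A phi 0 A * VV n A (xi n.+1 y) = (y \in val D0)%:R.
        rewrite (bigD1 D0) //= [X in _ + X]big1 ?addr0 => [|A /negbTE nB]; last by rewrite /phi trans0 nB mul0r.
        by rewrite /phi trans0 eqxx mul1r /VV (V_xi r0 irr m0 m1 rev).
      rewrite /EN mem_imset; last exact: xi_inj.
      by rewrite subrr.
    by rewrite !mulr0.
  move=> _; rewrite mulrC ler_wpM2r // -expr2 -[leLHS]real_normK ?num_real // lerXn2r ?nnegrE //.
  exact: wM.
have hT := derive_le_growth hh dhb ht.
have fin : mu' (xi n.+1 x) * (w t (xi n.+1 x) * w t (xi n.+1 x)) <= 2 * h t.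
  rewrite /h [leRHS]mulrA mulfV ?pnatr_eq0 // mul1r (bigD1 (xi n.+1 x)) //= lerDl sumr_ge0 // => eta _.
  by rewrite mulr_ge0 // -expr2 sqr_ge0.
have wE : w t (xi n.+1 x) = \sum_(y in val D0) trans (Q n.+1) (th * t) (xi n.+1 x) (xi n.+1 y) - trans rt t C D0.
  rewrite /w /u /v /semig; congr (_ - _).
    rewrite (bigID (fun eta => eta \in EN n.+1 (val D0))) /= [X in _ + X]big1 ?addr0 => [|eta /negbTE e]; last by rewrite /f e mulr0.
    rewrite (eq_bigr (fun eta => trans (Q n.+1) (th * t) (xi n.+1 x) eta)) => [|eta e]; last by rewrite /f e mulr1.
    by rewrite /EN big_imset //= => y z _ _; exact: xi_inj.
  have xS := cls_sub xC.
  rewrite (bigD1 C) //= [X in _ + X]big1 ?addr0 => [|A AC]; last first.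
    rewrite /VV (V_xi r0 irr m0 m1 rev) //; case: (boolP (x \in val A)) => xA; last by rewrite mulr0.
    by case/eqP: AC; exact: clsE xA xC.
  by rewrite /VV (V_xi r0 irr m0 m1 rev) // xC mulr1.
rewrite -wE mulrC expr2; apply: le_trans fin _; rewrite -[leRHS]mulrA ler_wpM2l //.
apply: le_trans hT _; rewrite [leRHS]mulrDl; apply: lerD; first exact: h0.
rewrite [leRHS]mulrAC; apply: ler_wpM2l; first by rewrite mulr_ge0 // ltW.
by case/andP: ht.
Qed.
End OneTarget.

Lemma sst0 : 0 < sst. Proof. exact: sst_gt0. Qed.

Lemma ev_mu_xi : ev (fun n => forall x, x \in Sstar -> (2 * sst)^-1 <= mu ms (d n.+1) (xi n.+1 x)).
Proof.
have [K K0 hK] := mu_xi; have s0 := sst0.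
pose q := Num.min 2^-1 ((2 * sst * (K + 1))^-1).
have K1 : 0 < K + 1 by rewrite ltr_wpDl.
have q0 : 0 < q by rewrite lt_min !invr_gt0 ltr0n /= mulr_gt0 // mulr_gt0.
have hq : 0 < q <= 2^-1 by rewrite q0 ge_min lexx.
have hv := ev_valid hq.
apply: ev_impl hv => n hv x xS.
have va : valid (Ctx (cn:=n) (d n.+1) q (fun _ => 0) 0) by apply: hv => eta; rewrite normr0.
have [h _] := hK _ va; have := h x xS; rewrite ler_norml => /andP[h1 _] /=.
have : K * q <= (2 * sst)^-1.
  apply: (@le_trans _ _ (K * (2 * sst * (K + 1))^-1)); first by rewrite ler_wpM2l // ge_min lexx orbT.
  rewrite invfM mulrCA ler_piMr ?invr_ge0 ?mulr_ge0 // ler_pdivrMr // mul1r lerDl //.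
have -> : (2 * sst)^-1 = sst^-1 / 2 by rewrite invfM mulrC.
by move: h1; rewrite /= => h1 h2; set u := mu _ _ _ in h1 *; lra.
Qed.

Lemma semig_conv (T eps : R) : 0 <= T -> 0 < eps -> ev (fun n => forall t : R, 0 <= t <= T -> forall (C D : cls) x, x \in val C ->
  `|\sum_(y in val D) trans (Q n.+1) (theta n.+1 * t) (xi n.+1 x) (xi n.+1 y) - trans rt t C D| <= eps).
Proof.
move=> T0 e0; have s0 := sst0.
suff h (D : cls) : ev (fun n => forall t : R, 0 <= t <= T -> forall (C : cls) x, x \in val C ->
  `|\sum_(y in val D) trans (Q n.+1) (theta n.+1 * t) (xi n.+1 x) (xi n.+1 y) - trans rt t C D| <= eps).
  by apply: ev_impl (ev_all h) => n hn t ht C D; exact: hn.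
have [K K0 hK] := energy_estimate D T0.
(* [s] is the square root of the error scale. It is chosen so that dividing the energy estimate by a
   mass at least [1 / (2 * sst)] leaves at most [eps ^ 2]. *)
pose s := Num.min 2^-1 (eps ^+ 2 / (2 * sst * (K + 1))).
have K1 : 0 < K + 1 by rewrite ltr_wpDl.
have sp : 0 < s by rewrite lt_min invr_gt0 ltr0n /= divr_gt0 ?exprn_gt0 // mulr_gt0 // mulr_gt0.
have s2 : s <= 2^-1 by rewrite ge_min lexx.
have s1 : s <= 1 by apply: le_trans s2 _; lra.
have hq : 0 < s ^+ 2 <= 2^-1 by rewrite exprn_gt0 //= expr2 (le_trans _ s2) // ler_piMl // ltW.
have sE : Num.sqrt (s ^+ 2) = s by rewrite sqrtr_sqr ger0_norm // ltW.
apply: ev_impl (ev_and (hK _ hq) ev_mu_xi) => n [h1 h2] t ht C x xC.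
have := h1 t ht C x xC; rewrite sE; have := h2 x (cls_sub xC).
set a := _ - _; set u := mu _ _ _ => ux hu.
have i0 : 0 < (2 * sst)^-1 by rewrite invr_gt0 mulr_gt0.
have : a ^+ 2 * (2 * sst)^-1 <= K * s by apply: le_trans hu; rewrite ler_wpM2l ?sqr_ge0.
rewrite ler_pdivrMr ?mulr_gt0 // => ha.
have : a ^+ 2 <= eps ^+ 2.
  apply: le_trans ha _; apply: (@le_trans _ _ (K * (eps ^+ 2 / (2 * sst * (K + 1))) * (2 * sst))).
    rewrite ler_wpM2r ?mulr_ge0 ?(ltW s0) // ler_wpM2l // ge_min lexx orbT //.
  have -> : K * (eps ^+ 2 / (2 * sst * (K + 1))) * (2 * sst) = eps ^+ 2 * (K / (K + 1)) by field; rewrite !gt_eqF.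
  by rewrite ler_piMr ?sqr_ge0 // ler_pdivrMr // mul1r lerDl.
by rewrite -[X in X <= _]real_normK ?num_real // ler_pXn2r ?nnegrE // ltW.
Qed.

(** A condensate on [Sstar] has mass bounded below, so [stationary_bound] transfers the smallness of
    the rest of the space to all times at once. *)
Lemma off_small (eps : R) : 0 < eps -> ev (fun n => forall s : R, 0 <= s -> forall x, x \in Sstar ->
  \sum_(z | z \notin EN n.+1 Sstar) trans (Q n.+1) s (xi n.+1 x) z <= eps).
Proof.
move=> e0; have [K K0 hK] := mu_xi; have s0 := sst0.
have K1 : 0 < K + 1 by rewrite ltr_wpDl.
pose q := Num.min 2^-1 (eps / (2 * sst * (K + 1))).
have q0 : 0 < q by rewrite lt_min invr_gt0 ltr0n /= divr_gt0 // mulr_gt0 // mulr_gt0.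
have hq : 0 < q <= 2^-1 by rewrite q0 ge_min lexx.
have hv := ev_valid hq.
apply: ev_impl (ev_and hv ev_mu_xi) => n [hn hm] s s_0 x xS.
have va : valid (Ctx (cn:=n) (d n.+1) q (fun _ => 0) 0) by apply: hn => eta; rewrite normr0.
have [_ ho] := hK _ va; have i0 : 0 < (2 * sst)^-1 by rewrite invr_gt0 mulr_gt0.
have h1 := stationary_bound (d_pos n.+1) (pos (N := n.+1)) (fun z => z \notin EN n.+1 Sstar) (xi n.+1 x) s_0.
have P0 : 0 <= \sum_(z | z \notin EN n.+1 Sstar) trans (Q n.+1) s (xi n.+1 x) z by apply: sumr_ge0 => z _; exact: pos.
have h2 := le_trans (ler_wpM2r P0 (hm x xS)) (le_trans h1 ho).
rewrite mulrC ler_pdivrMr ?mulr_gt0 // in h2; apply: le_trans h2 _; rewrite /=.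
apply: (@le_trans _ _ (K * (eps / (2 * sst * (K + 1))) * (2 * sst))).
  by rewrite ler_wpM2r ?mulr_ge0 ?(ltW s0) // ler_wpM2l // ge_min lexx orbT.
have -> : K * (eps / (2 * sst * (K + 1))) * (2 * sst) = eps * (K / (K + 1)) by field; rewrite !gt_eqF.
by rewrite ler_piMr ?(ltW e0) // ler_pdivrMr // mul1r lerDl.
Qed.

(* The escape probability of a well: its Dirichlet energy is computed by testing [Dir_V] against itself. *)
Lemma escape_small (C : cls) x y (eps : R) : x \in val C -> y \in val C -> 0 < eps -> ev (fun n =>
  forall g : Hn S n.+1 -> R, (forall z, 0 <= g z <= 1) -> g (xi n.+1 y) = 0 ->
   (forall z, z \in EN n.+1 (Sstar :\: val C) -> g z = 1) ->
   (forall z, z != xi n.+1 y -> z \notin EN n.+1 (Sstar :\: val C) -> \sum_z' gen (Q n.+1) z z' * g z' = 0) ->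
   g (xi n.+1 x) <= eps).
Proof.
move=> xC yC e0; have [rep repP] := choice (fun D : cls => cls_neq0 D).
have [gp [b [L prof]]] := profiles C.
have [K [K0 hK]] := Dir_V r0 rxx irr m0 m1 rev prof repP.
have [K' [K'0 hK']] := small_xi xC yC.
pose A := sst^-1 * \sum_(D | D != C) `|rho C D| + K.
have s0 := sst0.
have A0 : 0 <= A by rewrite addr_ge0 // mulr_ge0 ?invr_ge0 ?(ltW s0) // sumr_ge0.
(* s := sqrt En satisfies s^2 <= A + K s *)
pose B := K + A + 1; have B0 : 0 < B by rewrite ltr_wpDl // addr_ge0.
pose s := Num.min 2^-1 (eps / (K' * (B + 1) + 1)).
have KB : 0 < K' * (B + 1) + 1 by rewrite ltr_wpDl // mulr_ge0 // addr_ge0 // ltW.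
have sp : 0 < s by rewrite lt_min invr_gt0 ltr0n /= divr_gt0.
have s2 : s <= 2^-1 by rewrite ge_min lexx.
have s1 : s <= 1 by apply: le_trans s2 _; lra.
have hq : 0 < s ^+ 2 <= 2^-1 by rewrite exprn_gt0 //= expr2 (le_trans _ s2) // ler_piMl // ltW.
have sE : Num.sqrt (s ^+ 2) = s by rewrite sqrtr_sqr ger0_norm // ltW.
have hv := ev_valid hq.
apply: ev_impl hv => n hn g g01 gy gB gh.
pose c := Ctx (cn := n) (d n.+1) (s ^+ 2) g 1.
have va : valid c by apply: hn => z; have /andP[a1 a2] := g01 z; rewrite ger0_norm.
have E0 := En_ge0 r0 irr m0 m1 rev va.
have e1 : err r m c = s * (Num.sqrt (En r m c) + 1) by rewrite /err /= sE.
have e2 : Num.sqrt (En r m c) ^+ 2 = En r m c by rewrite sqr_sqrtr.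
set E := Num.sqrt _ in e1 e2.
have Ep : 0 <= E by exact: sqrtr_ge0.
have gyy z : z \in EN n.+1 (Sstar :\: val C) -> @V R S r m C b n.+1 z = 0.
  case/imsetP => x' /finset.setDP[x'S /negbTE x'C] ->.
  by have [D x'D] := cls_ex r x'S; rewrite (V_xi r0 irr m0 m1 rev) ?x'C.
(* [g + V] equals 1 at [xi y] and on the condensates of the other classes, and [g] is harmonic
   elsewhere; the form of [g + V] against [g] is therefore that of the constant 1, which
   vanishes. *)
have EV : En r m c = - (theta_ c * Dir r ms (cd c) (@V R S r m C b (cn c).+1) (cw c)).
  rewrite /En -mulrN; congr (_ * _).
  apply/eqP; rewrite -subr_eq0 opprK -[X in X + _]opprK -[X in _ + X]opprK -opprD oppr_eq0; apply/eqP.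
  rewrite -!(Dir_gen _ rxx (ms_rev rev)) /= -big_split /=.
  transitivity (\sum_eta mu ms (d n.+1) eta * 1 * (\sum_z gen (Q n.+1) eta z * g z)).
    apply: eq_bigr => eta _; rewrite -mulrDl -mulrDr.
    case: (eqVneq eta (xi n.+1 y)) => [->|ey]; first by rewrite gy (V_xi r0 irr m0 m1 rev) ?(cls_sub yC) // yC add0r.
    case: (boolP (eta \in EN n.+1 (Sstar :\: val C))) => [eB|eB]; first by rewrite gB // gyy // addr0.
    by rewrite gh // !mulr0.
  rewrite (Dir_gen _ rxx (ms_rev rev)) /Dir !big1 ?mulr0 ?oppr0 // => z _; rewrite big1 // => x' _; rewrite big1 // => y' _.
  by rewrite subrr mul0r mulr0.
have hA : En r m c <= A + K * E.
  have := hK c va; rewrite e1 EV /=; set u := theta_ _ * _; set t := sst^-1 * _ => h.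
  have ht : `|t| <= sst^-1 * \sum_(D | D != C) `|rho C D|.
    rewrite normrM ger0_norm ?invr_ge0 ?(ltW s0) // ler_wpM2l ?invr_ge0 ?(ltW s0) //.
    apply: le_trans (ler_norm_sum _ _ _) _; apply: ler_sum => D _; rewrite normrM ler_piMr // ler_norml.
    by have /andP[a1 a2] := g01 (xi n.+1 (rep C)); have /andP[b1 b2] := g01 (xi n.+1 (rep D)); rewrite /=; apply/andP; split; lra.
  have h' : `|u - t| <= K * E + K.
    apply: le_trans h _; rewrite -[X in _ <= _ + X]mulr1 -mulrDr ler_wpM2l // ler_piMl //; lra.
  rewrite /A; move: ht h'; rewrite !ler_norml => /andP[t1 t2] /andP[u1 u2]; lra.
have EB : E <= B.
  rewrite leNgt /B; apply/negP => lt; move: hA; rewrite -e2 leNgt => /negP; apply.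
  have KE : K * E + A * 1 < (K + A + 1) * E by nra.
  apply: (@lt_le_trans _ _ ((K + A + 1) * E)); first by move: KE; rewrite mulr1 addrC.
  by rewrite expr2 ler_wpM2r // ltW.
(* With bounded energy, [g] takes nearly equal values at the condensates on [x] and [y], and it
   vanishes at the latter. *)
have := hK' c va; rewrite /= gy subr0 e1 => h; apply: le_trans (ler_norm _) (le_trans h _).
apply: (@le_trans _ _ (K' * (eps / (K' * (B + 1) + 1) * (B + 1)))).
  apply: ler_wpM2l => //; apply: ler_pM; rewrite ?(ltW sp) ?addr_ge0 // ?lerD2r //.
  by rewrite ge_min lexx orbT.
have -> : K' * (eps / (K' * (B + 1) + 1) * (B + 1)) = eps * (K' * (B + 1) / (K' * (B + 1) + 1)) by field; rewrite gt_eqF.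
by rewrite ler_piMr ?(ltW e0) // ler_pdivrMr // mul1r lerDl.
Qed.

(** * Visits within a class and occupation of a component *)

Local Notation leb := (@lebesgue_measure R).

(** The solution is the mean hitting time of [A]; it is the function required by the recurrence
    estimates. *)
Lemma return_potential n (A : {set Hn S n.+1}) : A != finset.set0 ->
  exists psi : Hn S n.+1 -> R, (forall x, 0 <= psi x) /\ forall x, x \notin A -> \sum_y gen (Q n.+1) x y * psi y = -1.
Proof.
move=> A0; have [f [h1 h2]] := solve_chain (d_pos n.+1) (fun x => if x \in A then 0 else -1) A0.
exists f; split; last by move=> x xA; rewrite h1 // (negbTE xA).
apply: (harmonic_ge0 (d_pos n.+1) A0) => x xA; first by rewrite h1 // (negbTE xA) lerN10.
by rewrite h2 // xA.
Qed.

Lemma other_cls_site (C : cls) : exists2 z, z \in Sstar & z \notin val C.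
Proof.
have [D DC] := other_cls C; have [z zD] := cls_neq0 D; exists z; first exact: cls_sub zD.
by apply/negP => zC; move: DC; rewrite (cls_eq r0 irr m0 m1 rev zD zC) eqxx.
Qed.

Lemma within_class (C : cls) :
  (fun N => \big[mine/1%E]_(x in val C) \big[mine/1%E]_(y in val C | xi N x != xi N y)
     P (xi N x) [set w | (hit (X N) [set xi N y]%SET w < hit (X N) (EN N (Sstar :\: val C)) w)%E]) @ \oo --> 1%E.
Proof.
apply: ev_cvge => e e0; apply: ev_unshift.
have h (xy : S * S) : ev (fun n => xy.1 \in val C -> xy.2 \in val C -> forall g : Hn S n.+1 -> R, (forall z, 0 <= g z <= 1) -> g (xi n.+1 xy.2) = 0 ->
   (forall z, z \in EN n.+1 (Sstar :\: val C) -> g z = 1) ->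
   (forall z, z != xi n.+1 xy.2 -> z \notin EN n.+1 (Sstar :\: val C) -> \sum_z' gen (Q n.+1) z z' * g z' = 0) ->
   g (xi n.+1 xy.1) <= e).
  case: xy => x y /=; case: (boolP (x \in val C)) => xC; last by exists 0%N.
  case: (boolP (y \in val C)) => yC; last by exists 0%N.
  by apply: ev_impl (escape_small xC yC e0) => n hn _ _.
apply: ev_impl (ev_all h) => n {}h.
have [z0 z0S z0C] := other_cls_site C.
pose good (u : \bar R) := ((1 - e)%:E <= u <= (1 + e)%:E)%E.
have g1 : good 1%E by rewrite /good !lee_fin; apply/andP; split; lra.
have gmin a b : good a -> good b -> good (mine a b) by rewrite /good /mine; case: ifP.
apply: (big_ind good) => // x xC; apply: (big_ind good) => // y /andP[yC xy].
pose A : {set Hn S n.+1} := [set xi n.+1 y]%SET; pose B := EN n.+1 (Sstar :\: val C).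
have A0 : A != finset.set0 by apply/set0Pn; exists (xi n.+1 y); rewrite finset.in_set1.
have AB z : z \in A -> z \notin B.
  rewrite finset.in_set1 => /eqP ->; apply/negP => /imsetP[y' y'S e'].
  by case/finset.setDP: y'S => _; rewrite -(xi_inj e') yC.
have [g [g01 gh gA gB]] := solve_harmonic (d_pos n.+1) A0 AB.
have [psi [psi0 psiA]] := return_potential A0.
have gx : g (xi n.+1 x) <= e.
  apply: (h (x, y)) => //=; first by rewrite gA // finset.in_set1.
  by move=> z zy zB; rewrite gh // finset.in_set1.
have hp := hit_probability (@pos _) psi0 psiA AB g01 gB gh (HX (xi n.+1 x)).
apply/andP; split; first by apply: le_trans hp; rewrite lee_fin; lra.
apply: (@le_trans _ _ 1%E); last by rewrite lee_fin; lra.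
by apply: probability_le1; exact: (hit_lt_meas (HX (xi n.+1 x))).
Qed.

Lemma rate2_ge0 C D : 0 <= rt C D.
Proof.
rewrite /rate2; case: eqP => // _; rewrite /Rres; case: (all_vanish _ _ _) => //.
rewrite invr_ge0; apply: mulr_ge0 => //; apply: fine_ge0; apply: integral_ge0 => t.
rewrite /= in_itv /= => /andP[t0 t1]; rewrite lee_fin divr_ge0 //.
apply: sumr_ge0 => x _; apply: sumr_ge0 => x' _; apply: sumr_ge0 => y _.
rewrite /Rsummand; case: ifP => // _; rewrite divr_ge0 //; apply: mulr_ge0.
  by rewrite subr_ge0; exact: (ms_le1 irr m0 m1 rev).
by apply: addr_ge0; rewrite divr_ge0 // subr_ge0.
Qed.

Lemma rt_sym C D : (0 < rt C D) = (0 < rt D C).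
Proof.
case: (eqVneq C D) => [->//|CD].
have s0 (F : cls) : 0 < #|val F|%:R :> R by have [z zF] := cls_neq0 F; rewrite ltr0n; apply/card_gt0P; exists z.
by have := rho_sym r0 irr m0 m1 rev CD; rewrite /rho => e; rewrite -(pmulr_rgt0 _ (s0 C)) e pmulr_rgt0.
Qed.

Definition linked (C D : cls) := connect (@rel2 R S r m) C D && connect (@rel2 R S r m) D C.

(** The relation of positive rate is symmetric, so the indicator of a component is harmonic and the
    semigroup fixes it. *)
Lemma unlinked_prob t C : \sum_(D | ~~ linked C D) trans rt t C D = 0.
Proof.
have sg x : semig rt t (fun D => (linked C D)%:R) x = (linked C x)%:R.
  apply: semig_fixed => {}x; have -> : \sum_z gen rt x z * (linked C z)%:R = \sum_z gen rt x z * (linked C x)%:R.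
    apply: eq_bigr => z _; case: (eqVneq x z) => [->//|xz].
    rewrite /gen (negbTE xz); have [p|] := ltP 0 (rt x z).
      have c1 : connect (@rel2 R S r m) x z by apply: connect1.
      have p' : 0 < rt z x by rewrite rt_sym.
      have c2 : connect (@rel2 R S r m) z x by apply: connect1.
      congr (_ * _%:R); rewrite /linked; congr (nat_of_bool _); apply/andP/andP => -[a b]; split.
      - exact: connect_trans a c2.
      - exact: connect_trans c1 b.
      - exact: connect_trans a c1.
      - exact: connect_trans c2 b.
    by rewrite le_eqVlt ltNge rate2_ge0 // orbF => /eqP ->; rewrite !mul0r.
  by rewrite -mulr_suml gen_rowsum mul0r.
have := trans_sum1 rt t C; rewrite (bigID (linked C)) /=.
have -> : \sum_(D | linked C D) trans rt t C D = 1.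
  have lCC : linked C C by rewrite /linked !connect0.
  transitivity ((linked C C)%:R : R); last by rewrite lCC.
  rewrite -(sg C) /semig [LHS]big_mkcond; apply: eq_bigr => D _.
  by case: ifP; rewrite ?mulr1 ?mulr0.
lra.
Qed.

Lemma scaled_rc n w t : 0 <= t -> exists e : R, 0 < e /\ forall s, t <= s < t + e -> X n.+1 (theta n.+1 * s) w = X n.+1 (theta n.+1 * t) w.
Proof.
have th0 : 0 < theta n.+1 by rewrite divr_gt0 // exprn_gt0.
move=> t0; have [e [e0 he]] := cadlag_rc (ctmc_cadlag (HX (xi n.+1 (xchoose (some_site m0 m1))))) w (mulr_ge0 (ltW th0) t0).
exists (e / theta n.+1); split; first by rewrite divr_gt0.
move=> s /andP[ts se]; apply: he; rewrite ler_pM2l // ts /=.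
by move: se; rewrite -(ltr_pM2l th0) mulrDr [_ * (e / _)]mulrC divfK // gt_eqF.
Qed.

Lemma outside_component (t e : R) : 0 < e -> ev (fun n => forall s : R, 0 <= s <= t -> forall x, x \in Sstar ->
  (P (xi n.+1 x) [set w | X n.+1 (theta n.+1 * s) w \notin EN n.+1 (S3of r m x)] <= e%:E)%E).
Proof.
move=> e0; case: (ltP t 0) => t0.
  by exists 0%N => n _ s /andP[a b]; have := le_lt_trans (le_trans a b) t0; rewrite ltxx.
(* One share of the error for each class, plus one for the configurations off the condensates of
   [Sstar]; half of the tolerance is enough. *)
pose k : R := #|{: cls}|%:R + 1; have k0 : 0 < k by rewrite ltr_wpDl.
pose e' := e / (2 * k); have e'0 : 0 < e' by rewrite divr_gt0 // mulr_gt0.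
have h1 := semig_conv t0 e'0.
have h2 := off_small e'0.
apply: ev_impl (ev_and h1 h2) => n [hc ho] s st x xS.
have [C xC] := cls_ex r xS; have /andP[s0 _] := st.
have ths : 0 <= theta n.+1 * s by rewrite mulr_ge0 // divr_ge0 // ?sqr_ge0.
rewrite (marginal (HX _) (fun z => z \notin EN n.+1 (S3of r m x)) ths) lee_fin.
set tr := trans _ _ _.
have tr0 z : 0 <= tr z by exact: pos.
apply: (@le_trans _ _ (\sum_(z | z \notin EN n.+1 Sstar) tr z + \sum_(D : cls | ~~ linked C D) \sum_(y in val D) tr (xi n.+1 y))).
  have -> : \sum_(D : cls | ~~ linked C D) \sum_(y in val D) tr (xi n.+1 y) =
    \sum_z tr z * \sum_(D : cls | ~~ linked C D) \sum_(y in val D) (z == xi n.+1 y)%:R.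
    under [RHS]eq_bigr do rewrite mulr_sumr; rewrite [RHS]exchange_big; apply: eq_bigr => D _.
    under [RHS]eq_bigr do rewrite mulr_sumr; rewrite [RHS]exchange_big; apply: eq_bigr => y _.
    by rewrite (bigD1 (xi n.+1 y)) //= eqxx mulr1 big1 ?addr0 // => z /negbTE ->; rewrite mulr0.
  rewrite [X in X <= _]big_mkcond [X in _ <= X + _]big_mkcond -big_split /=; apply: ler_sum => z _.
  have s01 : 0 <= \sum_(D : cls | ~~ linked C D) \sum_(y in val D) (z == xi n.+1 y)%:R :> R.
    by apply: sumr_ge0 => D _; apply: sumr_ge0.
  case: (boolP (z \notin EN n.+1 Sstar)) => zE; first by case: ifP => _; rewrite ?lerDl ?addr_ge0 // mulr_ge0.
  rewrite add0r; case: ifP => zS; last exact: mulr_ge0.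
  rewrite ler_peMr //; move/negPn/imsetP: zE => [y yS zy].
  have [D yD] := cls_ex r yS.
  have nl : ~~ linked C D.
    apply/negP => l; move/negP: zS; apply; rewrite zy; apply: imset_f.
    by apply/bigcupP; exists C => //; apply/bigcupP; exists D.
  rewrite (bigD1 D) //= (bigD1 y) //= zy eqxx -addrA lerDl addr_ge0 //; first exact: sumr_ge0.
  by apply: sumr_ge0 => D' _; apply: sumr_ge0.
have b1 : \sum_(D : cls | ~~ linked C D) \sum_(y in val D) tr (xi n.+1 y) <= (k - 1) * e'.
  apply: (@le_trans _ _ (\sum_(D : cls | ~~ linked C D) (trans rt s C D + e'))).
    by apply: ler_sum => D _; have := hc s st C D x xC; rewrite ler_norml => /andP[_]; rewrite lerBlDr addrC.
  rewrite big_split /= unlinked_prob add0r /k addrK sumr_const -[leLHS]mulr_natl ler_wpM2r ?(ltW e'0) // ler_nat.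
  exact: max_card.
apply: le_trans (lerD (ho _ ths x xS) b1) _.
have -> : e' + (k - 1) * e' = e / 2 by rewrite /e'; field; rewrite gt_eqF.
lra.
Qed.

Lemma component_occupation (t : R) : 0 < t ->
  (fun N => \big[maxe/0%E]_(x in Sstar) \int[P (xi N x)]_w
     (\int[leb]_(s in `[0%R, t]) ((X N (theta N * s) w \notin EN N (S3of r m x))%:R : R)%:E))%E @ \oo --> 0%E.
Proof.
move=> t0; apply: ev_cvge => e e0; apply: ev_unshift.
have e1 : 0 < e / t by rewrite divr_gt0.
apply: ev_impl (outside_component t e1) => n hn; rewrite !add0r.
pose good (u : \bar R) := ((- e)%:E <= u <= e%:E)%E.
have g0 : good 0%E by rewrite /good !lee_fin oppr_le0 !ltW.
have gmax a b : good a -> good b -> good (maxe a b) by rewrite /good /maxe; case: ifP.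
apply: (big_ind good) => // x xS.
have mX s z : measurable [set w | X n.+1 (theta n.+1 * s) w = z] by case: (HX (xi n.+1 x)).
have := expected_time mX (@scaled_rc n) (P := P (xi n.+1 x)) (A := fun z => z \notin EN n.+1 (S3of r m x)) (b := e / t) (t := t) (ltW t0) _.
have hb s : 0 <= s <= t -> (P (xi n.+1 x) [set w | X n.+1 (theta n.+1 * s) w \notin EN n.+1 (S3of r m x)] <= (e / t)%:E)%E.
  by move=> st; exact: hn.
move=> /(_ hb)[+ _]; rewrite [t * _]mulrC divfK ?gt_eqF // => le.
rewrite /good le andbT; apply: (@le_trans _ _ 0%E); first by rewrite lee_fin oppr_le0 ltW.
by apply: integral_ge0 => w _; apply: integral_ge0 => s _; rewrite lee_fin.
Qed.

(** * Changes of class within one cell and laws of samples *)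

Definition cl n (eta : Hn S n) : option cls := [pick C : cls | eta \in EN n (val C)].

Lemma EN_xi n (A : {set S}) y : (xi n.+1 y \in EN n.+1 A) = (y \in A).
Proof. by apply/imsetP/idP => [[y' y'A /xi_inj ->]//|yA]; exists y. Qed.

Lemma cl_xi n (C : cls) y : y \in val C -> cl (xi n.+1 y) = Some C.
Proof.
move=> yC; rewrite /cl; case: pickP => [D|/(_ C)]; rewrite EN_xi ?yC //.
by move=> yD; rewrite (cls_eq r0 irr m0 m1 rev yD yC).
Qed.

Lemma Yval_cl n dflt (eta : Hn S n) : Yval dflt eta = odflt dflt (cl eta).
Proof. by []. Qed.

Lemma cl_Some n (eta : Hn S n.+1) (C : cls) : cl eta = Some C -> exists2 x, x \in val C & eta = xi n.+1 x.
Proof. by rewrite /cl; case: pickP => // D /imsetP[x xD ->] [<-]; exists x. Qed.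

Lemma sum_cl n (F : Hn S n.+1 -> R) :
  \sum_z F z = \sum_(z | z \notin EN n.+1 Sstar) F z + \sum_(D : cls) \sum_(y in val D) F (xi n.+1 y).
Proof.
rewrite (bigID (fun z => z \in EN n.+1 Sstar)) /= addrC; congr (_ + _).
rewrite big_imset /=; last by move=> x y _ _; exact: xi_inj.
exact: (sum_Sstar r0 irr m0 m1 rev).
Qed.

Lemma other_cl n (b C : cls) y : y \in val C -> other (@cl n.+1) b (xi n.+1 y) = (C != b).
Proof. by move=> yC; rewrite /other (cl_xi n yC). Qed.

Lemma sum_other n (F : Hn S n.+1 -> R) (b : cls) :
  \sum_(z | other (@cl n.+1) b z) F z = \sum_(D | D != b) \sum_(y in val D) F (xi n.+1 y).
Proof.
rewrite big_mkcond sum_cl big1 ?add0r => [|z zE]; last first.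
  case: ifP => //; rewrite /other; case e : (cl z) => [C|] // _; have [x xC ze] := cl_Some e.
  by move: zE; rewrite ze EN_xi (cls_sub xC).
rewrite [RHS]big_mkcond; apply: eq_bigr => D _; case: ifP => Db.
  by apply: eq_bigr => y yD; rewrite (other_cl _ _ yD) Db.
by rewrite big1 // => y yD; rewrite (other_cl _ _ yD) Db.
Qed.

(** A negative entry would contradict its approximation by sums of nonnegative entries of the
    inclusion kernel. *)
Lemma rt_kernel : nonneg_kernel rt.
Proof.
move=> t C D t0; rewrite leNgt; apply/negP => neg; have e0 : 0 < - trans rt t C D / 2 by rewrite divr_gt0 // oppr_gt0.
have [n0 hn] := semig_conv t0 e0; have [x xC] := cls_neq0 C.
have := hn n0 (leqnn _) t _ C D x xC; rewrite t0 lexx => /(_ isT).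
set s := \sum_(y in _) _; have s0 : 0 <= s.
  by apply: sumr_ge0 => y _; apply: pos; rewrite mulr_ge0 // divr_ge0 // sqr_ge0.
by rewrite ler_norml => /andP[_]; lra.
Qed.

Lemma rt_stay : exists2 L : R, 0 <= L & forall u D, 0 <= u <= 1 -> 1 - L * u <= trans rt u D D.
Proof.
pose g := genbound rt; have g1 : 1 <= g by exact: genbound_ge1.
exists (g + g ^+ 2) => [|u D /andP[u0 u1]]; first by rewrite addr_ge0 ?sqr_ge0 // (le_trans ler01).
have f1 z : `|(z == D)%:R : R| <= 1 by case: (z == D); rewrite ?normr1 ?normr0.
have := semig_taylor rt_kernel D ler01 f1 u0; rewrite semig_ind eqxx mulr1 (_ : true%:R = 1 :> R) //.
have := @gen_sum_bound R _ rt (fun z => (z == D)%:R) 1 D ler01 f1; rewrite mulr1 -/g; set G := \sum_z _.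
rewrite !ler_norml => /andP[a1 a2] /andP[b1 b2].
have : u * - g <= u * G by apply: ler_wpM2l.
have : g ^+ 2 * u ^+ 2 <= g ^+ 2 * u by rewrite ler_wpM2l ?sqr_ge0 // expr2 ler_piMl.
have -> : (g + g ^+ 2) * u = g * u + g ^+ 2 * u by ring.
lra.
Qed.

Section Cell.
Variables (L h e : R).
Hypothesis L0 : 0 <= L.
Hypothesis stay : forall u D, 0 <= u <= 1 -> 1 - L * u <= trans rt u D D.
Hypothesis h01 : 0 <= h <= 1.
Hypothesis Lh : L * h <= 4^-1.
Hypothesis e0 : 0 < e <= 4^-1.
Let q := L * h + #|{: cls}|%:R * e.

(** The two halves feed Ottaviani's inequality: [q] bounds the chance of being elsewhere at a given
    time, and 1/2 is the chance of still being away once away. The conditions on [L * h] and [e] are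
    there for the 1/2. *)
Lemma cell_exit : ev (fun n => forall u : R, 0 <= u <= h -> forall (C b : cls) x, x \in val C ->
  (C = b -> \sum_(z | other (@cl n.+1) b z) trans (Q n.+1) (theta n.+1 * u) (xi n.+1 x) z <= q) /\
  (C != b -> 2^-1 <= \sum_(z | other (@cl n.+1) b z) trans (Q n.+1) (theta n.+1 * u) (xi n.+1 x) z)).
Proof.
have /andP[h0 h1] := h01; have /andP[ep e4] := e0.
apply: ev_impl (semig_conv h0 ep) => n hn u hu C b x xC; have /andP[u0 uh] := hu.
have th : 0 <= theta n.+1 * u by rewrite mulr_ge0 // divr_ge0 // sqr_ge0.
have st : 1 - L * h <= trans rt u C C.
  by apply: le_trans (stay _ _); [rewrite lerD2l lerN2 ler_wpM2l|rewrite u0 (le_trans uh)].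
rewrite sum_other; split => [Cb|Cb].
  apply: (@le_trans _ _ (\sum_(D | D != b) (trans rt u C D + e))).
    by apply: ler_sum => D _; have := hn u hu C D x xC; rewrite ler_norml => /andP[_]; rewrite lerBlDr addrC.
  rewrite big_split /= sumr_const; apply: lerD.
    have := trans_sum1 rt u C; rewrite (bigD1 C) //= -Cb; lra.
  by rewrite -[leLHS]mulr_natl ler_wpM2r ?(ltW ep) // ler_nat max_card.
have := hn u hu C C x xC; rewrite ler_norml => /andP[lo _].
rewrite (bigD1 C) //= -[leLHS]addr0; apply: lerD.
  move: lo; set sC := \sum_(y in val C) _ => lo; have l1 := Lh; have l2 := e4; have l3 := st.
  move: (trans rt u C C) sC (L * h) lo l1 l2 l3 => p sC lh lo l1 l2 l3.
  lra.
by apply: sumr_ge0 => D _; apply: sumr_ge0 => y _; exact: pos.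
Qed.

(** Each change has probability at most [2 * q]. The bound is uniform in the refinement [p] of the
    cell, which allows the passage to continuous time. *)
Lemma cell_two_changes : ev (fun n => forall p (C : cls) x, x \in val C ->
  epath (Q n.+1) p.+1 (theta n.+1 * h / p.+1%:R) (xi n.+1 x) (fun s => (two_changes (@cl n.+1) C (xi n.+1 x :: s))%:R)
    <= (2 * q) ^+ 2).
Proof.
have /andP[h0 h1] := h01; have /andP[ep e4] := e0.
have q0 : 0 <= q by rewrite addr_ge0 ?mulr_ge0 // ltW.
apply: ev_impl cell_exit => n hn p C x xC; pose g := theta n.+1 * h / p.+1%:R.
have g0 : 0 <= g by rewrite divr_ge0 // mulr_ge0 // divr_ge0 // sqr_ge0.
have time j : (j <= p.+1)%N -> exists2 u, 0 <= u <= h & g *+ j = theta n.+1 * u.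
  move=> jp; have p0 : 0 < p.+1%:R :> R by [].
  exists (h * (j%:R / p.+1%:R)); last by rewrite -mulr_natr /g !mulrA -[LHS]mulrA [_^-1 * _]mulrC mulrA.
  by rewrite mulr_ge0 ?divr_ge0 //= ler_piMr // ler_pdivrMr // mul1r ler_nat.
have bound b y : cl y = Some b -> forall j, (j <= p.+1)%N ->
    epath (Q n.+1) j g y (fun s => (has (other (@cl n.+1) b) (y :: s))%:R) <= 2 * q.
  move=> yb j jp; have [z zb ->] := cl_Some yb; have [u hu ug] := time j jp.
  have [up _] := hn u hu b b z zb; have {}up := up erefl; rewrite -ug in up.
  have hl : 2^-1 * epath (Q n.+1) j g (xi n.+1 z) (fun s => (has (other (@cl n.+1) b) (xi n.+1 z :: s))%:R) <=
      \sum_(z' | other (@cl n.+1) b z') trans (Q n.+1) (g *+ j) (xi n.+1 z) z'.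
    apply: has_le => // y' ob i ij.
    have [D Db y'D] : exists2 D, D != b & cl y' = Some D by move: ob; rewrite /other; case: (cl y') => // D; exists D.
    have [z' z'D ->] := cl_Some y'D; have [v hv ->] := time i (leq_trans ij jp).
    by have [_] := hn v hv D b z' z'D; apply.
  by have := le_trans hl up; lra.
apply: le_trans (two_changes_le (q := 2 * q) (pos (N := n.+1)) g0 _ _ _ bound) _ => //; first by rewrite mulr_ge0.
by rewrite expr2; apply: ler_wpM2l; [rewrite mulr_ge0|apply: (bound _ _ (cl_xi n xC))].
Qed.
End Cell.

Lemma fdd_conv (h : R) N (Phi : seq cls -> R) (M : R) (dflt : cls) : 0 <= h -> (forall s, `|Phi s| <= M) ->
  forall e : R, 0 < e -> ev (fun n => forall (C : cls) x, x \in val C ->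
  `|epath (Q n.+1) N (theta n.+1 * h) (xi n.+1 x) (fun s => Phi (map (Yval dflt) s)) - epath rt N h C Phi| <= e).
Proof.
move=> h0; elim: N Phi => [|N ih] Phi PM e e0.
  by exists 0%N => n _ C x _ /=; rewrite subrr normr0 ltW.
have M0 : 0 <= M by apply: le_trans (PM [::]).
pose PD D s := Phi (D :: s); pose K := \sum_D `|epath rt N h D (PD D)|.
have K0 : 0 <= K by apply: sumr_ge0.
pose e3 := e / 3; have e30 : 0 < e3 by rewrite divr_gt0.
pose eK := e3 / (K + 1); pose eM := e3 / (M + 1).
have eK0 : 0 < eK by rewrite divr_gt0 // ltr_wpDl.
have eM0 : 0 < eM by rewrite divr_gt0 // ltr_wpDl.
have hD := ev_all (fun D => ih (PD D) (fun s => PM (D :: s)) e3 e30).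
have hc := semig_conv h0 eK0.
apply: ev_impl (ev_and hD (ev_and hc (off_small eM0))) => n {hD hc} [hD [hc ho]] C x xC /=.
have th : 0 <= theta n.+1 * h by rewrite mulr_ge0 // divr_ge0 // sqr_ge0.
set tr := trans (Q n.+1) _ _; have tr0 z : 0 <= tr z by exact: pos.
pose A z := epath (Q n.+1) N (theta n.+1 * h) z (fun s => Phi (Yval dflt z :: map (Yval dflt) s)).
have bA z : `|A z| <= M.
  rewrite ler_norml -{1}(epath_cst (Q n.+1) (theta n.+1 * h) N z (- M)) -{2}(epath_cst (Q n.+1) (theta n.+1 * h) N z M).
  by apply/andP; split; apply: epath_le => // s; have := PM (Yval dflt z :: map (Yval dflt) s); rewrite ler_norml => /andP[].
rewrite -/(A _) sum_cl.
have -> : \sum_(D : cls) trans rt h C D * epath rt N h D (PD D) = \sum_(D : cls) trans rt h C D * epath rt N h D (PD D) by [].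
(* Three errors of one step: the chain is off the condensates, the induction hypothesis after the
   step, and the one-step kernel itself. *)
pose T1 := \sum_(z | z \notin EN n.+1 Sstar) tr z * A z.
pose T2 := \sum_(D : cls) \sum_(y in val D) tr (xi n.+1 y) * (A (xi n.+1 y) - epath rt N h D (PD D)).
pose T3 := \sum_(D : cls) (\sum_(y in val D) tr (xi n.+1 y) - trans rt h C D) * epath rt N h D (PD D).
rewrite [X in `|X|](_ : _ = T1 + T2 + T3); last first.
  rewrite -[RHS]addrA -addrA; congr (_ + _); rewrite /T2 /T3 -big_split -sumrB; apply: eq_bigr => D _ /=.
  by under [X in _ = X + _]eq_bigr do rewrite mulrBr; rewrite sumrB -mulr_suml mulrBl addrA subrK.
have b1 : `|T1| <= e3.
  apply: (@le_trans _ _ (\sum_(z | z \notin EN n.+1 Sstar) tr z * M)).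
    by apply: le_trans (ler_norm_sum _ _ _) _; apply: ler_sum => z _; rewrite normrM (ger0_norm (tr0 z)) ler_wpM2l.
  rewrite -mulr_suml; apply: (@le_trans _ _ (eM * M)); first by rewrite ler_wpM2r // ho // (cls_sub xC).
  by rewrite /eM mulrAC ler_pdivrMr ?ltr_wpDl // ler_wpM2l ?(ltW e30) // lerDl.
have b2 : `|T2| <= e3.
  apply: (@le_trans _ _ (\sum_(D : cls) \sum_(y in val D) tr (xi n.+1 y) * e3)).
    apply: le_trans (ler_norm_sum _ _ _) _; apply: ler_sum => D _.
    apply: le_trans (ler_norm_sum _ _ _) _; apply: ler_sum => y yD.
    rewrite normrM (ger0_norm (tr0 _)) ler_wpM2l //; apply: le_trans (hD D D y yD).
    by rewrite /A Yval_cl (cl_xi n yD).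
  under eq_bigr do rewrite -mulr_suml.
  rewrite -mulr_suml ler_piMl ?(ltW e30) // -(trans_sum1 (Q n.+1) (theta n.+1 * h) (xi n.+1 x)) sum_cl lerDr.
  by apply: sumr_ge0.
have b3 : `|T3| <= e3.
  apply: (@le_trans _ _ (\sum_(D : cls) eK * `|epath rt N h D (PD D)|)).
    apply: le_trans (ler_norm_sum _ _ _) _; apply: ler_sum => D _; rewrite normrM ler_wpM2r //.
    by apply: hc => //; rewrite h0 lexx.
  by rewrite -mulr_sumr -/K /eK mulrAC ler_pdivrMr ?ltr_wpDl // ler_wpM2l ?(ltW e30) // lerDl.
apply: le_trans (ler_normD _ _) _; apply: le_trans (lerD (ler_normD _ _) b3) _.
apply: le_trans (lerD (lerD b1 b2) (lexx _)) _; rewrite /e3; lra.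
Qed.

(** * Comparison of the trace with its skeleton *)

Local Notation Xn n := (X n.+1).
Local Notation klass := (@cl _).
Local Notation "'G' n" := (EN n.+1 Sstar) (at level 10, n at level 9).

Lemma occ_null n x : x \in Sstar -> exists N, [/\ measurable N, P (xi n.+1 x) N = 0 &
  forall w, ~ N w -> forall a : R, exists2 t, 0 <= t & a < occ (Xn n) (G n) w t].
Proof.
move=> xS; have G0 : G n != finset.set0 by apply/set0Pn; exists (xi n.+1 x); rewrite EN_xi.
have [psi [psi0 psiG]] := return_potential G0.
exact: (occ_unbounded (@pos _) psi0 psiG (HX (xi n.+1 x))).
Qed.

Section Path.
Variables (n k : nat) (w : Om) (dflt : cls).
Hypothesis unb : forall a : R, exists2 t, 0 <= t & a < occ (Xn n) (G n) w t.
Let th : 0 < theta n.+1. Proof. by rewrite divr_gt0 // exprn_gt0. Qed.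
Let cX w' : cadlag ((Xn n) ^~ w'). Proof. exact: ctmc_cadlag (HX (xi n.+1 (xchoose (some_site m0 m1)))) w'. Qed.
Let mX t x : measurable [set w | Xn n t w = x]. Proof. by case: (HX (xi n.+1 (xchoose (some_site m0 m1)))). Qed.
Local Notation s j := (theta n.+1 * (mesh R k *+ j)).
Local Notation o := (occ (Xn n) (G n) w).
Local Notation Y t := (Ytr dflt (Xn n) (theta n.+1 * t) w).

Lemma Ytr_cadlag : cadlag (fun t => Y t).
Proof.
move=> t t0; have [[e [e0 he]] left] := trace_cadlag mX cX unb (mulr_ge0 (ltW th) t0).
have up v a b : (theta n.+1 * a < theta n.+1 * v + b) = (a < v + b / theta n.+1).
  by rewrite -(ltr_pM2l th a) mulrDr [_ * (b / _)]mulrC divfK // gt_eqF.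
split.
  exists (e / theta n.+1); split; first by rewrite divr_gt0.
  move=> u /andP[tu ue]; rewrite /Ytr he // ler_pM2l // tu up //.
move=> tp; have [e' [l [e'0 hl]]] := left (mulr_gt0 th tp).
exists (e' / theta n.+1), (Yval dflt l); split; first by rewrite divr_gt0.
move=> u /andP[ue ut]; rewrite /Ytr hl // ltr_pM2l // ut andbT.
by rewrite ltrBlDr up -ltrBlDr.
Qed.

Hypothesis on : forall j, (j <= steps k)%N -> Xn n (s j) w \in G n.
Hypothesis offt : occ (Xn n) (~: G n) w (theta n.+1 * k.+1%:R) <= theta n.+1 * slack R k.
Hypothesis one : forall j, (j < steps k)%N -> forall a1 a2 b c, s j <= a1 -> a1 <= a2 -> a2 <= s j.+1 ->
  klass (Xn n a1 w) = Some b -> klass (Xn n a2 w) = Some c -> b = Yval dflt (Xn n (s j) w) \/ c = b.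

(** The checkpoints are the readings of the trace clock at the grid times. They lag behind by at
    most the total time spent outside, and between two of them the trace only shows states of the
    original path in that cell. *)
Lemma Ytr_follows : follows (mesh R k) (slack R k) (steps k) (fun t => Y t) (fun j => Yval dflt (Xn n (s j) w)).
Proof.
have s0 j : 0 <= s j by rewrite mulr_ge0 ?(ltW th) // mulrn_wge0 // ltW // mesh_gt0.
have smono i j : (i <= j)%N -> s i <= s j by move=> ij; rewrite ler_wpM2l ?(ltW th) // mesh_mono.
have thn : theta n.+1 != 0 by rewrite gt_eqF.
have tK j : theta n.+1 * (o (s j) / theta n.+1) = o (s j) by rewrite mulrC divfK.
exists (fun j => o (s j) / theta n.+1); split.
- by rewrite mulr0n mulr0 occ0 mul0r.
- move=> j jn; have sk : s j <= theta n.+1 * k.+1%:R by rewrite -(mesh_steps R k) smono.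
  have e1 : s j - o (s j) <= theta n.+1 * slack R k.
    rewrite -(occ_setC mX cX (G n) w (s0 j)); apply: le_trans offt; apply: (occ_mono mX cX).
    by rewrite s0.
  have e2 := occ_le mX cX (G n) w (s0 j).
  rewrite distrC ger0_norm; last by rewrite subr_ge0 -(ler_pM2l th) tK.
  by rewrite -(ler_pM2l th) mulrBr tK.
- by move=> j jn; rewrite /Ytr tK /trace (trtime_occ mX cX unb) // on.
- by move=> j jn; rewrite ler_pM2r ?invr_gt0 //; apply: (occ_mono mX cX); rewrite s0 smono.
move=> j jn u v ju uv vj.
have u0 : 0 <= u by apply: le_trans ju; rewrite divr_ge0 ?(ltW th) // (occ_ge0 mX cX).
have v0 := le_trans u0 uv.
have tu : 0 <= theta n.+1 * u by rewrite mulr_ge0 // ltW.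
have tv : 0 <= theta n.+1 * v by rewrite mulr_ge0 // ltW.
have [Su0 oSu _] := trtime_spec mX cX unb tu; have [Sv0 oSv _] := trtime_spec mX cX unb tv.
set Su := trtime _ _ _ _ in Su0 oSu; set Sv := trtime _ _ _ _ in Sv0 oSv.
have a1 : s j <= Su by rewrite (trtime_le mX cX unb) // -tK ler_pM2l.
have a2 : Su <= Sv by rewrite (trtime_le mX cX unb) // oSu ler_pM2l.
have a3 : Sv <= s j.+1.
  rewrite -(trtime_occ mX cX unb (s0 j.+1)) ?on // (trtime_le mX cX unb) ?(occ_ge0 mX cX) // oSv.
  by rewrite -tK ler_pM2l.
have inG t : 0 <= t -> exists2 C, klass (trace (Xn n) (G n) t w) = Some C & Yval dflt (trace (Xn n) (G n) t w) = C.
  move=> t0; have /imsetP[x xS e] := trace_in mX cX unb t0; have [C xC] := cls_ex r xS.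
  by exists C; rewrite /trace ?Yval_cl e (cl_xi n xC).
have [b b1 b2] := inG _ tu; have [c c1 c2] := inG _ tv.
rewrite /Ytr b2 c2; exact: one jn _ _ _ _ a1 a2 a3 b1 c1.
Qed.
End Path.

(** Two changes of class at arbitrary real times of a cell are seen by every sufficiently fine grid,
    by right-continuity; [liminf_cover] then provides a measurable cover of the event. *)
Lemma two_changes_cover k (q e : R) (n : nat) (dflt : cls) x j : x \in Sstar -> 0 <= q ->
  (forall p (C : cls) x, x \in val C ->
    epath (Q n.+1) p.+1 (theta n.+1 * mesh R k / p.+1%:R) (xi n.+1 x) (fun s => (two_changes klass C (xi n.+1 x :: s))%:R) <= q) ->
  (forall s : R, 0 <= s -> \sum_(z | z \notin G n) trans (Q n.+1) s (xi n.+1 x) z <= e) ->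
  exists M, [/\ measurable M, (P (xi n.+1 x) M <= (q + e)%:E)%E & forall w, ~ M w -> forall a1 a2 b c,
    theta n.+1 * (mesh R k *+ j) <= a1 -> a1 <= a2 -> a2 <= theta n.+1 * (mesh R k *+ j.+1) ->
    klass (Xn n a1 w) = Some b -> klass (Xn n a2 w) = Some c -> b = Yval dflt (Xn n (theta n.+1 * (mesh R k *+ j)) w) \/ c = b].
Proof.
move=> xS q0 hq ho; set s0 := theta n.+1 * (mesh R k *+ j); set s1 := theta n.+1 * (mesh R k *+ j.+1).
have th : 0 < theta n.+1 by rewrite divr_gt0 // exprn_gt0.
have hX := HX (xi n.+1 x); have cX := ctmc_cadlag hX.
have m_gt := mesh_gt0 R k.
have s00 : 0 <= s0 by rewrite mulr_ge0 ?(ltW th) // mulrn_wge0 // ltW.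
pose g p := theta n.+1 * mesh R k / p.+1%:R.
have g0 p : 0 < g p by rewrite divr_gt0 // mulr_gt0.
have gE p : g p *+ p.+1 = theta n.+1 * mesh R k by rewrite -(mulr_natr (g p)) divfK.
have s1E : s1 = s0 + theta n.+1 * mesh R k by rewrite /s1 [mesh R k *+ j.+1]mulrSr mulrDr.
(* The reference class is that of the first sample. When this sample is off the condensates the
   event is not estimated at all, at the cost [e]. *)
pose A (s : seq (Hn S n.+1)) := if s is y :: _ then two_changes klass (Yval dflt y) s else false.
pose Ev := [set w | exists a1 a2 b c, [/\ s0 <= a1, a1 <= a2, a2 <= s1, klass (Xn n a1 w) = Some b &
  [/\ klass (Xn n a2 w) = Some c, b != Yval dflt (Xn n s0 w) & c != b]]].
have [||u|M [mM sub PM]] // := liminf_cover (P := P (xi n.+1 x)) (Ev := Ev) (b := q + e)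
  (A := fun p => [set w | A (smp (Xn n) s0 (g p) p.+1 w)]).
- by move=> p; exact: (path_meas hX).
- move=> w [a1 [a2 [b [c [h1 h2 h3 c1 [c2 nb nc]]]]]].
  have a12 : a1 < a2 by rewrite lt_neqAle h2 andbT; apply/eqP => e'; move: c1 nc; rewrite e' c2 => -[->]; rewrite eqxx.
  have [e1 [e10 he1]] := cadlag_rc cX w (le_trans s00 h1).
  have [e2 [e20 he2]] := cadlag_rc cX w (le_trans s00 (le_trans h1 h2)).
  pose ee := Num.min (Num.min e1 e2) (a2 - a1); have ee0 : 0 < ee by rewrite !lt_min e10 e20 subr_gt0.
  have ev1 : ev (fun p => g p < ee).
    have thm := mulr_gt0 th m_gt; have t0 : 0 < ee / (theta n.+1 * mesh R k) by exact: divr_gt0.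
    apply: ev_impl (ev_h_lt t0) => p; by rewrite (ltr_pdivlMr _ _ thm) mulrC.
  apply: ev_impl ev1 => p; rewrite !lt_min -andbA => /and3P[p1 p2 p3].
  have [|i [ip /andP[i1 i2] _]] := @grid_after R (g p) (a1 - s0) p.+1 (g0 p).
    rewrite gE; apply/andP; split; [lra|by move: s1E; lra].
  have [|l [lp /andP[l1 l2] _]] := @grid_after R (g p) (a2 - s0) p.+1 (g0 p).
    rewrite gE; apply/andP; split; [lra|by move: s1E; lra].
  have il : (i < l)%N.
    rewrite ltnNge; apply/negP => li; have : g p *+ l <= g p *+ i.
      by rewrite -!(mulr_natr (g p)) ler_wpM2l ?ler_nat // ltW.
    move: i2 l1 p3; lra.
  have yhead : exists s', smp (Xn n) s0 (g p) p.+1 w = Xn n s0 w :: s' by rewrite /smp gridS; eexists.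
  change (A (smp (Xn n) s0 (g p) p.+1 w)); have [s' es] := yhead.
  have -> : A (smp (Xn n) s0 (g p) p.+1 w) = two_changes klass (Yval dflt (Xn n s0 w)) (smp (Xn n) s0 (g p) p.+1 w).
    by rewrite es.
  apply: (@two_changes_intro _ _ _ _ _ i l (xi n.+1 x) b c) => //.
  + by rewrite il (eqP (size_smp _ _ _ _ _)) ltnS.
  + by rewrite nth_smp ?(leq_trans (ltnW il)) // he1 //; apply/andP; split; lra.
  + by rewrite nth_smp // he2 //; apply/andP; split; lra.
- move=> u0; exists 0%N => p _; rewrite (path_probability hX _ A s00 (ltW (g0 p))) lee_fin.
  set tr := trans _ _ _; have tr0 z : 0 <= tr z by exact: pos.
  pose T z := epath (Q n.+1) p.+1 (g p) z (fun s => (A (z :: s))%:R).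
  have T1 z : T z <= 1 by rewrite -[leRHS](epath_cst (Q n.+1) (g p) p.+1 z 1); apply: epath_le; [exact: pos|exact: ltW|move=> s; case: (A _)].
  rewrite -/(T _) (sum_cl) addrC -addrA; apply: lerD; last first.
    apply: (@le_trans _ _ e); last by rewrite lerDl ltW.
    by apply: le_trans (ho s0 s00); apply: ler_sum => z _; apply: ler_piMr; [exact: tr0|exact: T1].
  apply: (@le_trans _ _ (\sum_(D : cls) \sum_(y in val D) tr (xi n.+1 y) * q)).
    apply: ler_sum => D _; apply: ler_sum => y yD; apply: ler_wpM2l => //.
    apply: le_trans (hq p D y yD); rewrite /T /A Yval_cl (cl_xi n yD) //.
  under eq_bigr do rewrite -mulr_suml.
  rewrite -mulr_suml ler_piMl // -(trans_sum1 (Q n.+1) s0 (xi n.+1 x)) (sum_cl) lerDr.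
  by apply: sumr_ge0.
exists M; split => // w nM a1 a2 b c h1 h2 h3 c1 c2.
case: (eqVneq b (Yval dflt (Xn n s0 w))) => nb; first by left.
case: (eqVneq c b) => nc; first by right.
by exfalso; apply: nM; apply: sub; exists a1, a2, b, c.
Qed.
(** The mesh [k] is fixed before the size [n], and the tolerance [e] of the cell estimates depends
    on [k] only. *)
Lemma rarely_bad : exists B : R, ev (fun k => ev (fun n => forall (dflt C : cls) x, x \in val C -> exists M,
  [/\ measurable M, (P (xi n.+1 x) M <= (B / k.+1%:R)%:E)%E & forall w, ~ M w ->
   (forall a : R, exists2 t, 0 <= t & a < occ (Xn n) (G n) w t) ->
   follows (mesh R k) (slack R k) (steps k) (fun t => Ytr dflt (Xn n) (theta n.+1 * t) w)
     (fun j => Yval dflt (Xn n (theta n.+1 * (mesh R k *+ j)) w))])).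
Proof.
have [L L0 stay] := rt_stay.
exists (4 * (L + 1) ^+ 2 + 1); have L4 : 0 < (4 * (L + 1))^-1 by rewrite invr_gt0 mulr_gt0 // ltr_wpDl.
apply: ev_impl (mesh_lt L4) => k hk; pose z : R := k.+1%:R; pose K : R := #|{: cls}|%:R.
have z1 : 1 <= z by rewrite ler1n.
have [] := @rare_arith R L K z L0 (ler0n _ _) z1; set e := (_ * _ * _)^-1 => e4 tot.
have m_gt := mesh_gt0 R k; have Lh : L * mesh R k <= 4^-1.
  by move: (mesh R k) m_gt hk => y y0; rewrite invfM ltr_pdivlMr ?ltr_wpDl //; nra.
have h01 : 0 <= mesh R k <= 1 by rewrite ltW //= exprn_ile1 // ?invr_ge0 // invf_le1 // ler1n.
have /andP[e0 _] := e4.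
have c1 := cell_two_changes L0 stay h01 Lh e4.
have c2 := off_small e0.
apply: ev_impl (ev_and c1 c2) => n [hc ho] dflt C x xC; have xS := cls_sub xC.
have th : 0 < theta n.+1 by rewrite divr_gt0 // exprn_gt0.
have hX := HX (xi n.+1 x); have cX := ctmc_cadlag hX.
have mX t y : measurable [set w | Xn n t w = y] by case: hX.
have offp t : 0 <= t -> (P (xi n.+1 x) [set w | Xn n t w \notin G n] <= e%:E)%E.
  by move=> t0; rewrite (marginal hX (fun y => y \notin G n) t0) lee_fin; exact: ho.
pose s j := theta n.+1 * (mesh R k *+ j).
have s0 j : 0 <= s j by rewrite mulr_ge0 ?(ltW th) // mulrn_wge0 // ltW.
set q := (2 * _) ^+ 2 in hc; have q0 : 0 <= q by exact: sqr_ge0.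
have tz : 0 <= theta n.+1 * z by rewrite mulr_ge0 ?(ltW th).
pose f w := (\int[lebesgue_measure]_(t in cc 0 (theta n.+1 * z)) ((Xn n t w \notin G n)%:R : R)%:E)%E.
have [f1 f2] : (\int[P (xi n.+1 x)]_w f w <= (theta n.+1 * z * e)%:E)%E /\ measurable_fun setT f.
  apply: (expected_time mX (cadlag_rc cX) (A := fun y => y \notin G n) tz) => t /andP[t0 _]; exact: offp.
have f0 w : (0 <= f w)%E by apply: integral_ge0 => t _; rewrite lee_fin.
have a0 : 0 < theta n.+1 * slack R k by rewrite mulr_gt0 // invr_gt0.
have f3 : (\int[P (xi n.+1 x)]_w f w <= (theta n.+1 * slack R k * (z ^+ 2 * e))%:E)%E.
  apply: le_trans f1 _; rewrite lee_fin /slack -/z; apply: le_of_eq.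
  have zz : z^-1 * z ^+ 2 = z by rewrite expr2 mulKf // gt_eqF // (lt_le_trans ltr01).
  by rewrite -[RHS]mulrA [z^-1 * _]mulrA zz mulrA.
have [mM1 PM1] := tail_bound f2 f0 a0 f3.
set M1 := [set w | _] in mM1 PM1.
have [mM2 PM2] := @union_bound R _ _ (P (xi n.+1 x)) (fun j => [set w | Xn n (s j) w \notin G n]) (steps k).+1 e
  (fun j _ => ctmc_meas hX (s j) (fun y => y \notin G n)) (fun j _ => offp _ (s0 j)).
have /choice[M3 hM3] := fun j => two_changes_cover dflt j xS q0 hc (fun t t0 => ho t t0 x xS).
have [mM3 PM3] := @union_bound R _ _ (P (xi n.+1 x)) M3 (steps k) (q + e)
  (fun j _ => let: And3 a _ _ := hM3 j in a) (fun j _ => let: And3 _ a _ := hM3 j in a).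
set M2 := \big[_/_]_(j < _) _ in mM2 PM2; set M3' := \big[_/_]_(j < _) _ in mM3 PM3.
(* Bad events: too much time outside up to the horizon, by Markov's inequality; a grid time outside;
   two changes of class in some cell. *)
exists (M1 `|` (M2 `|` M3')); split.
- by do 2?apply: measurableU.
- apply: le_trans (measureU2 _ mM1 (measurableU _ _ mM2 mM3)) _.
  apply: le_trans (leeD PM1 (le_trans (measureU2 _ mM2 mM3) (leeD PM2 PM3))) _.
  rewrite -!EFinD lee_fin; apply: le_trans tot.
  have stE : (steps k)%:R = z ^+ 3 :> R by rewrite /steps -lock natrX.
  by rewrite -[(steps k).+1%:R]natr1 stE.
- move=> w nM unb; apply: (Ytr_follows unb).
  + move=> j jn; apply: contrapT => /negP out; apply: nM; right; left.
    by rewrite /M2 -(bigcup_mkord (steps k).+1 (fun j => [set w | Xn n (s j) w \notin G n])); exists j.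
  + have fw : (f w <= (theta n.+1 * slack R k)%:E)%E by rewrite leNgt; apply/negP => lt; apply: nM; left.
    have -> : occ (Xn n) (~: G n) w (theta n.+1 * k.+1%:R) = fine (f w).
      by congr fine; apply: eq_integral => t _; rewrite finset.in_setC.
    by rewrite -lee_fin fineK // ge0_fin_numE // (le_lt_trans fw) // ltry.
  + move=> j jn; have [_ _] := hM3 j; apply => M3w; apply: nM; right; right.
    by rewrite /M3' -(bigcup_mkord (steps k) M3); exists j.
Qed.

Theorem second_time_scale (i0 : cls) (eta : forall N, Hn S N) : (forall N, eta N \in EN N (val i0)) ->
  forall (dT2 : measure_display) (T2 : measurableType dT2) (P2 : probability T2 R) (Z : R -> T2 -> cls), is_ctmc rt P2 i0 Z ->
  sk_law_conv (fun N => P (eta N)) (fun N t w => Ytr i0 (X N) (theta N * t) w) P2 Z.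
Proof.
move=> etaE dT2 T2 P2 Z hZ F [[M FM] Fc] mFY mFZ.
have M0 : 0 <= M by apply: le_trans (FM (fun=> i0) _) => //; move=> t _; split; [exists 1|move=> _; exists 1, i0].
have [cZ _ _] := hZ.
pose U k s := F (skel k (nth i0 (i0 :: s))).
pose V k s := osc F k (nth i0 (i0 :: s)).
pose U' k s := F (skel k (nth i0 s)); pose V' k s := osc F k (nth i0 s).
have [cvG cvO] := skel_expectation FM Fc hZ mFZ.
set l := fine _ in cvG.
have -> : (\int[P2]_w (F (Z ^~ w))%:E = l%:E)%E.
  rewrite fineK //; apply: (integrable_fin_num measurableT).
  apply: (le_integrable measurableT _ _ (finite_measure_integrable_cst P2 M measurableT)); first exact/measurable_EFinP.
  by move=> w _; rewrite /= lee_fin (le_trans (FM _ (cZ w))) // ler_norm.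
have GM k c : `|F (skel k c)| <= M by apply: FM; exact: skel_cadlag.
have OM k c : `|osc F k c| <= 2 * M by have /andP[p q] := osc_bounds FM k c; rewrite ger0_norm.
have [B rare] := rarely_bad.
(* Five errors: the expectation over skeletons and the oscillation for the limit chain, the bad
   event, and the convergence in [n] of those two expectations. The first three fix [k]. *)
apply: ev_cvge => e e0; pose e5 := e / 5; have e50 : 0 < e5 by rewrite divr_gt0.
have [k [hk [kG [kO kB]]]] : exists k, (ev (fun n => forall (dflt C : cls) x, x \in val C -> exists M,
  [/\ measurable M, (P (xi n.+1 x) M <= (B / k.+1%:R)%:E)%E & forall w, ~ M w ->
   (forall a : R, exists2 t, 0 <= t & a < occ (Xn n) (G n) w t) ->
   follows (mesh R k) (slack R k) (steps k) (fun t => Ytr dflt (Xn n) (theta n.+1 * t) w)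
     (fun j => Yval dflt (Xn n (theta n.+1 * (mesh R k *+ j)) w))])) /\
   (`|l - epath rt (steps k) (mesh R k) i0 (U k)| <= e5 /\ (`|epath rt (steps k) (mesh R k) i0 (V k)| <= e5 /\
     2 * M * (B / k.+1%:R) <= e5)).
  have kB : ev (fun k => 2 * M * (B / k.+1%:R) <= e5).
    apply: ev_impl (ev_shift (cvgy_ev cvgr_idn (2 * M * B / e5))) => k.
    by rewrite ler_pdivrMr // [2 * M * (_ / _)]mulrA => hk; rewrite ler_pdivrMr ?ltr0n // [e5 * _]mulrC.
  have kU : ev (fun k => `|l - epath rt (steps k) (mesh R k) i0 (U k)| <= e5) by apply: near_ev; move/cvgrPdist_le: cvG; exact.
  have [k0 hk0] := ev_and rare (ev_and kU (ev_and (cvg0_ev cvO e50) kB)).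
  by exists k0; exact: hk0.
apply: ev_unshift.
have fG := fdd_conv (steps k) i0 (ltW (mesh_gt0 R k)) (fun s => GM k (nth i0 (i0 :: s))) e50.
have fO := fdd_conv (steps k) i0 (ltW (mesh_gt0 R k)) (fun s => OM k (nth i0 (i0 :: s))) e50.
apply: ev_impl (ev_and hk (ev_and fG fO)) => n {hk fG fO} [bad [nG nO]].
have /imsetP[x xi0 etax] := etaE n.+1; rewrite etax.
have xS : x \in Sstar by exact: cls_sub xi0.
have {bad} [A [mA PA badA]] := bad i0 i0 x xi0.
have [N [mN PN unbN]] := occ_null n xS.
have th0 : 0 <= theta n.+1 * mesh R k by rewrite mulr_ge0 ?(ltW (mesh_gt0 _ _)) // divr_ge0 // sqr_ge0.
pose c w := [seq Yval i0 z | z <- smp (Xn n) 0 (theta n.+1 * mesh R k) (steps k) w].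
have cE w j : (j <= steps k)%N -> nth i0 (c w) j = Yval i0 (Xn n (theta n.+1 * (mesh R k *+ j)) w).
  move=> jn; rewrite (nth_map (xi n.+1 x)) ?(eqP (size_smp _ _ _ _ _)) ?ltnS // nth_smp // add0r.
  by rewrite mulrnAr.
have Yx : Yval i0 (xi n.+1 x) = i0.
  by rewrite Yval_cl (cl_xi n xi0).
have intE (H : seq cls -> R) : (\int[P (xi n.+1 x)]_w (H (c w))%:E)%E =
   (epath (Q n.+1) (steps k) (theta n.+1 * mesh R k) (xi n.+1 x) (fun s => H (i0 :: map (Yval i0) s)))%:E.
  by rewrite (path_expectation0 _ (fun s => H (map (Yval i0) s)) (HX (xi n.+1 x))) //= Yx.
have mH (H : seq cls -> R) : measurable_fun setT (fun w => H (c w)).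
  exact: (path_fun_meas (HX (xi n.+1 x)) 0 (theta n.+1 * mesh R k) (steps k) (fun s => H (map (Yval i0) s))).
have cY w (nN : ~ N w) := Ytr_cadlag i0 (unbN w nN).
have fol w : ~ N w -> ~ A w -> `|F (fun t => Ytr i0 (Xn n) (theta n.+1 * t) w) - U' k (c w)| <= V' k (c w).
  move=> nN nA; apply: (osc_ge FM); first exact: cY.
  by apply: follows_ext (badA w nA (unbN w nN)) => j jn; rewrite cE.
have /andP[] := @expectation_close _ _ _ (P (xi n.+1 x)) (fun w => F (fun t => Ytr i0 (Xn n) (theta n.+1 * t) w))
  (fun w => U' k (c w)) (fun w => V' k (c w)) A N M _ _ _ (mFY n.+1) (mH _) (mH _) mA mN PN PA (fun w nN => FM _ (cY w nN))
  (fun w => GM k _) (fun w => osc_bounds FM k _) fol (intE _) (intE _).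
move: nG => /(_ i0 x xi0); move: nO => /(_ i0 x xi0).
rewrite -/(U k) -/(V k); move: kG kO kB.
set a' := epath rt _ _ _ (U k); set b' := epath rt _ _ _ (V k); set Bk := 2 * M * _.
set a := epath _ _ _ _ _; set b := epath _ _ _ _ _.
rewrite !ler_norml => /andP[g1 g2] /andP[p1 p2] B5 /andP[p3 p4] /andP[g3 g4] lo hi.
apply/andP; split; [apply: le_trans _ lo|apply: le_trans hi _]; rewrite lee_fin; rewrite /e5 in g1 g2 p1 p2 g3 g4 p3 p4 B5; lra.
Qed.
End Inclusion.

Theorem theorem2p10 (R : realType) (S : finType) (r : S -> S -> R) (m : S -> R)
  (d : nat -> R)
  (Hr0 : forall x y, 0 <= r x y) (Hrxx : forall x, r x x = 0)
  (Hirr : forall x y, connect [rel a b | 0 < r a b] x y)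
  (Hm0 : forall x, 0 <= m x) (Hm1 : \sum_x m x = 1)
  (Hrev : forall x y, m x * r x y = m y * r y x)
  (Hkappa : (2 <= #|classes r m|)%N)
  (Hdpos : forall N, 0 < d N)
  (Hd0 : d @ \oo --> 0)
  (Hdlog : (fun N => d N * ln N%:R) @ \oo --> 0)
  (Hdsubexp : forall eps : R, 0 < eps -> (fun N => d N * expR (eps * N%:R)) @ \oo --> +oo)
  (Hd2 : (fun N => d N * N%:R ^+ 2 * (ln N%:R) ^+ 2) @ \oo --> 0)
  (* a realization of the inclusion processes: for each N and each initial
     configuration eta, X N is the inclusion process under P N eta *)
  (dT : measure_display) (T : measurableType dT)
  (P : forall N, Hn S N -> probability T R) (X : forall N, R -> T -> Hn S N)
  (HX : forall N (eta : Hn S N), is_ctmc (Qinc r (d N)) (P N eta) eta (X N)) :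
  let theta := fun N : nat => N%:R / d N ^+ 2 in
  (* (1) *)
  (forall C : cls r m,
     (fun N => \big[mine/1%E]_(x in val C) \big[mine/1%E]_(y in val C | xi N x != xi N y)
        P N (xi N x) [set w | (hit (X N) [set xi N y] w
                               < hit (X N) (EN N (Sstar m :\: val C)) w)%E])
       @ \oo --> 1%E)
  /\
  (* (2) *)
  (forall (i0 : cls r m) (eta : forall N, Hn S N),
     (forall N, eta N \in EN N (val i0)) ->
     forall (dT2 : measure_display) (T2 : measurableType dT2)
            (P2 : probability T2 R) (Z : R -> T2 -> cls r m),
       is_ctmc (@rate2 R S r m) P2 i0 Z ->
       sk_law_conv (fun N => P N (eta N))
                   (fun N t w => Ytr i0 (X N) (theta N * t) w) P2 Z)
  /\
  (* (3) *)
  (forall t : R, 0 < t ->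
     (fun N => \big[maxe/0%E]_(x in Sstar m)
        \int[P N (xi N x)]_w
           (\int[lebesgue_measure]_(s in `[0%R, t])
              ((X N (theta N * s) w \notin EN N (S3of r m x))%:R : R)%:E))%E
       @ \oo --> 0%E).

Proof.
move=> theta; split; first exact: (within_class Hr0 Hrxx Hirr Hm0 Hm1 Hrev Hkappa Hdpos Hd0 Hdsubexp Hd2 HX).
split; last exact: (component_occupation Hr0 Hrxx Hirr Hm0 Hm1 Hrev Hkappa Hdpos Hd0 Hdsubexp Hd2 HX).
exact: (second_time_scale Hr0 Hrxx Hirr Hm0 Hm1 Hrev Hkappa Hdpos Hd0 Hdsubexp Hd2 HX).
Qed.
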